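(* Let $U(y)$ be in class $\mathcal{K}^+$ and $\alpha>0$, where $2\pi/\alpha$ is the $x$-period, and let $X$, $J$, $L$, $E^s$, $E^u$, $E^c$ be as defined in the context. Then the decomposition $X=E^s\oplus E^u\oplus E^c$ holds and is invariant under $JL$. Moreover, $n^-(L|_{E^c})=0$, and as a consequence $L|_{E^c/\ker L}>0$.
   Context: Setting. $y_1<y_2$ are finite, $U\in C^2([y_1,y_2])$ is real-valued, and $S_\ell$ denotes the circle of length $\ell$. The domain is either the periodic channel $S_{2\pi/\alpha}\times[y_1,y_2]$ (stream functions vanish at $y=y_1,y_2$) or the torus $S_{2\pi/\alpha}\times S_{y_2-y_1}$ ($U$ being $C^2$ and $(y_2-y_1)$-periodic; doubly periodic stream functions). $U$ is in class $\mathcal{K}^+$ if there is $U_s$ in the range of $U$ such that $K_2(y)=-\frac{U''(y)}{U(y)-U_s}$ is (extends to) a positive bounded function. Set $$X=\Big\{\omega=\sum_{0\ne k\in\mathbb{Z}}e^{ik\alpha x}\omega_k(y):\ \|\omega\|_X^2=\big\|K_2^{-1/2}\omega\big\|_{L^2}^2<\infty\Big\},$$ $$J=U''(y)\partial_x,\qquad L=\frac1{K_2(y)}-(-\Delta)^{-1},$$ so that $JL\omega=-(U-U_s)\partial_x\omega-U''\partial_x(-\Delta)^{-1}\omega$ is the linearized Euler operator at $(U(y),0)$ in the frame moving with speed $U_s$. $E^s$ (resp. $E^u$) $\subset X$ denotes the stable (resp. unstable) eigenspace of $JL$, i.e. the span of the generalized eigenspaces for eigenvalues with negative (resp. positive)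 real part; these are finite dimensional. The center space is $$E^c=\{\omega\in X:\ \langle L\omega,\omega_1\rangle=0\ \ \forall\,\omega_1\in E^s\oplus E^u\}.$$ $n^-(L|_{E^c})$ is the maximal dimension of a subspace of $E^c$ on which the quadratic form $\langle L\cdot,\cdot\rangle$ is negative definite.
   Formalization: In class K^+, ''extends to a positive bounded function'' is taken as m <= K_2 <= M with a constant m > 0 (so K_2 may not tend to 0 at zeros of U-U_s, where the claim can fail), and U is assumed not identically U_s. *)

(* Defs.v *)
From HB Require Import structures.
From mathcomp Require Import all_boot all_order all_algebra.
From mathcomp Require Import all_classical all_reals all_analysis.
From mathcomp Require Import complex.

Set Implicit Arguments.
Unset Strict Implicit.
Unset Printing Implicit Defensive.

Import Order.TTheory GRing.Theory Num.Theory.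
Import numFieldNormedType.Exports.

Local Open Scope classical_set_scope.
Local Open Scope complex_scope.
Local Open Scope ring_scope.

(* One-sided at the end points when D is a closed interval; a junk value where
   the limit does not exist. *)
Definition diff_quot (R : realType) (f : R -> R) (y : R) : R -> R :=
  fun z => (f z - f y) / (z - y).

Definition deriv_in (R : realType) (D : set R) (f : R -> R) (y : R) : R :=
  lim (diff_quot f y @ within D y^').

Definition derivable_in (R : realType) (D : set R) (f : R -> R) : Prop :=
  forall y, D y -> cvg (diff_quot f y @ within D y^').

Definition C2_on (R : realType) (D : set R) (f : R -> R) : Prop :=
  [/\ derivable_in D f, derivable_in D (deriv_in D f) &
      {within D, continuous (deriv_in D (deriv_in D f))}].

Inductive geometry := Channel | Torus.

Record shear_flow (R : realType) := ShearFlow {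
  geom : geometry;
  y1 : R;
  y2 : R;
  alpha : R;      (* the x-period is 2 pi / alpha *)
  U : R -> R;
  Us : R;
  K2 : R -> R
}.

Section Profile.
Context {R : realType} (F : shear_flow R).

Definition yI : set R := `[y1 F, y2 F]%classic.

(* On the torus U is a periodic function on the whole line. *)
Definition profile_dom : set R :=
  match geom F with Channel => yI | Torus => setT end.

Definition ddU : R -> R := deriv_in profile_dom (deriv_in profile_dom (U F)).

Definition C2_profile : Prop :=
  C2_on profile_dom (U F) /\
  match geom F with
  | Channel => True
  | Torus => forall y, U F (y + (y2 F - y1 F)) = U F y
  end.

(* K2 is an extension of - U'' / (U - Us), which is 0 / 0 where U = Us.
   - U is not identically Us: otherwise the quotient is defined nowhere and
     K2 would be arbitrary.
   - The values of K2 on the (finite) set U = Us are irrelevant in L^2, so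
     positivity of the extension is only meaningful as a positive lower bound;
     it holds in particular whenever the quotient extends to a continuous
     positive function on [y1, y2]. *)
Definition class_Kplus : Prop :=
  [/\ exists2 y, yI y & U F y = Us F,
      exists2 y, yI y & U F y != Us F,
      forall y, yI y -> U F y != Us F -> K2 F y = - ddU y / (U F y - Us F) &
      exists m M : R, 0 < m /\ forall y, yI y -> m <= K2 F y <= M].

End Profile.

Section Vorticity.
Context {R : realType} (F : shear_flow R).
Local Notation mu := (@lebesgue_measure R).
Local Notation I := (yI F).
Local Notation Re := complex.Re.
Local Notation Im := complex.Im.

(* The formal series sum_k e^{i k alpha x} w_k(y) is represented by its family
   of complex Fourier coefficients w_k; only the restriction of w_k to [y1, y2]
   matters, up to equality almost everywhere. *)
Definition vorticity : Type := int -> R -> R[i].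

Definition feq (v w : vorticity) : Prop := forall k, v k = w k %[ae mu in I].

Definition fzero : vorticity := fun _ _ => 0.
Definition fadd (v w : vorticity) : vorticity := fun k y => v k y + w k y.
Definition fscale (c : R[i]) (w : vorticity) : vorticity :=
  fun k y => c * w k y.
Definition lincomb (n : nat) (c : 'I_n -> R[i]) (v : 'I_n -> vorticity) :
    vorticity :=
  fun k y => \sum_(j < n) c j * v j k y.

(* || K2^{-1/2} w ||_{L^2}^2 over one period cell, by Parseval's identity *)
Definition normX2 (w : vorticity) : \bar R :=
  ((2 * pi / alpha F)%:E * \esum_(k in [set k : int | (k != 0)%R])
     \int[mu]_(y in I) ((Re (w k y) ^+ 2 + Im (w k y) ^+ 2) / K2 F y)%:E)%E.

Definition X : set vorticity :=
  [set w : vorticity | [/\ forall k, measurable_fun I (fun y => Re (w k y)) /\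
                         measurable_fun I (fun y => Im (w k y)),
               w 0 = cst 0 %[ae mu in I] &
               (normX2 w < +oo)%E]].

(* psi in H^2(y1, y2) solves - psi'' + m psi = f : the function dpsi is psi',
   and is itself absolutely continuous with derivative m psi - f. *)
Definition helmholtz (m : R) (f psi : R -> R) : Prop :=
  exists dpsi : R -> R,
  [/\ {within I, continuous psi}, {within I, continuous dpsi},
      forall y, I y ->
        psi y = psi (y1 F) + \int[mu]_(z in `[y1 F, y]) dpsi z,
      forall y, I y ->
        dpsi y = dpsi (y1 F) + \int[mu]_(z in `[y1 F, y]) (m * psi z - f z) &
      match geom F with
      | Channel => psi (y1 F) = 0 /\ psi (y2 F) = 0
      | Torus => psi (y1 F) = psi (y2 F) /\ dpsi (y1 F) = dpsi (y2 F)
      end].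

Definition helmholtz_inv (m : R) (f : R -> R) : R -> R :=
  xget (cst 0) [set psi | helmholtz m f psi].

(* (- Delta)^{-1}, mode by mode; the k = 0 mode is absent in X. *)
Definition inv_laplacian (w : vorticity) : vorticity := fun k y =>
  let m := (k%:~R * alpha F) ^+ 2 in
  if k == 0 then 0 else
  helmholtz_inv m (fun z => Re (w k z)) y +i*
  helmholtz_inv m (fun z => Im (w k z)) y.

Definition dx (w : vorticity) : vorticity := fun k y =>
  'i%C * (k%:~R * alpha F)%:C * w k y.

Definition J (f : vorticity) : vorticity := fun k y => (ddU F y)%:C * dx f k y.

Definition L (w : vorticity) : vorticity := fun k y =>
  (K2 F y)^-1%:C * w k y - inv_laplacian w k y.

Definition JL (w : vorticity) : vorticity := J (L w).

(* JL is an unbounded operator on X with its natural domain. *)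
Definition domJL : set vorticity := [set w : vorticity | X w /\ X (JL w)].

Definition cintegral (f : R -> R[i]) : R[i] :=
  (\int[mu]_(y in I) Re (f y)) +i* (\int[mu]_(y in I) Im (f y)).

(* sum over the nonzero integers, as the limit of the sums over |k| <= N *)
Definition sum_modes (a : int -> R) : R :=
  limn (fun N => \sum_(n < N) (a n.+1%:Z + a (- n.+1%:Z))).

(* <f, w> = int int f conj(w) dx dy over one period cell *)
Definition pairing (f w : vorticity) : R[i] :=
  let a k := cintegral (fun y => f k y * (w k y)^*%C) in
  (2 * pi / alpha F)%:C *
  (sum_modes (fun k => Re (a k)) +i* sum_modes (fun k => Im (a k))).

Definition Lform (v w : vorticity) : R[i] := pairing (L v) w.

Definition kerL : set vorticity := [set w : vorticity | X w /\ feq (L w) fzero].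

(* ker (JL - lambda)^n *)
Fixpoint ker_pow (lambda : R[i]) (n : nat) (w : vorticity) : Prop :=
  match n with
  | 0%N => X w /\ feq w fzero
  | n'.+1 => domJL w /\
             ker_pow lambda n' (fadd (JL w) (fscale (- lambda) w))
  end.

Definition gen_eigenspace (lambda : R[i]) : set vorticity :=
  [set w : vorticity | exists n, ker_pow lambda n w].

Definition span (S : set vorticity) : set vorticity :=
  [set w : vorticity | X w /\ exists n (c : 'I_n -> R[i]) (v : 'I_n -> vorticity),
     (forall j, S (v j)) /\ feq w (lincomb c v)].

Definition Es : set vorticity :=
  span [set w : vorticity | exists2 lambda, Re lambda < 0 & gen_eigenspace lambda w].

Definition Eu : set vorticity :=
  span [set w : vorticity | exists2 lambda, 0 < Re lambda & gen_eigenspace lambda w].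

Definition Ec : set vorticity :=
  [set w : vorticity | X w /\ forall s u, Es s -> Eu u -> Lform w (fadd s u) = 0].

(* X = A (+) B (+) C for linear subspaces A, B, C of X *)
Definition direct_sum3 (A B C : set vorticity) : Prop :=
  [/\ [/\ A `<=` X, B `<=` X & C `<=` X],
      forall w, X w -> exists a b c,
        [/\ A a, B b, C c & feq w (fadd (fadd a b) c)] &
      forall a b c, A a -> B b -> C c ->
        feq (fadd (fadd a b) c) fzero ->
        [/\ feq a fzero, feq b fzero & feq c fzero]].

Definition invariant_JL (E : set vorticity) : Prop :=
  forall w, E w -> domJL w -> E (JL w).

(* E contains an n-dimensional subspace on which <L ., .> is negative
   definite. The order of R[i] makes [z < 0] imply that z is real. *)
Definition has_neg_subspace (E : set vorticity) (n : nat) : Prop :=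
  exists v : 'I_n -> vorticity,
  [/\ forall c, E (lincomb c v),
      forall c, feq (lincomb c v) fzero -> forall j, c j = 0 &
      forall c, ~ feq (lincomb c v) fzero ->
        Lform (lincomb c v) (lincomb c v) < 0].

Definition nminus (E : set vorticity) : \bar R :=
  ereal_sup [set (n%:R)%:E | n in [set n | has_neg_subspace E n]].

(* <L ., .> is positive definite on the quotient E / kerL *)
Definition L_pos_mod_ker (E : set vorticity) : Prop :=
  kerL `<=` E /\ forall w, E w -> ~ kerL w -> 0 < Lform w w.

End Vorticity.

(* Main.v *)
From HB Require Import structures.
From mathcomp Require Import all_boot all_order all_algebra.
From mathcomp Require Import all_classical all_reals all_analysis.
From mathcomp Require Import complex ring lra measurable_realfun.
Require Import Defs.
Set Implicit Arguments.
Unset Strict Implicit.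
Unset Printing Implicit Defensive.
Import Order.TTheory GRing.Theory Num.Theory.
Import numFieldNormedType.Exports.
Local Open Scope classical_set_scope.
Local Open Scope ring_scope.

(** Fourier modes decouple. For a wave number [k <> 0] put [m = (k alpha)^2] and
    let [G] be the inverse of [- d^2/dy^2 + m] with the boundary conditions of
    the geometry. On this mode [L] is [1/K2 - G], and [JL] is [- i k alpha B]
    with [B = D L], where [D] is the multiplication by [- U'' = K2 (U - Us)].
    The three operators [1/K2], [G] and [D] are bounded and symmetric on
    [L^2(y1, y2)], [1/K2] has a positive lower bound, and [G] is nonnegative and
    compact. Hence the form [h(u, v) = <L u, v>] has finitely many negative
    squares; [B] is symmetric for [h] and commutes with complex conjugation.
    Stable and unstable eigenvalues of [JL] are the nonreal eigenvalues of [B],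
    so one mode requires a splitting of the space into the generalized
    eigenspaces of [B] over the open half planes and their [h]-orthogonal
    complement, on which [h] has to be nonnegative and to vanish only on
    [ker L].

    Two facts yield the splitting.

    - There are no neutral modes ([no_neutral_mode], [no_real_eigenfunction]): if
      [B u - c u] lies in [ker L] for a real [c], then so does [u]. This reduces
      to a potential [psi] solving [psi'' - m psi = - f] with [Q f = - Q'' psi],
      [Q = U - Us - c], and [psi / Q] square integrable. With the Wronskian
      [W = psi' Q - psi Q'], the function [Theta = psi W / Q] satisfies
      [Theta' = (W / Q)^2 + m psi^2] off the zeros of [Q]. As
      [(psi^2 / Q^2)' = 2 Theta / Q^2] and [Q] vanishes at least to first order
      at its zeros, integrability makes [Theta] nonpositive before a zero and
      nonnegative after it. Monotonicity then gives [Theta = 0] and [psi = 0].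

    - An [n]-dimensional [h]-negative subspace can be replaced by an
      [n]-dimensional [h]-nonpositive one, independent of [ker L], which [B]
      leaves invariant modulo [ker L] and on which the spectrum of [B] lies in
      the closed upper half plane ([hL_neg_invariant]). This is proved for
      matrices made strictly dissipative by a term [- i e]
      ([dissipative_invariant_subspace]) and passed to a weak limit of Galerkin
      approximations ([galerkin_step]); the compactness of [G] keeps the limit
      from degenerating.

    Take [n] maximal. By the first fact [B] maps the subspace of the second
    onto an invariant space [M] with spectrum in the open upper half plane. A
    Gram matrix intertwining two matrices with disjoint spectra vanishes, so [M]
    and its conjugate are neutral; maximality of [n] makes [h] pair them without
    kernel and makes [h] nonnegative on the complement of their sum, where the
    Cauchy--Schwarz inequality identifies the null vectors with [ker L]
    ([unstable_splitting], [hilbert_splitting], [mode_splitting]).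

    For large [k] the bound [G <= 1/m < 1/K2] makes [h] positive definite, so
    that only finitely many modes have nonreal eigenvalues ([unstableP]).
    Membership in the center space is tested mode by mode ([EcP]), and on it the
    form [<L w, w>] is a convergent sum of nonnegative mode energies
    ([Lform_center]). *)

(** * Invariant subspaces of dissipative matrices *)

Section FiniteDimension.
Local Open Scope sesquilinear_scope.
Context {C : numClosedFieldType}.

Definition hform (p : nat) (H : 'M[C]_p) (x y : 'rV[C]_p) : C :=
  (x *m H *m y ^t*) 0 0.

Lemma hformDl p (H : 'M[C]_p) (x y z : 'rV[C]_p) :
  hform H (x + y) z = hform H x z + hform H y z.
Proof. by rewrite /hform !mulmxDl mxE. Qed.

Lemma hformDr p (H : 'M[C]_p) (x y z : 'rV[C]_p) :
  hform H x (y + z) = hform H x y + hform H x z.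
Proof. by rewrite /hform linearD /= map_mxD mulmxDr mxE. Qed.

Lemma hformZl p (H : 'M[C]_p) a (x y : 'rV[C]_p) :
  hform H (a *: x) y = a * hform H x y.
Proof. by rewrite /hform -!scalemxAl mxE. Qed.

Lemma hformZr p (H : 'M[C]_p) a (x y : 'rV[C]_p) :
  hform H x (a *: y) = a^* * hform H x y.
Proof. by rewrite /hform linearZ /= map_mxZ -scalemxAr mxE. Qed.

Lemma hform_comp p q (H : 'M[C]_p) (Q : 'M[C]_(q, p)) (x y : 'rV[C]_q) :
  hform (Q *m H *m Q ^t*) x y = hform H (x *m Q) (y *m Q).
Proof. by rewrite /hform trmx_mul map_mxM !mulmxA. Qed.

Lemma hformC p (H : 'M[C]_p) (x y : 'rV[C]_p) :
  H ^t* = H -> hform H y x = (hform H x y)^*.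
Proof.
move=> HH; rewrite /hform.
have -> : (y *m H *m x ^t*) = (x *m H *m y ^t*) ^t*.
  by rewrite !trmx_mul !map_mxM HH trmxCK mulmxA.
by rewrite !mxE.
Qed.

Lemma hyperplane_basis p (f : 'cV[C]_p.+1) : f != 0 ->
  exists2 Q : 'M[C]_(p, p.+1), row_free Q &
    forall m (A : 'M[C]_(m, p.+1)), (A <= Q)%MS = (A *m f == 0).
Proof.
move=> f0.
have rf : \rank f = 1%N.
  by apply/eqP; rewrite eqn_leq rank_leq_col lt0n mxrank_eq0 f0.
have rk : \rank (kermx f) = p by rewrite mxrank_ker rf subn1.
suff [Q rQ eQ] : exists2 Q : 'M[C]_(\rank (kermx f), p.+1), row_free Q &
    forall m (A : 'M[C]_(m, p.+1)), (A <= Q)%MS = (A *m f == 0).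
  by move: Q rQ eQ; rewrite rk => Q *; exists Q.
exists (row_base (kermx f)); first exact: row_base_free.
by move=> m A; rewrite eq_row_base; apply/idP/eqP => [/sub_kermxP|/sub_kermxP].
Qed.

Lemma hyperplane_exists n (g : 'cV[C]_n.+1) :
  exists2 Z : 'M[C]_(n, n.+1), row_free Z & Z *m g = 0.
Proof.
have [-> | g0] := eqVneq g 0.
  have [|Q rQ _] := @hyperplane_basis n (const_mx 1).
    by apply/eqP => /matrixP /(_ 0 0) /eqP; rewrite !mxE oner_eq0.
  by exists Q; rewrite ?mulmx0.
have [Q rQ eQ] := hyperplane_basis g0.
by exists Q => //; apply/eqP; rewrite -eQ.
Qed.

Lemma row_free_mul_eq0 m n (A : 'M[C]_(m, n)) (x : 'rV[C]_m) :
  row_free A -> x *m A = 0 -> x = 0.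
Proof. by move=> /row_freeP[A' AA'] /(congr1 (mulmx^~ A')); rewrite -mulmxA AA' mulmx1 mul0mx. Qed.

Definition dissipative p (H B : 'M[C]_p) :=
  forall x : 'rV[C]_p, x != 0 -> 'Im (hform H (x *m B) x) < 0.

Definition negdef p (H : 'M[C]_p) n (Y : 'M[C]_(n, p)) :=
  forall a : 'rV[C]_n, a != 0 -> hform H (a *m Y) (a *m Y) < 0.

Lemma negdef_free p (H : 'M[C]_p) n (Y : 'M[C]_(n, p)) :
  negdef H Y -> row_free Y.
Proof.
move=> nY; apply: contraT; rewrite -kermx_eq0 => /rowV0Pn[a /sub_kermxP aY a0].
by have := nY a a0; rewrite aY /hform !mul0mx mxE ltxx.
Qed.

Lemma hform_real p (H : 'M[C]_p) (x : 'rV[C]_p) : H ^t* = H ->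
  hform H x x \is Num.real.
Proof. by move=> HH; rewrite CrealE -(hformC _ _ HH). Qed.

Lemma Im_eigen p (H B : 'M[C]_p) c (e : 'rV[C]_p) : H ^t* = H -> dissipative H B ->
  e != 0 -> e *m B = c *: e -> 'Im c * hform H e e < 0.
Proof.
move=> HH dB e0 eB; have := dB e e0.
by rewrite eB hformZl ImMr ?hform_real.
Qed.

(** Induction on the dimension. For an eigenvector [e] with eigenvalue [c] the
    signs of [h(e, e)] and of [Im c] are opposite. If [Im c > 0], then [e] is a
    negative direction of the invariant space, and compressing to the
    [h]-orthogonal complement of [e] loses one negative direction. If
    [Im c < 0], an eigenvector of the transpose gives an invariant hyperplane
    whose [h]-normal is positive, so no negative direction is lost. *)
Lemma dissipative_invariant_subspace p (H B : 'M[C]_p) n (Y : 'M[C]_(n, p)) :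
  H ^t* = H -> dissipative H B -> negdef H Y ->
  exists U : 'M[C]_(n, p), exists T : 'M[C]_n, U *m B = T *m U /\ negdef H U.
Proof.
elim: p n H B Y => [|p IHp] [|n] H B Y HH dB nY.
- by exists 0, 0; split; [rewrite mulmx0 mul0mx|move=> a; rewrite (thinmx0 a) eqxx].
- have /nY : (const_mx 1 : 'rV[C]_n.+1) != 0.
    by apply/eqP => /matrixP /(_ 0 0) /eqP; rewrite !mxE oner_eq0.
  by rewrite [_ *m Y]thinmx0 /hform !mul0mx mxE ltxx.
- by exists 0, 0; split; [rewrite !mul0mx|move=> a; rewrite (thinmx0 a) eqxx].
have [c /eigenvalueP [e eB e0]] := eigenvalue_closed B (ltn0Sn p).
have Ice := Im_eigen HH dB e0 eB.
have Ic0 : 'Im c != 0 by apply: contraTneq Ice => ->; rewrite mul0r ltxx.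
have [Ic|Ic] := real_ltP (real0 C) (Creal_Im c).
  (* [e] is negative: split it off together with one negative direction *)
- have he : hform H e e < 0 by rewrite -(pmulr_rlt0 _ Ic).
  pose f := H *m e ^t*.
  have ef : e *m f = (hform H e e)%:M by rewrite /f mulmxA [LHS]mx11_scalar.
  have f0 : f != 0.
    apply: contraTneq he => f0; rewrite /hform -mulmxA -/f f0 mulmx0 mxE ltxx //.
  have [Q rQ eQ] := hyperplane_basis f0.
  have Qf : Q *m f = 0 by apply/eqP; rewrite -eQ.
  have heQ x : hform H (x *m Q) e = 0.
    by rewrite /hform -mulmxA -/f -mulmxA Qf mulmx0 mxE.
  have heQ' x : hform H e (x *m Q) = 0 by rewrite hformC // heQ conjC0.
  pose g := (hform H e e)^-1 *: (Q *m B *m f).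
  have : (Q *m B - g *m e <= Q)%MS.
    rewrite eQ mulmxBl -(mulmxA g) ef /g mul_mx_scalar scalerA mulfV ?lt_eqF //.
    by rewrite scale1r subrr.
  case/submxP => B' QB.
  have {}QB : Q *m B = g *m e + B' *m Q by rewrite -QB addrC subrK.
  have [Z rZ ZY] := hyperplane_exists (Y *m f).
  have /submxP [Y' ZYE] : (Z *m Y <= Q)%MS by rewrite eQ -mulmxA ZY.
  have [||| U [T [UB nU]]] := IHp n (Q *m H *m Q ^t*) B' Y'.
  + by rewrite !trmx_mul !map_mxM HH trmxCK mulmxA.
  + move=> x x0.
    have xQ0 : x *m Q != 0 by apply: contra_neq x0; exact: row_free_mul_eq0.
    have := dB _ xQ0; rewrite -mulmxA QB mulmxDr hformDl !mulmxA hform_comp.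
    rewrite [x *m g]mx11_scalar mul_scalar_mx hformZl heQ' mulr0 add0r //.
  + move=> a a0; rewrite hform_comp -mulmxA -ZYE mulmxA; apply: nY.
    by apply: contra_neq a0; exact: row_free_mul_eq0.
  exists (col_mx e (U *m Q) : 'M[C]_(1 + n, p.+1)), (block_mx c%:M 0 (U *m g) T : 'M[C]_(1 + n, 1 + n)).
  split.
    apply: etrans (mul_col_mx e (U *m Q) B) _; symmetry.
    apply: etrans (mul_block_col c%:M 0 (U *m g) T e (U *m Q)) _.
    by rewrite eB mul0mx addr0 mul_scalar_mx -(mulmxA U Q) QB mulmxDr !mulmxA UB.
  move=> a; rewrite -[a](@hsubmxK _ 1 1 n); set a1 := lsubmx _; set a2 := rsubmx _ => a0.
  rewrite (mul_row_col a1 a2 e (U *m Q)) [a1]mx11_scalar mul_scalar_mx mulmxA !hformDl !hformDr.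
  rewrite !hformZl !hformZr heQ heQ' !mulr0 addr0 add0r -hform_comp mulrA -normCK.
  have [a20|a20] := eqVneq a2 0.
    rewrite a20 !mul0mx /hform !mul0mx [X in _ + X]mxE addr0 nmulr_llt0 //.
    rewrite exprn_gt0 // normr_gt0; apply: contra_neq a0 => a10.
    by rewrite a20 [a1]mx11_scalar a10 raddf0 row_mx0.
  have := nU _ a20; rewrite -hform_comp => nU2.
  by apply: ltr_wnDl => //; rewrite nmulr_lle0 // exprn_ge0.
  (* an eigenvector [z0] of the transpose has an invariant kernel, with positive
     [h]-normal [w] *)
- have {}Ic : 'Im c < 0 by rewrite lt_neqAle Ic0.
  have Hunit : row_free H.
    rewrite -kermx_eq0; apply: contraT => /rowV0Pn[x /sub_kermxP xH x0].
    have := dB x x0; rewrite /hform -mulmxA.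
    have -> : H *m x ^t* = 0.
      by rewrite -[H]HH -map_mxM -trmx_mul xH trmx0 map_mx0.
    by rewrite mulmx0 mxE raddf0 ltxx.
  have [z0 z00 Bz] : exists2 z : 'cV[C]_p.+1, z != 0 & B *m z = c *: z.
    have : ~~ row_free (B - c%:M).
      rewrite -kermx_eq0; apply/rowV0Pn; exists e => //.
      by apply/sub_kermxP; rewrite mulmxBr eB mul_mx_scalar subrr.
    rewrite row_free_unit -unitmx_tr -row_free_unit -kermx_eq0.
    case/rowV0Pn => v /sub_kermxP vB v0; exists v^T; first by rewrite trmx_eq0.
    apply/eqP; rewrite -subr_eq0 -mul_scalar_mx -mulmxBl -[_ - _]trmxK -trmx_mul.
    by rewrite vB trmx0.
  have Hu : H \in unitmx by rewrite -row_free_unit.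
  pose w : 'rV[C]_p.+1 := (invmx H *m z0) ^t*.
  have Hw : H *m w ^t* = z0 by rewrite /w trmxCK mulKVmx.
  have w0 : w != 0.
    by apply: contra_neq z00 => w0; rewrite -Hw w0 trmx0 map_mx0 mulmx0.
  have hw : 0 < hform H w w.
    have := dB w w0; rewrite {1}/hform -mulmxA Hw -mulmxA Bz -Hw -scalemxAr mulmxA.
    rewrite [X in 'Im X]mxE -/(hform H w w) ImMr ?hform_real //.
    by rewrite nmulr_rlt0.
  have [Q rQ eQ] := hyperplane_basis z00.
  have Qf : Q *m z0 = 0 by apply/eqP; rewrite -eQ.
  have hwQ x : hform H (x *m Q) w = 0.
    by rewrite /hform -mulmxA Hw -mulmxA Qf mulmx0 mxE.
  have hwQ' x : hform H w (x *m Q) = 0 by rewrite hformC // hwQ conjC0.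
  have /submxP [B' QB] : (Q *m B <= Q)%MS.
    by rewrite eQ -mulmxA Bz -scalemxAr Qf scaler0.
  pose g := (hform H w w)^-1 *: (Y *m z0).
  have wz : w *m z0 = (hform H w w)%:M by rewrite -Hw mulmxA [LHS]mx11_scalar.
  have /submxP [Y' YE] : (Y - g *m w <= Q)%MS.
    rewrite eQ mulmxBl -(mulmxA g) wz /g mul_mx_scalar scalerA mulfV ?gt_eqF //.
    by rewrite scale1r subrr.
  have {}YE : Y = g *m w + Y' *m Q by rewrite -YE addrC subrK.
  have [||| U [T [UB nU]]] := IHp n.+1 (Q *m H *m Q ^t*) B' Y'.
  + by rewrite !trmx_mul !map_mxM HH trmxCK mulmxA.
  + move=> x x0.
    have xQ0 : x *m Q != 0 by apply: contra_neq x0; exact: row_free_mul_eq0.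
    by have := dB _ xQ0; rewrite -mulmxA QB hform_comp mulmxA.
  + move=> a a0; have := nY a a0; rewrite hform_comp {1 2}YE mulmxDr !mulmxA.
    rewrite [a *m g]mx11_scalar mul_scalar_mx !hformDl !hformDr.
    rewrite !hformZl !hformZr hwQ hwQ' !mulr0 addr0 add0r mulrA -normCK.
    by apply: le_lt_trans; rewrite lerDr mulr_ge0 ?exprn_ge0 // ltW.
  exists (U *m Q), T; split; first by rewrite -(mulmxA U) QB !mulmxA UB.
  by move=> a a0; rewrite mulmxA -hform_comp; exact: nU.
Qed.

(** An orthonormal basis is chosen so that the matrices [T] stay bounded along
    the approximation scheme; the sign of [Im_eigen] locates their spectrum. *)
Lemma dissipative_invariant_unitary p (H B : 'M[C]_p) n (Y : 'M[C]_(n, p)) :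
  H ^t* = H -> dissipative H B -> negdef H Y ->
  exists U : 'M[C]_(n, p), exists T : 'M[C]_n,
    [/\ U \is unitarymx, U *m B = T *m U, negdef H U &
      forall c, root (char_poly T) c -> 0 < 'Im c].
Proof.
move=> HH dB nY.
have [U0 [T0 [U0B nU0]]] := dissipative_invariant_subspace HH dB nY.
have fU0 := negdef_free nU0.
have np : (n <= p)%N by rewrite -(eqP fU0) rank_leq_col.
pose U := schmidt U0.
have UU : U \is unitarymx by exact: schmidt_unitarymx.
have eU : (U :=: U0)%MS by exact: eqmx_schmidt_free.
have /submxP [T UB] : (U *m B <= U)%MS.
  rewrite (eqmxMr B eU) U0B; apply: submx_trans (submxMl _ _) _.
  by rewrite eU.
have fU : row_free U by rewrite /row_free mxrank_unitary.
have nU : negdef H U.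
  move=> a a0; have /submxP [b aU] : (a *m U <= U0)%MS.
    by apply: submx_trans (submxMl _ _) _; rewrite eU.
  rewrite aU; apply: nU0; apply: contra_neq a0 => b0.
  by apply: (row_free_mul_eq0 fU); rewrite aU b0 mul0mx.
exists U, T; split => // c; rewrite -eigenvalue_root_char => /eigenvalueP[a aT a0].
have aU0 : a *m U != 0 by apply: contra_neq a0; exact: row_free_mul_eq0.
have : 'Im c * hform H (a *m U) (a *m U) < 0.
  apply: (Im_eigen HH dB aU0); by rewrite -mulmxA UB mulmxA aT scalemxAl.
by rewrite nmulr_llt0 // nU.
Qed.
End FiniteDimension.

(** * Symmetric operators for a form with finitely many negative squares *)

Section ShiftedProducts.
Context {C : numClosedFieldType} {n : nat}.
Implicit Types (T A G : 'M[C]_n) (s : seq C).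

(** [A] times the product of the [T - c]. The recursion avoids the ring
    structure of square matrices, which excludes the size zero. *)
Fixpoint mx_shifts T s A : 'M[C]_n :=
  if s is c :: s' then mx_shifts T s' (A *m (T - c%:M)) else A.

Lemma mx_shifts_intertwine T T' G s A A' : T *m G = G *m T' ->
  A *m G = G *m A' -> mx_shifts T s A *m G = G *m mx_shifts T' s A'.
Proof.
move=> TG; elim: s A A' => //= c s IH A A' AG; apply: IH.
by rewrite -mulmxA mulmxBl TG mul_scalar_mx -mul_mx_scalar -mulmxBr !mulmxA AG.
Qed.

Lemma mx_shifts_unit T s A : (forall c, c \in s -> T - c%:M \in unitmx) ->
  A \in unitmx -> mx_shifts T s A \in unitmx.
Proof.
elim: s A => //= c s IH A sU AU; apply: IH => [d ds|].
  by apply: sU; rewrite inE ds orbT.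
by rewrite unitmx_mul AU sU // mem_head.
Qed.
End ShiftedProducts.

Lemma cayley_hamilton_shifts {C : numClosedFieldType} n (T : 'M[C]_n) :
  exists2 s : seq C, (forall c, c \in s -> root (char_poly T) c) &
    mx_shifts T s 1%:M = 0.
Proof.
case: n T => [|n] T; first by exists [::] => //; exact: flatmx0.
have [s sE] := closed_field_poly_normal (char_poly T).
move: sE; rewrite (eqP (char_poly_monic T)) scale1r => sE.
exists s => [c cs|]; first by rewrite sE root_prod_XsubC.
have aux (l : seq C) A : mx_shifts T l A =
    A *m horner_mx T (\prod_(z <- l) ('X - z%:P)).
  elim: l A => [|c l IH] A /=; first by rewrite big_nil rmorph1 mulmx1.
  by rewrite IH big_cons rmorphM rmorphB /= horner_mx_X horner_mx_C mulmxA.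
by rewrite aux -sE Cayley_Hamilton mul1mx.
Qed.

Lemma nonroot_unit {C : numClosedFieldType} n (T : 'M[C]_n) c :
  ~~ root (char_poly T) c -> T - c%:M \in unitmx.
Proof.
move=> rc; rewrite -row_free_unit -kermx_eq0; apply: contraNT rc => k0.
by rewrite -eigenvalue_root_char /eigenvalue /eigenspace.
Qed.

Section LinearCombinations.
Context {C : numClosedFieldType} {V : lmodType C} {n : nat}.

Implicit Types (N : 'I_n -> V) (a b : 'rV[C]_n).

Definition comb (N : 'I_n -> V) (a : 'rV[C]_n) : V := \sum_i a 0 i *: N i.

Lemma combD N a b : comb N (a + b) = comb N a + comb N b.
Proof. by rewrite -big_split; apply: eq_bigr => i _; rewrite mxE scalerDl. Qed.

Lemma combZ N c a : comb N (c *: a) = c *: comb N a.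
Proof. by rewrite scaler_sumr; apply: eq_bigr => i _; rewrite mxE scalerA. Qed.

Lemma comb0 N : comb N 0 = 0.
Proof. by rewrite /comb big1 // => i _; rewrite mxE scale0r. Qed.

Lemma combB N a b : comb N (a - b) = comb N a - comb N b.
Proof. by rewrite combD -[- b]scaleN1r combZ scaleN1r. Qed.

Lemma comb_delta N i : comb N (delta_mx 0 i) = N i.
Proof.
rewrite /comb (bigD1 i) //= mxE !eqxx scale1r big1 ?addr0 // => j /negPf ji.
by rewrite mxE ji andbF scale0r.
Qed.

Lemma comb_linear N (f : V -> V) a :
  (forall u v, f (u + v) = f u + f v) -> (forall c u, f (c *: u) = c *: f u) ->
  f (comb N a) = comb (f \o N) a.
Proof.
move=> fD fZ; have f0 : f 0 = 0 by rewrite -(scale0r 0) fZ !scale0r.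
rewrite /comb (big_morph f fD f0); by apply: eq_bigr => i _; rewrite fZ.
Qed.
End LinearCombinations.

Section SelfAdjointIndefinite.
Context {C : numClosedFieldType} {V : lmodType C}.
Context (h : V -> V -> C) (B sg S : V -> V).

Definition hker (u : V) := forall v, h u v = 0.

Definition neg_family n (N : 'I_n -> V) :=
  forall a : 'rV[C]_n, a != 0 -> h (comb N a) (comb N a) < 0.

Definition bshift (c : C) (u : V) : V := B u - c *: u.

Definition gen_eigvec (c : C) (u : V) := exists j, iter j (bshift c) u = 0.

Inductive sum_gen (P : C -> Prop) : V -> Prop :=
| sum_gen0 : sum_gen P 0
| sum_genD c u v : P c -> gen_eigvec c u -> sum_gen P v -> sum_gen P (u + v).

Context (hD : forall u v w, h (u + v) w = h u w + h v w)
  (hZ : forall c u v, h (c *: u) v = c * h u v)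
  (hC : forall u v, h v u = (h u v)^*).
Context (BD : forall u v, B (u + v) = B u + B v)
  (BZ : forall c u, B (c *: u) = c *: B u)
  (Bsym : forall u v, h (B u) v = h u (B v))
  (Bker : forall u, hker u -> B u = 0).
Context (sgD : forall u v, sg (u + v) = sg u + sg v)
  (sgZ : forall c u, sg (c *: u) = c^* *: sg u)
  (sgK : involutive sg) (sgB : forall u, sg (B u) = B (sg u))
  (sgh : forall u v, h (sg u) (sg v) = (h u v)^*).
Context (SD : forall u v, S (u + v) = S u + S v)
  (SZ : forall c u, S (c *: u) = c *: S u)
  (Sneg : forall u, h u u <= 0 -> ~ hker u -> h (S u) (S u) < 0).
Context (neg_bounded : exists d, forall n (N : 'I_n -> V), neg_family N -> (n <= d)%N).
Context (no_real : forall c u, c \is Num.real -> hker (bshift c u) -> hker u).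
Context (neg_invariant : forall n (N : 'I_n -> V), neg_family N ->
  exists (N' : 'I_n -> V) (T : 'M[C]_n),
  [/\ forall a, hker (B (comb N' a) - comb N' (a *m T)),
      forall a : 'rV[C]_n, a != 0 -> ~ hker (comb N' a) /\ h (comb N' a) (comb N' a) <= 0 &
      forall c, root (char_poly T) c -> 0 <= 'Im c]).

Lemma hDr u v w : h w (u + v) = h w u + h w v.
Proof. by rewrite hC hD rmorphD /= -!hC. Qed.
Lemma hZr c u v : h v (c *: u) = c^* * h v u.
Proof. by rewrite hC hZ rmorphM /= -hC. Qed.
Lemma h0l v : h 0 v = 0. Proof. by rewrite -(scale0r 0) hZ mul0r. Qed.
Lemma h0r v : h v 0 = 0. Proof. by rewrite hC h0l conjC0. Qed.
Lemma hNl u v : h (- u) v = - h u v. Proof. by rewrite -scaleN1r hZ mulN1r. Qed.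
Lemma hreal u : h u u \is Num.real. Proof. by rewrite CrealE -hC. Qed.
Lemma B0 : B 0 = 0. Proof. by rewrite -(scale0r 0) BZ !scale0r. Qed.
Lemma BN u : B (- u) = - B u. Proof. by rewrite -scaleN1r BZ scaleN1r. Qed.
Lemma sg0 : sg 0 = 0. Proof. by rewrite -(scale0r 0) sgZ conjC0 !scale0r. Qed.
Lemma sgN u : sg (- u) = - sg u.
Proof. by rewrite -scaleN1r sgZ rmorphN rmorph1 scaleN1r. Qed.

Lemma hker_sg u : hker u -> hker (sg u).
Proof. by move=> ku v; rewrite -[v]sgK sgh ku conjC0. Qed.

Lemma neg_family_max : exists n (N : 'I_n -> V), neg_family N /\
  forall m (N : 'I_m -> V), neg_family N -> (m <= n)%N.
Proof.
have [d Hd] := neg_bounded.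
pose P k := `[< exists N : 'I_k -> V, neg_family N >].
have P0 : P 0%N by apply/asboolP; exists (fun=> 0) => a; rewrite thinmx0 eqxx.
have Pd k : P k -> (k <= d)%N by move=> /asboolP[N]; exact: Hd.
case: (ex_maxnP (ex_intro P _ P0) Pd) => n /asboolP[N nN] nmax.
by exists n, N; split => // m N' nN'; apply: nmax; apply/asboolP; exists N'.
Qed.

Lemma bshiftD c u v : bshift c (u + v) = bshift c u + bshift c v.
Proof. by rewrite /bshift BD scalerDr opprD addrACA. Qed.

Lemma bshiftZ c d u : bshift c (d *: u) = d *: bshift c u.
Proof. by rewrite /bshift BZ scalerBr !scalerA mulrC. Qed.

Lemma bshiftN c u : bshift c (- u) = - bshift c u.
Proof. by rewrite -scaleN1r bshiftZ scaleN1r. Qed.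

Lemma bshift0 c : bshift c 0 = 0.
Proof. by rewrite -(scale0r 0) bshiftZ !scale0r. Qed.

Lemma bshiftC c d u : bshift c (bshift d u) = bshift d (bshift c u).
Proof.
rewrite /bshift !BD !BN !BZ !scalerBr !scalerA (mulrC d c).
by rewrite !opprD !opprK !addrA; congr (_ + _); rewrite addrAC.
Qed.

Lemma iter_bshiftD c j u v :
  iter j (bshift c) (u + v) = iter j (bshift c) u + iter j (bshift c) v.
Proof. by elim: j => //= j ->; rewrite bshiftD. Qed.

Lemma iter_bshiftZ c j d u :
  iter j (bshift c) (d *: u) = d *: iter j (bshift c) u.
Proof. by elim: j => //= j ->; rewrite bshiftZ. Qed.

Lemma iter_bshiftC c d j u :
  iter j (bshift c) (bshift d u) = bshift d (iter j (bshift c) u).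
Proof. by elim: j => //= j ->; rewrite bshiftC. Qed.

Lemma iter_bshift0 c j : iter j (bshift c) 0 = 0.
Proof. by elim: j => //= j ->; rewrite bshift0. Qed.

Lemma iter_bshift_le c i j u : (i <= j)%N ->
  iter i (bshift c) u = 0 -> iter j (bshift c) u = 0.
Proof. by move=> /subnK <-; rewrite iterD => ->; rewrite iter_bshift0. Qed.

Lemma gen_eigvecD c u v : gen_eigvec c u -> gen_eigvec c v -> gen_eigvec c (u + v).
Proof.
move=> [i ui] [j vj]; exists (maxn i j); rewrite iter_bshiftD.
by rewrite (iter_bshift_le (leq_maxl i j) ui) (iter_bshift_le (leq_maxr i j) vj) addr0.
Qed.

Lemma gen_eigvecZ c d u : gen_eigvec c u -> gen_eigvec c (d *: u).
Proof. by move=> [i ui]; exists i; rewrite iter_bshiftZ ui scaler0. Qed.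

Lemma gen_eigvec_bshift c d u : gen_eigvec c u -> gen_eigvec c (bshift d u).
Proof. by move=> [i ui]; exists i; rewrite iter_bshiftC ui bshift0. Qed.

(** Induction along the nilpotency index: on the generalized eigenspace of [c]
    the operator [B - d] is [c - d] plus a nilpotent one. *)
Lemma gen_eigvec_solve c d u : c != d -> gen_eigvec c u ->
  exists2 z, gen_eigvec c z & bshift d z = u.
Proof.
move=> cd [j]; elim: j u => [|j IH] u /=.
  by move=> ->; exists 0; [exists 0%N|rewrite bshift0].
rewrite -iterS iterSr => /IH[z gz zE].
have gu : gen_eigvec c u.
  have [i zi] := gz; exists i.+1.
  by rewrite iterSr -zE iter_bshiftC zi bshift0.
have cd0 : c - d != 0 by rewrite subr_eq0.
exists ((c - d)^-1 *: (u - z)).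
  by apply: gen_eigvecZ; apply: gen_eigvecD => //; rewrite -scaleN1r; exact: gen_eigvecZ.
rewrite bshiftZ bshiftD bshiftN zE /bshift.
have -> : (B u - d *: u) - (B u - c *: u) = (c - d) *: u.
  by rewrite opprB addrC addrA subrK scalerBl.
by rewrite scalerA mulVf // scale1r.
Qed.

Lemma sum_gen_add P u v : sum_gen P u -> sum_gen P v -> sum_gen P (u + v).
Proof.
elim => [|c u1 u2 Pc g1 s2 IH] sv; first by rewrite add0r.
by rewrite -addrA; exact: sum_genD Pc g1 (IH sv).
Qed.

Lemma sum_genZ P d u : sum_gen P u -> sum_gen P (d *: u).
Proof.
elim => [|c u1 u2 Pc g1 s2 IH]; first by rewrite scaler0; exact: sum_gen0.
by rewrite scalerDr; apply: (sum_genD Pc) IH; exact: gen_eigvecZ.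
Qed.

Lemma sum_genB P u : sum_gen P u -> sum_gen P (B u).
Proof.
elim => [|c u1 u2 Pc g1 s2 IH]; first by rewrite B0; exact: sum_gen0.
rewrite BD; apply: (sum_genD Pc) IH.
have -> : B u1 = bshift 0 u1 by rewrite /bshift scale0r subr0.
exact: gen_eigvec_bshift.
Qed.

Fixpoint bshifts (s : seq C) (u : V) : V :=
  if s is c :: s' then bshifts s' (bshift c u) else u.

(** Primary decomposition without a finite dimension: one factor is removed at a
    time, and the equation for the other eigenvalues is solved by
    [gen_eigvec_solve]. *)
Lemma bshifts_sum_gen P s u : (forall c, c \in s -> P c) ->
  bshifts s u = 0 -> sum_gen P u.
Proof.
elim: s u => [|c s IH] u Ps /=; first by move=> ->; exact: sum_gen0.
move=> /IH su; have {su} : sum_gen P (bshift c u).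
  by apply: su => d ds; apply: Ps; rewrite inE ds orbT.
have Pc : P c by apply: Ps; rewrite mem_head.
suff aux w : sum_gen P w -> exists z g, [/\ sum_gen P z, gen_eigvec c g & w = bshift c z + g].
  move=> /aux [z [g [sz gg uE]]].
  rewrite -[u](subrK z); apply: sum_gen_add => //.
  rewrite -[_ - _]addr0; apply: (sum_genD Pc) (sum_gen0 P).
  have [j gj] := gg; exists j.+1.
  by rewrite iterSr bshiftD bshiftN uE addrAC subrr add0r.
elim => [|d w1 w2 Pd g1 s2 [z [g [sz gg ->]]]].
  by exists 0, 0; split; [exact: sum_gen0|exists 0%N|rewrite bshift0 addr0].
have [dc|dc] := eqVneq d c.
  exists z, (w1 + g); split => //; first by apply: gen_eigvecD => //; rewrite -dc.
  by rewrite addrCA.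
have [z1 gz1 <-] := gen_eigvec_solve dc g1.
exists (z1 + z), g; split => //; first exact: (sum_genD Pd).
by rewrite bshiftD addrA.
Qed.

Lemma bshifts_comb n (M : 'I_n -> V) T s A a :
  (forall a, B (comb M a) = comb M (a *m T)) ->
  bshifts s (comb M (a *m A)) = comb M (a *m mx_shifts T s A).
Proof.
move=> MT; elim: s A => //= c s IH A; rewrite -IH; congr (bshifts s _).
by rewrite /bshift MT -combZ -combB mulmxA mulmxBr mul_mx_scalar.
Qed.

(** Start from a negative space of maximal dimension. Applying [B] once turns
    invariance modulo the kernel of [h] into invariance; the absence of real
    eigenvalues makes [B] injective there and removes the real axis from the
    spectrum. The map [S] turns nonpositive vectors into negative ones, so
    nonpositive spaces that avoid the kernel are no larger. *)
Lemma max_invariant_family :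
  exists n (M : 'I_n -> V) (T : 'M[C]_n),
  [/\ forall a, B (comb M a) = comb M (a *m T),
      forall a, hker (comb M a) -> a = 0,
      forall a, h (comb M a) (comb M a) <= 0,
      forall c, root (char_poly T) c -> 0 < 'Im c &
      forall m (P : 'I_m -> V), (forall a : 'rV[C]_m, a != 0 ->
        ~ hker (comb P a) /\ h (comb P a) (comb P a) <= 0) -> (m <= n)%N].
Proof.
have [n [N [nN nmax]]] := neg_family_max.
have [N' [T [N'T N'neg Tup]]] := neg_invariant nN.
have N'ker a : hker (comb N' a) -> a = 0.
  by move=> ka; apply/eqP; apply: contrapT => /negP /N'neg[].
pose M i := B (N' i).
have ME a : comb M a = B (comb N' a) by rewrite (comb_linear _ _ BD BZ).
have MT a : B (comb M a) = comb M (a *m T).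
  rewrite !ME; apply/eqP; rewrite -subr_eq0 -BN -BD; apply/eqP; exact: Bker.
have kM a : hker (comb M a) -> a = 0.
  rewrite ME => ka; apply: N'ker; apply: (no_real (real0 C)).
  by rewrite /bshift scale0r subr0.
exists n, M, T; split => //.
- move=> a; rewrite ME.
  have -> : h (B (comb N' a)) (B (comb N' a)) = h (comb N' (a *m T)) (comb N' (a *m T)).
    have /(_ _)kk := N'T a; set k := _ - _ in kk.
    have -> : B (comb N' a) = k + comb N' (a *m T) by rewrite subrK.
    by rewrite hD kk add0r hDr [h _ k]hC kk conjC0 add0r.
  have [->|/N'neg[]//] := eqVneq (a *m T) 0.
  by rewrite comb0 h0l.
- move=> c rc; rewrite lt_neqAle Tup // andbT eq_sym.
  apply/eqP => /Creal_ImP cR; move: rc; rewrite -eigenvalue_root_char.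
  case/eigenvalueP => a aT /negP[]; apply/eqP/N'ker/(no_real cR).
  by rewrite /bshift -combZ -aT; exact: N'T.
- move=> m P Pneg; apply: (nmax m (S \o P)) => a a0.
  rewrite -(comb_linear _ _ SD SZ); have [nk np] := Pneg a a0.
  exact: Sneg.
Qed.

Section Splitting.
Context (n : nat) (M : 'I_n -> V) (T : 'M[C]_n).
Context (MT : forall a, B (comb M a) = comb M (a *m T))
  (Mker : forall a, hker (comb M a) -> a = 0)
  (Mle0 : forall a, h (comb M a) (comb M a) <= 0)
  (Tup : forall c, root (char_poly T) c -> 0 < 'Im c)
  (Mmax : forall m (P : 'I_m -> V), (forall a : 'rV[C]_m, a != 0 ->
        ~ hker (comb P a) /\ h (comb P a) (comb P a) <= 0) -> (m <= n)%N).

Lemma lower_unit c : 'Im c <= 0 -> T - c%:M \in unitmx.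
Proof.
move=> Ic; apply: nonroot_unit; apply: contraTN Ic => /Tup.
by move=> I0; rewrite -real_ltNge ?Creal_Im ?real0.
Qed.

Lemma conj_unit c : 0 <= 'Im c -> map_mx (@Num.conj_op C) T - c%:M \in unitmx.
Proof.
move=> Ic; have -> : map_mx (@Num.conj_op C) T - c%:M = map_mx (@Num.conj_op C) (T - (c^*)%:M).
  by rewrite map_mxB map_scalar_mx /= conjCK.
by rewrite map_unitmx lower_unit // Im_conj oppr_le0.
Qed.

Definition gram : 'M[C]_n := \matrix_(i, j) h (M i) (M j).

Lemma h_comb (N N' : 'I_n -> V) a b :
  h (comb N a) (comb N' b) =
  (a *m (\matrix_(i, j) h (N i) (N' j)) *m (map_mx (@Num.conj_op C) b)^T) 0 0.
Proof.
have hsum (I : Type) (r : seq I) (f : I -> V) u : h (\sum_(i <- r) f i) u = \sum_(i <- r) h (f i) u.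
  by apply: (big_morph (fun x => h x u)) => [x y|]; rewrite ?hD ?h0l.
have hsumr (I : Type) (r : seq I) (f : I -> V) u : h u (\sum_(i <- r) f i) = \sum_(i <- r) h u (f i).
  by apply: (big_morph (h u)) => [x y|]; rewrite ?hDr ?h0r.
rewrite mxE /comb hsumr; apply: eq_bigr => j _; rewrite hsum !mxE mulr_suml.
by apply: eq_bigr => i _; rewrite hZ hZr !mxE -mulrA [h _ _ * _]mulrC.
Qed.

(** The Gram matrix intertwines [T] with its adjoint, and their spectra lie in
    opposite half planes. *)
Lemma M_neutral a b : h (comb M a) (comb M b) = 0.
Proof.
rewrite h_comb -/gram.
suff -> : gram = 0 by rewrite mulmx0 mul0mx mxE.
pose T' := (map_mx (@Num.conj_op C) T)^T.
have TG : T *m gram = gram *m T'.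
  apply/matrixP => i j.
  have entry (A : 'M[C]_n) : ((delta_mx 0 i : 'rV_n) *m A *m (delta_mx 0 j : 'rV_n)^T) 0 0 = A i j.
    by rewrite -rowE trmx_delta -colE !mxE.
  have cd : map_mx (@Num.conj_op C) (delta_mx 0 j : 'rV_n) = delta_mx 0 j.
    by apply/rowP => k; rewrite !mxE; case: (_ && _); rewrite ?conjC1 ?conjC0.
  have := Bsym (comb M (delta_mx 0 i)) (comb M (delta_mx 0 j)).
  rewrite !MT !h_comb -/gram cd -[_ *m T *m gram]mulmxA entry => ->.
  by rewrite map_mxM trmx_mul cd -/T' mulmxA -(mulmxA _ gram) entry.
have [s sT sE] := cayley_hamilton_shifts T.
have := mx_shifts_intertwine s TG (etrans (mul1mx _) (esym (mulmx1 gram))).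
rewrite sE mul0mx => /esym G0.
have sU : mx_shifts T' s 1%:M \in unitmx.
  apply: mx_shifts_unit; last exact: unitmx1.
  move=> c /sT /Tup Ic; rewrite /T' -(tr_scalar_mx n c) -linearB /= unitmx_tr.
  by rewrite conj_unit // ltW.
by rewrite -[gram](mulmxK sU) G0 mul0mx.
Qed.

Lemma bshiftsD s u v : bshifts s (u + v) = bshifts s u + bshifts s v.
Proof. by elim: s u v => //= c s IH u v; rewrite bshiftD IH. Qed.

Definition Mbar (i : 'I_n) : V := sg (M i).
Definition Tbar := map_mx (@Num.conj_op C) T.

Lemma comb_bar a : comb Mbar a = sg (comb M (map_mx (@Num.conj_op C) a)).
Proof.
rewrite /comb (big_morph sg sgD sg0); apply: eq_bigr => i _.
by rewrite sgZ !mxE conjCK.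
Qed.

Lemma MbarT a : B (comb Mbar a) = comb Mbar (a *m Tbar).
Proof.
rewrite !comb_bar -sgB MT map_mxM /Tbar -map_mx_comp /=.
by rewrite (_ : map_mx _ T = T) //; apply/matrixP => i j; rewrite mxE /= conjCK.
Qed.

Lemma Mbar_ker a : hker (comb Mbar a) -> a = 0.
Proof.
rewrite comb_bar => /hker_sg; rewrite sgK => /Mker /(congr1 (map_mx (@Num.conj_op C))).
rewrite -map_mx_comp map_mx0 => <-.
by apply/matrixP => i j; rewrite mxE /= conjCK.
Qed.

Lemma Mbar_neutral a b : h (comb Mbar a) (comb Mbar b) = 0.
Proof. by rewrite !comb_bar sgh M_neutral conjC0. Qed.

(** A vector common to both spaces modulo the kernel is annihilated by the
    characteristic polynomial of [T], which is invertible on the conjugate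
    family. *)
Lemma comb_indep a b : hker (comb M a + comb Mbar b) -> a = 0 /\ b = 0.
Proof.
move=> k; suff b0 : b = 0.
  by move: k; rewrite b0 comb0 addr0 => /Mker.
have := Bker k; rewrite BD MT MbarT => Bk0.
have [s sT sE] := cayley_hamilton_shifts T.
have := congr1 (bshifts s) Bk0; rewrite bshiftsD.
have -> : bshifts s (comb M (a *m T)) = 0.
  by rewrite -[_ *m T]mulmx1 (bshifts_comb _ _ _ MT) sE mulmx0 comb0.
rewrite -[b *m Tbar]mulmx1 (bshifts_comb _ _ _ MbarT) add0r.
have -> : bshifts s 0 = 0.
  by elim: (s) => //= c l IH; rewrite bshift0.
have sU : mx_shifts Tbar s 1%:M \in unitmx.
  apply: mx_shifts_unit; last exact: unitmx1.
  by move=> c /sT /Tup Ic; apply: conj_unit; exact: ltW.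
have TU : Tbar \in unitmx.
  by have := @conj_unit 0; rewrite [(0:C)%:M]raddf0 subr0; apply; rewrite raddf0.
move=> E; have : hker (comb Mbar (b *m Tbar *m mx_shifts Tbar s 1%:M)).
  by move=> v; rewrite E h0l.
move=> /Mbar_ker /(congr1 (mulmx^~ (invmx (mx_shifts Tbar s 1%:M)))).
rewrite mulmxK // mul0mx => /(congr1 (mulmx^~ (invmx Tbar))).
by rewrite mulmxK // mul0mx.
Qed.

Lemma hsub_comb a b : h (comb M a) (comb Mbar b) =
  (a *m (\matrix_(i, j) h (M i) (Mbar j)) *m (map_mx (@Num.conj_op C) b)^T) 0 0.
Proof. exact: h_comb. Qed.

Definition pairing_mx : 'M[C]_n := \matrix_(i, j) h (M i) (Mbar j).

(** A nonzero vector of the first family orthogonal to the second would enlarge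
    the second to a neutral space of dimension [n + 1]. *)
Lemma pairing_unit : pairing_mx \in unitmx.
Proof.
rewrite -row_free_unit -kermx_eq0; apply: contraT => /rowV0Pn[a /sub_kermxP aP a0].
pose P (i : 'I_(1 + n)) : V :=
  match fintype.split i with inl _ => comb M a | inr j => Mbar j end.
have PE (x : 'rV[C]_(1 + n)) :
    comb P x = comb M (lsubmx x 0 0 *: a) + comb Mbar (rsubmx x).
  rewrite combZ [LHS]/comb big_split_ord /= big_ord1; congr (_ + _).
    by rewrite /P -[lshift n ord0]/(unsplit (inl ord0)) unsplitK !mxE.
  apply: eq_bigr => i _.
  by rewrite /P -[rshift 1 i]/(unsplit (inr i)) unsplitK !mxE.
suff : (1 + n <= n)%N by rewrite ltnn.
apply: (Mmax (P := P)) => x x0; rewrite PE; split.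
  move=> /comb_indep [xa0 r0]; case/negP: x0; apply/eqP.
  rewrite -[x]hsubmxK r0 [lsubmx x]mx11_scalar.
  move/eqP: xa0; rewrite scaler_eq0 (negPf a0) orbF => /eqP ->.
  by rewrite raddf0 row_mx0.
rewrite hD !hDr M_neutral Mbar_neutral add0r addr0 [h (comb Mbar _) _]hC.
by rewrite hsub_comb -/pairing_mx -scalemxAl aP scaler0 mul0mx mxE conjC0 addr0.
Qed.

Definition orth_comb (v : V) :=
  (forall a, h v (comb M a) = 0) /\ (forall a, h v (comb Mbar a) = 0).

Lemma orth_comb_decomposition u : exists a b v,
  orth_comb v /\ u = comb M a + comb Mbar b + v.
Proof.
pose r1 : 'rV[C]_n := \row_j h u (Mbar j).
pose r2 : 'rV[C]_n := \row_j h u (M j).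
pose P2 : 'M[C]_n := \matrix_(i, j) h (Mbar i) (M j).
have P2U : P2 \in unitmx.
  have -> : P2 = map_mx (@Num.conj_op C) pairing_mx^T.
    by apply/matrixP => i j; rewrite !mxE hC.
  by rewrite map_unitmx unitmx_tr pairing_unit.
pose a := r1 *m invmx pairing_mx; pose b := r2 *m invmx P2.
exists a, b, (u - (comb M a + comb Mbar b)); split; last by rewrite addrC subrK.
have basis (N : 'I_n -> V) v : (forall j, h v (N j) = 0) -> forall c, h v (comb N c) = 0.
  move=> vN c; rewrite /comb (big_morph (h v) (fun x y => hDr x y v) (h0r v)).
  by rewrite big1 // => i _; rewrite hZr vN mulr0.
have ent (N N' : 'I_n -> V) c j : h (comb N c) (N' j) = (c *m \matrix_(i, j) h (N i) (N' j)) 0 j.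
  rewrite mxE /comb (big_morph (fun x => h x (N' j)) (fun x y => hD x y (N' j)) (h0l (N' j))).
  by apply: eq_bigr => i _; rewrite hZ mxE.
split; apply: basis => j; rewrite hD hNl hD.
- have -> : h (comb M a) (M j) = 0 by rewrite -(comb_delta M j) M_neutral.
  rewrite add0r ent -/P2 mulmxKV // mxE subrr //.
- have -> : h (comb Mbar b) (Mbar j) = 0 by rewrite -(comb_delta Mbar j) Mbar_neutral.
  rewrite addr0 ent -/pairing_mx mulmxKV ?pairing_unit // mxE subrr //.
Qed.

Lemma orth_comb_disjoint a b : orth_comb (comb M a + comb Mbar b) -> a = 0 /\ b = 0.
Proof.
move=> [oa ob]; apply: comb_indep => w.
have [c [d [v [[v1 v2] ->]]]] := orth_comb_decomposition w.
rewrite !hDr oa ob !add0r hC hDr v1 v2 addr0 conjC0 //.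
Qed.

(** A negative vector orthogonal to the first family would enlarge it to a
    nonpositive space of dimension [n + 1]. *)
Lemma orth_comb_ge0 v : orth_comb v -> 0 <= h v v.
Proof.
move=> [v1 v2]; rewrite real_leNgt ?hreal ?real0 //; apply/negP => vneg.
pose P (i : 'I_(1 + n)) : V :=
  match fintype.split i with inl _ => v | inr j => M j end.
have PE (x : 'rV[C]_(1 + n)) :
    comb P x = lsubmx x 0 0 *: v + comb M (rsubmx x).
  rewrite [LHS]/comb big_split_ord /= big_ord1; congr (_ + _).
    by rewrite /P -[lshift n ord0]/(unsplit (inl ord0)) unsplitK !mxE.
  apply: eq_bigr => i _.
  by rewrite /P -[rshift 1 i]/(unsplit (inr i)) unsplitK !mxE.
suff : (1 + n <= n)%N by rewrite ltnn.
apply: (Mmax (P := P)) => x x0; rewrite PE; split.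
  move=> k; have := k v; rewrite hD hZ [h (comb M _) v]hC v1 conjC0 addr0.
  move/eqP; rewrite mulf_eq0 (lt_eqF vneg) orbF => /eqP l0.
  move: k; rewrite l0 scale0r add0r => /Mker r0.
  by move: x0; rewrite -[x]hsubmxK r0 [lsubmx x]mx11_scalar l0 raddf0 row_mx0 eqxx.
rewrite hD !hDr !hZ !hZr v1 [h (comb M _) v]hC v1 conjC0 !mulr0 M_neutral !addr0.
by rewrite mulrA -normCK nmulr_lle0 // exprn_ge0.
Qed.

Lemma orth_combD u v : orth_comb u -> orth_comb v -> orth_comb (u + v).
Proof. by move=> [u1 u2] [v1 v2]; split=> a; rewrite hD ?u1 ?u2 ?v1 ?v2 addr0. Qed.

Lemma orth_combZ c u : orth_comb u -> orth_comb (c *: u).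
Proof. by move=> [u1 u2]; split=> a; rewrite hZ ?u1 ?u2 mulr0. Qed.

Lemma orth_combB u : orth_comb u -> orth_comb (B u).
Proof. by move=> [u1 u2]; split=> a; rewrite Bsym ?MT ?MbarT ?u1 ?u2. Qed.

Lemma orth_comb_shift c u : orth_comb u -> orth_comb (bshift c u).
Proof.
move=> ou; rewrite /bshift -scaleNr; apply: orth_combD; last exact: orth_combZ.
exact: orth_combB.
Qed.

(** The Cauchy--Schwarz argument for the nonnegative form on the complement. *)
Lemma orth_comb_null v : orth_comb v -> h v v = 0 -> hker v.
Proof.
move=> ov v0 w; have [c [d [u [ou ->]]]] := orth_comb_decomposition w.
have [oa ob] := ov; rewrite !hDr oa ob !add0r.
apply/eqP; apply: contraT => vu0.
pose z := h v u.
have key t : t \is Num.real -> 0 <= h u u + 2 * t * `|z| ^+ 2.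
  move=> tR; have := orth_comb_ge0 (orth_combD ou (orth_combZ (t * z^*) ov)).
  rewrite hD !hDr !hZ !hZr v0 !mulr0 addr0 -/z [h u v]hC -/z rmorphM /= conjCK.
  rewrite (CrealP tR) => H; rewrite (le_trans H) // le_eqVlt; apply/orP; left.
  by apply/eqP; rewrite normCK; ring.
have uR := hreal u.
have z2 : 0 < `|z| ^+ 2 by rewrite exprn_gt0 // normr_gt0.
have tR : - (h u u + 1) / (2 * `|z| ^+ 2) \is Num.real.
  by rewrite realM ?realV ?realN ?realD ?real1 ?realM ?realn ?realX ?normr_real.
have := key _ tR.
have -> : h u u + 2 * (- (h u u + 1) / (2 * `|z| ^+ 2)) * `|z| ^+ 2 = -1.
  by field; rewrite normr_eq0 vu0.
by rewrite oppr_ge0 ler10.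
Qed.

(** An eigenvector with nonreal eigenvalue is neutral, and neutral vectors of
    the complement are killed by [B]. *)
Lemma orth_comb_gen_eigvec c v : 'Im c != 0 -> orth_comb v -> gen_eigvec c v -> v = 0.
Proof.
move=> Ic ov [j]; elim: j => [//|j IH] jv; apply: IH.
set x := iter j _ _.
have ox : orth_comb x.
  by rewrite /x; elim: (j) => //= i; exact: orth_comb_shift.
have Bx : B x = c *: x by apply/eqP; rewrite -subr_eq0; apply/eqP.
have hx : h x x = 0.
  have := Bsym x x; rewrite Bx hZ hZr => /eqP; rewrite -subr_eq0 -mulrBl mulf_eq0.
  case/orP => [|/eqP//]; rewrite subr_eq0 => /eqP cc.
  by case/negP: Ic; apply/eqP/Creal_ImP; rewrite CrealE -cc.
have := Bker (orth_comb_null ox hx); rewrite Bx => /eqP; rewrite scaler_eq0.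
by case/orP => [/eqP c0|/eqP//]; move: Ic; rewrite c0 raddf0 eqxx.
Qed.

Lemma iter_comb (N : 'I_n -> V) A c j a : (forall a, B (comb N a) = comb N (a *m A)) ->
  iter j (bshift c) (comb N a) = comb N (iter j (fun x => x *m (A - c%:M)) a).
Proof.
move=> NA; elim: j => //= j ->; rewrite /bshift NA -combZ -combB.
by rewrite mulmxBr mul_mx_scalar.
Qed.

Lemma iter_unit0 (A : 'M[C]_n) j (a : 'rV[C]_n) : A \in unitmx ->
  iter j (fun x => x *m A) a = 0 -> a = 0.
Proof.
move=> AU; elim: j => //= j IH E; apply: IH.
by rewrite -[LHS](mulmxK AU) E mul0mx.
Qed.

(** On the two other summands the shift by [c] is injective. *)
Lemma gen_eigvec_upper c u : 0 < 'Im c -> gen_eigvec c u -> exists a, u = comb M a.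
Proof.
move=> Ic [j ju]; have [a [b [v [ov uE]]]] := orth_comb_decomposition u.
exists a; move: ju; rewrite uE !iter_bshiftD (iter_comb _ _ _ MT) (iter_comb _ _ _ MbarT).
set a' := iter j _ a; set b' := iter j _ b; set v' := iter j _ v => E.
have ov' : orth_comb v'.
  by rewrite /v'; elim: (j) => //= i; exact: orth_comb_shift.
have [|a0 b0] := @orth_comb_disjoint a' b'.
  have -> : comb M a' + comb Mbar b' = -1 *: v'.
    by rewrite scaleN1r; apply/eqP; rewrite -subr_eq0 opprK E.
  exact: orth_combZ.
have -> : b = 0.
  by apply: iter_unit0 b0; apply: conj_unit; exact: ltW.
have -> : v = 0.
  apply: (@orth_comb_gen_eigvec c) => //; first by rewrite gt_eqF.
  by exists j; move: E; rewrite a0 b0 !comb0 !add0r.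
by rewrite comb0 !addr0.
Qed.

Lemma gen_eigvec_sg c u : gen_eigvec c u -> gen_eigvec c^* (sg u).
Proof.
move=> [j ju]; exists j.
have -> : iter j (bshift c^*) (sg u) = sg (iter j (bshift c) u).
  by elim: (j) => //= i ->; rewrite /bshift sgD sgN sgZ sgB.
by rewrite ju sg0.
Qed.

Lemma sum_gen_upper u : sum_gen (fun c => 0 < 'Im c) u <-> exists a, u = comb M a.
Proof.
split=> [|[a ->]].
  elim => [|c u1 u2 Ic /(gen_eigvec_upper Ic)[a ->] _ [b ->]].
    by exists 0; rewrite comb0.
  by exists (a + b); rewrite combD.
have [s sT sE] := cayley_hamilton_shifts T.
apply: (@bshifts_sum_gen _ s) => [c /sT /Tup //|].
by rewrite -[a]mulmx1 (bshifts_comb _ _ _ MT) sE mulmx0 comb0.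
Qed.

Lemma sum_gen_sg (P : C -> Prop) u : sum_gen P u -> sum_gen (fun c => P c^*) (sg u).
Proof.
elim => [|c u1 u2 Pc g1 _ IH]; first by rewrite sg0; exact: sum_gen0.
rewrite sgD; apply: sum_genD IH; last exact: (gen_eigvec_sg g1).
by rewrite conjCK.
Qed.

Lemma sum_gen_sub (P Q : C -> Prop) u : (forall c, P c -> Q c) -> sum_gen P u -> sum_gen Q u.
Proof.
move=> PQ; elim => [|c u1 u2 Pc g1 _ IH]; first exact: sum_gen0.
by apply: sum_genD IH; [exact: PQ Pc|].
Qed.

Lemma sum_gen_lower u : sum_gen (fun c => 'Im c < 0) u <-> exists a, u = comb Mbar a.
Proof.
split=> [su|[a ->]].
  have /sum_gen_upper [a E] : sum_gen (fun c => 0 < 'Im c) (sg u).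
    apply: (@sum_gen_sub (fun c => 'Im (c^*) < 0)); last exact: (sum_gen_sg su).
    by move=> c; rewrite Im_conj oppr_lt0.
  exists (map_mx (@Num.conj_op C) a); rewrite comb_bar -[u]sgK E; congr (sg (comb M _)).
  by apply/matrixP => i j; rewrite !mxE conjCK.
rewrite comb_bar; apply: (@sum_gen_sub (fun c => 0 < 'Im (c^*))).
  by move=> c; rewrite Im_conj oppr_gt0.
apply: (@sum_gen_sg (fun c => 0 < 'Im c)); apply/sum_gen_upper; by eexists.
Qed.
End Splitting.

Definition gen_orth v := forall u,
  sum_gen (fun c => 0 < 'Im c) u \/ sum_gen (fun c => 'Im c < 0) u -> h v u = 0.

Theorem unstable_splitting :
  [/\ forall u, exists a b v,
        [/\ sum_gen (fun c => 0 < 'Im c) a, sum_gen (fun c => 'Im c < 0) b,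
            gen_orth v & u = a + b + v],
      forall a b v, sum_gen (fun c => 0 < 'Im c) a -> sum_gen (fun c => 'Im c < 0) b ->
        gen_orth v -> a + b + v = 0 -> [/\ a = 0, b = 0 & v = 0],
      forall v, gen_orth v -> 0 <= h v v &
      forall v, gen_orth v -> h v v = 0 -> hker v].
Proof.
have [n [M [T [MT Mker Mle0 Tup Mmax]]]] := max_invariant_family.
have upE := sum_gen_upper MT Mker Tup Mmax.
have loE := sum_gen_lower MT Mker Tup Mmax.
have oE v : gen_orth v <-> orth_comb M v.
  split=> [ov|[oa ob] u [/upE|/loE] [a ->] //].
  by split=> a; apply: ov; [left; apply/upE|right; apply/loE]; exists a.
split.
- move=> u; have [a [b [v [ov ->]]]] := orth_comb_decomposition MT Mker Tup Mmax u.
  exists (comb M a), (comb (Mbar M) b), v; split => //; last exact/oE.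
  + by apply/upE; exists a.
  + by apply/loE; exists b.
- move=> a b v /upE [a' ->] /loE [b' ->] /oE ov E.
  have [|a0 b0] := orth_comb_disjoint MT Mker Tup Mmax (a := a') (b := b').
    have -> : comb M a' + comb (Mbar M) b' = -1 *: v.
      by rewrite scaleN1r; apply/eqP; rewrite -subr_eq0 opprK E.
    exact: orth_combZ.
  by move: E; rewrite a0 b0 !comb0 !add0r.
- by move=> v /oE; exact: orth_comb_ge0.
- by move=> v /oE; exact: orth_comb_null.
Qed.
End SelfAdjointIndefinite.

(** * Absolutely continuous functions *)

Section Primitives.
Context {R : realType}.
Notation mu := (@lebesgue_measure R).
Implicit Types (a b c d y : R) (f g : R -> R).

Definition itg a b f := mu.-integrable `[a, b] (EFin \o f).

Lemma itgS a b c d f : a <= c -> d <= b -> itg a b f -> itg c d f.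
Proof.
move=> ac db; apply: integrableS => //= x /=.
by rewrite !in_itv /= => /andP[cx xd]; rewrite (le_trans ac cx) (le_trans xd db).
Qed.

Lemma eq_itg a b f g : (forall x, a <= x <= b -> f x = g x) -> itg a b f -> itg a b g.
Proof.
move=> fg; apply: eq_integrable => //= x; rewrite inE /= in_itv /= => xab.
by rewrite fg.
Qed.

Lemma itgD a b f g : itg a b f -> itg a b g -> itg a b (fun x => f x + g x).
Proof. by move=> fi gi; have := integrableD _ fi gi; apply; exact: measurable_itv. Qed.

Lemma itgZ a b k f : itg a b f -> itg a b (fun x => k * f x).
Proof. by move=> fi; have := integrableZl _ k fi; apply; exact: measurable_itv. Qed.

Lemma itgN a b f : itg a b f -> itg a b (fun x => - f x).
Proof. by move=> fi; have := integrableN fi. Qed.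

Lemma itgB a b f g : itg a b f -> itg a b g -> itg a b (fun x => f x - g x).
Proof. by move=> fi gi; apply: itgD => //; exact: itgN. Qed.

Lemma itg_norm a b f : itg a b f -> itg a b (fun x => `|f x|).
Proof. by move=> fi; have := integrable_norm fi. Qed.

Lemma itg_cont a b f : {within `[a, b], continuous f} -> itg a b f.
Proof. by move=> cf; apply: continuous_compact_integrable => //; exact: segment_compact. Qed.

Lemma itg_measurable a b f : itg a b f -> measurable_fun `[a, b] f.
Proof. by move=> /(measurable_int mu) fm; exact/measurable_EFinP. Qed.

Lemma itg_bounded a b f k : measurable_fun `[a, b] f ->
  (forall x, a <= x <= b -> `|f x| <= k) -> itg a b f.
Proof.
move=> mf fk.
have fin : (mu `[a, b]%classic < +oo)%E.
  by rewrite lebesgue_measure_itv /=; case: ifP => _; rewrite ?ltry // -EFinB ltry.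
apply: measurable_bounded_integrable => //.
exists k; split; first exact: num_real.
by move=> M kM x /=; rewrite in_itv /= => xab; rewrite (le_trans (fk _ xab)) // ltW.
Qed.

Lemma itg_mul_bounded a b f g k : itg a b f -> measurable_fun `[a, b] g ->
  (forall x, a <= x <= b -> `|g x| <= k) -> itg a b (fun x => f x * g x).
Proof.
move=> fi mg gk; have := @integrableMl _ _ _ mu _ (measurable_itv `[a, b]) _ g fi mg; apply.
exists k; split; first exact: num_real.
by move=> M kM x /=; rewrite in_itv /= => xab; rewrite (le_trans (gk _ xab)) // ltW.
Qed.

Lemma cont_bounded a b f : a <= b -> {within `[a, b], continuous f} ->
  exists2 k, 0 <= k & forall x, a <= x <= b -> `|f x| <= k.
Proof.
move=> ab cf; have [c cab cmax] : exists2 c, c \in `[a, b] & forall t, t \in `[a, b] -> `|f t| <= `|f c|.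
  apply: (@EVT_max R (fun x => `|f x|)) => //.
  by move=> x; apply: cvg_norm; exact: cf.
by exists `|f c| => // x xab; apply: cmax; rewrite in_itv /=.
Qed.

Lemma itg_mul_cont a b f g : a <= b -> itg a b f -> {within `[a, b], continuous g} ->
  itg a b (fun x => f x * g x).
Proof.
move=> ab fi cg; have [k _ gk] := cont_bounded ab cg.
exact: (itg_mul_bounded fi (itg_measurable (itg_cont cg)) gk).
Qed.

Lemma eq_int a b f g : (forall x, a <= x <= b -> f x = g x) ->
  \int[mu]_(x in `[a, b]) f x = \int[mu]_(x in `[a, b]) g x.
Proof. by move=> fg; apply: eq_Rintegral => x; rewrite inE /= in_itv /= => /fg. Qed.

Lemma intU a b c f : a <= c <= b -> itg a b f ->
  \int[mu]_(x in `[a, b]) f x =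
  \int[mu]_(x in `[a, c]) f x + \int[mu]_(x in `[c, b]) f x.
Proof.
move=> /andP[ac cb] fi; apply/eqP; rewrite addrC -subr_eq; apply/eqP.
rewrite Rintegral_itvB //; first by rewrite Rintegral_itv_obnd_cbnd //; apply: integrableS fi => //= x /=; rewrite !in_itv /= => /andP[cx ->]; rewrite (le_trans ac (ltW cx)).
Qed.

Lemma intaa a f : \int[mu]_(x in `[a, a]) f x = 0.
Proof. by rewrite set_itv1 Rintegral_set1. Qed.

Lemma intD a b f g : itg a b f -> itg a b g ->
  \int[mu]_(x in `[a, b]) (f x + g x) =
  \int[mu]_(x in `[a, b]) f x + \int[mu]_(x in `[a, b]) g x.
Proof. exact: RintegralD. Qed.

Lemma intB a b f g : itg a b f -> itg a b g ->
  \int[mu]_(x in `[a, b]) (f x - g x) =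
  \int[mu]_(x in `[a, b]) f x - \int[mu]_(x in `[a, b]) g x.
Proof. exact: RintegralB. Qed.

Lemma intZ a b k f : itg a b f ->
  \int[mu]_(x in `[a, b]) (k * f x) = k * \int[mu]_(x in `[a, b]) f x.
Proof. exact: RintegralZl. Qed.

Lemma int_le a b f g : itg a b f -> itg a b g ->
  (forall x, a <= x <= b -> f x <= g x) ->
  \int[mu]_(x in `[a, b]) f x <= \int[mu]_(x in `[a, b]) g x.
Proof. by move=> fi gi fg; apply: le_Rintegral => // x /=; rewrite in_itv /= => /fg. Qed.

Lemma int_ge0 a b f : (forall x, a <= x <= b -> 0 <= f x) ->
  0 <= \int[mu]_(x in `[a, b]) f x.
Proof. by move=> f0; apply: Rintegral_ge0 => x /=; rewrite in_itv /= => /f0. Qed.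

Lemma int_norm a b f : itg a b f ->
  `|\int[mu]_(x in `[a, b]) f x| <= \int[mu]_(x in `[a, b]) `|f x|.
Proof. exact: le_normr_Rintegral. Qed.

Lemma int_cst a b k : a <= b -> \int[mu]_(x in `[a, b]) k = k * (b - a).
Proof.
move=> ab; rewrite Rintegral_cst //; congr (_ * _).
suff E : mu `[a, b]%classic = (b - a)%:E by exact: (congr1 fine E).
rewrite lebesgue_measure_itv /= lte_fin.
by have [ab'|ba] := ltP a b; rewrite //= (le_anti (introT andP (conj ab ba))) subrr.
Qed.

Lemma itg_cst a b k : itg a b (fun=> k).
Proof. by apply: itg_cont => x; exact: cvg_cst. Qed.

Lemma int_norm_le a b c d f : a <= c -> d <= b -> c <= d -> itg a b f ->
  \int[mu]_(x in `[c, d]) `|f x| <= \int[mu]_(x in `[a, b]) `|f x|.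
Proof.
move=> ac db cd fi; have fi' := itg_norm fi.
rewrite (intU (c := c) _ fi') ?ac ?(le_trans cd db) //.
rewrite (@intU c b d) ?cd //; last exact: itgS fi'.
by rewrite addrCA lerDl addr_ge0 ?int_ge0.
Qed.

(** Absolute continuity, with the derivative as a datum. *)
Definition prim a b f g :=
  itg a b g /\ forall y, a <= y <= b -> f y = f a + \int[mu]_(z in `[a, y]) g z.

Lemma prim_diff a b c d f g : prim a b f g -> a <= c -> c <= d -> d <= b ->
  f d = f c + \int[mu]_(z in `[c, d]) g z.
Proof.
move=> [gi fE] ac cd db; have ad := le_trans ac cd; have cb := le_trans cd db.
rewrite (fE d) ?ad // (fE c) ?ac // (@intU a d c) ?ac ?cd ?addrA //.
exact: itgS gi.
Qed.

Lemma primS a b c d f g : a <= c -> d <= b -> prim a b f g -> prim c d f g.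
Proof.
move=> ac db fg; split; first by have [gi _] := fg; exact: itgS gi.
by move=> y /andP[cy yd]; apply: (prim_diff fg) => //; exact: le_trans db.
Qed.

Lemma prim_cont a b f g : a <= b -> prim a b f g -> {within `[a, b], continuous f}.
Proof.
move=> ab [gi fE].
have cF := parameterized_integral_continuous ab gi.
apply: (@subspace_eq_continuous _ _ _ (fun y => f a + \int[mu]_(z in `[a, y]) g z)).
  by move=> y; rewrite inE /= in_itv /= => /fE.
by move=> y; apply: cvgD; [exact: cvg_cst|exact: cF].
Qed.

Lemma primD a b f f' g g' : prim a b f f' -> prim a b g g' ->
  prim a b (fun y => f y + g y) (fun y => f' y + g' y).
Proof.
move=> [fi fE] [gi gE]; split; first exact: itgD.
move=> y yab; have /andP[ay yb] := yab.
rewrite (intD (itgS (lexx a) yb fi) (itgS (lexx a) yb gi)).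
by rewrite (fE _ yab) (gE _ yab) addrACA.
Qed.

Lemma primZ a b k f f' : prim a b f f' -> prim a b (fun y => k * f y) (fun y => k * f' y).
Proof.
move=> [fi fE]; split; first exact: itgZ.
move=> y yab; have /andP[ay yb] := yab.
by rewrite (intZ _ (itgS (lexx a) yb fi)) (fE _ yab) mulrDr.
Qed.

Lemma prim_cst a b k : prim a b (fun=> k) (fun=> 0).
Proof.
split; first exact: itg_cst.
by move=> y /andP[ay yb]; rewrite int_cst // mul0r addr0.
Qed.

Lemma prim_int a b g k : itg a b g -> prim a b (fun y => k + \int[mu]_(z in `[a, y]) g z) g.
Proof. by move=> gi; split=> // y _; rewrite intaa addr0. Qed.

Lemma eq_prim a b f f' g g' : a <= b -> (forall y, a <= y <= b -> f y = g y) ->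
  (forall y, a <= y <= b -> f' y = g' y) -> prim a b f f' -> prim a b g g'.
Proof.
move=> ab fg fg' [fi fE]; split; first exact: eq_itg fi.
move=> y yab; have /andP[ay yb] := yab.
rewrite -!fg ?lexx // fE //; congr (_ + _); apply: eq_int => z /andP[az zy].
by rewrite fg' // az (le_trans zy).
Qed.

(** The defect of the product rule over a short interval is of second order:
    it is bounded by a product of two small variations. *)
Lemma prim_mul_incr a b f f' g g' c d : prim a b f f' -> prim a b g g' ->
  a <= c -> c <= d -> d <= b ->
  `|f d * g d - f c * g c - \int[mu]_(z in `[c, d]) (f' z * g z + f z * g' z)| <=
  2 * (\int[mu]_(z in `[c, d]) `|f' z| * \int[mu]_(z in `[c, d]) `|g' z|).
Proof.
move=> pf pg ac cd db.
have fcd := primS ac db pf; have gcd := primS ac db pg.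
have cf := prim_cont cd fcd; have cg := prim_cont cd gcd.
have [fi _] := fcd; have [gi _] := gcd.
have i1 : itg c d (fun z => f' z * g z) by exact: itg_mul_cont.
have i2 : itg c d (fun z => f z * g' z).
  by apply: eq_itg (itg_mul_cont cd gi cf) => z _; rewrite mulrC.
have i3 : itg c d (fun z => g d * f' z) by exact: itgZ.
have i4 : itg c d (fun z => f c * g' z) by exact: itgZ.
have E : f d * g d - f c * g c - \int[mu]_(z in `[c, d]) (f' z * g z + f z * g' z) =
   \int[mu]_(z in `[c, d]) (g d * f' z - f' z * g z) +
   \int[mu]_(z in `[c, d]) (f c * g' z - f z * g' z).
  rewrite !intB // intD // !intZ //.
  have := prim_diff fcd (lexx _) cd (lexx _); have := prim_diff gcd (lexx _) cd (lexx _).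
  move=> -> ->; ring.
have osc k k' : prim c d k k' -> forall x y, c <= x <= d -> c <= y <= d ->
    `|k x - k y| <= \int[mu]_(z in `[c, d]) `|k' z|.
  move=> pk; have [ki _] := pk.
  suff w x y : c <= x -> x <= y -> y <= d -> `|k y - k x| <= \int[mu]_(z in `[c, d]) `|k' z|.
    move=> x y /andP[cx xd] /andP[cy yd]; have [xy|/ltW yx] := leP x y.
      by rewrite distrC; exact: w.
    exact: w.
  move=> cx xy yd; rewrite (prim_diff pk cx xy yd) addrAC subrr add0r.
  apply: le_trans (int_norm_le cx yd xy ki); apply: int_norm; exact: itgS ki.
rewrite E (le_trans (ler_normD _ _)) // mulr_natl mulr2n lerD //.
- apply: le_trans (int_norm (itgB i3 i1)) _.
  rewrite mulrC -intZ; last exact: itg_norm.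
  apply: int_le => [||z zcd]; first by apply: itg_norm; exact: itgB.
    by apply: itgZ; exact: itg_norm.
  rewrite mulrC -mulrBr normrM mulrC ler_wpM2r // (osc _ _ gcd) // cd lexx //.
- apply: le_trans (int_norm (itgB i4 i2)) _.
  rewrite -intZ; last exact: itg_norm.
  apply: int_le => [||z zcd]; first by apply: itg_norm; exact: itgB.
    by apply: itgZ; exact: itg_norm.
  by rewrite -mulrBl normrM ler_wpM2r // (osc _ _ fcd) // lexx cd.
Qed.

Lemma prim_mul_end a b f f' g g' : a <= b -> prim a b f f' -> prim a b g g' ->
  f b * g b - f a * g a = \int[mu]_(z in `[a, b]) (f' z * g z + f z * g' z).
Proof.
rewrite le_eqVlt => /predU1P[-> _ _|ltab pf pg]; first by rewrite intaa subrr.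
have ab := ltW ltab.
have [fi _] := pf; have [gi _] := pg.
have cf := prim_cont ab pf; have cg := prim_cont ab pg.
pose w z := f' z * g z + f z * g' z.
have wi : itg a b w.
  apply: itgD; first exact: itg_mul_cont.
  by apply: eq_itg (itg_mul_cont ab gi cf) => z _; rewrite mulrC.
pose v z := `|f' z| + `|g' z| + 1.
have vi : itg a b v by apply: itgD; [apply: itgD; exact: itg_norm|exact: itg_cst].
have v1 z : 1 <= v z by rewrite /v lerDr addr_ge0.
pose A := fun y => \int[mu]_(z in `[a, y]) v z.
have pA : prim a b A v by apply: eq_prim (prim_int 0 vi) => // y _; rewrite add0r.
have Aa : A a = 0 by rewrite /A intaa.
have Amon c d : a <= c -> c <= d -> d <= b -> d - c <= A d - A c.
  move=> ac cd db; rewrite (prim_diff pA ac cd db) addrAC subrr add0r.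
  rewrite -[leLHS]mul1r -int_cst //; apply: int_le => //; first exact: itg_cst.
  exact: itgS vi.
pose E y := f y * g y - f a * g a - \int[mu]_(z in `[a, y]) w z.
have Einc c d : a <= c -> c <= d -> d <= b -> `|E d - E c| <= 2 * (A d - A c) ^+ 2.
  move=> ac cd db.
  have -> : E d - E c = f d * g d - f c * g c - \int[mu]_(z in `[c, d]) w z.
    rewrite /E (intU (a := a) (b := d) (c := c)) ?ac ?cd //; last exact: itgS wi.
    by ring.
  apply: le_trans (prim_mul_incr pf pg ac cd db) _; rewrite ler_wpM2l //.
  have fi' := itg_norm (itgS ac db fi); have gi' := itg_norm (itgS ac db gi).
  rewrite (prim_diff pA ac cd db) addrAC subrr add0r /v intD; [|exact: itgD|exact: itg_cst].
  rewrite intD // int_cst //.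
  set x := (X in X * _ <= _); set y := (X in _ * X <= _).
  have x0 : 0 <= x by exact: int_ge0.
  have y0 : 0 <= y by exact: int_ge0.
  have z0 : 0 <= d - c by rewrite subr_ge0.
  rewrite mul1r -/x -/y; move: x y (d - c) x0 y0 z0 => x y z x0 y0 z0.
  have := (mulr_ge0 x0 y0, mulr_ge0 x0 z0, mulr_ge0 y0 z0, sqr_ge0 (x + y), sqr_ge0 z).
  case=> [[[[h1 h2] h3] h4] h5]; rewrite -subr_ge0.
  have -> : (x + y + z) ^+ 2 - x * y =
    (x ^+ 2 + y ^+ 2) + x * y + 2 * (x * z) + 2 * (y * z) + z ^+ 2 by ring.
  by rewrite !addr_ge0 ?sqr_ge0 // mulr_ge0.
suff Eb : E b = 0 by move: Eb => /eqP; rewrite subr_eq0 => /eqP.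
set S := A b; have S0 : 0 < S.
  by have := Amon a b (lexx _) ab (lexx _); rewrite Aa subr0 -/S; apply: lt_le_trans; rewrite subr_gt0.
have step N : (0 < N)%N -> `|E b| <= 2 * S ^+ 2 / N%:R.
  move=> N0; have N0' : N%:R != 0 :> R by rewrite pnatr_eq0 -lt0n.
  have pt t : 0 <= t <= S -> exists2 y, a <= y <= b & A y = t.
    move=> tS; have [|y yab yt] := @IVT R A a b t ab (prim_cont ab pA).
      by rewrite Aa minEle maxEle (ltW S0).
    by exists y.
  have ind k : (k <= N)%N -> exists y, [/\ a <= y <= b, A y = S * k%:R / N%:R &
      `|E y| <= 2 * S ^+ 2 / N%:R * (k%:R / N%:R)].
    elim: k => [|k IH] kN.
      exists a; rewrite lexx ab Aa !mul0r mulr0 mul0r /E intaa !subrr normr0 mulr0.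
      by split.
    have [y [yab Ay Ey]] := IH (ltnW kN).
    have [|y' y'ab Ay'] := pt (S * k.+1%:R / N%:R).
      rewrite -mulrA mulr_ge0 ?divr_ge0 ?(ltW S0) //= ler_piMr ?(ltW S0) //.
      by rewrite ler_pdivrMr ?mul1r ?ler_nat // ltr0n.
    exists y'; split => //.
    have [/andP[ay yb] /andP[ay' y'b]] := (yab, y'ab).
    have Add : A y' - A y = S / N%:R.
      by rewrite Ay Ay' -mulrBl -mulrBr -natr1 addrAC subrr add0r mulr1.
    have yy' : y <= y'.
      rewrite leNgt; apply/negP => y'y.
      have := Amon y' y ay' (ltW y'y) yb; rewrite -opprB Add.
      have : 0 < S / N%:R by rewrite divr_gt0 // ltr0n.
      by move: y'y; rewrite -subr_gt0; lra.
    rewrite -[E y'](subrK (E y)) (le_trans (ler_normD _ _)) //.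
    have := Einc _ _ ay yy' y'b; rewrite Add => Ei.
    apply: le_trans (lerD Ei Ey) _; rewrite le_eqVlt; apply/orP; left; apply/eqP.
    by rewrite -natr1; field.
  have [y [/andP[ay yb] Ay Ey]] := ind N (leqnn N).
  have yE : y = b.
    apply/le_anti; rewrite yb /= -subr_le0.
    have := Amon y b ay yb (lexx _); rewrite Ay -/S mulfK //; lra.
  by move: Ey; rewrite yE divff // mulr1.
apply/eqP; rewrite -normr_le0 leNgt; apply/negP => E0.
have S2 : 0 < 2 * S ^+ 2 by rewrite mulr_gt0 ?exprn_gt0.
pose N := (Num.truncn (2 * S ^+ 2 / `|E b|)).+1.
have := step N isT; apply/negP; rewrite -ltNge ltr_pdivrMr ?ltr0n //.
by rewrite [ltRHS]mulrC -ltr_pdivrMr // truncnS_gt.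
Qed.

Lemma prim_mul a b f f' g g' : a <= b -> prim a b f f' -> prim a b g g' ->
  prim a b (fun y => f y * g y) (fun y => f' y * g y + f y * g' y).
Proof.
move=> ab pf pg; have cf := prim_cont ab pf; have cg := prim_cont ab pg.
have [fi _] := pf; have [gi _] := pg; split.
  apply: itgD; first exact: itg_mul_cont.
  by apply: eq_itg (itg_mul_cont ab gi cf) => z _; rewrite mulrC.
move=> y /andP[ay yb]; rewrite -(prim_mul_end ay (primS _ yb pf) (primS _ yb pg)) //.
by rewrite addrC subrK.
Qed.

End Primitives.

(** * The Helmholtz problem on an interval *)

Section Helmholtz.
Context {R : realType}.
Notation mu := (@lebesgue_measure R).

Lemma prim_derive (a b : R) (f f' : R -> R) : a <= b ->
  {within `[a, b], continuous f} -> {within `[a, b], continuous f'} ->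
  (forall y, a < y < b -> is_derive y 1 f (f' y)) -> prim a b f f'.
Proof.
move=> ab cf cf' df; split; first exact: itg_cont.
move=> y /andP[]; rewrite le_eqVlt => /predU1P[<- _|ay yb]; first by rewrite intaa addr0.
have sub : `[a, y] `<=` `[a, b].
  by move=> x /=; rewrite !in_itv /= => /andP[-> xy]; exact: le_trans yb.
have cfy := continuous_subspaceW sub cf.
have [_ fa fy] := (continuous_within_itvP f ay).1 cfy.
have E : (\int[mu]_(x in `[a, y]) (f' x)%:E = (f y)%:E - (f a)%:E)%E.
  apply: continuous_FTC2 => //; first exact: continuous_subspaceW cf'.
    split => // x; rewrite in_itv /= => /andP[ax xy].
    by have [|//] := df x; rewrite ax (lt_le_trans xy).
  move=> x; rewrite in_itv /= => /andP[ax xy]; rewrite derive1E.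
  by apply: (@derive_val _ _ _ _ _ _ _ (df x _)); rewrite ax (lt_le_trans xy).
by rewrite (_ : Rintegral _ _ _ = f y - f a) ?subrKC //; exact: (congr1 fine E).
Qed.

Lemma prim_exp (a b k : R) : a <= b ->
  prim a b (fun y => expR (k * (y - a))) (fun y => k * expR (k * (y - a))).
Proof.
move=> ab.
have d (y : R) : is_derive y (1 : R) (fun y => expR (k * (y - a))) (k * expR (k * (y - a))).
  have -> : (fun y => expR (k * (y - a))) = expR \o (k *: (id - cst a)) by [].
  apply: is_derive_eq; rewrite /GRing.scale /= subr0 mulr1 mulrC //.
have c (y : R) : {for y, continuous (fun y : R => expR (k * (y - a)))}.
  by apply: differentiable_continuous; apply/derivable1_diffP; case: (d y).
apply: prim_derive => //.
  exact/continuous_subspaceT.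
apply: continuous_subspaceT => y; apply: cvgM; [exact: cvg_cst|exact: c].
Qed.

Lemma cont_eps (a b : R) (f : R -> R) (y e : R) : {within `[a, b], continuous f} ->
  a <= y <= b -> 0 < e ->
  exists2 d, 0 < d & forall z, a <= z <= b -> `|z - y| < d -> `|f z - f y| < e.
Proof.
move=> /subspace_continuousP cf yab e0.
have /cf/cvgrPdist_lt/(_ e e0) : `[a, b]%classic y by rewrite /= in_itv.
rewrite near_withinE => -[d /= d0 Hd]; exists d => // z zab zy.
by rewrite distrC; apply: Hd; rewrite /= ?in_itv // distrC.
Qed.

Definition helm_bc (geo : geometry) (a b : R) (psi dpsi : R -> R) : Prop :=
  match geo with
  | Channel => psi a = 0 /\ psi b = 0
  | Torus => psi a = psi b /\ dpsi a = dpsi b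
  end.

Definition helm geo (a b m : R) (f psi dpsi : R -> R) :=
  [/\ prim a b psi dpsi, prim a b dpsi (fun y => m * psi y - f y) &
      helm_bc geo a b psi dpsi].

Ltac nonneg := repeat first
  [assumption | exact: ler01 | apply: divr_ge0 | apply: addr_ge0 | apply: mulr_ge0].

Section Interval.
Context (geo : geometry) (a b : R) (ltab : a < b).
Let ab : a <= b := ltW ltab.

(** Variation of constants for [p = psi' + F + k psi] and [q = psi' + F - k psi]:
    in their equations the continuous primitive [F] replaces the merely
    integrable [f]. *)
Lemma helm_formula (k : R) (f : R -> R) (p0 q0 : R) : 0 < k -> itg a b f ->
  let F y := \int[mu]_(z in `[a, y]) f z in
  let p y := expR (k * (y - a)) *
    (p0 - k * \int[mu]_(z in `[a, y]) (expR (- k * (z - a)) * F z)) in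
  let q y := expR (- k * (y - a)) *
    (q0 + k * \int[mu]_(z in `[a, y]) (expR (k * (z - a)) * F z)) in
  prim a b (fun y => (p y - q y) / (2 * k)) (fun y => (p y + q y) / 2 - F y) /\
  prim a b (fun y => (p y + q y) / 2 - F y)
    (fun y => k ^+ 2 * ((p y - q y) / (2 * k)) - f y).
Proof.
move=> k0 fi F p q; have k0' : k != 0 by rewrite gt_eqF.
have pF : prim a b F f.
  by apply: eq_prim (prim_int 0 fi) => // y _; rewrite add0r.
have cF := prim_cont ab pF.
have aux (c : R) : itg a b (fun z => expR (c * (z - a)) * F z).
  apply: itg_mul_cont => //; apply: itg_cont; exact: (prim_cont ab (prim_exp c ab)).
have ee y : expR (k * (y - a)) * expR (- k * (y - a)) = 1.
  by rewrite -expRD mulNr subrr expR0.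
have pp : prim a b p (fun y => k * p y - k * F y).
  have := prim_mul ab (prim_exp k ab) (primZ (- k) (prim_int (- p0 / k) (aux (- k)))).
  apply: eq_prim => // y yab; first by rewrite /p; field.
  have -> : expR (k * (y - a)) * (- k * (expR (- k * (y - a)) * F y)) = - k * F y.
    transitivity (- k * F y * (expR (k * (y - a)) * expR (- k * (y - a)))); first by ring.
    by rewrite ee mulr1.
  by rewrite /p; field.
have pq : prim a b q (fun y => - k * q y + k * F y).
  have := prim_mul ab (prim_exp (- k) ab) (primZ k (prim_int (q0 / k) (aux k))).
  apply: eq_prim => // y yab; first by rewrite /q; field.
  have -> : expR (- k * (y - a)) * (k * (expR (k * (y - a)) * F y)) = k * F y.
    transitivity (k * F y * (expR (k * (y - a)) * expR (- k * (y - a)))); first by ring.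
    by rewrite ee mulr1.
  by rewrite /q; field.
split.
  have := primZ (2 * k)^-1 (primD pp (primZ (-1) pq)).
  by apply: eq_prim => // y _; field.
have := primD (primZ 2^-1 (primD pp pq)) (primZ (-1) pF).
by apply: eq_prim => // y _; field.
Qed.

Lemma helm_exists (k : R) : 0 < k -> exists2 K, 0 <= K & forall f, itg a b f ->
  exists psi dpsi, helm geo a b (k ^+ 2) f psi dpsi /\
    forall y, a <= y <= b -> `|psi y| <= K * \int[mu]_(z in `[a, b]) `|f z| /\
       `|dpsi y| <= K * \int[mu]_(z in `[a, b]) `|f z|.
Proof.
move=> k0; have k0' : k != 0 by rewrite gt_eqF.
pose E := expR (k * (b - a)); pose l := b - a.
have l0 : 0 < l by rewrite subr_gt0.
have E1 : 1 < E by rewrite /E expR_gt1 mulr_gt0.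
have E0 : 0 < E by apply: lt_trans E1.
have Ei : expR (- k * (b - a)) = E^-1 by rewrite mulNr expRN.
have Ei1 : E^-1 < 1 by rewrite invf_lt1.
have Eip : 0 < E^-1 by rewrite invr_gt0.
have e_le (c y : R) : `|c| <= k -> a <= y <= b -> `|expR (c * (y - a))| <= E.
  move=> ck /andP[ay yb]; rewrite ger0_norm ?expR_ge0 // ler_expR.
  apply: le_trans (ler_norm _) _; rewrite normrM ler_pM // ger0_norm ?subr_ge0 //.
  by rewrite lerD2r.
suff [K0 K00 HK0] : exists2 K0, 0 <= K0 & forall P Q Fb N : R, 0 <= N ->
    `|P| <= l * E * N -> `|Q| <= l * E * N -> `|Fb| <= N ->
    exists p0 q0 : R, [/\ `|p0| <= K0 * N, `|q0| <= K0 * N &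
    let pb := E * (p0 - k * P) in let qb := E^-1 * (q0 + k * Q) in
    match geo with Channel => p0 = q0 /\ pb = qb
    | Torus => pb = p0 + Fb /\ qb = q0 + Fb end].
  pose K := E * (K0 + k * (l * E)).
  have K_ge0 : 0 <= K.
    by rewrite /K mulr_ge0 ?addr_ge0 ?mulr_ge0 ?(ltW k0) ?(ltW l0) ?(ltW E0).
  exists (K / k + K + 1); first by rewrite !addr_ge0 // divr_ge0 // ltW.
  move=> f fi; pose N := \int[mu]_(z in `[a, b]) `|f z|.
  have N0 : 0 <= N by exact: int_ge0.
  pose F y := \int[mu]_(z in `[a, y]) f z.
  have FN y : a <= y <= b -> `|F y| <= N.
    move=> /andP[ay yb]; apply: le_trans (int_norm (itgS (lexx a) yb fi)) _.
    exact: int_norm_le.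
  have pF : prim a b F f.
    by apply: eq_prim (prim_int 0 fi) => // y _; rewrite add0r.
  have cF := prim_cont ab pF.
  have aux (c : R) : itg a b (fun z => expR (c * (z - a)) * F z).
    apply: itg_mul_cont => //; apply: itg_cont; exact: (prim_cont ab (prim_exp c ab)).
  pose PQ c y := \int[mu]_(z in `[a, y]) (expR (c * (z - a)) * F z).
  have PQle c y : `|c| <= k -> a <= y <= b -> `|PQ c y| <= l * E * N.
    move=> ck /andP[ay yb]; apply: le_trans (int_norm (itgS (lexx a) yb (aux c))) _.
    apply: le_trans (int_norm_le (lexx a) yb ay (aux c)) _.
    rewrite -mulrA mulrC /l -int_cst //; apply: int_le; first exact: itg_norm.
      exact: itg_cst.
    by move=> z zab; rewrite normrM ler_pM // ?e_le ?FN.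
  have ck : `|k| <= k by rewrite gtr0_norm.
  have cnk : `|- k| <= k by rewrite normrN gtr0_norm.
  have bab : a <= b <= b by rewrite ab lexx.
  have [p0 [q0 [p0N q0N bc]]] := HK0 _ _ _ _ N0 (PQle _ _ cnk bab) (PQle _ _ ck bab) (FN _ bab).
  have [pr1 pr2] := helm_formula p0 q0 k0 fi.
  pose p y := expR (k * (y - a)) * (p0 - k * PQ (- k) y).
  pose q y := expR (- k * (y - a)) * (q0 + k * PQ k y).
  have pa : p a = p0 by rewrite /p subrr mulr0 expR0 mul1r /PQ intaa mulr0 subr0.
  have qa : q a = q0 by rewrite /q subrr mulr0 expR0 mul1r /PQ intaa mulr0 addr0.
  exists (fun y => (p y - q y) / (2 * k)), (fun y => (p y + q y) / 2 - F y).
  split.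
    split => //; rewrite /helm_bc; case: geo bc => /=.
      rewrite pa qa /p /q Ei -/E => -[-> ->].
      by rewrite !subrr !mul0r.
    rewrite pa qa /p /q Ei -/E => -[-> ->]; rewrite /F intaa; split; first by congr (_ / _); ring.
    by field.
  have pK y : a <= y <= b -> `|p y| <= K * N.
    move=> yab; rewrite /p normrM /K -mulrA ler_pM ?e_le //.
    rewrite (le_trans (ler_normB _ _)) // mulrDl lerD // normrM gtr0_norm //.
    by rewrite -mulrA ler_wpM2l ?(ltW k0) // PQle.
  have qK y : a <= y <= b -> `|q y| <= K * N.
    move=> yab; rewrite /q normrM /K -mulrA ler_pM ?e_le //.
    rewrite (le_trans (ler_normD _ _)) // mulrDl lerD // normrM gtr0_norm //.
    by rewrite -mulrA ler_wpM2l ?(ltW k0) // PQle.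
  have KN : 0 <= K * N by rewrite mulr_ge0.
  move=> y yab; have := pK y yab; have := qK y yab; have := FN y yab.
  move=> FyN qyK pyK; split.
    apply: (@le_trans _ _ (K / k * N)); last first.
      by rewrite ler_wpM2r // -addrA lerDl addr_ge0.
    rewrite normrM normfV (gtr0_norm (_ : 0 < 2 * k)) ?mulr_gt0 //.
    rewrite ler_pdivrMr ?mulr_gt0 //.
    have -> : K / k * N * (2 * k) = K * N + K * N by field.
    by rewrite (le_trans (ler_normB _ _)) // lerD.
  apply: (@le_trans _ _ (K * N + N)); last first.
    rewrite -[X in _ + X]mul1r -mulrDl ler_wpM2r // -addrA lerDr divr_ge0 // ltW //.
  rewrite (le_trans (ler_normB _ _)) // lerD // normrM normfV (gtr0_norm (_ : 0 < 2)) //.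
  by rewrite ler_pdivrMr // mulrDr mulr1 (le_trans (ler_normD _ _)) // lerD.
have EE : 0 < E - E^-1 by rewrite subr_gt0 (lt_trans Ei1).
have EE1 : 0 < E - 1 by rewrite subr_gt0.
have EE2 : 0 < 1 - E^-1 by rewrite subr_gt0.
have lE : 0 <= l * E by rewrite mulr_ge0 // ltW.
have [[gE gEi gk gl] [g1 g2 g3]] := (And4 (ltW E0) (ltW Eip) (ltW k0) (ltW l0), And3 (ltW EE) (ltW EE1) (ltW EE2)).
have E0' : E != 0 by rewrite gt_eqF.
have key (N P c : R) : `|P| <= l * E * N -> 0 <= c -> `|k * (c * P)| <= k * (c * (l * E)) * N.
  move=> HP c0; rewrite !normrM gtr0_norm // (ger0_norm c0) -!mulrA.
  by rewrite !ler_wpM2l // !mulrA.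
case: (geo).
- exists ((k * (E * (l * E)) + k * (E^-1 * (l * E))) / (E - E^-1)).
    by nonneg.
  move=> P Q Fb N N0 HP HQ HF.
  pose p0 := (k * (E * P) + k * (E^-1 * Q)) / (E - E^-1).
  have p0N : `|p0| <= (k * (E * (l * E)) + k * (E^-1 * (l * E))) / (E - E^-1) * N.
    rewrite /p0 normrM normfV (gtr0_norm EE) mulrAC ler_wpM2r ?invr_ge0 //.
    by rewrite (le_trans (ler_normD _ _)) // mulrDl lerD // key.
  exists p0, p0; split => //; split => //; rewrite /p0; field.
  by rewrite E0' /= (_ : E * E - 1 = E * (E - E^-1)) ?mulf_neq0 ?(gt_eqF EE) // mulrBr mulfV.
- exists ((1 + k * (E * (l * E))) / (E - 1) + (1 + k * (E^-1 * (l * E))) / (1 - E^-1)).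
    by nonneg.
  move=> P Q Fb N N0 HP HQ HF.
  exists ((Fb + k * (E * P)) / (E - 1)), ((k * (E^-1 * Q) - Fb) / (1 - E^-1)); split.
  + rewrite [leRHS]mulrDl; apply: ler_wpDr.
      by nonneg.
    rewrite normrM normfV (gtr0_norm EE1) mulrAC ler_wpM2r ?invr_ge0 //.
    by rewrite (le_trans (ler_normD _ _)) // mulrDl mul1r lerD // key.
  + rewrite [leRHS]mulrDl; apply: ler_wpDl.
      by nonneg.
    rewrite normrM normfV (gtr0_norm EE2) mulrAC ler_wpM2r ?invr_ge0 //.
    by rewrite (le_trans (ler_normB _ _)) // addrC mulrDl mul1r lerD // key.
  + move=> pb qb; rewrite /pb /qb; split; field; first by rewrite gt_eqF.
    by rewrite E0' /= (_ : E - 1 = E - 1) // gt_eqF.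
Qed.

(** Green's identity; the boundary terms cancel in both geometries. *)
Lemma helm_energy m f g psi dpsi phi dphi : itg a b f ->
  helm geo a b m f psi dpsi -> helm geo a b m g phi dphi ->
  \int[mu]_(z in `[a, b]) (f z * phi z) =
  \int[mu]_(z in `[a, b]) (dpsi z * dphi z + m * (psi z * phi z)).
Proof.
move=> fi [p1 p2 bc1] [q1 q2 bc2].
have := prim_mul_end ab p2 q1.
have -> : dpsi b * phi b - dpsi a * phi a = 0.
  by move: bc1 bc2; rewrite /helm_bc; case: (geo) => -[e1 e2] [e3 e4]; rewrite ?e3 ?e4 ?e2 ?mulr0 subrr.
have c1 := prim_cont ab p1; have c2 := prim_cont ab p2.
have d1 := prim_cont ab q1; have d2 := prim_cont ab q2.
have i1 : itg a b (fun z => dpsi z * dphi z + m * (psi z * phi z)).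
  by apply: itg_cont => x; apply: cvgD; [apply: cvgM; [exact: c2|exact: d2]|
    apply: cvgM; [exact: cvg_cst|apply: cvgM; [exact: c1|exact: d1]]].
have i2 : itg a b (fun z => f z * phi z) by exact: itg_mul_cont.
move/esym => E; apply/esym/eqP; rewrite -subr_eq0 -intB // -[X in _ == X]E; apply/eqP.
by apply: eq_int => z _; ring.
Qed.

Lemma helm_cont m f psi dpsi : helm geo a b m f psi dpsi ->
  {within `[a, b], continuous psi} /\ {within `[a, b], continuous dpsi}.
Proof. by move=> [p1 p2 _]; split; [exact: prim_cont p1|exact: prim_cont p2]. Qed.

Lemma helmD m f g psi dpsi phi dphi : helm geo a b m f psi dpsi ->
  helm geo a b m g phi dphi ->
  helm geo a b m (fun y => f y + g y) (fun y => psi y + phi y) (fun y => dpsi y + dphi y).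
Proof.
move=> [p1 p2 p3] [q1 q2 q3]; split; first exact: primD.
  by apply: eq_prim (primD p2 q2) => // y _; ring.
by move: p3 q3; rewrite /helm_bc; case: (geo) => -[e1 e2] [e3 e4]; rewrite e1 e2 e3 e4 ?addr0.
Qed.

Lemma helmZ m c f psi dpsi : helm geo a b m f psi dpsi ->
  helm geo a b m (fun y => c * f y) (fun y => c * psi y) (fun y => c * dpsi y).
Proof.
move=> [p1 p2 p3]; split; first exact: primZ.
  by apply: eq_prim (primZ c p2) => // y _; ring.
by move: p3; rewrite /helm_bc; case: (geo) => -[e1 e2]; rewrite e1 e2 ?mulr0.
Qed.

Lemma int_eq0_cont (f : R -> R) : {within `[a, b], continuous f} ->
  (forall y, a <= y <= b -> 0 <= f y) -> \int[mu]_(z in `[a, b]) f z = 0 ->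
  forall y, a <= y <= b -> f y = 0.
Proof.
move=> cf f0 I0 y yab; apply/eqP; apply: contraT => fy0.
have fyp : 0 < f y by rewrite lt_neqAle eq_sym fy0 f0.
have [d d0 Hd] := cont_eps cf yab (divr_gt0 fyp (ltr0Sn _ 1)).
have /andP[ay yb] := yab.
pose c1 := Num.max a (y - d / 2); pose c2 := Num.min b (y + d / 2).
have c12 : c1 < c2.
  rewrite /c1 /c2 gt_max !lt_min ltab /=; move: ay yb ltab; lra.
have ac1 : a <= c1 by rewrite le_max lexx.
have c2b : c2 <= b by rewrite ge_min lexx.
have fi := itg_cont cf.
have : f y / 2 * (c2 - c1) <= \int[mu]_(z in `[a, b]) f z.
  rewrite -(int_cst _ (ltW c12)).
  apply: (@le_trans _ _ (\int[mu]_(z in `[c1, c2]) `|f z|)); last first.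
    have := int_norm_le ac1 c2b (ltW c12) fi; rewrite (@eq_int _ a b (fun x => `|f x|) f) //.
    by move=> x xab; rewrite ger0_norm // f0.
  apply: int_le => [||z /andP[c1z zc2]]; [exact: itg_cst|exact/itg_norm/(itgS ac1 c2b)|].
  have zab : a <= z <= b by rewrite (le_trans ac1 c1z) (le_trans zc2 c2b).
  have zd : `|z - y| < d.
    move: c1z zc2; rewrite /c1 /c2 ge_max le_min => /andP[_ h1] /andP[_ h2].
    rewrite ltr_norml; move: h1 h2 d0; lra.
  rewrite (ger0_norm (f0 _ zab)); have := Hd z zab zd.
  by rewrite ltr_norml; lra.
rewrite I0 leNgt mulr_gt0 // ?subr_gt0 // divr_gt0 //.
Qed.

Lemma helm_unique m f psi dpsi phi dphi : 0 < m ->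
  helm geo a b m f psi dpsi -> helm geo a b m f phi dphi ->
  forall y, a <= y <= b -> psi y = phi y.
Proof.
move=> m0 hp hq.
have hd := helmD hp (helmZ (-1) hq).
set d := fun y => psi y + _ in hd; set dd := fun y => dpsi y + _ in hd.
have hd0 : helm geo a b m (fun=> 0) d dd.
  have [p1 p2 p3] := hd; split => //; apply: eq_prim p2 => // y _; ring.
have := helm_energy (itg_cst a b 0) hd0 hd0.
rewrite (_ : \int[mu]_(z in _) (0 * _) = 0); last first.
  rewrite (eq_int (g := fun=> 0)) ?int_cst ?mul0r // => z _; exact: mul0r.
have [c1 c2] := helm_cont hd0.
move/esym => E y yab; have := int_eq0_cont _ _ E yab.
move=> H; have : dd y * dd y + m * (d y * d y) = 0.
  apply: H => [x|z _].
    by apply: cvgD; [apply: cvgM; exact: c2|apply: cvgM; [exact: cvg_cst|apply: cvgM; exact: c1]].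
  by rewrite -!expr2 addr_ge0 ?sqr_ge0 // mulr_ge0 ?sqr_ge0 // ltW.
move/eqP; rewrite -!expr2 paddr_eq0 ?sqr_ge0 //; last by rewrite mulr_ge0 ?sqr_ge0 // ltW.
case/andP => _; rewrite mulf_eq0 (gt_eqF m0) /= sqrf_eq0 /d mulN1r subr_eq0.
by move/eqP.
Qed.
End Interval.
End Helmholtz.

(** * Absence of neutral modes *)

Section NoNeutralModes.
Context {R : realType}.
Notation mu := (@lebesgue_measure R).

Instance ae_lebesgue_filter : Filter (nbhs (almost_everywhere mu)).
Proof. exact: ae_filter_ringOfSetsType. Qed.

Definition aeon (a b : R) (P : R -> Prop) := \forall y \ae mu, a <= y <= b -> P y.

Lemma aeonS (a b c d : R) P : a <= c -> d <= b -> aeon a b P -> aeon c d P.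
Proof.
move=> ac db; rewrite /aeon; apply: filterS => y H /andP[cy yd].
by apply: H; rewrite (le_trans ac) // (le_trans yd).
Qed.

Lemma aeon_imp (a b : R) (P Q : R -> Prop) :
  (forall y, a <= y <= b -> P y -> Q y) -> aeon a b P -> aeon a b Q.
Proof.
by move=> PQ; rewrite /aeon; apply: filterS => y H yab; apply: (PQ _ yab); apply: H.
Qed.

Lemma aeon_and (a b : R) (P Q : R -> Prop) :
  aeon a b P -> aeon a b Q -> aeon a b (fun y => P y /\ Q y).
Proof.
move=> + H2; move: H2; rewrite /aeon; apply: filterS2 => y H1 H2 yab.
by split; [exact: H2|exact: H1].
Qed.

Lemma aeonT (a b : R) (P : R -> Prop) : (forall y, a <= y <= b -> P y) -> aeon a b P.
Proof. by move=> H; rewrite /aeon; exact: aeW. Qed.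

Lemma aeon_EFin (a b : R) (f g : R -> R) :
  aeon a b (fun y => f y = g y) ->
  forall h : R -> \bar R, (h \o f) = (h \o g) %[ae mu in `[a, b]%classic].
Proof.
move=> H k; move: H; rewrite /aeon /ae_eq; apply: filterS => y H /=.
by rewrite in_itv /= => /H ->.
Qed.

Lemma eq_int_ae (a b : R) (f g : R -> R) :
  measurable_fun `[a, b] f -> measurable_fun `[a, b] g -> aeon a b (fun y => f y = g y) ->
  \int[mu]_(z in `[a, b]) f z = \int[mu]_(z in `[a, b]) g z.
Proof.
move=> mf mg fg; congr fine; apply: ae_eq_integral => //; try exact/measurable_EFinP.
exact: (aeon_EFin fg EFin).
Qed.

Lemma eq_itg_ae (a b : R) (f g : R -> R) : itg a b f -> measurable_fun `[a, b] g ->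
  aeon a b (fun y => f y = g y) -> itg a b g.
Proof.
move=> fi mg fg; have mf := itg_measurable fi.
apply/integrableP; split; first exact/measurable_EFinP.
have /integrableP [_ foo] := fi; apply: le_lt_trans foo.
rewrite le_eqVlt; apply/orP; left; apply/eqP/esym.
apply: ae_eq_integral => //.
- by apply: measurableT_comp => //; exact/measurable_EFinP.
- by apply: measurableT_comp => //; exact/measurable_EFinP.
- exact: (aeon_EFin fg (fun x => `|x%:E|%E)).
Qed.

Lemma eq_prim_ae (a b : R) (f g g' : R -> R) : prim a b f g -> itg a b g' ->
  aeon a b (fun y => g y = g' y) -> prim a b f g'.
Proof.
move=> [gi fE] gi' gg; split => // y yab; have /andP[ay yb] := yab.
rewrite fE // (@eq_int_ae a y g g') //; first exact: itg_measurable (itgS (lexx a) yb gi).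
  exact: itg_measurable (itgS (lexx a) yb gi').
exact: aeonS gg.
Qed.

Lemma first_zero (a b : R) (Q : R -> R) : {within `[a, b], continuous Q} ->
  forall y, a <= y -> y <= b -> (forall z, y <= z <= b -> Q z != 0) \/
  exists z, [/\ y <= z <= b, Q z = 0 & forall t, y <= t -> t < z -> Q t != 0].
Proof.
move=> cQ y ay yb.
pose S := [set z | y <= z <= b /\ Q z = 0].
have [S0|nS] := pselect (S !=set0); last first.
  by left=> z zyb; apply/eqP => Qz; apply: nS; exists z.
right; have hS : has_inf S by split => //; exists y => z [/andP[]].
have lS z : S z -> inf S <= z by move=> Sz; apply: ge_inf => //; case: hS.
have yS : y <= inf S by apply: lb_le_inf => // z [/andP[]].
have Sb : inf S <= b.
  by have [z Sz] := S0; apply: le_trans (lS _ Sz) _; case: Sz => /andP[].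
have Q0 : Q (inf S) = 0.
  apply/eqP; apply: contraT => Qn0.
  have iab : a <= inf S <= b by rewrite (le_trans ay).
  have Qp : 0 < `|Q (inf S)| by rewrite normr_gt0.
  have [d d0 Hd] := cont_eps cQ iab Qp.
  have [z [/andP[yz zb] Qz] zi] := inf_adherent d0 hS.
  have /Hd : a <= z <= b by rewrite (le_trans ay).
  rewrite Qz sub0r normrN ltxx => /(_ _)/=; rewrite ger0_norm; last first.
    by rewrite subr_ge0; apply: lS; split => //; rewrite yz.
  by rewrite ltrBlDl => /(_ zi).
exists (inf S); split => //; first by rewrite yS.
move=> t yt ti; apply/eqP => Qt; move: (ti); rewrite ltNge lS //.
by split => //; rewrite yt (le_trans (ltW ti)).
Qed.

Lemma last_zero (a b : R) (Q : R -> R) : {within `[a, b], continuous Q} ->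
  forall y, a <= y -> y <= b -> (forall z, a <= z <= y -> Q z != 0) \/
  exists z, [/\ a <= z <= y, Q z = 0 & forall t, z < t -> t <= y -> Q t != 0].
Proof.
move=> cQ y ay yb.
have cQ' : {within `[- b, - a], continuous (fun x => Q (- x))}.
  apply/subspace_continuousP => x; rewrite /= in_itv /= => /andP[bx xa].
  apply/cvgrPdist_lt => e e0; rewrite near_withinE.
  have nab : a <= - x <= b by rewrite lerNr xa lerNl bx.
  have [d d0 Hd] := cont_eps cQ nab e0.
  exists d => //= z /=; rewrite in_itv /= => xz /andP[bz za].
  rewrite distrC; apply: Hd; first by rewrite lerNr za lerNl bz.
  by rewrite opprK addrC.
have nb : - b <= - y by rewrite lerN2.
have na : - y <= - a by rewrite lerN2.
have [H|[z [zI Qz Ht]]] := first_zero cQ' nb na.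
  by left=> z /andP[az zy]; rewrite -[z]opprK H // !lerN2 zy.
right; exists (- z); split => //.
  by move/andP: zI => [h1 h2]; rewrite lerNr h2 lerNl.
by move=> t zt ty; rewrite -[t]opprK; apply: Ht; rewrite ?lerN2 // ltrNl.
Qed.

(** The growth condition bounds [g] from below by a multiple of [1 / (z - y)]
    near [z], which is not integrable. *)
Lemma blowup_left (y0 z K : R) (g : R -> R) : y0 < z -> 0 < K ->
  (forall y, y0 <= y -> y < z -> 0 <= g y) ->
  (forall c d, y0 <= c -> c <= d -> d < z -> g c + (d - c) * K / (z - c) ^+ 2 <= g d) ->
  itg y0 z g -> False.
Proof.
move=> yz K0 g0 gincr gi.
have pG := prim_int 0 gi; set G := fun y => _ in pG.
have K8 : 0 < K / 8 by rewrite divr_gt0.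
have zz : y0 <= z <= z by rewrite lexx ltW.
have [d d0 Hd] := cont_eps (prim_cont (ltW yz) pG) zz K8.
pose y := Num.max y0 (z - d / 2).
have yy : y0 <= y by rewrite le_max lexx.
have yltz : y < z by rewrite /y gt_max yz /=; move: d0; lra.
pose c := (y + z) / 2; pose c' := (c + z) / 2.
have h1 : y < c by rewrite /c; lra.
have h2 : c < c' by rewrite /c' /c; lra.
have h3 : c' < z by rewrite /c' /c; lra.
have gl t : c <= t -> t < z -> K / (2 * (z - y)) <= g t.
  move=> ct tz; have y0c : y0 <= c by rewrite (le_trans yy) // ltW.
  have := gincr y c yy (ltW h1) (lt_trans h2 h3).
  have := gincr c t y0c ct tz.
  have : 0 <= (t - c) * K / (z - c) ^+ 2.
    by rewrite divr_ge0 ?sqr_ge0 // mulr_ge0 ?subr_ge0 // ltW.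
  have -> : (c - y) * K / (z - y) ^+ 2 = K / (2 * (z - y)).
    by rewrite /c; field; rewrite subr_eq0 gt_eqF.
  by have := g0 y yy yltz; lra.
have le1 : K / 8 <= G z - G c.
  have pGE := prim_diff pG (le_trans yy (ltW h1)) (ltW (lt_trans h2 h3)) (lexx _).
  rewrite pGE addrAC subrr add0r.
  have gi' : itg c z g by apply: itgS gi => //; rewrite (le_trans yy) // ltW.
  rewrite (@intU _ c z c') // ?(ltW h2) ?(ltW h3) //.
  apply: ler_wpDr.
    rewrite -Rintegral_itv_bndo_bndc; last first.
      by apply: integrableS gi' => //= x /=; rewrite !in_itv /= => /andP[cx xz]; rewrite (le_trans (ltW h2) cx) ltW.
    apply: Rintegral_ge0 => x /=; rewrite in_itv /= => /andP[cx xz].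
    by apply: g0 => //; rewrite (le_trans yy) // (le_trans (ltW h1)) // (le_trans (ltW h2)).
  have -> : K / 8 = K / (2 * (z - y)) * (c' - c).
    by rewrite /c' /c; field; rewrite subr_eq0 gt_eqF.
  rewrite -(int_cst _ (ltW h2)); apply: int_le; first exact: itg_cst.
    exact: itgS (lexx _) (ltW h3) gi'.
  by move=> x /andP[cx xc']; apply: gl => //; exact: le_lt_trans h3.
have := Hd c; rewrite (le_trans yy (ltW h1)) (ltW (lt_trans h2 h3)) => /(_ isT).
rewrite distrC ger0_norm ?subr_ge0 ?(ltW (lt_trans h2 h3)) // => H.
have : z - c < d.
  have : z - d / 2 <= y by rewrite le_max lexx orbT.
  by rewrite /c; move: d0; lra.
by move=> /H; rewrite distrC => /(le_lt_trans (ler_norm _)); rewrite ltNge le1.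
Qed.

Lemma blowup_right (y0 z K : R) (g : R -> R) : z < y0 -> 0 < K ->
  (forall y, z < y -> y <= y0 -> 0 <= g y) ->
  (forall c d, z < c -> c <= d -> d <= y0 -> g d + (d - c) * K / (d - z) ^+ 2 <= g c) ->
  itg z y0 g -> False.
Proof.
move=> yz K0 g0 gincr gi.
have pG := prim_int 0 gi; set G := fun y => _ in pG.
have K8 : 0 < K / 8 by rewrite divr_gt0.
have zz : z <= z <= y0 by rewrite lexx ltW.
have [d d0 Hd] := cont_eps (prim_cont (ltW yz) pG) zz K8.
pose y := Num.min y0 (z + d / 2).
have yy : y <= y0 by rewrite ge_min lexx.
have yltz : z < y by rewrite /y lt_min yz /=; move: d0; lra.
pose c := (y + z) / 2; pose c' := (c + z) / 2.
have h1 : c < y by rewrite /c; lra.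
have h2 : c' < c by rewrite /c' /c; lra.
have h3 : z < c' by rewrite /c' /c; lra.
have h13 : z < c by exact: lt_trans h2.
have cy0 : c <= y0 by rewrite (le_trans _ yy) // ltW.
have gl t : z < t -> t <= c -> K / (2 * (y - z)) <= g t.
  move=> zt tc.
  have := gincr c y h13 (ltW h1) yy.
  have := gincr t c zt tc cy0.
  have : 0 <= (c - t) * K / (c - z) ^+ 2.
    by rewrite divr_ge0 ?sqr_ge0 // mulr_ge0 ?subr_ge0 // ltW.
  have -> : (y - c) * K / (y - z) ^+ 2 = K / (2 * (y - z)).
    by rewrite /c; field; rewrite subr_eq0 gt_eqF.
  by have := g0 y yltz yy; lra.
have le1 : K / 8 <= G c - G z.
  have pGE := prim_diff pG (lexx _) (ltW h13) cy0.
  rewrite pGE addrAC subrr add0r.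
  have gi' : itg z c g by exact: itgS gi.
  rewrite (@intU _ z c c') // ?(ltW h2) ?(ltW h3) //.
  apply: ler_wpDl.
    rewrite -Rintegral_itv_obnd_cbnd; last first.
      by apply: integrableS gi' => //= x /=; rewrite !in_itv /= => /andP[cx xz]; rewrite (ltW cx) (le_trans xz) // ltW.
    apply: Rintegral_ge0 => x /=; rewrite in_itv /= => /andP[cx xz].
    by apply: g0 => //; rewrite (le_trans xz) // (le_trans (ltW h2)).
  have -> : K / 8 = K / (2 * (y - z)) * (c - c').
    by rewrite /c' /c; field; rewrite subr_eq0 gt_eqF.
  rewrite -(int_cst _ (ltW h2)); apply: int_le; first exact: itg_cst.
    exact: itgS (ltW h3) (lexx _) gi'.
  by move=> x /andP[cx xc']; apply: gl => //; exact: lt_le_trans cx.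
have := Hd c; rewrite (ltW h13) cy0 => /(_ isT).
rewrite ger0_norm ?subr_ge0 ?(ltW h13) // => H.
have : c - z < d.
  have : y <= z + d / 2 by rewrite ge_min lexx orbT.
  by rewrite /c; move: d0; lra.
by move=> /H /(le_lt_trans (ler_norm _)); rewrite ltNge le1.
Qed.

Section Comparison.
Context (geo : geometry) (a b m : R) (ltab : a < b) (m0 : 0 < m).
Context (Q Q' Q'' f psi dpsi : R -> R).
Let ab : a <= b := ltW ltab.
Context (cQ : {within `[a, b], continuous Q}) (cQ' : {within `[a, b], continuous Q'})
  (cQ'' : {within `[a, b], continuous Q''})
  (dQ : forall y, a < y < b -> is_derive y 1 Q (Q' y))
  (dQ' : forall y, a < y < b -> is_derive y 1 Q' (Q'' y))
  (Qper : if geo is Torus then Q a = Q b /\ Q' a = Q' b else True)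
  (fi : itg a b f) (hpsi : helm geo a b m f psi dpsi)
  (fQ : aeon a b (fun y => Q y * f y = - (Q'' y * psi y)))
  (phi2 : itg a b (fun y => (psi y / Q y) ^+ 2)).

Let W y := dpsi y * Q y - psi y * Q' y.
Let Theta y := psi y / Q y * W y.

Let pQ : prim a b Q Q'. Proof. exact: prim_derive. Qed.
Let pQ' : prim a b Q' Q''. Proof. exact: prim_derive. Qed.
Let cpsi : {within `[a, b], continuous psi}. Proof. by have [] := helm_cont ltab hpsi. Qed.
(** The singular density [f] cancels in the derivative of the Wronskian of
    [psi] and [Q]. *)
Lemma wronskian_prim : prim a b W (fun y => m * psi y * Q y).
Proof.
have [p1 p2 _] := hpsi.
have pw := primD (prim_mul ab p2 pQ) (primZ (-1) (prim_mul ab p1 pQ')).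
have pw' : prim a b W (fun y => (m * psi y - f y) * Q y - psi y * Q'' y).
  by apply: eq_prim pw => // y _; rewrite /W; ring.
apply: eq_prim_ae pw' _ _.
  by apply: itg_cont => x; apply: cvgM; [apply: cvgM; [exact: cvg_cst|exact: cpsi]|exact: cQ].
by apply: aeon_imp fQ => y _ E; rewrite mulrBl [f y * _]mulrC E; ring.
Qed.

Let cW : {within `[a, b], continuous W}.
Proof. exact: prim_cont ab wronskian_prim. Qed.

Section Nonvanishing.
Context (c d : R) (ac : a <= c) (ltcd : c < d) (db : d <= b).
Context (Q0 : forall y, c <= y <= d -> Q y != 0).
Let cd : c <= d := ltW ltcd.

Let sub : `[c, d] `<=` `[a, b].
Proof.
move=> x /=; rewrite !in_itv /= => /andP[cx xd].
by rewrite (le_trans ac cx) (le_trans xd db).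
Qed.

Let cinv : {within `[c, d], continuous (fun y => (Q y)^-1)}.
Proof.
apply/subspace_continuousP => x xcd; apply: cvgV.
  by apply: Q0; move: xcd; rewrite /= in_itv.
by move/subspace_continuousP : (continuous_subspaceW sub cQ); apply.
Qed.

Lemma prim_phi : prim c d (fun y => psi y / Q y) (fun y => W y / Q y ^+ 2).
Proof.
have [p1 _ _] := hpsi.
have pinv : prim c d (fun y => (Q y)^-1) (fun y => - (Q' y * ((Q y)^-1 * (Q y)^-1))).
  apply: prim_derive => //.
    move=> x; apply: cvgN; apply: cvgM; first exact: (continuous_subspaceW sub cQ').
    by apply: cvgM; exact: cinv.
  move=> y /andP[cy yd].
  have ycd : c <= y <= d by rewrite !ltW.
  have dy := dQ (y := y); rewrite (le_lt_trans ac cy) (lt_le_trans yd db) in dy.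
  have -> : - (Q' y * ((Q y)^-1 * (Q y)^-1)) = - Q y ^- 2 *: Q' y.
    by rewrite /GRing.scale /= -exprVn expr2; ring.
  by apply: is_deriveV; [exact: Q0|exact: dy].
have := prim_mul cd (primS ac db p1) pinv; apply: eq_prim => // y ycd.
by rewrite /W; field; exact: Q0.
Qed.

(** The derivative is a sum of squares, whence the monotonicity of [Theta]
    between zeros of [Q]. *)
Lemma prim_Theta : prim c d Theta (fun y => W y ^+ 2 / Q y ^+ 2 + m * psi y ^+ 2).
Proof.
have := prim_mul cd prim_phi (primS ac db wronskian_prim); apply: eq_prim => // y ycd.
by field; exact: Q0.
Qed.

(** The sign of [Theta] decides the growth of [psi / Q]. *)
Lemma prim_phi2 : prim c d (fun y => (psi y / Q y) ^+ 2) (fun y => 2 * Theta y / Q y ^+ 2).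
Proof.
have := prim_mul cd prim_phi prim_phi; apply: eq_prim => // y ycd.
by rewrite /Theta; field; exact: Q0.
Qed.

Lemma Theta_mono : Theta c <= Theta d.
Proof.
have := prim_diff prim_Theta (lexx _) cd (lexx _) => ->; rewrite lerDl int_ge0 // => y _.
by rewrite addr_ge0 ?divr_ge0 ?sqr_ge0 // mulr_ge0 ?sqr_ge0 // ltW.
Qed.

Lemma Theta_const : Theta c = Theta d -> forall y, c <= y <= d -> psi y = 0.
Proof.
move=> TE y ycd; have := prim_diff prim_Theta (lexx _) cd (lexx _).
rewrite TE => /esym/eqP; rewrite -subr_eq0 addrAC subrr add0r => /eqP I0.
pose g z := W z * W z * ((Q z)^-1 * (Q z)^-1) + m * (psi z * psi z).
have gE z : W z ^+ 2 / Q z ^+ 2 + m * psi z ^+ 2 = g z.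
  by rewrite /g -exprVn !expr2.
have cg : {within `[c, d], continuous g}.
  move=> x; have cW' := continuous_subspaceW sub cW.
  have cp' := continuous_subspaceW sub cpsi.
  apply: cvgD; first by apply: cvgM; apply: cvgM; first [exact: cW'|exact: cinv].
  by apply: cvgM; [exact: cvg_cst|apply: cvgM; exact: cp'].
have g0 z : 0 <= g z.
  by rewrite -gE addr_ge0 ?divr_ge0 ?sqr_ge0 // mulr_ge0 ?sqr_ge0 // ltW.
have : g y = 0.
  apply: (int_eq0_cont ltcd cg) => //.
  by rewrite -I0; apply: eq_int => z _; rewrite gE.
rewrite -gE => /eqP; rewrite paddr_eq0 ?divr_ge0 ?sqr_ge0 //; last first.
  by rewrite mulr_ge0 ?sqr_ge0 // ltW.
by case/andP => _; rewrite mulf_eq0 (gt_eqF m0) /= sqrf_eq0 => /eqP.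
Qed.
End Nonvanishing.

Lemma Q_lipschitz : exists2 k, 0 < k & forall y z, a <= y <= b -> a <= z <= b ->
  `|Q y - Q z| <= k * `|y - z|.
Proof.
have [k k0 Hk] := cont_bounded ab cQ'.
exists (k + 1); first by rewrite ltr_wpDl.
suff w y z : a <= y -> y <= z -> z <= b -> `|Q z - Q y| <= (k + 1) * (z - y).
  move=> y z /andP[ay yb] /andP[az zb]; have [yz|/ltW zy] := leP y z.
    by rewrite distrC (distrC y) (ger0_norm (_ : 0 <= z - y)) ?subr_ge0 //; exact: w.
  by rewrite (ger0_norm (_ : 0 <= y - z)) ?subr_ge0 //; exact: w.
move=> ay yz zb; rewrite (prim_diff pQ ay yz zb) addrAC subrr add0r.
have [qi _] := pQ; have qi' := itgS ay zb qi.
apply: le_trans (int_norm qi') _; rewrite -(int_cst _ yz); apply: int_le.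
- exact: itg_norm.
- exact: itg_cst.
move=> x /andP[yx xz]; rewrite (le_trans (Hk _ _)) ?lerDl //.
by rewrite (le_trans ay) // (le_trans xz).
Qed.

(** A positive value persists up to the zero [z], where [Q] is at most of the
    size of the distance to [z]; then [(psi / Q)^2] blows up too fast to be
    integrable. *)
Lemma Theta_le0 (y z : R) : a <= y -> y < z -> z <= b -> Q z = 0 ->
  (forall t, y <= t -> t < z -> Q t != 0) -> Theta y <= 0.
Proof.
move=> ay yz zb Qz Qt; rewrite leNgt; apply/negP => T0.
have [k k0 Hk] := Q_lipschitz.
have mono t : y <= t -> t < z -> Theta y <= Theta t.
  rewrite le_eqVlt => /predU1P[<- //|yt] tz.
  apply: Theta_mono => //; first by rewrite (le_trans (ltW tz)).
  by move=> s /andP[ys st]; apply: Qt => //; exact: le_lt_trans tz.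
apply: (@blowup_left y z (2 * Theta y / k ^+ 2) (fun t => (psi t / Q t) ^+ 2)) => //.
- by apply: divr_gt0; [exact: mulr_gt0|exact: exprn_gt0].
- by move=> t _ _; exact: sqr_ge0.
- move=> c d yc; rewrite le_eqVlt => /predU1P[<- _|cd dz].
    by rewrite subrr !mul0r addr0.
  have ac : a <= c by exact: le_trans yc.
  have db : d <= b by rewrite (le_trans (ltW dz)).
  have Qcd s : c <= s <= d -> Q s != 0.
    by move=> /andP[cs sd]; apply: Qt; [exact: le_trans cs|exact: le_lt_trans dz].
  have pp := prim_phi2 ac cd db Qcd.
  rewrite (prim_diff pp (lexx _) (ltW cd) (lexx _)) lerD2l.
  have [pi _] := pp.
  have -> : (d - c) * (2 * Theta y / k ^+ 2) / (z - c) ^+ 2 =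
     2 * Theta y / (k * (z - c)) ^+ 2 * (d - c).
    by field; rewrite (gt_eqF k0) subr_eq0 gt_eqF // (lt_trans cd).
  rewrite -(int_cst _ (ltW cd)); apply: int_le => //; first exact: itg_cst.
  move=> s scd; have /andP[cs sd] := scd.
  have sz : s < z by exact: le_lt_trans dz.
  have ys : y <= s by exact: le_trans cs.
  have Qs0 : 0 < Q s ^+ 2 by rewrite exprn_even_gt0 //= Qcd.
  have kz0 : 0 < (k * (z - c)) ^+ 2.
    by rewrite exprn_gt0 // mulr_gt0 // subr_gt0 (lt_trans cd).
  apply: ler_pM; [exact: mulr_ge0 (ler0n _ 2) (ltW T0)|by rewrite invr_ge0 ltW| |].
    by rewrite ler_wpM2l // mono.
  rewrite lef_pV2 ?posrE // -[Q s]subr0 -Qz -real_normK ?num_real //.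
  rewrite lerXn2r ?nnegrE ?mulr_ge0 ?(ltW k0) ?subr_ge0 ?(ltW (lt_trans cd dz)) //.
  have sab : a <= s <= b by rewrite (le_trans ay ys) (le_trans sd db).
  have zab : a <= z <= b by rewrite zb (le_trans ay) // ltW.
  apply: le_trans (Hk _ _ sab zab) _; rewrite ler_wpM2l ?(ltW k0) //.
  by rewrite distrC ger0_norm ?subr_ge0 ?(ltW sz) // lerB.
- by apply: itgS phi2.
Qed.

Lemma Theta_ge0 (y z : R) : a <= z -> z < y -> y <= b -> Q z = 0 ->
  (forall t, z < t -> t <= y -> Q t != 0) -> 0 <= Theta y.
Proof.
move=> az zy yb Qz Qt; rewrite leNgt; apply/negP => T0.
have [k k0 Hk] := Q_lipschitz.
have mono t : z < t -> t <= y -> Theta t <= Theta y.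
  move=> zt; rewrite le_eqVlt => /predU1P[-> //|ty].
  apply: Theta_mono => //; first by rewrite (le_trans az) // ltW.
  by move=> s /andP[ys st]; apply: Qt => //; exact: lt_le_trans ys.
apply: (@blowup_right y z (2 * - Theta y / k ^+ 2) (fun t => (psi t / Q t) ^+ 2)) => //.
- by apply: divr_gt0; [apply: mulr_gt0; rewrite ?oppr_gt0|exact: exprn_gt0].
- by move=> t _ _; exact: sqr_ge0.
- move=> c d zc; rewrite le_eqVlt => /predU1P[<- _|cd dy].
    by rewrite subrr !mul0r addr0.
  have ac : a <= c by rewrite (le_trans az) // ltW.
  have db : d <= b by rewrite (le_trans dy).
  have zd : z < d by exact: lt_trans cd.
  have Qcd s : c <= s <= d -> Q s != 0.
    by move=> /andP[cs sd]; apply: Qt; [exact: lt_le_trans cs|exact: le_trans dy].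
  have pp := prim_phi2 ac cd db Qcd.
  rewrite (prim_diff pp (lexx _) (ltW cd) (lexx _)) -addrA gerDl.
  have [pi _] := pp.
  have -> : (d - c) * (2 * - Theta y / k ^+ 2) / (d - z) ^+ 2 =
     2 * - Theta y / (k * (d - z)) ^+ 2 * (d - c).
    by field; rewrite (gt_eqF k0) subr_eq0 gt_eqF.
  rewrite -lerBrDr sub0r -mulNr -(int_cst _ (ltW cd)).
  apply: int_le => //; first exact: itg_cst.
  move=> s scd; have /andP[cs sd] := scd.
  have zs : z < s by exact: lt_le_trans cs.
  have sy : s <= y by exact: le_trans dy.
  have Qs0 : 0 < Q s ^+ 2 by rewrite exprn_even_gt0 //= Qcd.
  have kz0 : 0 < (k * (d - z)) ^+ 2.
    by rewrite exprn_gt0 // mulr_gt0 // subr_gt0.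
  rewrite lerNr (_ : - (2 * Theta s / Q s ^+ 2) = 2 * - Theta s / Q s ^+ 2); last first.
    by move: (Theta s) => T; ring.
  have nT : 0 <= - Theta y by rewrite oppr_ge0 ltW.
  apply: ler_pM; [exact: mulr_ge0 (ler0n _ 2) nT|by rewrite invr_ge0 ltW| |].
    by rewrite ler_wpM2l // lerN2 mono.
  rewrite lef_pV2 ?posrE // -[Q s]subr0 -Qz -real_normK ?num_real //.
  rewrite lerXn2r ?nnegrE ?mulr_ge0 ?(ltW k0) ?subr_ge0 ?(ltW zd) //.
  have sab : a <= s <= b by rewrite (le_trans ac cs) (le_trans sd db).
  have zab : a <= z <= b by rewrite az (le_trans (ltW zd) db).
  apply: le_trans (Hk _ _ sab zab) _; rewrite ler_wpM2l ?(ltW k0) //.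
  by rewrite ger0_norm ?subr_ge0 ?(ltW zs) // lerB.
- by apply: itgS phi2.
Qed.

(** Between consecutive zeros of [Q] the monotone function [Theta] goes from a
    nonnegative to a nonpositive value, so it is constant and [psi] vanishes. At
    the end points the boundary conditions take the place of the zeros. *)
Lemma no_neutral_mode y : a <= y <= b -> Q y != 0 -> psi y = 0.
Proof.
move=> yab Qy; have /andP[ay yb] := yab.
have [nv|[z [zab Qz]]] : (forall t, a <= t <= b -> Q t != 0) \/ exists z, a <= z <= b /\ Q z = 0.
    have [|[z [zab Qz _]]] := first_zero cQ (lexx a) ab; first by left.
    by right; exists z.
  apply: (Theta_const (lexx a) ltab (lexx b) nv) => //.
  have [_ _] := hpsi; move: Qper; rewrite /helm_bc /Theta /W; case: (geo).
    by move=> _ [-> ->]; rewrite !mul0r.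
  by move=> [-> ->] [-> ->].
(* the end points: zero in the channel, and glued on the torus *)
have bdry : (Q a != 0 -> Theta a <= 0) /\ (Q b != 0 -> 0 <= Theta b).
  split=> Q0.
    have [nv|[t [/andP[at_ tb] Qt Ht]]] := first_zero cQ (lexx a) ab.
      by have := nv z zab; rewrite Qz eqxx.
    apply: (@Theta_le0 a t) => //; rewrite lt_neqAle at_ andbT.
    by apply: contra_neq Q0 => ->.
  have [nv|[t [/andP[at_ tb] Qt Ht]]] := last_zero cQ ab (lexx b).
    by have := nv z zab; rewrite Qz eqxx.
  apply: (@Theta_ge0 b t) => //; rewrite lt_neqAle tb andbT.
  by apply: contra_neq Q0 => <-.
have bdry2 : (Q b != 0 -> Theta b <= 0) /\ (Q a != 0 -> 0 <= Theta a).
  have [_ _] := hpsi; move: Qper bdry; rewrite /helm_bc /Theta /W; case: (geo).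
    by move=> _ _ [-> ->]; rewrite !mul0r.
  by move=> [-> ->] [h1 h2] [e1 e2]; rewrite e1 e2 in h1 *; split.
have T0 x : a <= x <= b -> Q x != 0 -> Theta x = 0.
  move=> /andP[ax xb] Qx; apply/le_anti/andP; split.
    have [nv|[t [/andP[xt tb] Qt Ht]]] := first_zero cQ ax xb.
      have [xE|xb'] : x = b \/ x < b by move: xb; rewrite le_eqVlt => /predU1P.
        by rewrite xE; apply: bdry2.1; rewrite -xE.
      apply: le_trans (bdry2.1 _); last by apply: nv; rewrite xb lexx.
      exact: Theta_mono.
    apply: (@Theta_le0 x t) => //; rewrite lt_neqAle xt andbT.
    by apply: contra_neq Qx => ->.
  have [nv|[t [/andP[at_ tx] Qt Ht]]] := last_zero cQ ax xb.
    have [xE|ax'] : a = x \/ a < x by move: ax; rewrite le_eqVlt => /predU1P.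
      by rewrite -xE; apply: bdry2.2; rewrite xE.
    apply: le_trans (bdry2.2 _) _; first by apply: nv; rewrite ax lexx.
    exact: Theta_mono.
  apply: (@Theta_ge0 x t) => //; rewrite lt_neqAle tx andbT.
  by apply: contra_neq Qx => <-.
have Qp : 0 < `|Q y| by rewrite normr_gt0.
have [d d0 Hd] := cont_eps cQ yab Qp.
  pose c1 := Num.max a (y - d / 2); pose c2 := Num.min b (y + d / 2).
  have c12 : c1 < c2.
    rewrite /c1 /c2 gt_max !lt_min ltab /=; move: ay yb ltab; lra.
  have ac1 : a <= c1 by rewrite le_max lexx.
  have c2b : c2 <= b by rewrite ge_min lexx.
  have Qc t : c1 <= t <= c2 -> Q t != 0.
    move=> /andP[c1t tc2]; apply/eqP => Qt.
    have tab : a <= t <= b by rewrite (le_trans ac1 c1t) (le_trans tc2 c2b).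
    have : `|t - y| < d.
      move: c1t tc2; rewrite /c1 /c2 ge_max le_min => /andP[_ h1] /andP[_ h2].
      rewrite ltr_norml; move: h1 h2 d0; lra.
    by move=> /(Hd t tab); rewrite Qt sub0r normrN ltxx.
  have c1c2 := ltW c12.
  apply: (Theta_const ac1 c12 c2b Qc).
    by rewrite !T0 ?Qc ?lexx ?c1c2 ?ac1 ?c2b ?(le_trans ac1 c1c2) ?(le_trans c1c2 c2b).
  by rewrite /c1 /c2 ge_max le_min ay yb /=; move: d0; lra.
Qed.
End Comparison.
End NoNeutralModes.

(** * The shear profile *)

Section OneSidedDerivatives.
Context {R : realType}.

Lemma diff_quot_eps (D : set R) (f : R -> R) (y : R) : derivable_in D f -> D y ->
  forall e, 0 < e -> exists2 d, 0 < d & forall z, D z -> z != y -> `|z - y| < d ->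
    `|f z - f y - deriv_in D f y * (z - y)| <= e * `|z - y|.
Proof.
move=> df Dy e e0; have := df y Dy => /cvgrPdist_lt /(_ e e0).
rewrite near_withinE -/(deriv_in D f y) => -[d /= d0 Hd]; exists d => // z Dz zy zd.
have zy0 : z - y != 0 by rewrite subr_eq0.
have -> : f z - f y - deriv_in D f y * (z - y) =
  (diff_quot f y z - deriv_in D f y) * (z - y).
  by rewrite /diff_quot mulrBl divfK.
rewrite normrM ler_wpM2r // distrC ltW //; apply: Hd => //=.
by rewrite distrC.
Qed.

Lemma derivable_in_cont (D : set R) (f : R -> R) : derivable_in D f ->
  {within D, continuous f}.
Proof.
move=> df; apply/subspace_continuousP => y Dy; apply/cvgrPdist_lt => e e0.
have [d d0 Hd] := diff_quot_eps df Dy ltr01.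
pose k := `|deriv_in D f y| + 1.
have k0 : 0 < k by rewrite ltr_wpDl.
rewrite near_withinE; exists (Num.min d (e / k)) => /=.
  by rewrite lt_min d0 divr_gt0.
move=> z /=; rewrite lt_min => /andP[]; rewrite distrC => zd ze Dz.
have [->|zy] := eqVneq z y; first by rewrite subrr normr0.
have := Hd z Dz zy zd; rewrite mul1r => H.
rewrite distrC; apply: (@le_lt_trans _ _ (k * `|z - y|)).
  rewrite -[f z - f y](subrK (deriv_in D f y * (z - y))).
  by rewrite (le_trans (ler_normD _ _)) // /k mulrDl mul1r addrC lerD // normrM.
by rewrite mulrC -ltr_pdivlMr.
Qed.

Lemma derivable_in_is_derive (D : set R) (f : R -> R) (y : R) : derivable_in D f ->
  nbhs y D -> is_derive y (1 : R) f (deriv_in D f y).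
Proof.
move=> df Dy; have Dy' := nbhs_singleton Dy.
suff H : (fun h => h^-1 *: (f (h *: (1 : R) + y) - f y)) @ (0 : R)^' --> deriv_in D f y.
  split; first by apply/cvg_ex; exists (deriv_in D f y).
  exact: cvg_lim H.
apply/cvgrPdist_lt => e e0; have [d d0 Hd] := diff_quot_eps df Dy' (divr_gt0 e0 (ltr0Sn _ 1)).
have [d' /= d'0 Hd'] := Dy.
exists (Num.min d d') => /=; first by rewrite lt_min d0.
move=> h /=; rewrite sub0r normrN lt_min => /andP[hd hd'] h0.
have Dz : D (h *: (1 : R) + y).
  by apply: Hd' => /=; rewrite opprD addrCA subrr addr0 normrN /GRing.scale /= mulr1.
have zE : h *: (1 : R) + y - y = h by rewrite addrK /GRing.scale /= mulr1.
have := Hd _ Dz; rewrite zE => /(_ _ hd); rewrite -subr_eq0 zE => /(_ h0) H.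
have hn : 0 < `|h| by rewrite normr_gt0.
rewrite distrC; apply: (@le_lt_trans _ _ (e / 2)); last by lra.
have -> : h^-1 *: (f (h *: (1 : R) + y) - f y) - deriv_in D f y =
   h^-1 * (f (h *: (1 : R) + y) - f y - deriv_in D f y * h).
  by rewrite /GRing.scale /=; field.
by rewrite normrM normfV mulrC ler_pdivrMr.
Qed.
End OneSidedDerivatives.

Section Profile.
Context {R : realType} (F : shear_flow R).
Notation mu := (@lebesgue_measure R).
Context (hy : y1 F < y2 F) (hU : C2_profile F) (hK : class_Kplus F).
Local Notation a := (y1 F).
Local Notation b := (y2 F).
Let dom := profile_dom F.
Definition dU : R -> R := deriv_in dom (U F).
Let ab : a <= b := ltW hy.

Let domI : `[a, b] `<=` dom.
Proof. by rewrite /dom /profile_dom; case: geom. Qed.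

Let domN (y : R) : a < y < b -> nbhs y dom.
Proof.
move=> yab; rewrite /dom /profile_dom; case: geom; last exact: filterT.
have : y \in `]a, b[ by rewrite in_itv.
move=> /near_in_itvoo; apply: filterS => z.
rewrite /yI /= !in_itv /= => /andP[az zb]; by rewrite !ltW.
Qed.

Lemma U_cont : {within `[a, b], continuous (U F)}.
Proof.
have [[d1 d2 _] _] := hU.
exact: continuous_subspaceW domI (derivable_in_cont d1).
Qed.

Lemma dU_cont : {within `[a, b], continuous dU}.
Proof.
have [[d1 d2 _] _] := hU.
exact: continuous_subspaceW domI (derivable_in_cont d2).
Qed.

Lemma ddU_cont : {within `[a, b], continuous (ddU F)}.
Proof. have [[_ _ c] _] := hU; exact: continuous_subspaceW domI c. Qed.

Lemma U_derive (y : R) : a < y < b -> is_derive y (1 : R) (U F) (dU y).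
Proof.
move=> /domN yD; have [[d1 _ _] _] := hU; exact: derivable_in_is_derive.
Qed.

Lemma dU_derive (y : R) : a < y < b -> is_derive y (1 : R) dU (ddU F y).
Proof.
move=> /domN yD; have [[_ d2 _] _] := hU; exact: derivable_in_is_derive.
Qed.

Lemma U_periodic :
  if geom F is Torus then U F a = U F b /\ dU a = dU b else True.
Proof.
have [[d1 _ _] per0] := hU; move: d1 per0; rewrite /dU /dom /profile_dom.
case: (geom F) => // d1 per.
have p1 y : U F (y + (b - a)) = U F y by exact: per.
have ba : a + (b - a) = b by rewrite subrKC.
split; first by rewrite -(p1 a) ba.
have dT y : is_derive y (1 : R) (U F) (deriv_in setT (U F) y).
  by apply: derivable_in_is_derive; [exact: d1|exact: filterT].
pose s y := y + (b - a).
have ds : is_derive a (1 : R) s 1.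
  rewrite -[X in is_derive _ _ _ X]addr0; apply: is_deriveD.
have dsb : is_derive (s a) (1 : R) (U F) (deriv_in setT (U F) b) by rewrite /s ba.
have dc := is_derive1_comp dsb ds; rewrite mulr1 in dc.
have -> : deriv_in setT (U F) a = 'D_1 (U F) a by rewrite (@derive_val _ _ _ _ _ _ _ (dT a)).
have Us_ : U F \o s = U F by apply/funext => y /=; exact: p1.
rewrite Us_ in dc; by rewrite (@derive_val _ _ _ _ _ _ _ dc).
Qed.

Lemma mvt (f f' : R -> R) (y z : R) : {within `[a, b], continuous f} ->
  (forall y, a < y < b -> is_derive y (1 : R) f (f' y)) ->
  a <= y <= b -> a <= z <= b -> z != y ->
  exists x, [/\ a < x < b, 0 < `|x - y|, `|x - y| < `|z - y| & f z - f y = f' x * (z - y)].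
Proof.
move=> cf df /andP[ay yb] /andP[az zb] zy.
have w (s t : R) : a <= s -> s < t -> t <= b -> exists2 x, s < x < t & f t - f s = f' x * (t - s).
  move=> as_ st tb; have [||x xst E] := @MVT R f f' s t st.
  - move=> x; rewrite in_itv /= => /andP[sx xt]; apply: df.
    by rewrite (le_lt_trans as_ sx) (lt_le_trans xt).
  - apply: continuous_subspaceW cf => x /=; rewrite !in_itv /= => /andP[sx xt].
    by rewrite (le_trans as_) // (le_trans xt).
  by exists x => //; move: xst; rewrite in_itv.
have [zlt|ygt|zE] := ltgtP z y; last by rewrite zE eqxx in zy.
  have [x /andP[zx xy] E] := w z y az zlt yb; exists x; split.
  - by rewrite (le_lt_trans az zx) (lt_le_trans xy).
  - by rewrite normr_gt0 subr_eq0 lt_eqF.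
  - by rewrite !ltr0_norm ?subr_lt0 // ltrN2 ltrD2r.
  - by rewrite -opprB E -mulrN opprB.
have [x /andP[zx xy] E] := w y z ay ygt zb; exists x; split => //.
- by rewrite (le_lt_trans ay zx) (lt_le_trans xy).
- by rewrite normr_gt0 subr_eq0 gt_eqF.
- by rewrite !gtr0_norm ?subr_gt0 // ltrD2r.
Qed.

Lemma cont_neq0 (f : R -> R) (y : R) : {within `[a, b], continuous f} -> a <= y <= b ->
  f y != 0 -> exists2 d, 0 < d & forall z, a <= z <= b -> `|z - y| < d -> f z != 0.
Proof.
move=> cf yab fy; have fy0 : 0 < `|f y| by rewrite normr_gt0.
have [d d0 Hd] := cont_eps cf yab fy0; exists d => // z zab zy.
by apply/eqP => fz; have := Hd z zab zy; rewrite fz sub0r normrN ltxx.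
Qed.

(** Mean value theorem, applied to [U] and, at a critical point, to [U']. *)
Lemma isolated_zero (c y : R) : a <= y <= b -> (dU y != 0) || (ddU F y != 0) ->
  U F y = c ->
  exists2 d, 0 < d & forall z, a <= z <= b -> z != y -> `|z - y| < d -> U F z != c.
Proof.
move=> yab D Uy.
have step (d : R) : 0 < d -> (forall x, a < x < b -> 0 < `|x - y| -> `|x - y| < d -> dU x != 0) ->
  exists2 d, 0 < d & forall z, a <= z <= b -> z != y -> `|z - y| < d -> U F z != c.
  move=> d0 Hd; exists d => // z zab zy zd.
  have [x [xab xy0 xy E]] := mvt U_cont U_derive yab zab zy.
  rewrite -subr_eq0 -Uy E mulf_neq0 ?subr_eq0 //.
  by apply: Hd => //; exact: lt_trans zd.
have [dUy|dUy] := eqVneq (dU y) 0.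
  have ddUy : ddU F y != 0 by move: D; rewrite dUy eqxx.
  have [d d0 Hd] := cont_neq0 ddU_cont yab ddUy.
  apply: (step d) => // x xab xy0 xyd.
  have xab' : a <= x <= b by case/andP: xab => ? ?; rewrite !ltW.
  have xy : x != y by move: xy0; rewrite normr_gt0 subr_eq0.
  have [t [tab ty0 ty E]] := mvt dU_cont dU_derive yab xab' xy.
  have -> : dU x = ddU F t * (x - y) by rewrite -E dUy subr0.
  rewrite mulf_neq0 ?subr_eq0 //.
  have tab' : a <= t <= b by case/andP: tab => ? ?; rewrite !ltW.
  by apply: Hd => //; exact: lt_trans xyd.
have [d d0 Hd] := cont_neq0 dU_cont yab dUy.
apply: (step d) => // x /andP[ax xb] _ xyd; apply: Hd => //.
by rewrite !ltW.
Qed.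

(** Off the zeros of [U - Us] this defines [K2]. If [U''] did not vanish at such
    a zero, the zero would be isolated, and the bound on [K2] would send
    [U''] to zero along nearby points. *)
Lemma ddU_K2 (y : R) : a <= y <= b -> ddU F y = - (K2 F y * (U F y - Us F)).
Proof.
move=> yab; have [_ _ K2E [m [M [m0 Hm]]]] := hK.
have inI (z : R) : a <= z <= b -> yI F z by rewrite /yI /= in_itv.
have K2U z : a <= z <= b -> U F z != Us F -> ddU F z = - (K2 F z * (U F z - Us F)).
  by move=> zab Uz; rewrite (K2E _ (inI _ zab) Uz) divfK ?opprK // subr_eq0.
have [Uy|/K2U-> //] := eqVneq (U F y) (Us F).
rewrite Uy subrr mulr0 oppr0; apply/eqP; apply: contraT => ddy.
have D : (dU y != 0) || (ddU F y != 0) by rewrite ddy orbT.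
have [d d0 Hd] := isolated_zero yab D Uy.
have e0 : 0 < `|ddU F y| / 2 by rewrite divr_gt0 // normr_gt0.
have [d1 d10 Hd1] := cont_eps ddU_cont yab e0.
have M0 : 0 < M by have /andP[h1 h2] := Hm _ (inI _ yab); rewrite (lt_le_trans m0) // (le_trans h1).
have e1 : 0 < `|ddU F y| / 2 / M by rewrite divr_gt0.
have [d2 d20 Hd2] := cont_eps U_cont yab e1.
have [z [zab zy zd]] : exists z, [/\ a <= z <= b, z != y & `|z - y| < Num.min d (Num.min d1 d2)].
  set r := Num.min _ _; have r0 : 0 < r by rewrite /r !lt_min d0 d10.
  have /andP[ay yb] := yab.
  have [ymid|ymid] := ltP y b.
    exists (Num.min b (y + r / 2)); split.
    - by rewrite le_min ab ge_min lexx /= (le_trans ay) // lerDl; lra.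
    - by rewrite gt_eqF // lt_min ymid /=; lra.
    - rewrite ger0_norm ?subr_ge0 ?le_min ?yb /=; last lra.
      by rewrite ltrBlDr gt_min; apply/orP; right; lra.
  have yE : y = b by apply/le_anti; rewrite yb.
  exists (Num.max a (b - r / 2)); split.
  - by rewrite le_max lexx ge_max ab /=; lra.
  - by rewrite yE lt_eqF // gt_max hy /=; lra.
  - rewrite yE ler0_norm ?subr_le0 ?ge_max ?ab /=; last lra.
    by rewrite opprB ltrBlDr -ltrBlDl lt_max; apply/orP; right; lra.
move: zd; rewrite !lt_min => /and3P[zd zd1 zd2].
have Uz := Hd z zab zy zd.
have h1 := Hd1 z zab zd1; have h2 := Hd2 z zab zd2.
have : `|ddU F z| <= `|ddU F y| / 2.
  rewrite K2U // normrN normrM; have /andP[k1 k2] := Hm _ (inI _ zab).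
  rewrite (ger0_norm (le_trans (ltW m0) k1)) -Uy.
  apply: (@le_trans _ _ (M * (`|ddU F y| / 2 / M))).
    by apply: ler_pM; [exact: le_trans (ltW m0) k1|exact: normr_ge0|exact: k2|exact: ltW].
  by rewrite mulrC divfK // gt_eqF.
have := ler_distD (ddU F z) (ddU F y) 0; rewrite !subr0.
by rewrite distrC; move: h1 e0; lra.
Qed.

Lemma K2_bounds : exists m M : R, 0 < m /\ forall y, a <= y <= b -> m <= K2 F y <= M.
Proof.
have [_ _ _ [m [M [m0 Hm]]]] := hK; by exists m, M.
Qed.

(** A double zero would give [U = Us] everywhere, by uniqueness for the linear
    equation [U'' = - K2 (U - Us)]. *)
Lemma simple_zero (y : R) : a <= y <= b -> U F y = Us F -> dU y != 0.
Proof.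
move=> yab Uy; apply/negP => /eqP dUy.
have [m [M [m0 Hm]]] := K2_bounds.
have K0 z : a <= z <= b -> 0 <= K2 F z.
  by move=> /Hm /andP[h _]; rewrite (le_trans _ h) // ltW.
pose Q z := U F z - Us F; pose E z := Q z * Q z + dU z * dU z.
have pU : prim a b (U F) dU := prim_derive ab U_cont dU_cont U_derive.
have pQ : prim a b Q dU.
  by apply: eq_prim (primD pU (prim_cst a b (- Us F))) => // z _; rewrite addr0.
have pdU : prim a b dU (ddU F) := prim_derive ab dU_cont ddU_cont dU_derive.
pose e z := 2 * Q z * dU z + 2 * dU z * ddU F z.
have pE : prim a b E e.
  apply: eq_prim (primD (prim_mul ab pQ pQ) (prim_mul ab pdU pdU)) => // z _.
  by rewrite /e; ring.
have E0 z : 0 <= E z by rewrite /E -!expr2 addr_ge0 ?sqr_ge0.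
have eE z : a <= z <= b -> `|e z| <= (1 + M) * E z.
  move=> zab; rewrite /e ddU_K2 // -/(Q z).
  have -> : 2 * Q z * dU z + 2 * dU z * - (K2 F z * Q z) = (1 - K2 F z) * (2 * (Q z * dU z)) by ring.
  rewrite normrM ler_pM //.
    rewrite (le_trans (ler_normB _ _)) // normr1 lerD2l ger0_norm ?K0 //.
    by have /andP[] := Hm z zab.
  rewrite /E ler_norml; apply/andP; split.
    rewrite -subr_ge0 opprK.
    have -> : 2 * (Q z * dU z) + (Q z * Q z + dU z * dU z) = (Q z + dU z) ^+ 2 by ring.
    exact: sqr_ge0.
  rewrite -subr_ge0.
  have -> : (Q z * Q z + dU z * dU z) - 2 * (Q z * dU z) = (Q z - dU z) ^+ 2 by ring.
  exact: sqr_ge0.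
have Ey : E y = 0 by rewrite /E /Q Uy subrr dUy !mulr0 addr0.
pose k := 1 + M.
have /andP[ay yb] := yab.
suff Eall z : a <= z <= b -> E z = 0.
  have [_ [z zI Uz] _ _] := hK.
  have zab : a <= z <= b by move: zI; rewrite /yI /= in_itv.
  have := Eall z zab => /eqP; rewrite /E -!expr2 paddr_eq0 ?sqr_ge0 // sqrf_eq0 subr_eq0.
  by rewrite (negPf Uz).
move=> /andP[az zb]; have [yz|/ltW zy] := leP y z.
  have pp := prim_mul ab pE (prim_exp (- k) ab).
  have := prim_diff pp ay yz zb; rewrite Ey mul0r add0r => H.
  have : E z * expR (- k * (z - a)) <= 0.
    rewrite H -oppr_ge0 -mulN1r -intZ; last by have [pi _] := pp; exact: itgS pi.
    apply: int_ge0 => x /andP[yx xz].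
    have xab : a <= x <= b by rewrite (le_trans ay yx) (le_trans xz zb).
    have -> : -1 * (e x * expR (- k * (x - a)) + E x * (- k * expR (- k * (x - a)))) =
       (k * E x - e x) * expR (- k * (x - a)) by ring.
    rewrite mulr_ge0 ?expR_ge0 // subr_ge0 (le_trans (ler_norm _)) // eE //.
  rewrite pmulr_lle0 ?expR_gt0 // => Ez; apply/le_anti; by rewrite Ez E0.
have pp := prim_mul ab pE (prim_exp k ab).
have := prim_diff pp az zy yb; rewrite Ey mul0r => /eqP; rewrite eq_sym addr_eq0 => /eqP H.
have : E z * expR (k * (z - a)) <= 0.
  rewrite H oppr_le0; apply: int_ge0 => x /andP[zx xy].
  have xab : a <= x <= b by rewrite (le_trans az zx) (le_trans xy yb).
  have -> : e x * expR (k * (x - a)) + E x * (k * expR (k * (x - a))) =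
     (k * E x + e x) * expR (k * (x - a)) by ring.
  rewrite mulr_ge0 ?expR_ge0 // -[e x]opprK subr_ge0.
  by rewrite (le_trans (ler_norm _)) // normrN eE.
rewrite pmulr_lle0 ?expR_gt0 // => Ez; apply/le_anti; by rewrite Ez E0.
Qed.

(** The points of a level set are isolated: at the level [Us] because zeros of
    [U - Us] are simple, at other levels because [U''] does not vanish there. *)
Lemma level_set_finite (c : R) : finite_set [set y | a <= y <= b /\ U F y = c].
Proof.
set Z := [set y | _].
pose FF : set_system (set R) := [set P : set (set R) | exists2 N0 : set R, finite_set N0 &
  forall N : set R, finite_set N -> N0 `<=` N -> P N].
have fF : Filter FF.
  split.
  - by exists set0; [exact: finite_set0|].
  - move=> P Q [N1 n1 H1] [N2 n2 H2]; exists (N1 `|` N2); first by rewrite finite_setU.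
    by move=> N nN sN; split; [apply: H1|apply: H2] => // x Nx; apply: sN; [left|right].
  - by move=> P Q PQ [N1 n1 H1]; exists N1 => // N nN sN; apply: PQ; exact: H1.
have := (compact_near_coveringP `[a, b]%classic).1 (@segment_compact _ a b).
move=> /(_ _ FF (fun N x => Z x -> N x) fF) H.
have : \forall N \near FF, `[a, b] `<=` (fun x => Z x -> N x).
  apply: H => y; rewrite /= in_itv /= => yab.
  have [d d0 Hd] : exists2 d, 0 < d & forall z, a <= z <= b -> z != y -> `|z - y| < d -> U F z != c.
    have [Uy|Uy] := eqVneq (U F y) c.
      apply: isolated_zero => //.
      have [cE|cN] := eqVneq c (Us F).
        by rewrite simple_zero // Uy.
      rewrite ddU_K2 // Uy oppr_eq0 mulf_eq0 (subr_eq0 c) (negPf cN) orbF orbC.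
      have [m [M [m0 Hm]]] := K2_bounds; have /andP[h _] := Hm y yab.
      by rewrite gt_eqF // (lt_le_trans m0).
    have Uy' : U F y - c != 0 by rewrite subr_eq0.
    have [|d d0 Hd] := @cont_neq0 (fun z => U F z - c) y _ yab Uy'.
      by move=> x; apply: cvgB; [exact: U_cont|exact: cvg_cst].
    by exists d => // z zab _ zy; have := Hd z zab zy; rewrite subr_eq0.
  exists (ball y d, [set N | N y]) => /=.
    split; first exact: nbhsx_ballx.
    by exists [set y]; [exact: finite_set1|move=> N nN sN; exact: sN].
  move=> [z N] /= [zy Ny] [zab Uz].
  have [-> //|zy'] := eqVneq z y.
  by have := Hd z zab zy'; rewrite distrC => /(_ zy); rewrite Uz eqxx.
move=> [N0 n0 /(_ N0 n0 (fun _ => id)) sub].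
apply: sub_finite_set n0 => y Zy; apply: sub => //.
by have [yab _] := Zy; rewrite /= in_itv.
Qed.

Lemma level_set_null (c : R) : aeon a b (fun y => U F y != c).
Proof.
have fin := level_set_finite c.
rewrite /aeon; exists [set y | a <= y <= b /\ U F y = c]; split.
- apply: countable_measurable; last exact: finite_set_countable.
  by move=> t; exact: measurable_set1.
- by apply: countable_lebesgue_measure0; exact: finite_set_countable.
- by move=> y /= /not_implyP[yab /negP/negPn/eqP Uy]; split.
Qed.

Lemma K2_measurable : measurable_fun `[a, b] (K2 F).
Proof.
pose Z := [set y | a <= y <= b /\ U F y = Us F].
have finZ : finite_set Z := level_set_finite (Us F).
have mcount (A : set R) : countable A -> measurable A.
  by apply: countable_measurable => t; exact: measurable_set1.
have mZ : measurable Z by apply: mcount; exact: finite_set_countable.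
have -> : `[a, b]%classic = Z `|` (`[a, b] `\` Z).
  by rewrite setDUK // => y [yab _]; rewrite /= in_itv.
apply/measurable_funU => //; first exact: measurableD.
split.
  move=> _ Y _; apply: mcount; apply: finite_set_countable.
  by apply: sub_finite_set finZ => y [].
have [_ _ K2E _] := hK.
apply: (@eq_measurable_fun _ _ _ _ _ (fun y => - ddU F y / (U F y - Us F))).
  move=> y; rewrite inE => -[yab Zy]; rewrite K2E //.
  by apply/eqP => Uy; apply: Zy; split => //; move: yab; rewrite /= in_itv.
apply: subspace_continuous_measurable_fun; first exact: measurableD.
have sub : `[a, b] `\` Z `<=` `[a, b] by move=> y [].
have c1 := continuous_subspaceW sub ddU_cont.
have c2 := continuous_subspaceW sub U_cont.
apply/subspace_continuousP => y yZ; apply: cvgM.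
  by apply: cvgN; move/subspace_continuousP : c1; apply.
have [yab Zy] := yZ; apply: cvgV.
  rewrite subr_eq0; apply/eqP => Uy; apply: Zy; split => //.
by apply: cvgB; [move/subspace_continuousP : c2; apply|exact: cvg_cst].
Qed.

End Profile.

(** * Square integrable functions *)

Section SquareIntegrable.
Context {R : realType} (a b : R) (ltab : a < b).
Notation mu := (@lebesgue_measure R).
Local Notation C := R[i].
Local Notation Re := complex.Re.
Local Notation Im := complex.Im.
Let ab : a <= b := ltW ltab.
Implicit Types (f g : R -> R) (u v w : R -> C) (c : C).

Definition L2r f := measurable_fun `[a, b] f /\ itg a b (fun y => f y ^+ 2).

Lemma L2r_mul f g : L2r f -> L2r g -> itg a b (fun y => f y * g y).
Proof.
move=> [mf fi] [mg gi]; apply: (le_integrable _ _ _ (itgD fi gi)) => //.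
  by apply/measurable_EFinP; exact: measurable_funM.
move=> y _ /=; rewrite lee_fin normrM.
rewrite [leRHS]ger0_norm ?addr_ge0 ?sqr_ge0 // -(real_normK (num_real (f y))) -(real_normK (num_real (g y))).
have := sqr_ge0 (`|f y| - `|g y|); have := sqr_ge0 (`|f y| + `|g y|).
rewrite !expr2; nra.
Qed.

Lemma L2r_bounded f k : measurable_fun `[a, b] f ->
  (forall y, a <= y <= b -> `|f y| <= k) -> L2r f.
Proof.
move=> mf fk; split => //; apply: (@itg_bounded _ _ _ _ (k ^+ 2)).
  exact: measurable_funX.
move=> y yab; rewrite normrX lerXn2r ?nnegrE ?fk //.
by rewrite (le_trans _ (fk y yab)).
Qed.

Lemma L2r_cont f : {within `[a, b], continuous f} -> L2r f.
Proof.
move=> cf; have [k _ fk] := cont_bounded ab cf.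
exact: L2r_bounded (itg_measurable (itg_cont cf)) fk.
Qed.

Lemma L2r_itg f : L2r f -> itg a b f.
Proof.
move=> f2; have one : L2r (fun=> 1) by apply: L2r_cont => x; exact: cvg_cst.
have := L2r_mul f2 one.
by apply: eq_itg => y _; rewrite mulr1.
Qed.

Lemma L2rD f g : L2r f -> L2r g -> L2r (fun y => f y + g y).
Proof.
move=> f2 g2; have fg := L2r_mul f2 g2; have [mf fi] := f2; have [mg gi] := g2.
split; first exact: measurable_funD.
have := itgD (itgD fi gi) (itgZ 2 fg).
by apply: eq_itg => y _; ring.
Qed.

Lemma L2rZ k f : L2r f -> L2r (fun y => k * f y).
Proof.
move=> [mf fi]; split; first exact: measurable_funM.
by have := itgZ (k ^+ 2) fi; apply: eq_itg => y _; ring.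
Qed.

Lemma L2rM f g k : L2r f -> measurable_fun `[a, b] g ->
  (forall y, a <= y <= b -> `|g y| <= k) -> L2r (fun y => g y * f y).
Proof.
move=> [mf fi] mg gk; split; first exact: measurable_funM.
have mg2 : measurable_fun `[a, b] (fun y => g y ^+ 2) by exact: measurable_funX.
have := @itg_mul_bounded _ a b _ _ (k ^+ 2) fi mg2.
have H : itg a b (fun x => f x ^+ 2 * g x ^+ 2) -> itg a b (fun y => (g y * f y) ^+ 2).
  by apply: eq_itg => y _; ring.
move=> H2; apply/H/H2 => y yab; rewrite normrX lerXn2r ?nnegrE ?gk //.
by rewrite (le_trans _ (gk y yab)).
Qed.

Lemma L2r_eq_ae f g : L2r f -> measurable_fun `[a, b] g -> aeon a b (fun y => f y = g y) -> L2r g.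
Proof.
move=> [mf fi] mg fg; split => //; apply: eq_itg_ae fi _ _; first exact: measurable_funX.
by apply: aeon_imp fg => y _ ->.
Qed.

Lemma int_eq0_ae f : itg a b f -> (forall y, a <= y <= b -> 0 <= f y) ->
  \int[mu]_(y in `[a, b]) f y = 0 -> aeon a b (fun y => f y = 0).
Proof.
move=> fi f0 I0.
have mf := itg_measurable fi.
have E : (\int[mu]_(x in `[a, b]) `|(f x)%:E| = 0)%E.
  transitivity (\int[mu]_(x in `[a, b]) (f x)%:E)%E.
    apply: eq_integral => y; rewrite inE /= in_itv /= => yab.
    by rewrite ger0_norm // f0.
  have fin : (\int[mu]_(x in `[a, b]) (f x)%:E)%E \is a fin_num.
    by apply: integrable_fin_num fi; exact: measurable_itv.
  by rewrite -(fineK fin); exact: (congr1 EFin I0).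
have mEf : measurable_fun `[a, b] (EFin \o f) by exact/measurable_EFinP.
have := (ae_eq_integral_abs mu (measurable_itv `[a, b]) mEf).1 E.
rewrite /aeon /ae_eq; apply: filterS => y H yab.
have : `[a, b]%classic y by rewrite /= in_itv.
by move=> /H /= [].
Qed.

(** Complex [L^2], through both components. *)
Definition C2 u := L2r (fun y => Re (u y)) /\ L2r (fun y => Im (u y)).

Definition citg u := itg a b (fun y => Re (u y)) /\ itg a b (fun y => Im (u y)).

Definition cint u : C :=
  ((\int[mu]_(y in `[a, b]) Re (u y)) +i* (\int[mu]_(y in `[a, b]) Im (u y)))%C.

Lemma cE (x y : C) : Re x = Re y -> Im x = Im y -> x = y.
Proof. by case: x y => [? ?] [? ?] /= -> ->. Qed.

Lemma ReD (x y : C) : Re (x + y) = Re x + Re y. Proof. by case: x; case: y. Qed.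
Lemma ImD (x y : C) : Im (x + y) = Im x + Im y. Proof. by case: x; case: y. Qed.
Lemma ReN (x : C) : Re (- x) = - Re x. Proof. by case: x. Qed.
Lemma ImN (x : C) : Im (- x) = - Im x. Proof. by case: x. Qed.
Lemma ReM (x y : C) : Re (x * y) = Re x * Re y - Im x * Im y. Proof. by case: x; case: y. Qed.
Lemma ImM (x y : C) : Im (x * y) = Re x * Im y + Im x * Re y. Proof. by case: x; case: y. Qed.
Lemma ReC (x : C) : Re (x^*)%C = Re x. Proof. by case: x. Qed.
Lemma ImC (x : C) : Im (x^*)%C = - Im x. Proof. by case: x. Qed.
Definition cDE := (ReD, ImD, ReN, ImN, ReM, ImM, ReC, ImC).

Lemma C2D u v : C2 u -> C2 v -> C2 (fun y => u y + v y).
Proof.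
move=> [u1 u2] [v1 v2]; split.
  by under eq_fun do rewrite ReD; exact: L2rD.
by under eq_fun do rewrite ImD; exact: L2rD.
Qed.

Lemma C2Z c u : C2 u -> C2 (fun y => c * u y).
Proof.
move=> [u1 u2]; split.
  under eq_fun do rewrite ReM -mulNr; apply: L2rD; exact: L2rZ.
under eq_fun do rewrite ImM; apply: L2rD; exact: L2rZ.
Qed.

Lemma C2_conj u : C2 u -> C2 (fun y => (u y)^*%C).
Proof.
move=> [u1 u2]; split; first by under eq_fun do rewrite ReC.
by under eq_fun do rewrite ImC -mulN1r; exact: L2rZ.
Qed.

Lemma C2M (g : R -> R) k u : C2 u -> measurable_fun `[a, b] g ->
  (forall y, a <= y <= b -> `|g y| <= k) -> C2 (fun y => (g y)%:C%C * u y).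
Proof.
move=> [u1 u2] mg gk; split.
  under eq_fun do rewrite ReM /= mul0r subr0; exact: L2rM gk.
under eq_fun do rewrite ImM /= mul0r addr0; exact: L2rM gk.
Qed.

Lemma C2_zero : C2 (fun=> 0).
Proof.
by split; (split; first exact: measurable_cst); apply: (itg_bounded (k := 0)) => // y _;
  rewrite expr0n normr0.
Qed.

Lemma C2_mul u v : C2 u -> C2 v -> citg (fun y => u y * v y).
Proof.
move=> [u1 u2] [v1 v2]; split.
  by under eq_fun do rewrite ReM; apply: itgB; exact: L2r_mul.
by under eq_fun do rewrite ImM; apply: itgD; exact: L2r_mul.
Qed.

Lemma cintD u v : citg u -> citg v -> cint (fun y => u y + v y) = cint u + cint v.
Proof.
move=> [u1 u2] [v1 v2]; apply: cE; rewrite !cDE /=.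
  by rewrite -intD //; apply: eq_int => y _; rewrite ReD.
by rewrite -intD //; apply: eq_int => y _; rewrite ImD.
Qed.

Lemma cintZ c u : citg u -> cint (fun y => c * u y) = c * cint u.
Proof.
move=> [u1 u2]; apply: cE; rewrite !cDE /=.
  by rewrite -!intZ // -intB; try exact: itgZ; apply: eq_int => y _; rewrite ReM.
by rewrite -!intZ // -intD; try exact: itgZ; apply: eq_int => y _; rewrite ImM.
Qed.

Lemma cint_conj u : citg u -> cint (fun y => (u y)^*%C) = (cint u)^*%C.
Proof.
move=> [u1 u2]; apply: cE; rewrite !cDE /=.
  by apply: eq_int => y _; rewrite ReC.
rewrite -[RHS]mulN1r -intZ //; apply: eq_int => y _; by rewrite ImC mulN1r.
Qed.

Lemma eq_cint u v : (forall y, a <= y <= b -> u y = v y) -> cint u = cint v.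
Proof. by move=> uv; apply: cE => /=; apply: eq_int => y /uv ->. Qed.

Lemma citg_measurable u : citg u ->
  measurable_fun `[a, b] (fun y => Re (u y)) /\ measurable_fun `[a, b] (fun y => Im (u y)).
Proof. by move=> [u1 u2]; split; exact: itg_measurable. Qed.

Lemma eq_cint_ae u v : citg u -> citg v -> aeon a b (fun y => u y = v y) -> cint u = cint v.
Proof.
move=> /citg_measurable[u1 u2] /citg_measurable[v1 v2] uv; apply: cE => /=.
  by apply: eq_int_ae => //; apply: aeon_imp uv => y _ ->.
by apply: eq_int_ae => //; apply: aeon_imp uv => y _ ->.
Qed.

Definition ip u v : C := cint (fun y => u y * (v y)^*%C).

Lemma ipDl u v w : C2 u -> C2 v -> C2 w -> ip (fun y => u y + v y) w = ip u w + ip v w.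
Proof.
move=> u2 v2 w2; have w2' := C2_conj w2.
by rewrite /ip -cintD; [apply: eq_cint => y _; rewrite mulrDl|exact: C2_mul..].
Qed.

Lemma ipZl c u v : C2 u -> C2 v -> ip (fun y => c * u y) v = c * ip u v.
Proof.
move=> u2 v2; rewrite /ip -cintZ; last by apply: C2_mul => //; exact: C2_conj.
by apply: eq_cint => y _; rewrite mulrA.
Qed.

Lemma ipC u v : C2 u -> C2 v -> ip v u = (ip u v)^*%C.
Proof.
move=> u2 v2; rewrite /ip -cint_conj; last by apply: C2_mul => //; exact: C2_conj.
by apply: eq_cint => y _; rewrite rmorphM /= conjcK mulrC.
Qed.

Lemma ip_mul (g : R -> R) u v : ip (fun y => (g y)%:C%C * u y) v = ip u (fun y => (g y)%:C%C * v y).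
Proof.
apply: eq_cint => y _.
by apply: cE; rewrite !cDE /=; ring.
Qed.

Lemma ip_eq_ae u u' v v' : C2 u -> C2 u' -> C2 v -> C2 v' ->
  aeon a b (fun y => u y = u' y) -> aeon a b (fun y => v y = v' y) -> ip u v = ip u' v'.
Proof.
move=> h1 h2 h3 h4 e1 e2; apply: eq_cint_ae; try by apply: C2_mul => //; exact: C2_conj.
by have := aeon_and e1 e2; apply: aeon_imp => y _ [-> ->].
Qed.

Lemma ip_self u : C2 u ->
  ip u u = ((\int[mu]_(y in `[a, b]) (Re (u y) ^+ 2 + Im (u y) ^+ 2))%:C)%C.
Proof.
move=> _; apply: cE => /=.
  by apply: eq_int => y _; rewrite !cDE; ring.
rewrite (@eq_int _ a b _ (fun=> 0)) ?int_cst ?mul0r // => y _; rewrite !cDE; ring.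
Qed.

Lemma C2_sqr u : C2 u -> itg a b (fun y => Re (u y) ^+ 2 + Im (u y) ^+ 2).
Proof. by move=> [[_ h1] [_ h2]]; exact: itgD. Qed.

Lemma ip_eq0 u : C2 u -> ip u u = 0 -> aeon a b (fun y => u y = 0).
Proof.
move=> u2; rewrite ip_self // => -[I0].
have := int_eq0_ae (C2_sqr u2) _ I0 => H.
have : aeon a b (fun y => Re (u y) ^+ 2 + Im (u y) ^+ 2 = 0).
  by apply: H => y _; rewrite addr_ge0 ?sqr_ge0.
apply: aeon_imp => y _ /eqP; rewrite paddr_eq0 ?sqr_ge0 // !sqrf_eq0.
by case/andP => /eqP h1 /eqP h2; apply: cE.
Qed.

Lemma C2_sum n (c : 'I_n -> C) (u : 'I_n -> R -> C) : (forall i, C2 (u i)) ->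
  C2 (fun y => \sum_i c i * u i y).
Proof.
elim: n c u => [|n IH] c u u2.
  by under eq_fun do rewrite big_ord0; exact: C2_zero.
under eq_fun do rewrite big_ord_recl.
by apply: C2D; [exact: C2Z|apply: (IH (fun i => c (lift ord0 i)) (fun i => u (lift ord0 i)))].
Qed.
End SquareIntegrable.

(** * The Green operator *)

Section GreenOperator.
Context {R : realType} (F : shear_flow R) (hy : y1 F < y2 F) (m : R) (m0 : 0 < m).
Notation mu := (@lebesgue_measure R).
Local Notation a := (y1 F).
Local Notation b := (y2 F).
Local Notation C := R[i].
Local Notation Re := complex.Re.
Local Notation Im := complex.Im.
Let ab : a <= b := ltW hy.

Definition gr (f : R -> R) : R -> R := helmholtz_inv F m f.

Lemma gr_exists : exists2 K, 0 <= K & forall f, itg a b f ->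
  exists dpsi, helm (geom F) a b m f (gr f) dpsi /\
   forall y, a <= y <= b -> `|gr f y| <= K * \int[mu]_(z in `[a, b]) `|f z| /\
     `|dpsi y| <= K * \int[mu]_(z in `[a, b]) `|f z|.
Proof.
have k0 : 0 < Num.sqrt m by rewrite sqrtr_gt0.
have [K K0 HK] := helm_exists (geom F) hy k0; rewrite sqr_sqrtr ?(ltW m0) // in HK.
exists K => // f fi; have [psi [dpsi [hpsi bnd]]] := HK f fi.
have [p1 p2 bc] := hpsi.
have ex : exists psi, helmholtz F m f psi.
  exists psi, dpsi; split.
  - exact: prim_cont p1.
  - exact: prim_cont p2.
  - by move=> y; rewrite /yI /= in_itv /= => yab; have [_ ->] := p1.
  - by move=> y; rewrite /yI /= in_itv /= => yab; have [_ ->] := p2.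
  - by move: bc; rewrite /helm_bc; case: (geom F).
have [d [c1 c2 e1 e2 bc']] : helmholtz F m f (gr f).
  by have [psi0 h0] := ex; exact: (xgetPex (cst 0) (ex_intro _ psi0 h0)).
have inI y : a <= y <= b -> yI F y by rewrite /yI /= in_itv.
have hg : helm (geom F) a b m f (gr f) d.
  split.
  - by split; [exact: itg_cont|move=> y /inI; exact: e1].
  - split; last by move=> y /inI; exact: e2.
    apply: itgB => //; apply: itg_cont => x; apply: cvgM; [exact: cvg_cst|exact: c1].
  - by move: bc'; rewrite /helm_bc; case: (geom F).
have E := helm_unique hy m0 hg hpsi.
exists dpsi; split; last by move=> y yab; rewrite E //; exact: bnd.
split.
- by apply: eq_prim p1 => // y yab; rewrite E.
- by apply: eq_prim p2 => // y yab; rewrite E.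
- by move: bc; rewrite /helm_bc; case: (geom F); rewrite !E ?lexx ?ab.
Qed.

Lemma gr_helm f : itg a b f -> exists dpsi, helm (geom F) a b m f (gr f) dpsi.
Proof. by move=> fi; have [K _ /(_ f fi) [d [hd _]]] := gr_exists; exists d. Qed.

Lemma gr_unique f psi dpsi : itg a b f -> helm (geom F) a b m f psi dpsi ->
  forall y, a <= y <= b -> gr f y = psi y.
Proof. by move=> fi hpsi; have [d hd] := gr_helm fi; exact: helm_unique hd hpsi. Qed.

Lemma gr_cont f : itg a b f -> {within `[a, b], continuous (gr f)}.
Proof. by move=> /gr_helm[d /(helm_cont hy)[]]. Qed.

Lemma gr_lipschitz : exists2 K, 0 <= K & forall f, itg a b f ->
  (forall y, a <= y <= b -> `|gr f y| <= K * \int[mu]_(z in `[a, b]) `|f z|) /\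
  (forall y z, a <= y <= b -> a <= z <= b ->
    `|gr f y - gr f z| <= K * \int[mu]_(t in `[a, b]) `|f t| * `|y - z|).
Proof.
have [K K0 HK] := gr_exists; exists K => // f fi.
have [d [[pr _ _] bnd]] := HK f fi.
split=> [y /bnd[]//|].
suff w y z : a <= y -> y <= z -> z <= b ->
    `|gr f z - gr f y| <= K * \int[mu]_(t in `[a, b]) `|f t| * (z - y).
  move=> y z /andP[ay yb] /andP[az zb]; have [yz|/ltW zy] := leP y z.
    by rewrite distrC (distrC y) (ger0_norm (_ : 0 <= z - y)) ?subr_ge0 //; exact: w.
  by rewrite (ger0_norm (_ : 0 <= y - z)) ?subr_ge0 //; exact: w.
move=> ay yz zb; rewrite (prim_diff pr ay yz zb) addrAC subrr add0r.
have [di _] := pr; have di' := itgS ay zb di.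
apply: le_trans (int_norm di') _; rewrite -(int_cst _ yz); apply: int_le.
- exact: itg_norm.
- exact: itg_cst.
move=> x /andP[yx xz]; apply: (bnd x _).2.
by rewrite (le_trans ay yx) (le_trans xz zb).
Qed.

Lemma grD f g : itg a b f -> itg a b g -> forall y, a <= y <= b ->
  gr (fun y => f y + g y) y = gr f y + gr g y.
Proof.
move=> fi gi; have [d1 h1] := gr_helm fi; have [d2 h2] := gr_helm gi.
by move=> y yab; rewrite (gr_unique (itgD fi gi) (helmD hy h1 h2)).
Qed.

Lemma grZ c f : itg a b f -> forall y, a <= y <= b -> gr (fun y => c * f y) y = c * gr f y.
Proof.
move=> fi; have [d1 h1] := gr_helm fi.
by move=> y yab; rewrite (gr_unique (itgZ c fi) (helmZ hy c h1)).
Qed.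

Lemma gr_eq_ae f g : itg a b f -> itg a b g -> aeon a b (fun y => f y = g y) ->
  forall y, a <= y <= b -> gr f y = gr g y.
Proof.
move=> fi gi fg y yab; have [d1 [p1 p2 p3]] := gr_helm fi.
have c1 := prim_cont ab p1.
suff h : helm (geom F) a b m g (gr f) d1 by rewrite (gr_unique gi h).
split => //; apply: eq_prim_ae p2 _ _.
  by apply: itgB => //; apply: itg_cont => x; apply: cvgM; [exact: cvg_cst|exact: c1].
by apply: aeon_imp fg => z _ ->.
Qed.

Lemma gr_sym f g : itg a b f -> itg a b g ->
  \int[mu]_(z in `[a, b]) (f z * gr g z) = \int[mu]_(z in `[a, b]) (gr f z * g z).
Proof.
move=> fi gi; have [d1 h1] := gr_helm fi; have [d2 h2] := gr_helm gi.
rewrite (helm_energy hy fi h1 h2).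
rewrite (@eq_int _ a b (fun z => gr f z * g z) (fun z => g z * gr f z)); last by move=> z _; rewrite mulrC.
rewrite (helm_energy hy gi h2 h1).
by apply: eq_int => z _; rewrite mulrC [gr f z * _]mulrC.
Qed.

Lemma gr_coercive f : itg a b f ->
  m * \int[mu]_(z in `[a, b]) (gr f z ^+ 2) <= \int[mu]_(z in `[a, b]) (f z * gr f z).
Proof.
move=> fi; have [d h] := gr_helm fi; rewrite (helm_energy hy fi h h).
have [c1 c2] := helm_cont hy h.
have i1 : itg a b (fun z => gr f z ^+ 2).
  have [] // := L2r_cont hy c1.
have i2 : itg a b (fun z => d z * d z) by apply: itg_cont => x; apply: cvgM; exact: c2.
rewrite -intZ //; apply: int_le; first exact: itgZ.
  by apply: itgD => //; apply: itgZ; apply: eq_itg i1 => z _; rewrite expr2.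
by move=> z _; rewrite expr2 lerDr -expr2 sqr_ge0.
Qed.

Lemma gr_pos f : itg a b f -> 0 <= \int[mu]_(z in `[a, b]) (f z * gr f z).
Proof.
move=> fi; apply: le_trans (gr_coercive fi); rewrite mulr_ge0 ?(ltW m0) //.
by apply: int_ge0 => z _; exact: sqr_ge0.
Qed.

Definition gc (u : R -> C) (y : R) : C :=
  (gr (fun z => Re (u z)) y +i* gr (fun z => Im (u z)) y)%C.

Implicit Types (u v : R -> C).
Local Notation C2 := (C2 a b).
Local Notation ip := (ip a b).

Lemma C2_re_itg u : C2 u -> itg a b (fun z => Re (u z)) /\ itg a b (fun z => Im (u z)).
Proof. by move=> [h1 h2]; split; exact: (L2r_itg hy). Qed.

Lemma C2_gc u : C2 u -> C2 (gc u).
Proof.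
move=> /C2_re_itg[h1 h2]; split => /=; apply: (L2r_cont hy); exact: gr_cont.
Qed.

Lemma gcD u v : C2 u -> C2 v -> forall y, a <= y <= b ->
  gc (fun y => u y + v y) y = gc u y + gc v y.
Proof.
move=> /C2_re_itg[h1 h2] /C2_re_itg[h3 h4] y yab; rewrite /gc.
apply: cE; rewrite !cDE /=; under eq_fun do rewrite ?ReD ?ImD; exact: grD.
Qed.

Lemma gcZ c u : C2 u -> forall y, a <= y <= b -> gc (fun y => c * u y) y = c * gc u y.
Proof.
move=> /C2_re_itg[h1 h2] y yab; rewrite /gc.
apply: cE; rewrite !cDE /=.
  under eq_fun do rewrite ReM -mulNr.
  by rewrite grD ?grZ ?mulNr //; exact: itgZ.
under eq_fun do rewrite ImM.
by rewrite grD ?grZ //; exact: itgZ.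
Qed.

Lemma gc_conj u : C2 u -> forall y, a <= y <= b -> gc (fun y => (u y)^*%C) y = (gc u y)^*%C.
Proof.
move=> /C2_re_itg[h1 h2] y yab; rewrite /gc.
apply: cE; rewrite !cDE /=; first by under eq_fun do rewrite ReC.
under eq_fun do rewrite ImC -mulN1r.
by rewrite grZ // mulN1r.
Qed.

Lemma gc_eq_ae u v : C2 u -> C2 v -> aeon a b (fun y => u y = v y) ->
  forall y, a <= y <= b -> gc u y = gc v y.
Proof.
move=> /C2_re_itg[h1 h2] /C2_re_itg[h3 h4] uv y yab; rewrite /gc.
by apply: cE => /=; apply: gr_eq_ae => //; apply: aeon_imp uv => z _ ->.
Qed.

Lemma gc_sym u v : C2 u -> C2 v -> ip (gc u) v = ip u (gc v).
Proof.
move=> u2 v2; have [u1 u3] := C2_re_itg u2; have [v1 v3] := C2_re_itg v2.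
have gu := C2_gc u2; have gv := C2_gc v2.
have [gu1 gu3] := gu; have [gv1 gv3] := gv; have [u4 u5] := u2; have [v4 v5] := v2.
have [ir1 ir2 ir3 ir4] : [/\ itg a b (fun y => gr (fun z => Re (u z)) y * Re (v y)),
    itg a b (fun y => gr (fun z => Im (u z)) y * Im (v y)),
    itg a b (fun y => gr (fun z => Im (u z)) y * Re (v y)) &
    itg a b (fun y => gr (fun z => Re (u z)) y * Im (v y))].
  by split; apply: L2r_mul.
have [is1 is2 is3 is4] : [/\ itg a b (fun y => Re (u y) * gr (fun z => Re (v z)) y),
    itg a b (fun y => Im (u y) * gr (fun z => Im (v z)) y),
    itg a b (fun y => Im (u y) * gr (fun z => Re (v z)) y) &
    itg a b (fun y => Re (u y) * gr (fun z => Im (v z)) y)].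
  by split; apply: L2r_mul.
apply: cE.
- transitivity (\int[mu]_(y in `[a, b]) (gr (fun z => Re (u z)) y * Re (v y) +
      gr (fun z => Im (u z)) y * Im (v y))).
    by apply: eq_int => y _; rewrite !cDE /=; ring.
  rewrite intD // -!gr_sym // -intD //.
  by apply: eq_int => y _; rewrite !cDE /=; ring.
- transitivity (\int[mu]_(y in `[a, b]) (gr (fun z => Im (u z)) y * Re (v y) -
      gr (fun z => Re (u z)) y * Im (v y))).
    by apply: eq_int => y _; rewrite !cDE /=; ring.
  rewrite intB // -!gr_sym // -intB //.
  by apply: eq_int => y _; rewrite !cDE /=; ring.
Qed.

Lemma gc_re u : C2 u -> Re (ip (gc u) u) =
  \int[mu]_(y in `[a, b]) (Re (u y) * gr (fun z => Re (u z)) y) +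
  \int[mu]_(y in `[a, b]) (Im (u y) * gr (fun z => Im (u z)) y).
Proof.
move=> u2; have [gu1 gu3] := C2_gc u2; have [u4 u5] := u2.
have i1 : itg a b (fun y => Re (u y) * gr (fun z => Re (u z)) y) by exact: L2r_mul.
have i2 : itg a b (fun y => Im (u y) * gr (fun z => Im (u z)) y) by exact: L2r_mul.
rewrite -intD //; by apply: eq_int => y _; rewrite !cDE /=; ring.
Qed.

Lemma gc_pos u : C2 u -> 0 <= Re (ip (gc u) u).
Proof.
by move=> u2; have [h1 h2] := C2_re_itg u2; rewrite gc_re // addr_ge0 ?gr_pos.
Qed.
End GreenOperator.

(** * Limits along ultrafilters *)

Section UltraLimits.
Context {C : numClosedFieldType} {I : Type} (F : set_system I) {FF : ProperFilter F}.
Implicit Types (f g : I -> C).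

Definition ulim f (l : C) := forall e : C, 0 < e -> F [set i | `|f i - l| < e].

Lemma ulim_cst l : ulim (fun=> l) l.
Proof. by move=> e e0; apply: filterE => i /=; rewrite subrr normr0. Qed.

Lemma ulim_near f g l : F [set i | f i = g i] -> ulim f l -> ulim g l.
Proof. by move=> fg fl e /fl; move: fg; apply: filterS2 => i /= ->. Qed.

Lemma ulimD f g l k : ulim f l -> ulim g k -> ulim (fun i => f i + g i) (l + k).
Proof.
move=> fl gk e e0; have e2 : 0 < e / 2 by rewrite divr_gt0.
move: (fl _ e2) (gk _ e2); apply: filterS2 => i /= h1 h2.
by rewrite opprD addrACA (le_lt_trans (ler_normD _ _)) // [ltRHS]splitr ltrD.
Qed.

Lemma ulimZ c f l : ulim f l -> ulim (fun i => c * f i) (c * l).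
Proof.
move=> fl e e0; have c0 : 0 < `|c| + 1 by rewrite ltr_wpDl.
move: (fl _ (divr_gt0 e0 c0)); apply: filterS => i /= h.
rewrite -mulrBr normrM; apply: le_lt_trans (_ : (`|c| + 1) * `|f i - l| < _).
  by rewrite ler_wpM2r // lerDl.
by rewrite mulrC -ltr_pdivlMr.
Qed.

Lemma ulimN f l : ulim f l -> ulim (fun i => - f i) (- l).
Proof. by move=> fl e /fl; apply: filterS => i /=; rewrite -opprD normrN. Qed.

Lemma ulimB f g l k : ulim f l -> ulim g k -> ulim (fun i => f i - g i) (l - k).
Proof. by move=> fl /ulimN; exact: ulimD. Qed.

Lemma ulim_conj f l : ulim f l -> ulim (fun i => (f i)^*) (l^*).
Proof. by move=> fl e /fl; apply: filterS => i /=; rewrite -rmorphB norm_conjC. Qed.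

Lemma ulim_norm f l : ulim f l -> ulim (fun i => `|f i|) `|l|.
Proof. by move=> fl e /fl; apply: filterS => i /=; apply: le_lt_trans; rewrite ler_dist_dist. Qed.

Lemma ulim_squeeze f g : ulim g 0 -> F [set i | `|f i| <= g i] -> ulim f 0.
Proof.
move=> g0 fg e e0; move: (g0 _ e0) fg; apply: filterS2 => i /=; rewrite !subr0 => h1 h2.
have gi : 0 <= g i by exact: le_trans (normr_ge0 _) h2.
by apply: le_lt_trans h2 _; rewrite -(ger0_norm gi).
Qed.

Lemma ulim_mul0 f g (k : C) : ulim f 0 -> (forall i, `|g i| <= k) -> ulim (fun i => f i * g i) 0.
Proof.
move=> f0 gk; apply: (@ulim_squeeze _ (fun i => k * `|f i|)).
  by have := ulimZ k (ulim_norm f0); rewrite normr0 mulr0.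
by apply: filterE => i /=; rewrite normrM mulrC ler_wpM2r.
Qed.

Lemma ulimM f g l k : ulim f l -> ulim g k -> ulim (fun i => f i * g i) (l * k).
Proof.
move=> fl gk e e0.
have c0 : 0 < `|k| + 1 by rewrite ltr_wpDl.
have d0 : 0 < `|l| + 1 by rewrite ltr_wpDl.
have e2 : 0 < e / 2 by rewrite divr_gt0.
have H1 := fl _ (divr_gt0 e2 c0); have H2 := gk _ (divr_gt0 e2 d0).
move: H1 H2 (gk 1 ltr01); apply: filterS3 => i /= h1 h2 h3.
have -> : f i * g i - l * k = (f i - l) * g i + l * (g i - k) by ring.
rewrite (le_lt_trans (ler_normD _ _)) // [ltRHS]splitr !normrM.
have g1 : `|g i| <= `|k| + 1.
  by rewrite -[g i](subrK k) addrC (le_trans (ler_normD _ _)) // lerD2l ltW.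
apply: ltr_leD.
  apply: le_lt_trans (_ : `|f i - l| * (`|k| + 1) < _); first by rewrite ler_wpM2l.
  by rewrite -ltr_pdivlMr.
apply: le_trans (_ : (`|l| + 1) * `|g i - k| <= _); first by rewrite ler_wpM2r // lerDl.
by rewrite mulrC -ler_pdivlMr // ltW.
Qed.

Lemma small_eq0 (x : C) : (forall e, 0 < e -> `|x| < e) -> x = 0.
Proof.
move=> H; apply/eqP; rewrite -normr_eq0; apply: contraT => x0.
have p : 0 < `|x| by rewrite lt0r x0 normr_ge0.
by have := H _ p; rewrite ltxx.
Qed.

Lemma ulim_unique f l k : ulim f l -> ulim f k -> l = k.
Proof.
move=> fl fk; apply/eqP; rewrite -subr_eq0; apply/eqP; apply: small_eq0 => e e0.
have e2 : 0 < e / 2 by rewrite divr_gt0.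
have FF' : Filter F by apply: filter_filter.
have /filter_ex [i /= [h1 h2]] := @filterI _ F FF' _ _ (fl _ e2) (fk _ e2).
have -> : l - k = (f i - k) - (f i - l) by ring.
by rewrite (le_lt_trans (ler_normB _ _)) // [ltRHS]splitr ltrD.
Qed.

Lemma ulim_ge0 f l : F [set i | 0 <= f i] -> ulim f l -> 0 <= l.
Proof.
move=> f0 fl; suff -> : l = `|l| by [].
apply: ulim_unique (fl) _; apply: ulim_near (ulim_norm fl).
by move: f0; apply: filterS => i /=; exact: ger0_norm.
Qed.

Lemma ulim_le f g l k : F [set i | f i <= g i] -> ulim f l -> ulim g k -> l <= k.
Proof.
move=> fg fl gk; rewrite -subr_ge0; apply: ulim_ge0 (ulimB gk fl).
by move: fg; apply: filterS => i /=; rewrite subr_ge0.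
Qed.

Lemma ulim_sum (J : Type) (r : seq J) (P : pred J) (f : J -> I -> C) (l : J -> C) :
  (forall j, ulim (f j) (l j)) ->
  ulim (fun i => \sum_(j <- r | P j) f j i) (\sum_(j <- r | P j) l j).
Proof.
move=> fl; elim: r => [|j r IH].
  by under eq_fun do rewrite big_nil; rewrite big_nil; exact: ulim_cst.
under eq_fun do rewrite big_cons; rewrite big_cons.
by case: (P j) => //; exact: ulimD.
Qed.

Lemma ulim_prod (J : Type) (r : seq J) (P : pred J) (f : J -> I -> C) (l : J -> C) :
  (forall j, ulim (f j) (l j)) ->
  ulim (fun i => \prod_(j <- r | P j) f j i) (\prod_(j <- r | P j) l j).
Proof.
move=> fl; elim: r => [|j r IH].
  by under eq_fun do rewrite big_nil; rewrite big_nil; exact: ulim_cst.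
under eq_fun do rewrite big_cons; rewrite big_cons.
by case: (P j) => //; exact: ulimM.
Qed.

Lemma ulim_det n (T : I -> 'M[C]_n) (T0 : 'M[C]_n) :
  (forall i j, ulim (fun x => T x i j) (T0 i j)) -> ulim (fun x => \det (T x)) (\det T0).
Proof.
move=> TT; apply: ulim_sum => p; apply: ulimZ; exact: ulim_prod.
Qed.
End UltraLimits.

Lemma char_poly_det {C : numClosedFieldType} n (T : 'M[C]_n) c :
  (char_poly T).[c] = \det (c%:M - T).
Proof.
rewrite /char_poly -horner_evalE -det_map_mx; congr (\det _).
apply/matrixP => i j; rewrite !mxE /= /horner_eval !hornerE hornerMn hornerX.
by case: (i == j).
Qed.

(** The characteristic polynomial at [c] is a product of factors [c - r], each of
    modulus at least [|Im c|]. *)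
Lemma det_shift_lower {C : numClosedFieldType} n (T : 'M[C]_n) c :
  (forall r, root (char_poly T) r -> 0 <= 'Im r) -> 'Im c <= 0 ->
  `|'Im c| ^+ n <= `|\det (c%:M - T)|.
Proof.
move=> rT c0; rewrite -char_poly_det.
have [s sE] := closed_field_poly_normal (char_poly T).
move: (sE); rewrite (eqP (char_poly_monic T)) scale1r => sE'.
have szs : size s = n.
  by apply: succn_inj; rewrite -(size_prod_XsubC s id) -sE' size_char_poly.
have Is z : z \in s -> 0 <= 'Im z by move=> zs; apply: rT; rewrite sE' root_prod_XsubC.
rewrite sE' horner_prod normr_prod -szs.
elim: s Is {sE sE' szs} => [|z s IH] Is; first by rewrite big_nil.
rewrite big_cons exprS ler_pM ?exprn_ge0 //; last by apply: IH => y ys; apply: Is; rewrite inE ys orbT.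
rewrite hornerXsubC.
have h : `|'Im c| <= `|'Im (c - z)|.
  rewrite raddfB /= !ler0_norm //; last by rewrite subr_le0 (le_trans c0) // Is ?mem_head.
  by rewrite lerN2 gerBl Is ?mem_head.
apply: le_trans h _; rewrite -(@ler_pXn2r _ 2) // ?nnegrE //.
by rewrite [leRHS]normC2_Re_Im real_normK ?Creal_Im // lerDr -realEsqr Creal_Re.
Qed.

Section UltraExistence.
Context {I : Type}.

(** The tails of the directed set of pairs formed by a finite list of vectors
    and a precision. *)
Definition net_filter (V : eqType) : set_system (seq V * nat) :=
  [set A | exists i0 : seq V * nat, forall i : seq V * nat,
     {subset i0.1 <= i.1} -> (i0.2 <= i.2)%N -> A i].

Lemma net_filter_proper (V : eqType) : ProperFilter (@net_filter V).
Proof.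
apply: Build_ProperFilter.
  by move=> [i0 /(_ i0) H]; apply: H.
split.
- by exists ([::], 0%N).
- move=> P Q [i Pi] [j Qj]; exists (i.1 ++ j.1, maxn i.2 j.2) => k /= sk mk.
  split; [apply: Pi|apply: Qj].
  + by move=> x xi; apply: sk; rewrite mem_cat xi.
  + exact: leq_trans (leq_maxl _ _) mk.
  + by move=> x xi; apply: sk; rewrite mem_cat xi orbT.
  + exact: leq_trans (leq_maxr _ _) mk.
- by move=> P Q PQ [i Pi]; exists i => j sj mj; apply: PQ; exact: Pi.
Qed.

Lemma real_ulim {R : realType} (U : set_system I) (UU : UltraFilter U) (f : I -> R) (M : R) :
  (forall i, `|f i| <= M) -> exists l, forall e, 0 < e -> U [set i | `|f i - l| < e].
Proof.
move=> fM; have cM : compact `[- M, M]%classic by exact: segment_compact.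
have FU : ProperFilter (f @ U) by apply: fmap_proper_filter.
have [|l [_ cl]] := cM _ FU.
  by apply: (@filterE _ U _) => i /=; rewrite in_itv /= -ler_norml.
exists l => e e0; have [//|UC] := in_ultra_setVsetC [set i | `|f i - l| < e] UU.
have [||x [xC xB]] := cl (~` ball l e) (ball l e); last by have := xC xB.
  by move: UC; apply: (@filterS _ U _) => i; rewrite /= distrC.
exact: (nbhsx_ballx l e e0).
Qed.

Lemma complex_ulim {R : realType} (U : set_system I) (UU : UltraFilter U) (f : I -> R[i]) (M : R[i]) :
  (forall i, `|f i| <= M) -> exists l, ulim U f l.
Proof.
move=> fM.
have [|x Hx] := @real_ulim R U UU (fun i => complex.Re (f i)) (complex.Re M).
  move=> i; have := fM i; case: (f i) (M) => [p q] [c d]; rewrite normc_def lecE /= => /andP[_].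
  by apply: le_trans; rewrite -sqrtr_sqr ler_wsqrtr // lerDl sqr_ge0.
have [|y Hy] := @real_ulim R U UU (fun i => complex.Im (f i)) (complex.Re M).
  move=> i; have := fM i; case: (f i) (M) => [p q] [c d]; rewrite normc_def lecE /= => /andP[_].
  by apply: le_trans; rewrite -sqrtr_sqr ler_wsqrtr // lerDr sqr_ge0.
exists (x +i* y)%C => -[e e'] /=; rewrite ltcE /= => /andP[/eqP e'0 e0].
have e2 : 0 < e / 2 by rewrite divr_gt0.
move: (Hx _ e2) (Hy _ e2); apply: filterS2 => i /=.
case: (f i) => [p q] /= h1 h2; rewrite normc_def ltcE /= e'0 eqxx /=.
apply: le_lt_trans (_ : `|p - x| + `|q - y| < e); last by rewrite [ltRHS]splitr ltrD.
rewrite -[leRHS]ger0_norm ?addr_ge0 // -sqrtr_sqr ler_wsqrtr //.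
rewrite -(real_normK (num_real (p - x))) -(real_normK (num_real (q - y))).
have := normr_ge0 (p - x); have := normr_ge0 (q - y); move: `|p - x| `|q - y| => u v; nra.
Qed.
End UltraExistence.

(** * Orthonormal families *)

Section InnerProduct.
Context {C : numClosedFieldType} {V : lmodType C} (g : V -> V -> C).
Context (gD : forall u v w, g (u + v) w = g u w + g v w)
  (gZ : forall c u v, g (c *: u) v = c * g u v)
  (gC : forall u v, g v u = (g u v)^*)
  (g_gt0 : forall u, u != 0 -> 0 < g u u).

Lemma gDr u v w : g w (u + v) = g w u + g w v.
Proof. by rewrite gC gD rmorphD /= -!gC. Qed.
Lemma gZr c u v : g v (c *: u) = c^* * g v u.
Proof. by rewrite gC gZ rmorphM /= -gC. Qed.
Lemma g0l v : g 0 v = 0. Proof. by rewrite -(scale0r 0) gZ mul0r. Qed.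
Lemma g0r v : g v 0 = 0. Proof. by rewrite gC g0l conjC0. Qed.
Lemma gNl u v : g (- u) v = - g u v. Proof. by rewrite -scaleN1r gZ mulN1r. Qed.
Lemma gNr u v : g u (- v) = - g u v. Proof. by rewrite gC gNl rmorphN /= -gC. Qed.
Lemma gBl u v w : g (u - v) w = g u w - g v w. Proof. by rewrite gD gNl. Qed.
Lemma gBr u v w : g w (u - v) = g w u - g w v. Proof. by rewrite gDr gNr. Qed.

Lemma g_ge0 u : 0 <= g u u.
Proof. by have [->|/g_gt0/ltW] := eqVneq u 0; rewrite ?g0l. Qed.

Lemma g_eq0 u : g u u = 0 -> u = 0.
Proof. by move=> E; apply/eqP; apply: contraT => /g_gt0; rewrite E ltxx. Qed.

Lemma g_comb_l n (N : 'I_n -> V) (x : 'rV[C]_n) v : g (comb N x) v = \sum_i x 0 i * g (N i) v.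
Proof.
rewrite /comb (big_morph (fun u => g u v) (fun u w => gD u w v) (g0l v)).
by apply: eq_bigr => i _; rewrite gZ.
Qed.

Lemma g_comb_r n (N : 'I_n -> V) (x : 'rV[C]_n) v : g v (comb N x) = \sum_i (x 0 i)^* * g v (N i).
Proof.
rewrite /comb (big_morph (g v) (fun u w => gDr u w v) (g0r v)).
by apply: eq_bigr => i _; rewrite gZr.
Qed.

Definition orthonormal_fam p (e : 'I_p -> V) := forall i j, g (e i) (e j) = (i == j)%:R.

Definition coords p (e : 'I_p -> V) x : 'rV[C]_p := \row_j g x (e j).

Definition proj p (e : 'I_p -> V) x := comb e (coords e x).

Definition sqn p (x : 'rV[C]_p) : C := \sum_i x 0 i * (x 0 i)^*.

Lemma sqn_ge0 p (x : 'rV[C]_p) : 0 <= sqn x.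
Proof. by apply: sumr_ge0 => i _; exact: mul_conjC_ge0. Qed.

Lemma sqn_gt0 p (x : 'rV[C]_p) : x != 0 -> 0 < sqn x.
Proof.
move=> x0; rewrite lt0r sqn_ge0 andbT; apply: contra_neq x0 => /eqP.
rewrite psumr_eq0; last by move=> i _; exact: mul_conjC_ge0.
move=> /allP H; apply/rowP => i; have := H i (mem_index_enum i).
by rewrite /= mul_conjC_eq0 mxE => /eqP.
Qed.

Section Family.
Context {p : nat} {e : 'I_p -> V} (eo : orthonormal_fam e).

Lemma on_comb_l x j : g (comb e x) (e j) = x 0 j.
Proof.
rewrite g_comb_l (bigD1 j) //= eo eqxx mulr1 big1 ?addr0 // => i /negPf ij.
by rewrite eo ij mulr0.
Qed.

Lemma coords_comb x : coords e (comb e x) = x.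
Proof. by apply/rowP => j; rewrite mxE on_comb_l. Qed.

Lemma proj_comb x : proj e (comb e x) = comb e x.
Proof. by rewrite /proj coords_comb. Qed.

Lemma on_comb x y : g (comb e x) (comb e y) = \sum_i x 0 i * (y 0 i)^*.
Proof. by rewrite g_comb_r; apply: eq_bigr => i _; rewrite on_comb_l mulrC. Qed.

Lemma proj_ortho x j : g (x - proj e x) (e j) = 0.
Proof. by rewrite gBl on_comb_l mxE subrr. Qed.

Lemma proj_sym x y : g (proj e x) y = g x (proj e y).
Proof.
rewrite g_comb_l g_comb_r; apply: eq_bigr => j _.
by rewrite !mxE -gC mulrC.
Qed.

Lemma projK x : proj e (proj e x) = proj e x. Proof. exact: proj_comb. Qed.

Lemma coordsD x y : coords e (x + y) = coords e x + coords e y.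
Proof. by apply/rowP => j; rewrite !mxE gD. Qed.

Lemma coordsZ c x : coords e (c *: x) = c *: coords e x.
Proof. by apply/rowP => j; rewrite !mxE gZ. Qed.

Lemma projD x y : proj e (x + y) = proj e x + proj e y.
Proof. by rewrite /proj coordsD combD. Qed.

Lemma projZ c x : proj e (c *: x) = c *: proj e x.
Proof. by rewrite /proj coordsZ combZ. Qed.

Lemma proj_pythagoras x : g x x = g (proj e x) (proj e x) + g (x - proj e x) (x - proj e x).
Proof.
have E : g (proj e x) (x - proj e x) = 0.
  by rewrite gBr (proj_sym x (proj e x)) projK -proj_sym subrr.
have E' : g (x - proj e x) (proj e x) = 0 by rewrite gC E conjC0.
transitivity (g (proj e x + (x - proj e x)) (proj e x + (x - proj e x))).
  by rewrite addrC subrK.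
by rewrite gD [g (proj e x) _]gDr [g (x - _) _]gDr E E' addr0 add0r.
Qed.

Lemma bessel x : g (proj e x) (proj e x) <= g x x.
Proof. by rewrite (proj_pythagoras x) lerDl g_ge0. Qed.

Lemma orthonormal_extend r : (forall j, g r (e j) = 0) -> r != 0 ->
  exists k (e' : 'I_p.+1 -> V), [/\ k != 0, orthonormal_fam e', e' ord0 = k *: r &
    forall j, e' (lift ord0 j) = e j].
Proof.
move=> re r0; have gr0 := g_gt0 r0.
have q0 : 0 < sqrtC (g r r) by rewrite sqrtC_gt0.
pose k := (sqrtC (g r r))^-1.
have kc : k^* = k by apply: CrealP; rewrite ger0_real // invr_ge0 ltW.
exists k, (fun i => oapp e (k *: r) (unlift ord0 i)); split.
- by rewrite invr_eq0 gt_eqF.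
- move=> i j; case: (unliftP ord0 i) => [i'|] ->; case: (unliftP ord0 j) => [j'|] ->;
    rewrite ?liftK ?unlift_none /=.
  + by rewrite eo (inj_eq lift_inj).
  + by rewrite gZr gC re conjC0 mulr0.
  + by rewrite gZ re mulr0.
  + by rewrite gZ gZr kc mulrA -expr2 exprVn sqrtCK mulVf ?gt_eqF.
- by rewrite unlift_none.
- by move=> j; rewrite liftK.
Qed.
End Family.

Lemma proj_extend p (e : 'I_p -> V) (e' : 'I_p.+1 -> V) x :
  (forall j, e' (lift ord0 j) = e j) ->
  proj e' x = g x (e' ord0) *: e' ord0 + proj e x.
Proof.
move=> ee; rewrite /proj /comb big_ord_recl mxE; congr (_ + _).
by apply: eq_bigr => i _; rewrite !mxE ee.
Qed.

Lemma gram_schmidt (l : seq V) : exists p (e : 'I_p -> V),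
  orthonormal_fam e /\ forall x, x \in l -> proj e x = x.
Proof.
elim: l => [|x l [p [e [eo el]]]]; first by exists 0%N, (fun=> 0); split=> // -[].
have [E|r0] := eqVneq (x - proj e x) 0.
  exists p, e; split=> // y; rewrite inE => /orP[/eqP ->|/el //].
  by apply/esym/eqP; rewrite -subr_eq0 E.
have [k [e' [k0 e'o e0 ee]]] := orthonormal_extend eo (proj_ortho eo x) r0.
have re j : g (e' ord0) (e j) = 0 by rewrite e0 gZ proj_ortho // mulr0.
have rc y : g (proj e y) (e' ord0) = 0.
  rewrite gC g_comb_r big1 ?conjC0 // => i _; by rewrite re mulr0.
exists p.+1, e'; split=> // y; rewrite inE (proj_extend _ ee) => /orP[/eqP ->|/el yl].
  have xr : x = k^-1 *: e' ord0 + proj e x by rewrite e0 scalerK // subrK.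
  by rewrite {1}xr gD rc addr0 gZ e'o eqxx mulr1 -xr.
by rewrite -{1}yl rc scale0r add0r.
Qed.

Definition nrm u := sqrtC (g u u).

Lemma nrm_ge0 u : 0 <= nrm u. Proof. by rewrite sqrtC_ge0 g_ge0. Qed.

Lemma nrmK u : nrm u ^+ 2 = g u u. Proof. exact: sqrtCK. Qed.

Lemma cauchy_schwarz u v : `|g u v| <= nrm u * nrm v.
Proof.
have [->|v0] := eqVneq v 0; first by rewrite g0r normr0 mulr_ge0 ?nrm_ge0.
have gv := g_gt0 v0.
rewrite -(@ler_pXn2r _ 2) // ?nnegrE ?mulr_ge0 ?nrm_ge0 // exprMn !nrmK.
have := g_ge0 (u - (g u v / g v v) *: v).
rewrite gBl !gBr gZ !gZr gZ rmorphM /= fmorphV /= -!gC.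
have -> : g u u - g v u / g v v * g u v - (g u v / g v v * g v u -
   g v u / g v v * (g u v / g v v * g v v)) = g u u - g u v * g v u / g v v.
  by field; rewrite gt_eqF.
by rewrite (gC u v) -normCK subr_ge0 ler_pdivrMr.
Qed.

Lemma nrmZ c u : nrm (c *: u) = `|c| * nrm u.
Proof.
rewrite /nrm gZ gZr mulrA -normCK rootCMl ?exprn_ge0 ?normr_ge0 //.
by rewrite sqrCK ?normr_ge0.
Qed.

Lemma nrmD u v : nrm (u + v) <= nrm u + nrm v.
Proof.
rewrite -(@ler_pXn2r _ 2) // ?nnegrE ?addr_ge0 ?nrm_ge0 // nrmK sqrrD !nrmK.
rewrite gD !gDr addrA -(addrA (g u u)) lerD2r lerD2l.
have R : g u v + g v u \is Num.real by rewrite (gC u v) CrealE rmorphD /= conjCK addrC.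
apply: le_trans (real_ler_norm R) _; apply: le_trans (ler_normD _ _) _.
by rewrite mulr2n lerD // ?cauchy_schwarz // mulrC cauchy_schwarz.
Qed.

Lemma nrm_le u v : g u u <= g v v -> nrm u <= nrm v.
Proof. by move=> uv; rewrite ler_sqrtC ?nnegrE ?g_ge0. Qed.

Lemma nrm_proj p (e : 'I_p -> V) x : orthonormal_fam e -> nrm (proj e x) <= nrm x.
Proof. by move=> eo; apply: nrm_le; exact: bessel. Qed.

Lemma comb_bounded n (N : 'I_n -> V) : exists2 k, 0 <= k &
  forall x, g (comb N x) (comb N x) <= k * sqn x.
Proof.
exists ((\sum_i nrm (N i)) ^+ 2) => [|x].
  by rewrite exprn_ge0 // sumr_ge0 // => i _; exact: nrm_ge0.
have S0 : 0 <= \sum_i nrm (N i) by apply: sumr_ge0 => i _; exact: nrm_ge0.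
have := sqn_ge0 x; set q := sqn x => q0.
rewrite -(sqrtCK q) -exprMn -nrmK ler_pXn2r ?nnegrE ?nrm_ge0 ?mulr_ge0 ?sqrtC_ge0 //.
rewrite mulr_suml /comb.
have xi i : `|x 0 i| <= sqrtC q.
  rewrite -(@ler_pXn2r _ 2) // ?nnegrE ?sqrtC_ge0 // sqrtCK normCK /q /sqn (bigD1 i) //= lerDl.
  by apply: sumr_ge0 => j _; exact: mul_conjC_ge0.
elim/big_rec2: _ => [|i u w _ IH]; first by rewrite /nrm g0l sqrtC0.
apply: le_trans (nrmD _ _) _; apply: lerD => //.
by rewrite nrmZ mulrC ler_wpM2l ?nrm_ge0.
Qed.
End InnerProduct.

(** * Galerkin approximation *)

Section Galerkin.
Local Open Scope sesquilinear_scope.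
Context {C : numClosedFieldType} {V : lmodType C} (s : V -> V -> C).
Context (sD : forall u v w, s (u + v) w = s u w + s v w)
  (sZ : forall c u v, s (c *: u) v = c * s u v)
  (sC : forall u v, s v u = (s u v)^*)
  (s_gt0 : forall u, u != 0 -> 0 < s u u).
Local Notation nrm := (nrm s).
Local Notation ortho := (orthonormal_fam s).
Local Notation proj := (proj s).

Definition op_linear (f : V -> V) :=
  (forall u v, f (u + v) = f u + f v) /\ (forall c u, f (c *: u) = c *: f u).

Definition op_sym (f : V -> V) := forall u v, s (f u) v = s u (f v).

Definition op_bounded (f : V -> V) (k : C) := 0 <= k /\ forall u, nrm (f u) <= k * nrm u.

Definition mx_of p (b : 'I_p -> V) (f : V -> V) : 'M[C]_p := \matrix_(i, j) s (f (b i)) (b j).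

Lemma mx_ofE p (b : 'I_p -> V) f (x : 'rV[C]_p) : op_linear f ->
  x *m mx_of b f = coords s b (f (comb b x)).
Proof.
move=> [fD fZ]; apply/rowP => j; rewrite !mxE (comb_linear _ _ fD fZ) (g_comb_l sD sZ).
by apply: eq_bigr => i _; rewrite mxE.
Qed.

Lemma mx_of_form p (b : 'I_p -> V) f (x y : 'rV[C]_p) : op_linear f ->
  hform (mx_of b f) x y = s (f (comb b x)) (comb b y).
Proof.
move=> fl; rewrite /hform (mx_ofE _ _ fl) mxE (g_comb_r sD sZ sC).
by apply: eq_bigr => i _; rewrite !mxE mulrC.
Qed.

Lemma mx_of_sym p (b : 'I_p -> V) f : op_sym f -> (mx_of b f) ^t* = mx_of b f.
Proof. by move=> fs; apply/matrixP => i j; rewrite !mxE -sC fs. Qed.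

(** Only finitely many shifts are excluded, by the eigenvalues. *)
Lemma unit_shift p (M : 'M[C]_p) :
  exists2 k : C, 0 < k & forall t, 0 < t -> t <= k -> M + t%:M \in unitmx.
Proof.
suff [k k0 H] : exists2 k : C, 0 < k & forall t, 0 < t -> t <= k ->
    ~~ root (char_poly (- M)) t.
  exists k => // t t0 tk; have := nonroot_unit (H t t0 tk).
  by rewrite -opprD unitmxE -scaleN1r detZ unitrM => /andP[_]; rewrite unitmxE.
have [r rE] := closed_field_poly_normal (char_poly (- M)).
move: rE; rewrite (eqP (char_poly_monic (- M))) scale1r => ->.
elim: r => [|c r [k k0 IH]].
  by exists 1 => // t _ _; rewrite big_nil root1.
exists (if 0 < c then k * c / (k + c + c) else k).
  by case: ifP => // c0; rewrite divr_gt0 ?mulr_gt0 ?addr_gt0.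
move=> t t0 tk; rewrite big_cons rootM negb_or root_XsubC.
case: ifP tk => c0 tk; last first.
  by rewrite IH // andbT; apply: contraFneq c0 => <-.
rewrite ler_pdivlMr ?addr_gt0 // in tk; apply/andP; split.
  apply: contraTneq tk => ->; rewrite -real_ltNge ?ger0_real ?mulr_ge0 ?addr_ge0 ?ltW //.
  by rewrite [ltLHS]mulrC ltr_pM2l // -addrA ltrDl addr_gt0.
apply: IH => //; rewrite -(ler_pM2r c0); apply: le_trans tk.
by rewrite ler_wpM2l ?(ltW t0) // lerDr addr_ge0 ?ltW.
Qed.

(** Compress to the span of the orthonormal family [b]. The shift [t] makes the
    compressed form nondegenerate, and the term [- i e] makes the compressed
    operator strictly dissipative for it, so the matrix theorem applies. The
    bounds do not depend on [b]. *)
Lemma galerkin_step (f d : V -> V) (kf kd kM kN e t : C) n (N : 'I_n -> V) p (b : 'I_p -> V) :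
  op_linear f -> op_linear d -> op_sym f -> op_sym d -> op_bounded f kf -> op_bounded d kd ->
  0 < kM -> (forall a, sqn a <= - (kM * s (f (comb N a)) (comb N a))) ->
  (forall a, s (comb N a) (comb N a) <= kN * sqn a) ->
  ortho b -> (forall i, proj b (N i) = N i) -> 0 < e -> 0 <= t -> t * (kM * kN) < 1 ->
  mx_of b f + t%:M \in unitmx ->
  exists (u : 'I_n -> V) (T : 'M[C]_n),
  [/\ ortho u,
      forall v i, proj b v = v -> proj b (d v) = d v ->
        \sum_j T i j * s (u j) v = s (f (u i) + t *: u i) (d v + ('i * e) *: v),
      forall a, s (f (comb u a)) (comb u a) <= 0,
      forall i j, `|T i j| <= (kd + e) * (kf + t) &
      forall c, root (char_poly T) c -> 0 < 'Im c].
Proof.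
move=> fl dl fs ds [kf0 fb] [kd0 db] kM0 fN kNE bo bN e0 t0 tkN Fu.
set Fm := mx_of b f + t%:M in Fu *; pose Dm := mx_of b d - ('i * e)%:M.
have er : e \is Num.real by exact: gtr0_real.
have tr : t \is Num.real by exact: ger0_real.
have hformD p' (M M' : 'M[C]_p') x y : hform (M + M') x y = hform M x y + hform M' x y.
  by rewrite /hform mulmxDr mulmxDl mxE.
have hform1 p' c (x y : 'rV[C]_p') : hform c%:M x y = c * \sum_i x 0 i * (y 0 i)^*.
  rewrite /hform mul_mx_scalar -scalemxAl mxE; congr (_ * _); rewrite mxE.
  by apply: eq_bigr => i _; rewrite !mxE.
have FmH : Fm ^t* = Fm.
  rewrite /Fm linearD /= map_mxD mx_of_sym //; congr (_ + _).
  by rewrite tr_scalar_mx map_scalar_mx /= conj_Creal.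
have FmE x y : hform Fm x y = s (f (comb b x)) (comb b y) + t * s (comb b x) (comb b y).
  by rewrite hformD hform1 mx_of_form // (on_comb sD sZ sC bo).
have dis : dissipative Fm (Fm *m Dm).
  move=> x x0; pose y := x *m Fm.
  have y0 : y != 0.
    by apply: contra_neq x0 => y0; rewrite -(mulmxK Fu x) -/y y0 mul0mx.
  have -> : hform Fm (x *m (Fm *m Dm)) x = hform Dm y y.
    by rewrite /hform -{2}FmH {2}/y trmx_mul map_mxM FmH !mulmxA.
  rewrite /Dm -scalemx1 -scaleNr scalemx1 hformD hform1 mx_of_form // -/(sqn y) raddfD /=.
  have /Creal_ImP -> : s (d (comb b y)) (comb b y) \is Num.real.
    by rewrite CrealE -sC ds.
  rewrite add0r mulNr raddfN /= -mulrA ImMil oppr_lt0.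
  have qr : sqn y \is Num.real by exact: ger0_real (sqn_ge0 _).
  by rewrite (Creal_ReP _ _) ?realM // mulr_gt0 // sqn_gt0.
have combN a : comb b (a *m \matrix_i coords s b (N i)) = comb N a.
  rewrite mulmx_sum_row /comb.
  transitivity (\sum_i a 0 i *: comb b (coords s b (N i))).
    rewrite -[LHS]/(comb b (\sum_i a 0 i *: row i (\matrix_i coords s b (N i)))).
    rewrite (big_morph (comb b) (combD b) (comb0 b)); apply: eq_bigr => i _.
    by rewrite combZ rowK.
  by apply: eq_bigr => i _; rewrite -[comb b _]/(proj b (N i)) bN.
have neg : negdef Fm (\matrix_i coords s b (N i)).
  move=> a a0; have q0 := sqn_gt0 a0.
  rewrite FmE combN -(pmulr_rlt0 _ kM0) mulrDr -[X in X + _]opprK addrC subr_lt0.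
  apply: lt_le_trans (fN a); apply: le_lt_trans (_ : t * (kM * (kN * sqn a)) < _).
    by rewrite mulrCA ler_wpM2l // ler_wpM2l // ltW.
  by rewrite !mulrA -[ltRHS]mul1r ltr_pM2r // -!mulrA.
have [U [T [UU UT nU rT]]] := dissipative_invariant_unitary FmH dis neg.
pose u i := comb b (row i U).
have combu a : comb u a = comb b (a *m U).
  rewrite mulmx_sum_row (big_morph (comb b) (combD b) (comb0 b)).
  by apply: eq_bigr => i _; rewrite combZ.
have uo : ortho u.
  move=> i j; rewrite (on_comb sD sZ sC bo).
  transitivity ((U *m U ^t*) i j).
    by rewrite mxE; apply: eq_bigr => l _; rewrite !mxE.
  by move/unitarymxP: UU => ->; rewrite mxE.
pose w i := f (u i) + t *: u i; pose w' i := proj b (w i).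
have w'E i : comb b (row i U *m Fm) = w' i.
  rewrite /w' /w (projD sD) (projZ sZ) mulmxDr combD mx_ofE // mul_mx_scalar combZ.
  by congr (_ + _ *: _); rewrite (proj_comb sD sZ bo).
have TE i v : \sum_j T i j * s (u j) v = s (proj b (d (w' i))) v - 'i * e * s (w' i) v.
  transitivity (s (comb b (row i (T *m U))) v).
    rewrite row_mul -combu (g_comb_l sD sZ).
    by apply: eq_bigr => j _; rewrite mxE.
  rewrite -UT row_mul mulmxA /Dm mulmxBr combB mul_mx_scalar combZ w'E mx_ofE // w'E.
  by rewrite (gBl sD sZ) sZ.
exists u, T; split=> //.
- move=> v i pv pdv; rewrite TE -/(w i).
  rewrite (proj_sym sD sZ sC) // pv ds {1}/w' (proj_sym sD sZ sC) // pdv.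
  rewrite {1}/w' (proj_sym sD sZ sC) // pv (gDr sD sC) (gZr sZ sC) rmorphM /= conjCi.
  by rewrite (conj_Creal er) !mulNr.
- move=> a; have [->|a0] := eqVneq a 0; first by rewrite comb0 (g0r sZ sC).
  rewrite combu; have := nU a a0; rewrite FmE.
  move/ltW; apply: le_trans; rewrite lerDl mulr_ge0 //.
  exact: g_ge0.
- move=> i j.
  have nu k : nrm (u k) = 1 by rewrite /nrm uo eqxx sqrtC1.
  have -> : T i j = \sum_k T i k * s (u k) (u j).
    rewrite (bigD1 j) //= uo eqxx mulr1 big1 ?addr0 // => k /negPf kj.
    by rewrite uo kj mulr0.
  have nw : nrm (w' i) <= kf + t.
    apply: le_trans (nrm_proj sD sZ sC s_gt0 _ bo) _.
    apply: le_trans (nrmD sD sZ sC s_gt0 _ _) _; apply: lerD.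
      by apply: le_trans (fb _) _; rewrite nu mulr1.
    by rewrite (nrmZ sZ sC) nu mulr1 ger0_norm.
  rewrite TE; apply: le_trans (ler_normB _ _) _.
  have h1 : `|s (proj b (d (w' i))) (u j)| <= kd * nrm (w' i).
    apply: le_trans (cauchy_schwarz sD sZ sC s_gt0 _ _) _; rewrite nu mulr1.
    by apply: le_trans (nrm_proj sD sZ sC s_gt0 _ bo) _.
  have h2 : `|'i * e * s (w' i) (u j)| <= e * nrm (w' i).
    rewrite !normrM normCi mul1r (ger0_norm (ltW e0)) ler_wpM2l ?(ltW e0) //.
    by apply: le_trans (cauchy_schwarz sD sZ sC s_gt0 _ _) _; rewrite nu mulr1.
  apply: le_trans (lerD h1 h2) _; rewrite -mulrDl ler_wpM2l ?addr_ge0 ?(ltW e0) //.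
Qed.
End Galerkin.

(** * Weak limits and invariant subspaces in Hilbert space *)

(** Compare the two forms through a [g]-orthonormal basis. *)
Lemma posdef_bound {C : numClosedFieldType} n (g : 'rV[C]_n -> 'rV[C]_n -> C) :
  (forall u v w, g (u + v) w = g u w + g v w) -> (forall c u v, g (c *: u) v = c * g u v) ->
  (forall u v, g v u = (g u v)^*) -> (forall u, u != 0 -> 0 < g u u) ->
  exists2 k : C, 0 < k & forall x, sqn x <= k * g x x.
Proof.
move=> gD gZ gC g0.
pose dot (x y : 'rV[C]_n) := \sum_i x 0 i * (y 0 i)^*.
have dD u v w : dot (u + v) w = dot u w + dot v w.
  by rewrite -big_split; apply: eq_bigr => i _; rewrite mxE mulrDl.
have dZ c u v : dot (c *: u) v = c * dot u v.
  by rewrite mulr_sumr; apply: eq_bigr => i _; rewrite mxE mulrA.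
have dC u v : dot v u = (dot u v)^*.
  by rewrite rmorph_sum; apply: eq_bigr => i _ /=; rewrite rmorphM /= conjCK mulrC.
have d0 u : u != 0 -> 0 < dot u u by exact: sqn_gt0.
have [p [e [eo es]]] := gram_schmidt gD gZ gC g0 [seq delta_mx 0 i | i <- enum 'I_n].
have pe x : proj g e x = x.
  rewrite {2}[x]row_sum_delta [x in LHS]row_sum_delta.
  have p0 : proj g e 0 = 0 by rewrite -(scale0r 0) (projZ gZ) !scale0r.
  rewrite (big_morph (proj g e) (fun y z => projD gD y z) p0); apply: eq_bigr => i _.
  by rewrite (projZ gZ) es // map_f // mem_enum.
have [k k0 kE] := comb_bounded dD dZ dC d0 e.
exists (k + 1) => [|x]; first by rewrite ltr_wpDl.
have -> : g x x = sqn (coords g e x) by rewrite -{1 2}(pe x) (on_comb gD gZ gC eo).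
apply: le_trans (_ : k * sqn (coords g e x) <= _); last by rewrite ler_wpM2r ?sqn_ge0 // lerDl.
by apply: le_trans (kE _); rewrite -/(proj g e x) pe.
Qed.

Lemma op_linearB {C : numClosedFieldType} {V : lmodType C} (f : V -> V) u v :
  op_linear f -> f (u - v) = f u - f v.
Proof. by move=> [fD fZ]; rewrite fD -scaleN1r fZ scaleN1r. Qed.

Section HilbertSpace.
Context {C : numClosedFieldType} {V : lmodType C} (s : V -> V -> C).
Context (sD : forall u v w, s (u + v) w = s u w + s v w)
  (sZ : forall c u v, s (c *: u) v = c * s u v)
  (sC : forall u v, s v u = (s u v)^*)
  (s_gt0 : forall u, u != 0 -> 0 < s u u).
Local Notation nrm := (nrm s).
Local Notation ortho := (orthonormal_fam s).
Local Notation proj := (proj s).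

Context (riesz : forall phi : V -> C, (forall u v, phi (u + v) = phi u + phi v) ->
    (forall c u, phi (c *: u) = c * phi u) -> (exists k, forall u, `|phi u| <= k * nrm u) ->
    exists w, forall u, phi u = s u w)
  (archi : forall e : C, 0 < e -> exists k : nat, k.+1%:R^-1 < e)
  (bw : forall (I : Type) (F : set_system I), UltraFilter F -> forall (f : I -> C) (M : C),
    (forall i, `|f i| <= M) -> exists l, ulim F f l).

Let sDr := gDr sD sC.
Let sZr := gZr sZ sC.
Let s0l := g0l sZ.
Let s0r := g0r sZ sC.
Let sBl := gBl sD sZ.
Let sBr := gBr sD sZ sC.
Let s_ge0 := g_ge0 sZ s_gt0.
Let CS := cauchy_schwarz sD sZ sC s_gt0.
Let nrm0 := nrm_ge0 sZ s_gt0.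

Section WeakLimits.
Context {I : Type} {F : set_system I} {UF : UltraFilter F}.
Implicit Types (x : I -> V).

Definition wlim x (x0 : V) := forall v, ulim F (fun i => s (x i) v) (s x0 v).

(** The limits of the functionals [s v (x i)] form a bounded functional, which
    is represented by a vector. *)
Lemma weak_compact x M : (forall i, nrm (x i) <= M) -> exists x0 : V, wlim x x0.
Proof.
move=> xM.
have bnd v i : `|s v (x i)| <= M * nrm v.
  by apply: le_trans (CS _ _) _; rewrite mulrC ler_wpM2r.
have /choice [phi Hphi] : forall v, exists l, ulim F (fun i => s v (x i)) l.
  by move=> v; apply: bw UF _ _ (bnd v).
have [||| w wE] := riesz (phi := phi).
- move=> u v; apply: ulim_unique (Hphi _) _.
  by under eq_fun do rewrite sD; exact: ulimD.
- move=> c u; apply: ulim_unique (Hphi _) _.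
  by under eq_fun do rewrite sZ; exact: ulimZ.
- exists M => u; apply: (@ulim_le C I F _ (fun i => `|s u (x i)|) (fun=> M * nrm u)).
  + by apply: filterE => i; exact: bnd.
  + exact: ulim_norm.
  + exact: ulim_cst.
- exists w => v; rewrite sC -wE.
  by under eq_fun do rewrite sC; apply: ulim_conj.
Qed.

Lemma wlim_op (f : V -> V) x (x0 : V) : op_sym s f -> wlim x x0 -> wlim (f \o x) (f x0).
Proof. by move=> fs xx0 v; rewrite fs /=; under eq_fun do rewrite fs; exact: xx0. Qed.

Lemma wlim_comb n (x : I -> 'I_n -> V) (x0 : 'I_n -> V) (a : 'rV[C]_n) :
  (forall j, wlim (x ^~ j) (x0 j)) -> wlim (fun i => comb (x i) a) (comb x0 a).
Proof.
move=> xx v; rewrite (g_comb_l sD sZ).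
under eq_fun do rewrite (g_comb_l sD sZ).
by apply: ulim_sum => j; apply: ulimZ; exact: xx.
Qed.

(** Expand the nonnegative number [s (f (x i - x0)) (x i - x0)]. *)
Lemma weak_lsc (f : V -> V) x (x0 : V) l : op_linear f -> op_sym s f -> (forall u, 0 <= s (f u) u) ->
  wlim x x0 -> ulim F (fun i => s (f (x i)) (x i)) l -> s (f x0) x0 <= l.
Proof.
move=> fl fs f0 xx xl; rewrite -subr_ge0.
have E i : s (f (x i - x0)) (x i - x0) =
    s (f (x i)) (x i) - s (x i) (f x0) - (s (x i) (f x0))^* + s (f x0) x0.
  by rewrite (op_linearB _ _ fl) sBl !sBr (fs (x i) x0) -(sC (x i) (f x0)); ring.
apply: (@ulim_ge0 C I F _ (fun i => s (f (x i - x0)) (x i - x0))).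
  by apply: (@filterE _ F _) => i; exact: f0.
under eq_fun do rewrite E.
have -> : l - s (f x0) x0 = l - s x0 (f x0) - (s x0 (f x0))^* + s (f x0) x0.
  by rewrite -sC -fs; ring.
apply: ulimD (ulim_cst _); apply: ulimB; first by apply: ulimB => //; exact: xx.
by apply: ulim_conj; exact: xx.
Qed.
End WeakLimits.

Context (A G D : V -> V) (kA kG kD kappa : C).
Context (Al : op_linear A) (As : op_sym s A) (Ab : op_bounded s A kA)
  (Gl : op_linear G) (Gs : op_sym s G) (Gb : op_bounded s G kG)
  (Dl : op_linear D) (Ds : op_sym s D) (Db : op_bounded s D kD)
  (kappa0 : 0 < kappa) (Ak : forall u, kappa * s u u <= s (A u) u)
  (G0 : forall u, 0 <= s (G u) u)
  (Gcpt : forall e : C, 0 < e -> exists q (f : 'I_q -> V), forall u,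
     (forall j, s u (f j) = 0) -> s (G u) u <= e * s u u).

Let AD := Al.1. Let AZ := Al.2. Let GD := Gl.1. Let GZ := Gl.2.

(** Off finitely many directions, along which weak limits are limits, the form
    of [G] is as small as desired. *)
Lemma compact_cont (I : Type) (F : set_system I) (UF : UltraFilter F) (x : I -> V) x0 M :
  (forall i, nrm (x i) <= M) -> wlim (F := F) x x0 ->
  ulim F (fun i => s (G (x i)) (x i)) (s (G x0) x0).
Proof.
move=> xM xx.
pose w i := x i - x0; pose K := M + nrm x0.
have wK i : nrm (w i) <= K.
  apply: le_trans (nrmD sD sZ sC s_gt0 _ _) _; rewrite lerD //.
  by rewrite -scaleN1r (nrmZ sZ sC) normrN1 mul1r.
have K0 : 0 <= K.
  have [i _] := @filter_ex _ F _ setT filterT.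
  exact: le_trans (nrm0 _) (wK i).
have w0 v : ulim F (fun i => s (w i) v) 0.
  suff : ulim F (fun i => s (x i) v - s x0 v) (s x0 v - s x0 v).
    by rewrite subrr; under eq_fun do rewrite -sBl.
  by apply: ulimB; [exact: xx|exact: ulim_cst].
suff z : ulim F (fun i => s (G (w i)) (w i)) 0.
  have E i : s (G (x i)) (x i) = s (G (w i)) (w i) + (s (x i) (G x0) + (s (x i) (G x0))^* - s (G x0) x0).
    by rewrite /w (op_linearB _ _ Gl) sBl !sBr (Gs (x i) x0) -(sC (x i) (G x0)); ring.
  have -> : (fun i => s (G (x i)) (x i)) = (fun i => s (G (w i)) (w i) +
      (s (x i) (G x0) + (s (x i) (G x0))^* - s (G x0) x0)) by apply/funext => i; exact: E.
  have H : 0 + (s x0 (G x0) + (s x0 (G x0))^* - s (G x0) x0) = s (G x0) x0.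
    by rewrite -sC -Gs; ring.
  suff : ulim F (fun i => s (G (w i)) (w i) + (s (x i) (G x0) + (s (x i) (G x0))^* - s (G x0) x0))
      (0 + (s x0 (G x0) + (s x0 (G x0))^* - s (G x0) x0)) by rewrite H.
  apply: ulimD => //.
  apply: ulimB; last exact: ulim_cst.
  by apply: ulimD; [exact: xx|apply: ulim_conj; exact: xx].
move=> eps eps0.
have k0 : 0 < 2 * (K ^+ 2 + 1) by rewrite mulr_gt0 // ltr_wpDl // exprn_ge0.
have [q [f fE]] := Gcpt (divr_gt0 eps0 k0).
have [p [e [eo es]]] := gram_schmidt sD sZ sC s_gt0 (codom f).
have {}fE u : (forall k, s u (e k) = 0) -> s (G u) u <= eps / (2 * (K ^+ 2 + 1)) * s u u.
  move=> ue; apply: fE => j; rewrite -(es (f j)) ?codom_f //.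
  by rewrite (g_comb_r sD sZ sC) big1 // => k _; rewrite ue mulr0.
pose z i := \sum_j `|s (w i) (e j)|.
have z0 : ulim F z 0.
  suff : ulim F z (\sum_(j < p) `|0 : C|) by rewrite big1 // => j _; rewrite normr0.
  by apply: ulim_sum => j; apply: ulim_norm; exact: w0.
have kG0 := Gb.1.
have c0 : 0 < 2 * (2 * (kG * K) + 1) by rewrite mulr_gt0 // ltr_wpDl // !mulr_ge0.
move: (z0 _ (divr_gt0 eps0 c0)); apply: filterS => i /=.
rewrite !subr0 !ger0_norm ?sumr_ge0 // => zi.
pose r := proj e (w i); pose w' := w i - r.
have rE v : `|s r v| <= z i * nrm v.
  rewrite (g_comb_l sD sZ) (le_trans (ler_norm_sum _ _ _)) // mulr_suml; apply: ler_sum => j _.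
  rewrite normrM mxE ler_wpM2l // (le_trans (CS _ _)) //.
  by rewrite {1}/nrm eo eqxx sqrtC1 mul1r.
have w'K : nrm w' <= K.
  apply: le_trans (wK i); apply: nrm_le => //.
  by rewrite (proj_pythagoras sD sZ sC eo (w i)) lerDr.
have HE : s (G (w i)) (w i) = s (G w') w' + (s r (G (w i)) + (s r (G w'))^*).
  have wE : w i = w' + r by rewrite /w' subrK.
  by rewrite -(sC r (G w')) -(Gs r (w i)) wE GD !(sD, sDr); ring.
rewrite HE.
have h1 : s (G w') w' <= eps / (2 * (K ^+ 2 + 1)) * K ^+ 2.
  apply: le_trans (fE _ _) _; first by move=> k; rewrite /w' /r (proj_ortho sD sZ).
  rewrite ler_wpM2l // ?divr_ge0 ?(ltW eps0) ?mulr_ge0 ?addr_ge0 ?exprn_ge0 //.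
  by rewrite -nrmK ler_pXn2r ?nnegrE.
have h2 v : nrm v <= K -> `|s r (G v)| <= z i * (kG * K).
  move=> vK; apply: le_trans (rE _) _; rewrite ler_wpM2l ?sumr_ge0 //.
  by apply: le_trans (Gb.2 _) _; rewrite ler_wpM2l.
apply: le_lt_trans (_ : eps / (2 * (K ^+ 2 + 1)) * K ^+ 2 + (z i * (kG * K) + z i * (kG * K)) < _).
  have P := G0 w'; rewrite -(ger0_norm P) in h1.
  have R : s (G w') w' + (s r (G (w i)) + (s r (G w'))^*) = `|s (G w') w' + (s r (G (w i)) + (s r (G w'))^*)|.
    by rewrite ger0_norm // -[X in 0 <= X]HE.
  rewrite R; apply: le_trans (ler_normD _ _) _; apply: lerD => //.
  apply: le_trans (ler_normD _ _) _; rewrite norm_conjC; apply: lerD; exact: h2.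
rewrite -mulr2n [ltRHS]splitr.
have hA : eps / (2 * (K ^+ 2 + 1)) * K ^+ 2 <= eps / 2.
  have p0 : 0 < K ^+ 2 + 1 by rewrite ltr_wpDl // exprn_ge0.
  have -> : eps / (2 * (K ^+ 2 + 1)) * K ^+ 2 = eps / 2 * (K ^+ 2 / (K ^+ 2 + 1)).
    by field; rewrite gt_eqF //= ?gt_eqF // ?pnatr_eq0.
  rewrite ler_piMr ?divr_ge0 ?(ltW eps0) //.
  by rewrite ler_pdivrMr // mul1r lerDl.
apply: ler_ltD hA _.
move: zi; rewrite ltr_pdivlMr // => zi; rewrite ltr_pdivlMr //.
apply: le_lt_trans zi; have z1 : 0 <= z i by rewrite sumr_ge0.
rewrite -subr_ge0; have -> : z i * (2 * (2 * (kG * K) + 1)) - z i * (kG * K) *+ 2 * 2 = 2 * z i by ring.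
by rewrite mulr_ge0.
Qed.

Definition Lop u := A u - G u.
Definition Bop u := D (Lop u).
Definition hL u v := s (Lop u) v.

Lemma Lop_linear : op_linear Lop.
Proof.
split=> [u v|c u]; first by rewrite /Lop AD GD opprD addrACA.
by rewrite /Lop AZ GZ scalerBr.
Qed.

Lemma Lop_sym : op_sym s Lop.
Proof. by move=> u v; rewrite /Lop sBl sBr As Gs. Qed.

Lemma nrmN u : nrm (- u) = nrm u.
Proof. by rewrite -scaleN1r (nrmZ sZ sC) normrN1 mul1r. Qed.

Lemma Lop_bounded : op_bounded s Lop (kA + kG).
Proof.
split=> [|u]; first by rewrite addr_ge0 // (Ab.1, Gb.1).
apply: le_trans (nrmD sD sZ sC s_gt0 _ _) _; rewrite nrmN mulrDl.
by rewrite lerD // (Ab.2, Gb.2).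
Qed.

Lemma hker_Lop u : hker hL u <-> Lop u = 0.
Proof.
split=> [H|H v]; last by rewrite /hL H s0l.
by apply: (g_eq0 s_gt0); exact: H.
Qed.

(** More vectors than constraints leave a combination that meets them all. *)
Lemma dimension_bound (e : C) : 0 < e -> exists q, forall n (N : 'I_n -> V),
  (forall a : 'rV[C]_n, a != 0 -> ~ s (G (comb N a)) (comb N a) <= e * s (comb N a) (comb N a)) ->
  (n <= q)%N.
Proof.
move=> e0; have [q [f fE]] := Gcpt e0; exists q => n N H.
rewrite leqNgt; apply/negP => qn.
pose M := \matrix_(i < n, j < q) s (N i) (f j).
have : kermx M != 0.
  rewrite kermx_eq0 /row_free neq_ltn (leq_ltn_trans _ qn) //; exact: rank_leq_col.
case/rowV0Pn => a /sub_kermxP aM a0.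
apply: (H a a0); apply: fE => j; move/rowP/(_ j): aM.
rewrite !mxE (g_comb_l sD sZ) => E; rewrite -[RHS]E.
by apply: eq_bigr => i _; rewrite mxE.
Qed.

Lemma h_small u : u != 0 -> s (G u) u <= kappa / 2 * s u u -> 0 < hL u u.
Proof.
move=> u0 H; rewrite /hL /Lop sBl subr_gt0; apply: le_lt_trans H _.
apply: lt_le_trans (Ak u); rewrite ltr_pM2r ?s_gt0 //.
by rewrite ltr_pdivrMr // mulr_natr mulr2n ltrDl.
Qed.

Lemma hL_neg_bounded : exists d, forall n (N : 'I_n -> V), neg_family hL N -> (n <= d)%N.
Proof.
have k2 : 0 < kappa / 2 by rewrite divr_gt0.
have [q qE] := dimension_bound k2; exists q => n N nN; apply: qE => a a0 H.
have x0 : comb N a != 0.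
  by apply: contraTneq (nN a a0) => ->; rewrite /hL s0r ltxx.
by have := lt_trans (h_small x0 H) (nN a a0); rewrite ltxx.
Qed.

Lemma kernel_basis : exists r (e : 'I_r -> V),
  [/\ ortho e, forall j, Lop (e j) = 0 & forall u, Lop u = 0 -> proj e u = u].
Proof.
have k2 : 0 < kappa / 2 by rewrite divr_gt0.
have [q qE] := dimension_bound k2.
have [LD LZ] := Lop_linear.
have comb_ker n (e : 'I_n -> V) a : (forall j, Lop (e j) = 0) -> Lop (comb e a) = 0.
  by move=> eL; rewrite (comb_linear _ _ LD LZ) /comb big1 // => i _ /=; rewrite eL scaler0.
pose P k := `[< exists e : 'I_k -> V, ortho e /\ forall j, Lop (e j) = 0 >].
have P0 : P 0%N by apply/asboolP; exists (fun=> 0); split=> -[].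
have Pq k : P k -> (k <= q)%N.
  move=> /asboolP[e [eo eL]]; apply: qE => a a0 H.
  have x0 : comb e a != 0.
    by apply: contra_neq a0 => x0; rewrite -(coords_comb sD sZ eo a) x0; apply/rowP => j; rewrite !mxE s0l.
  by have := h_small x0 H; rewrite /hL comb_ker // s0l ltxx.
case: (ex_maxnP (ex_intro P _ P0) Pq) => r /asboolP[e [eo eL]] rmax.
exists r, e; split=> // u uL; apply/eqP; apply: contraT => pu.
have r0 : u - proj e u != 0 by rewrite subr_eq0 eq_sym.
have [k [e' [k0 e'o e'0 e'e]]] := orthonormal_extend sZ sC s_gt0 eo (proj_ortho sD sZ eo u) r0.
suff : P r.+1 by move=> /rmax; rewrite ltnn.
apply/asboolP; exists e'; split=> // j; case: (unliftP ord0 j) => [j'|] ->; first by rewrite e'e.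
by rewrite e'0 LZ (op_linearB _ _ Lop_linear) uL comb_ker // subr0 scaler0.
Qed.

Section KernelProjection.
Context (r : nat) (e : 'I_r -> V) (eo : ortho e) (eL : forall j, Lop (e j) = 0)
  (ker_e : forall u, Lop u = 0 -> proj e u = u).

Definition Qop u := u - proj e u.
(** [L] completed by the projection on its kernel, so that it becomes injective.
    With [Dop'], the compression of [D] to the complement, the product
    [Dop' (Lop' u)] is [B u] without its component in the kernel. *)
Definition Lop' u := Lop u + proj e u.
Definition Dop' u := Qop (D (Qop u)).

Lemma Qop_linear : op_linear Qop.
Proof.
split=> [u v|c u]; first by rewrite /Qop (projD sD) opprD addrACA.
by rewrite /Qop (projZ sZ) scalerBr.
Qed.

Lemma Qop_sym : op_sym s Qop.
Proof. by move=> u v; rewrite /Qop sBl sBr (proj_sym sD sZ sC). Qed.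

Lemma Qop_bounded u : nrm (Qop u) <= nrm u.
Proof. by apply: nrm_le => //; rewrite (proj_pythagoras sD sZ sC eo u) lerDr. Qed.

Lemma Dop'_linear : op_linear Dop'.
Proof.
have [QD QZ] := Qop_linear; have [DD DZ] := Dl.
by split=> [u v|c u]; rewrite /Dop' ?(QD, DD, QZ, DZ).
Qed.

Lemma Dop'_sym : op_sym s Dop'.
Proof. by move=> u v; rewrite /Dop' Qop_sym Ds Qop_sym. Qed.

Lemma Dop'_bounded : op_bounded s Dop' kD.
Proof.
split=> [|u]; first exact: Db.1.
apply: le_trans (Qop_bounded _) _; apply: le_trans (Db.2 _) _.
by rewrite ler_wpM2l ?Db.1 // Qop_bounded.
Qed.

Lemma Lop'_linear : op_linear Lop'.
Proof.
have [LD LZ] := Lop_linear; split=> [u v|c u]; first by rewrite /Lop' LD (projD sD) addrACA.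
rewrite /Lop' LZ (projZ sZ).
by rewrite -scalerDr.
Qed.

Lemma Lop'_sym : op_sym s Lop'.
Proof. by move=> u v; rewrite /Lop' sD sDr Lop_sym (proj_sym sD sZ sC). Qed.

Lemma Lop'_bounded : op_bounded s Lop' (kA + kG + 1).
Proof.
split=> [|u]; first by rewrite addr_ge0 // Lop_bounded.1.
apply: le_trans (nrmD sD sZ sC s_gt0 _ _) _; rewrite mulrDl mul1r.
by rewrite lerD ?Lop_bounded.2 // (nrm_proj sD sZ sC).
Qed.

Lemma Lop_proj u : Lop (proj e u) = 0.
Proof.
have [LD LZ] := Lop_linear.
by rewrite (comb_linear _ _ LD LZ) /comb big1 // => i _ /=; rewrite eL scaler0.
Qed.

Lemma proj_Lop u : proj e (Lop u) = 0.
Proof.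
rewrite -[LHS]/(comb e (coords s e (Lop u))) /comb big1 // => i _; by rewrite mxE Lop_sym eL s0r scale0r.
Qed.

Lemma Lop_Qop u : Lop (Qop u) = Lop u.
Proof. by rewrite /Qop (op_linearB _ _ Lop_linear) Lop_proj subr0. Qed.

Lemma Qop_Lop' u : Qop (Lop' u) = Lop u.
Proof.
by rewrite /Qop /Lop' (projD sD) proj_Lop add0r (projK sD sZ eo) addrK.
Qed.

Lemma Lop'_Qop u : Lop' (Qop u) = Lop u.
Proof.
have pQ : proj e (Qop u) = 0.
  have Pl : op_linear (proj e) by split=> [x y|c x]; rewrite ?(projD sD) ?(projZ sZ).
  by rewrite /Qop (op_linearB _ _ Pl) (projK sD sZ eo) subrr.
by rewrite /Lop' Lop_Qop pQ addr0.
Qed.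
End KernelProjection.

Lemma ulim_inv_net (F : set_system (seq V * nat)) (FF : ProperFilter F) (f : seq V * nat -> C) :
  (@net_filter V) `<=` F -> (forall i, 0 <= f i /\ f i <= i.2.+1%:R^-1) -> ulim F f 0.
Proof.
move=> nF fE e e0; have [k ke] := archi e0; apply: nF; exists ([::], k) => i _ /= ki.
have [f0 fi] := fE i; rewrite subr0 ger0_norm //; apply: le_lt_trans fi _.
by apply: le_lt_trans ke; rewrite lef_pV2 ?posrE ?ltr0n // ler_nat ltnS.
Qed.

Lemma small_shift (x k z : C) : 0 < x -> x <= 1 -> 0 < k -> 0 <= z ->
  exists t, [/\ 0 < t, t <= x, t <= k & t * z < 1].
Proof.
move=> x0 x1 k0 z0; have z1 : 0 < z + 1 by rewrite ltr_wpDl.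
have [tau [tau0 taux tauz]] : exists tau : C, [/\ 0 < tau, tau <= x & tau * z < 1].
  exists (x / (z + 1)); split; first by rewrite divr_gt0.
    by rewrite ler_pdivrMr // ler_peMr ?(ltW x0) // lerDr.
  rewrite mulrAC ltr_pdivrMr // mul1r; apply: le_lt_trans (_ : z < _); last by rewrite ltrDl.
  by rewrite ler_piMl.
have tk : 0 < tau + k by rewrite addr_gt0.
have tt : tau * k / (tau + k) <= tau.
  by rewrite ler_pdivrMr // ler_wpM2l ?(ltW tau0) // lerDr ltW.
exists (tau * k / (tau + k)); split.
- by rewrite divr_gt0 // mulr_gt0.
- exact: le_trans taux.
- by rewrite ler_pdivrMr // mulrC ler_wpM2l ?(ltW k0) // lerDl ltW.
- by apply: le_lt_trans tauz; rewrite ler_wpM2r.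
Qed.

(** Galerkin approximations over all finite lists of vectors, along an
    ultrafilter. Each test vector eventually lies in the approximating space, so
    the invariance relation passes to the weak limits. The form stays
    nonpositive, since that of [A] is weakly lower semicontinuous and that of
    [G] weakly continuous. The lower bound of [A] keeps the form of [G] away
    from zero along the approximations, hence the limits are independent modulo
    the kernel. *)
Theorem hL_neg_invariant n (N : 'I_n -> V) : neg_family hL N ->
  exists (N' : 'I_n -> V) (T : 'M[C]_n),
  [/\ forall a, hker hL (Bop (comb N' a) - comb N' (a *m T)),
      forall a : 'rV[C]_n, a != 0 -> ~ hker hL (comb N' a) /\ hL (comb N' a) (comb N' a) <= 0 &
      forall c, root (char_poly T) c -> 0 <= 'Im c].
Proof.
move=> nN; have [r [e [eo eL ker_e]]] := kernel_basis.
have [QD QZ] := @Qop_linear r e.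
have fl := @Lop'_linear r e; have dl := @Dop'_linear r e.
have fs := @Lop'_sym r e; have ds := @Dop'_sym r e.
have fb := Lop'_bounded eo; have db := Dop'_bounded eo.
set f := Lop' e in fl fs fb; set d := Dop' e in dl ds db.
have [fD fZ] := fl.
pose M i := Qop e (N i).
have combM a : comb M a = Qop e (comb N a) by rewrite (comb_linear _ _ QD QZ).
pose g a b := - s (f (comb M a)) (comb M b).
have [|||| kM kM0 kME] := @posdef_bound C n g.
- by move=> u v w; rewrite /g combD fD sD opprD.
- by move=> c u v; rewrite /g combZ fZ sZ mulrN.
- by move=> u v; rewrite /g rmorphN /= -sC fs.
- move=> a a0; rewrite /g /f combM (Lop'_Qop eo) // oppr_gt0.
  rewrite /Qop sBr [X in _ - X]Lop_sym (Lop_proj eL) s0r subr0; exact: nN.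
have [kN kN0 kNE] := comb_bounded sD sZ sC s_gt0 M.
have step (i : seq V * nat) : exists w : C * ('I_n -> V) * 'M[C]_n,
    [/\ ortho w.1.2, 0 <= w.1.1 /\ w.1.1 <= i.2.+1%:R^-1,
      forall v k, v \in i.1 -> d v \in i.1 -> \sum_j w.2 k j * s (w.1.2 j) v =
        s (f (w.1.2 k) + w.1.1 *: w.1.2 k) (d v + ('i * i.2.+1%:R^-1) *: v),
      forall a, s (f (comb w.1.2 a)) (comb w.1.2 a) <= 0 &
      (forall k j, `|w.2 k j| <= (kD + 1) * (kA + kG + 1 + 1)) /\
      forall c, root (char_poly w.2) c -> 0 < 'Im c].
  have [p [b [bo bs]]] := gram_schmidt sD sZ sC s_gt0 (codom M ++ i.1).
  have [k k0 kE] := unit_shift (mx_of s b f).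
  have eps0 : 0 < (i.2.+1%:R : C)^-1 by rewrite invr_gt0 ltr0n.
  have eps1 : (i.2.+1%:R : C)^-1 <= 1 by rewrite invf_le1 ?ltr0n // ler1n.
  have kMN : 0 <= kM * kN by rewrite mulr_ge0 // ltW.
  have [t [t0 te tk tkk]] := small_shift eps0 eps1 k0 kMN.
  have hM a : sqn a <= - (kM * s (f (comb M a)) (comb M a)) by rewrite -mulrN; exact: kME.
  have bM j : proj b (M j) = M j by apply: bs; rewrite mem_cat codom_f.
  have [u [T [uo uT un TK Tr]]] := galerkin_step sD sZ sC s_gt0 fl dl fs ds fb db kM0 hM
    kNE bo bM eps0 (ltW t0) tkk (kE t t0 tk).
  exists (t, u, T); split=> //=.
  - by split=> //; exact: ltW.
  - by move=> v j vi dvi; apply: uT; apply: bs; rewrite mem_cat ?vi ?dvi orbT.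
  - split=> // j l; apply: le_trans (TK j l) _; apply: ler_pM => //.
    + by rewrite addr_ge0 ?(ltW eps0) // db.1.
    + by rewrite addr_ge0 ?(ltW t0) // fb.1.
    + by rewrite lerD2l.
    + by rewrite lerD2l (le_trans te).
have [W WE] := choice step.
have [U [UU nU]] := ultraFilterLemma (@net_filter_proper V).
pose t i := (W i).1.1; pose u i := (W i).1.2; pose T i := (W i).2.
have uo i : ortho (u i) by have [] := WE i.
have nu i j : nrm (u i j) = 1 by rewrite /nrm uo eqxx sqrtC1.
have /choice [T0f T0E] (ij : 'I_n * 'I_n) : exists l, ulim U (fun i => T i ij.1 ij.2) l.
  by apply: bw UU _ ((kD + 1) * (kA + kG + 1 + 1)) _ => i; have [_ _ _ _ [+ _]] := WE i; exact.
pose T0 : 'M[C]_n := \matrix_(i, j) T0f (i, j).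
have {}T0E i j : ulim U (fun x => T x i j) (T0 i j) by rewrite mxE; exact: (T0E (i, j)).
have /choice [u0 u0E] j : exists x0 : V, wlim (F := U) (fun i => u i j) x0.
  by apply: (weak_compact (M := 1)) => i; rewrite nu.
have inU (v : V) : U [set i : seq V * nat | v \in i.1].
  by apply: nU; exists ([:: v], 0%N) => i /= H _; apply: H; rewrite mem_head.
have t_0 : ulim U t 0 by apply: (ulim_inv_net _ nU) => i; have [] := WE i.
have e_0 : ulim U (fun i : seq V * nat => (i.2.+1%:R : C)^-1) 0.
  by apply: (ulim_inv_net _ nU) => i; rewrite lexx invr_ge0.
have bnd (x y : V) K : nrm x <= K -> `|s x y| <= K * nrm y.
  by move=> xK; apply: le_trans (CS _ _) _; rewrite ler_wpM2r.
(* [t] and [e] tend to zero while the test vectors [v] and [d v] are eventually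
   in the approximating space *)
have rel k : \sum_j T0 k j *: u0 j = d (f (u0 k)).
  suff H v : s (\sum_j T0 k j *: u0 j) v = s (d (f (u0 k))) v.
    by apply/eqP; rewrite -subr_eq0; apply/eqP; apply: (g_eq0 s_gt0); rewrite sBl H subrr.
  rewrite ds.
  have sumE (c : 'I_n -> C) (x : 'I_n -> V) : s (\sum_j c j *: x j) v = \sum_j c j * s (x j) v.
    rewrite (big_morph (fun y => s y v) (fun y z => sD y z v) (s0l v)).
    by apply: eq_bigr => j _; rewrite sZ.
  rewrite sumE.
  apply: (@ulim_unique C _ U _ (fun i => \sum_j T i k j * s (u i j) v)).
    by apply: ulim_sum => j; apply: ulimM; [exact: T0E|exact: u0E].
  pose z i := s (f (u i k)) (d v) + (t i * s (u i k) (d v) +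
    (i.2.+1%:R^-1 * (- 'i * s (f (u i k) + t i *: u i k) v))).
  apply: (@ulim_near C _ U _ z).
    move: (inU v) (inU (d v)); apply: filterS2 => i vi dvi /=.
    have [_ _ R _ _] := WE i; rewrite (R v k vi dvi) /z sDr sZr rmorphM /= conjCi.
    by rewrite /t /u !sD !sZ fmorphV rmorph_nat; ring.
  suff : ulim U z (s (f (u0 k)) (d v) + (0 + 0)) by rewrite !addr0.
  apply: ulimD; first exact: (wlim_op fs (u0E k)).
  apply: ulimD.
    by apply: (ulim_mul0 t_0 (k := 1 * nrm (d v))) => i; apply: bnd; rewrite nu.
  apply: (ulim_mul0 e_0 (k := (kA + kG + 1 + 1) * nrm v)) => i.
  rewrite normrM normrN normCi mul1r; apply: bnd.
  apply: le_trans (nrmD sD sZ sC s_gt0 _ _) _; apply: lerD.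
    by apply: le_trans (fb.2 _) _; rewrite nu mulr1.
  have [_ [t0 t1] _ _ _] := WE i.
  rewrite (nrmZ sZ sC) nu mulr1 ger0_norm //; apply: le_trans t1 _.
  by rewrite invf_le1 ?ltr0n // ler1n.
exists u0, T0; split.
- move=> a.
  have BE x : d (f x) = Bop x - proj e (Bop x) by rewrite /d /f /Dop' (Qop_Lop' eo).
  have Bl : op_linear Bop.
    have [LD LZ] := Lop_linear; have [DD DZ] := Dl.
    by split=> [x y|c x]; rewrite /Bop; [rewrite LD DD|rewrite LZ DZ].
  have Pl : op_linear (proj e) by split=> [x y|c x]; rewrite ?(projD sD) ?(projZ sZ).
  have -> : comb u0 (a *m T0) = Bop (comb u0 a) - proj e (Bop (comb u0 a)).
    transitivity (\sum_k a 0 k *: d (f (u0 k))).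
      rewrite /comb; under eq_bigr do rewrite mxE scaler_suml.
      rewrite exchange_big /=; apply: eq_bigr => k _; rewrite -rel scaler_sumr.
      by apply: eq_bigr => j _; rewrite scalerA.
    rewrite -BE (comb_linear _ _ fl.1 fl.2) (comb_linear _ _ dl.1 dl.2); exact: eq_bigr.
  rewrite opprB addrC subrK; apply/hker_Lop; exact: Lop_proj.
- move=> a a0; set x0 := comb u0 a.
  pose x i := comb (u i) a.
  have xx : wlim (F := U) x x0 by apply: wlim_comb => j; exact: u0E.
  have sx i : s (x i) (x i) = sqn a by rewrite (on_comb sD sZ sC (uo i)).
  have nx i : nrm (x i) <= sqrtC (sqn a) by rewrite /nrm sx.
  pose P y := A y + proj e y.
  have Pl : op_linear P.
    by split=> [y z|c y]; rewrite /P ?AD ?AZ ?(projD sD) ?(projZ sZ) ?scalerDr // addrACA.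
  have Ps : op_sym s P by move=> y z; rewrite /P sD sDr As (proj_sym sD sZ sC).
  have PE y : s (P y) y = s (A y) y + s (proj e y) (proj e y).
    by rewrite /P sD (proj_sym sD sZ sC y (proj e y)) (projK sD sZ eo) -(proj_sym sD sZ sC).
  have AP y : s (A y) y <= s (P y) y by rewrite PE lerDl.
  have kP y : kappa * s y y <= s (P y) y by apply: le_trans (AP y).
  have P0 y : 0 <= s (P y) y by apply: le_trans (kP y); rewrite mulr_ge0 // ltW.
  have [l lE] : exists l, ulim U (fun i => s (P (x i)) (x i)) l.
    have c0 : 0 <= sqrtC (sqn a) by rewrite sqrtC_ge0 sqn_ge0.
    apply: bw UU _ ((kA + 1) * sqrtC (sqn a) * sqrtC (sqn a)) _ => i.
    apply: le_trans (CS _ _) _; apply: ler_pM => //.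
    apply: le_trans (nrmD sD sZ sC s_gt0 _ _) _; rewrite mulrDl mul1r; apply: lerD.
      by apply: le_trans (Ab.2 _) _; rewrite ler_wpM2l ?Ab.1.
    by apply: le_trans (nrm_proj sD sZ sC s_gt0 _ eo) _.
  have GE := compact_cont UU nx xx.
  have lG : l <= s (G x0) x0.
    apply: (ulim_le _ lE GE); apply: (@filterE _ U _) => i /=.
    have [_ _ _ /(_ a) H _] := WE i; move: H; rewrite -/(u i) -/(x i) /f /Lop' /Lop.
    by rewrite sD sBl /P sD addrAC subr_le0.
  have Pl0 : s (P x0) x0 <= l by exact: weak_lsc Pl Ps P0 xx lE.
  have lp : kappa * sqn a <= l.
    apply: (ulim_le _ (ulim_cst (kappa * sqn a)) lE).
    by apply: (@filterE _ U _) => i /=; rewrite -(sx i).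
  (* the limit of a unit sphere may vanish in the weak topology, but not here *)
  have Gx : 0 < s (G x0) x0.
    by apply: lt_le_trans lG; apply: lt_le_trans lp; rewrite mulr_gt0 // sqn_gt0.
  have hx : hL x0 x0 + s (proj e x0) (proj e x0) <= 0.
    by rewrite /hL /Lop sBl addrAC -PE subr_le0 (le_trans Pl0).
  split; last by apply: le_trans hx; rewrite lerDl.
  move=> kx; have Lx := (hker_Lop _).1 kx; move: hx; rewrite kx add0r ker_e // => x00.
  have x0E : x0 = 0 by apply: (g_eq0 s_gt0); apply/eqP; rewrite eq_le x00 s_ge0.
  by move: Gx; rewrite x0E s0r ltxx.
- move=> c rc; have cR := Creal_Im c; rewrite real_leNgt ?real0 //; apply/negP => c0.
  have : `|'Im c| ^+ n <= `|\det (c%:M - T0)|.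
    apply: (@ulim_le C _ U _ (fun=> `|'Im c| ^+ n) (fun i => `|\det (c%:M - T i)|)).
    - apply: (@filterE _ U _) => i /=; apply: det_shift_lower; last exact: ltW.
      by move=> z rz; have [_ _ _ _ [_ H]] := WE i; exact: ltW (H z rz).
    - exact: ulim_cst.
    - apply: ulim_norm; apply: ulim_det => i j.
      have E (M' : 'M[C]_n) : (c%:M - M') i j = c%:M i j - M' i j.
        by rewrite mxE; congr (_ + _); rewrite mxE.
      have -> : (fun x => (c%:M - T x) i j) = (fun x => (c%:M : 'M[C]_n) i j - T x i j).
        by apply/funext => x; exact: E.
      rewrite E; by apply: ulimB; [exact: ulim_cst|exact: T0E].
  rewrite -char_poly_det (eqP rc) normr0 => H.
  have : 0 < `|'Im c| ^+ n by rewrite exprn_gt0 // normr_gt0 lt_eqF.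
  by move=> /lt_le_trans/(_ H); rewrite ltxx.
Qed.

Section Splitting.
Context (sg : V -> V) (sgD : forall u v, sg (u + v) = sg u + sg v)
  (sgZ : forall c u, sg (c *: u) = c^* *: sg u) (sgK : involutive sg)
  (sgs : forall u v, s (sg u) (sg v) = (s u v)^*)
  (sgA : forall u, sg (A u) = A (sg u)) (sgG : forall u, sg (G u) = G (sg u))
  (sgDop : forall u, sg (D u) = D (sg u)).
Context (no_real : forall c u, c \is Num.real -> Lop (Bop u - c *: u) = 0 -> Lop u = 0).

Lemma sgL u : sg (Lop u) = Lop (sg u).
Proof.
by rewrite /Lop sgD sgA -scaleN1r sgZ rmorphN rmorph1 scaleN1r sgG.
Qed.

(** The map [S] of [unstable_splitting] is a short step of steepest descent for
    the energy, [u - t L u]. *)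
Theorem hilbert_splitting :
  [/\ forall u, exists a b v,
        [/\ sum_gen Bop (fun c => 0 < 'Im c) a, sum_gen Bop (fun c => 'Im c < 0) b,
            gen_orth hL Bop v & u = a + b + v],
      forall a b v, sum_gen Bop (fun c => 0 < 'Im c) a -> sum_gen Bop (fun c => 'Im c < 0) b ->
        gen_orth hL Bop v -> a + b + v = 0 -> [/\ a = 0, b = 0 & v = 0],
      forall v, gen_orth hL Bop v -> 0 <= hL v v &
      forall v, gen_orth hL Bop v -> hL v v = 0 -> Lop v = 0].
Proof.
have [LD LZ] := Lop_linear; have [DD DZ] := Dl.
have [k0 kL] := Lop_bounded; pose t : C := (kA + kG + 1)^-1.
have k1 : 0 < kA + kG + 1 by rewrite ltr_wpDl.
have t0 : 0 < t by rewrite invr_gt0.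
have tR : t^* = t by apply: conj_Creal; exact: gtr0_real.
have tk : t * (kA + kG) <= 1 by rewrite mulrC ler_pdivrMr // mul1r lerDl.
suff [H1 H2 H3 H4] : [/\ forall u, exists a b v,
        [/\ sum_gen Bop (fun c => 0 < 'Im c) a, sum_gen Bop (fun c => 'Im c < 0) b,
            gen_orth hL Bop v & u = a + b + v],
      forall a b v, sum_gen Bop (fun c => 0 < 'Im c) a -> sum_gen Bop (fun c => 'Im c < 0) b ->
        gen_orth hL Bop v -> a + b + v = 0 -> [/\ a = 0, b = 0 & v = 0],
      forall v, gen_orth hL Bop v -> 0 <= hL v v &
      forall v, gen_orth hL Bop v -> hL v v = 0 -> hker hL v].
  by split=> // v vo hv; apply/hker_Lop; exact: H4.
apply: (unstable_splitting (sg := sg) (S := fun u => u - t *: Lop u)).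
- by move=> u v w; rewrite /hL LD sD.
- by move=> c u v; rewrite /hL LZ sZ.
- by move=> u v; rewrite /hL Lop_sym sC.
- by move=> u v; rewrite /Bop LD DD.
- by move=> c u; rewrite /Bop LZ DZ.
- by move=> u v; rewrite /hL /Bop Lop_sym Ds.
- by move=> u /hker_Lop E; rewrite /Bop E -(scale0r 0) DZ !scale0r.
- exact: sgD.
- exact: sgZ.
- exact: sgK.
- by move=> u; rewrite /Bop sgDop sgL.
- by move=> u v; rewrite /hL -sgL sgs.
- by move=> u v; rewrite LD scalerDr opprD addrACA.
- by move=> c u; rewrite LZ scalerBr !scalerA mulrC.
- move=> u hu nk; have [r rE] : exists r, r = Lop u by exists (Lop u).
  rewrite -rE.
  have r0 : r != 0 by apply/eqP => E; apply: nk; apply/hker_Lop; rewrite -rE.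
  have sr := s_gt0 r0.
  have -> : hL (u - t *: r) (u - t *: r) = hL u u - (t * s r r *+ 2 - t ^+ 2 * s (Lop r) r).
    rewrite /hL (op_linearB _ _ Lop_linear) LZ sBl !sBr !sZ !sZr tR -rE.
    by rewrite [s (Lop r) u]Lop_sym -rE; ring.
  have h1 : t ^+ 2 * s (Lop r) r <= t * s r r.
    rewrite expr2 -mulrA ler_pM2l //.
    have R : s (Lop r) r \is Num.real by rewrite CrealE -sC Lop_sym.
    apply: le_trans (_ : t * ((kA + kG) * s r r) <= _); last first.
      by rewrite mulrA ler_piMl // ltW.
    rewrite ler_pM2l //; apply: le_trans (real_ler_norm R) _; apply: le_trans (CS _ _) _.
    by rewrite -nrmK expr2 mulrA ler_wpM2r.
  rewrite subr_lt0; apply: le_lt_trans hu _; rewrite subr_gt0; apply: le_lt_trans h1 _.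
  by rewrite mulr2n ltrDl mulr_gt0.
- exact: hL_neg_bounded.
- by move=> c u cR /hker_Lop /(no_real cR) /hker_Lop.
- exact: hL_neg_invariant.
Qed.
End Splitting.
End HilbertSpace.

(** * The Riesz representation theorem *)

(** Completeness of the order on the real elements of a complex field. *)
Definition has_infima (C : numClosedFieldType) := forall (T : Type) (x0 : T) (f : T -> C) (m0 : C),
  (forall x, f x \is Num.real) -> (forall x, m0 <= f x) ->
  exists2 m : C, (forall x, m <= f x) & forall e, 0 < e -> exists x, f x < m + e.

Section ComplexOrder.
Context {R : realType}.
Local Notation C := R[i].

Lemma complex_infima : has_infima C.
Proof.
move=> T x0 f m0.
move=> fR fm.
have fE x : f x = (complex.Re (f x))%:C%C.
  by have := fR x; case: (f x) => p q; rewrite complex_real => /eqP ->.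
pose S := [set complex.Re (f x) | x in setT].
have m0R x : complex.Re m0 <= complex.Re (f x).
  by have := fm x; rewrite lecE => /andP[].
have hS : has_inf S.
  split; first by exists (complex.Re (f x0)), x0.
  by exists (complex.Re m0) => _ [x _ <-].
exists (inf S)%:C%C => [x|e e0].
  by rewrite (fE x) lecR; apply: ge_inf; [case: hS|exists x].
have e1 : 0 < complex.Re e by move: e0; rewrite ltcE => /andP[].
have eE : e = (complex.Re e)%:C%C.
  by move: e0; rewrite ltcE => /andP[/eqP /= h _]; case: e h e1 => p q /= ->.
have [_ [x _ <-] xe] := inf_adherent e1 hS.
by exists x; rewrite (fE x) eE -rmorphD ltcR.
Qed.

Lemma complex_archi (e : C) : 0 < e -> exists k : nat, k.+1%:R^-1 < e.
Proof.
move=> e0.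
have e1 : 0 < complex.Re e by move: e0; rewrite ltcE => /andP[].
have eE : e = (complex.Re e)%:C%C.
  by move: e0; rewrite ltcE => /andP[/eqP /= h _]; case: e h {e1} => p q /= ->.
have [k _ kE] := near_infty_natSinv_lt (PosNum e1).
exists k; have {kE} := kE k (leqnn k); rewrite /=; move: (complex.Re e) eE => r -> kr.
have -> : (k.+1%:R^-1 : C) = ((k.+1%:R : R)^-1)%:C%C by rewrite fmorphV rmorph_nat.
by rewrite ltcR.
Qed.
End ComplexOrder.

Section Riesz.
Context {C : numClosedFieldType} {V : lmodType C} (s : V -> V -> C).
Context (sD : forall u v w, s (u + v) w = s u w + s v w)
  (sZ : forall c u v, s (c *: u) v = c * s u v)
  (sC : forall u v, s v u = (s u v)^*)
  (s_gt0 : forall u, u != 0 -> 0 < s u u).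
Local Notation nrm := (nrm s).
Context (complete : forall x : nat -> V,
  (forall k l, (k <= l)%N -> s (x l - x k) (x l - x k) <= 4^-1 ^+ k) ->
  exists y, ulim \oo (fun k => s (y - x k) (y - x k)) 0)
  (infima : has_infima C) (archi : forall e : C, 0 < e -> exists k : nat, k.+1%:R^-1 < e).

Lemma quarter_lim : ulim \oo (fun k => 4^-1 ^+ k : C) 0.
Proof.
move=> e e0; have [k ke] := archi e0; exists k => // j /= kj.
rewrite subr0 ger0_norm ?exprn_ge0 ?invr_ge0 //; apply: le_lt_trans ke.
rewrite exprVn lef_pV2 ?posrE ?ltr0n ?exprn_gt0 // -natrX ler_nat.
by apply: leq_trans (ltn_expl j (isT : 1 < 4)%N); rewrite ltnS.
Qed.

(** Minimising sequences of [s u u - 2 Re (phi u)] are Cauchy by the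
    parallelogram law, and their limit represents [phi]. *)
Theorem riesz_representation (phi : V -> C) : (forall u v, phi (u + v) = phi u + phi v) ->
  (forall c u, phi (c *: u) = c * phi u) -> (exists k, forall u, `|phi u| <= k * nrm u) ->
  exists w, forall u, phi u = s u w.
Proof.
move=> pD pZ [k0 phik].
have sDr := gDr sD sC; have sZr := gZr sZ sC.
have sBl := gBl sD sZ; have sBr := gBr sD sZ sC.
have s_ge0 := g_ge0 sZ s_gt0.
have [k [k_ge0 {}phik]] : exists k, 0 <= k /\ forall u, `|phi u| <= k * nrm u.
  exists `|k0|; split=> // u; apply: le_trans (real_ler_norm (normr_real _)) _.
  rewrite normr_id; have := phik u; have n0 := nrm_ge0 sZ s_gt0 u => H.
  have R0 : k0 * nrm u \is Num.real by rewrite ger0_real // (le_trans _ H).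
  by apply: le_trans H _; apply: le_trans (real_ler_norm R0) _; rewrite normrM (ger0_norm n0).
pose J u := s u u - (phi u + (phi u)^*).
have JR u : J u \is Num.real.
  by rewrite CrealE /J rmorphB rmorphD /= conjCK -sC [X in _ - X]addrC.
have Jlow u : - k ^+ 2 <= J u.
  rewrite -subr_ge0 opprK; have n0 := nrm_ge0 sZ s_gt0 u.
  apply: le_trans (_ : 0 <= (nrm u - k) ^+ 2) _.
    by rewrite -realEsqr rpredB ?ger0_real.
  rewrite sqrrB (nrmK s) /J -addrA -[leRHS]addrA lerD2l [leRHS]addrC -[leLHS]addrC lerD2l lerN2.
  have r : phi u + (phi u)^* \is Num.real by rewrite CrealE rmorphD /= conjCK addrC.
  apply: le_trans (real_ler_norm r) _; apply: le_trans (ler_normD _ _) _.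
  by rewrite norm_conjC mulr2n lerD // mulrC.
have [mn mnJ mnE] := infima 0 JR Jlow.
have q0 i : 0 < (4^-1 ^+ i / 4 : C) by rewrite divr_gt0 // exprn_gt0 // invr_gt0.
have [x xE] := choice (fun i => mnE _ (q0 i)).
have Jpar u v : s (u - v) (u - v) = 2 * J u + 2 * J v - 4 * J (2^-1 *: (u + v)).
  have h2 : (2^-1 : C)^* = 2^-1 by rewrite fmorphV rmorph_nat.
  rewrite /J pZ pD sZ sZr h2 sBl !sBr sD !sDr rmorphM rmorphD /= h2; by field.
have [y yE] : exists y, ulim \oo (fun k => s (y - x k) (y - x k)) 0.
  apply: complete => i j ij; rewrite Jpar.
  have h1 := ltW (xE i); have h2 := ltW (xE j); have h3 := mnJ (2^-1 *: (x j + x i)).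
  have h4 : (4^-1 ^+ j : C) <= 4^-1 ^+ i.
    by apply: ler_wiXn2l; rewrite ?invr_ge0 ?invf_le1 ?ler1n.
  apply: le_trans (_ : 2 * (mn + 4^-1 ^+ j / 4) + 2 * (mn + 4^-1 ^+ i / 4) - 4 * mn <= _).
    by rewrite lerD ?lerN2 ?ler_pM2l // lerD ?ler_pM2l.
  have -> : 2 * (mn + 4^-1 ^+ j / 4) + 2 * (mn + 4^-1 ^+ i / 4) - 4 * mn =
    4^-1 ^+ j / 2 + 4^-1 ^+ i / 2 :> C by field.
  by rewrite [leRHS]splitr lerD2r ler_pM2r ?invr_gt0.
exists y => v; have [->|v0] := eqVneq v 0.
  by rewrite (g0l sZ) -(scale0r 0) pZ mul0r.
have sv := s_gt0 v0.
pose z i := s v (x i) - phi v.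
have zb i : `|z i| ^+ 2 <= 4^-1 ^+ i / 4 * s v v.
  have := mnJ (x i - ((z i)^* / s v v) *: v).
  have sR : (s v v)^* = s v v by rewrite -sC.
  have -> : J (x i - ((z i)^* / s v v) *: v) = J (x i) - `|z i| ^+ 2 / s v v.
    rewrite /J normCK -scaleN1r scalerA mulN1r !(sD, sDr, pD, pZ, sZ, sZr).
    rewrite !(rmorphD, rmorphN, rmorphM) /= fmorphV /= sR conjCK /z.
    by rewrite -!sC !conjCK; field; rewrite gt_eqF.
  rewrite lerBrDr -lerBrDl ler_pdivrMr // => h; apply: le_trans h _.
  by rewrite ler_pM2r // lerBlDl ltW // xE.
have sq_lim (f : nat -> C) : ulim \oo (fun i => `|f i| ^+ 2) 0 -> ulim \oo f 0.
  move=> f0 e e0; have := f0 _ (exprn_gt0 2 e0); apply: filterS => i /=.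
  by rewrite !subr0 ger0_norm ?exprn_ge0 // ltr_pXn2r ?nnegrE // ltW.
have z0 : ulim \oo z 0.
  apply: sq_lim; apply: (@ulim_squeeze _ _ _ _ _ (fun i => (s v v / 4) * 4^-1 ^+ i)).
    suff : ulim \oo (fun i => (s v v / 4) * 4^-1 ^+ i) ((s v v / 4) * 0) by rewrite mulr0.
    by apply: ulimZ; exact: quarter_lim.
  apply: filterE => i /=; rewrite ger0_norm ?exprn_ge0 //; apply: le_trans (zb i) _.
  by have -> : 4^-1 ^+ i / 4 * s v v = s v v / 4 * 4^-1 ^+ i by ring.
have d0 : ulim \oo (fun i => s v (y - x i)) 0.
  apply: sq_lim; apply: (@ulim_squeeze _ _ _ _ _ (fun i => s v v * s (y - x i) (y - x i))).
    suff : ulim \oo (fun i => s v v * s (y - x i) (y - x i)) (s v v * 0) by rewrite mulr0.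
    exact: ulimZ.
  apply: filterE => i /=; rewrite ger0_norm ?exprn_ge0 //.
  rewrite -!(nrmK s) -exprMn ler_pXn2r ?nnegrE ?mulr_ge0 ?(nrm_ge0 sZ s_gt0) //.
  exact: cauchy_schwarz.
suff : s v y - phi v = 0 by move/eqP; rewrite subr_eq0 => /eqP.
apply: (@ulim_unique _ _ \oo _ (fun=> s v y - phi v)); first exact: ulim_cst.
suff : ulim \oo (fun i => z i + s v (y - x i)) (0 + 0).
  rewrite addr0; apply: ulim_near; apply: filterE => i /=.
  by rewrite /z sBr; ring.
by apply: ulimD.
Qed.
End Riesz.

(** * Completeness of L^2 *)

Section L2Complete.
Context {R : realType} (a b : R) (ltab : a < b).
Notation mu := (@lebesgue_measure R).
Let ab : a <= b := ltW ltab.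
Local Existing Instance ae_lebesgue_filter.
Implicit Types (f g : R -> R).

Lemma EFin_int f : itg a b f ->
  (\int[mu]_(x in `[a, b]) (f x)%:E)%E = (\int[mu]_(x in `[a, b]) f x)%:E.
Proof.
move=> fi; have fin : (\int[mu]_(x in `[a, b]) (f x)%:E)%E \is a fin_num.
  by apply: integrable_fin_num fi; exact: measurable_itv.
by rewrite -{1}(fineK fin).
Qed.

(** By monotone convergence the sum of the series is integrable, hence finite
    almost everywhere. *)
Lemma aeon_bounded_sums (d : nat -> R -> R) M : (forall k, itg a b (d k)) ->
  (forall k y, 0 <= d k y) ->
  (forall n, \sum_(0 <= k < n) \int[mu]_(y in `[a, b]) d k y <= M) ->
  aeon a b (fun y => exists K, forall n, \sum_(0 <= k < n) d k y <= K).
Proof.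
move=> di d0 dM.
pose S y := (\sum_(k <oo) (d k y)%:E)%E.
have md k : measurable_fun `[a, b] (EFin \o d k) by apply/measurable_EFinP; exact: itg_measurable.
have S0 y : (0 <= S y)%E by apply: nneseries_ge0 => k _ _; rewrite lee_fin.
have IS : (\int[mu]_(y in `[a, b]) S y <= M%:E)%E.
  have -> : (\int[mu]_(y in `[a, b]) S y = \sum_(k <oo) \int[mu]_(y in `[a, b]) (d k y)%:E)%E.
    by apply: integral_nneseries => // k y _; rewrite lee_fin.
  apply: lime_le.
    apply: is_cvg_nneseries => k _ _; apply: integral_ge0 => y _; by rewrite lee_fin.
  apply: nearW => n; rewrite (eq_bigr (fun k => (\int[mu]_(y in `[a, b]) d k y)%:E)).
    by rewrite sumEFin lee_fin.
  by move=> k _; exact: EFin_int.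
have mS : measurable_fun `[a, b] S.
  have H0 k y : `[a, b]%classic y -> xpredT k -> (0 <= (d k y)%:E)%E by rewrite lee_fin.
  exact: (ge0_emeasurable_sum (P := xpredT) H0 (fun k _ => md k)).
have Si : mu.-integrable `[a, b] S.
  apply/integrableP; split=> //; apply: le_lt_trans (ltry M).
  apply: le_trans IS; rewrite le_eqVlt; apply/orP; left; apply/eqP.
  by apply: eq_integral => y _; rewrite gee0_abs.
have H : {ae mu, forall y, `[a, b]%classic y -> S y \is a fin_num}.
  by apply: integrable_ae Si; exact: measurable_itv.
move: H; rewrite /aeon; apply: filterS => y H yab.
have yab' : `[a, b]%classic y by rewrite /= in_itv.
exists (fine (S y)) => n; rewrite -lee_fin fineK ?H // -sumEFin.
by apply: nneseries_lim_ge => k _ _; rewrite lee_fin.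
Qed.

Lemma limn_einf_le (u : nat -> \bar R) N x : (forall n, (N <= n)%N -> (u n <= x)%E) ->
  (limn_einf u <= x)%E.
Proof.
move=> ux; rewrite limn_einf_lim; apply: lime_le; first exact: is_cvg_einfs.
apply: nearW => n; apply: le_trans (ux (maxn N n) (leq_maxl _ _)).
by apply: ereal_inf_lbound; exists (maxn N n) => //=; exact: leq_maxr.
Qed.

(** The differences of consecutive terms are summable almost everywhere; Fatou's
    lemma carries the estimates over to the limit. *)
Lemma L2r_complete (f : nat -> R -> R) : (forall k, L2r a b (f k)) ->
  (forall k l, (k <= l)%N -> \int[mu]_(y in `[a, b]) ((f l y - f k y) ^+ 2) <= 4^-1 ^+ k) ->
  exists2 g, L2r a b g & forall k, \int[mu]_(y in `[a, b]) ((g y - f k y) ^+ 2) <= 4^-1 ^+ k.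
Proof.
move=> f2 fc.
have fB k l : L2r a b (fun y => f l y - f k y).
  have := L2rD (f2 l) (L2rZ (-1) (f2 k)).
  by under eq_fun do rewrite mulN1r.
pose d k y := `|f k.+1 y - f k y|.
have di k : itg a b (d k) by apply: itg_norm; exact: (L2r_itg ltab (fB k k.+1)).
have c0 : 0 <= (1 + (b - a)) / 2 by rewrite divr_ge0 // addr_ge0 // subr_ge0.
have dI k : \int[mu]_(y in `[a, b]) d k y <= (1 + (b - a)) / 2 * 2^-1 ^+ k.
  pose t : R := 2 ^+ k.
  have t0 : 0 < t by rewrite exprn_gt0.
  have i1 : itg a b (fun y => t / 2 * (f k.+1 y - f k y) ^+ 2) by apply: itgZ; exact: (fB k k.+1).2.
  have i2 : itg a b (fun=> t^-1 / 2) by exact: itg_cst.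
  apply: (@le_trans _ _ (\int[mu]_(y in `[a, b]) (t / 2 * (f k.+1 y - f k y) ^+ 2 + t^-1 / 2))).
    apply: int_le => //; first exact: itgD.
    move=> y _; rewrite /d -(real_normK (num_real (f k.+1 y - f k y))); set x := `| _ |.
    have := sqr_ge0 (t * x - 1) => h; rewrite -(ler_pM2l (_ : 0 < 2 * t)) ?mulr_gt0 //.
    have -> : 2 * t * (t / 2 * x ^+ 2 + t^-1 / 2) = (t * x) ^+ 2 + 1 by field; rewrite gt_eqF.
    by nra.
  rewrite intD // intZ; last exact: (fB k k.+1).2.
  rewrite int_cst //.
  have h := fc k k.+1 (leqnSn k).
  apply: le_trans (_ : t / 2 * 4^-1 ^+ k + t^-1 / 2 * (b - a) <= _).
    by rewrite lerD2r ler_wpM2l // divr_ge0 // ltW.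
  have -> : (2^-1 : R) ^+ k = t^-1 by rewrite exprVn.
  have -> : (4^-1 : R) ^+ k = t^-1 * t^-1.
    rewrite /t -exprVn -exprMn; congr (_ ^+ _); by field.
  rewrite le_eqVlt; apply/orP; left; apply/eqP; field; by rewrite gt_eqF.
have ds n : \sum_(0 <= k < n) \int[mu]_(y in `[a, b]) d k y <= (1 + (b - a)) / 2 * 2.
  apply: (@le_trans _ _ (\sum_(0 <= k < n) (1 + (b - a)) / 2 * 2^-1 ^+ k)).
    by apply: ler_sum => k _; exact: dI.
  rewrite -mulr_sumr ler_wpM2l //.
  suff -> : \sum_(0 <= k < n) (2^-1 : R) ^+ k = 2 - 2 * 2^-1 ^+ n.
    by rewrite gerBl mulr_ge0 // exprn_ge0 // invr_ge0.
  elim: n => [|n IH]; first by rewrite big_nil expr0 mulr1 subrr.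
  by rewrite big_nat_recr //= IH exprS; field.
have bs := aeon_bounded_sums di (fun k y => normr_ge0 _) ds.
have fcv : aeon a b (fun y => cvgn (f ^~ y)).
  apply: aeon_imp bs => y _ [K HK].
  have c1 : cvgn [normed series (telescope (f ^~ y))].
    apply: nondecreasing_is_cvgn.
      by apply: nondecreasing_series => n _ _; exact: normr_ge0.
    by exists K => _ [n _ <-]; exact: HK.
  have := normed_cvg c1; rewrite telescopeK => c2.
  have -> : f ^~ y = (fun n => (f n y - f 0%N y) + f 0%N y).
    by apply/funext => n; rewrite subrK.
  by apply: is_cvgD; [exact: c2|exact: is_cvg_cst].
pose g y := fine (limn_esup (fun k => (f k y)%:E)).
have mg : measurable_fun `[a, b] g.
  apply: (measurableT_comp (fine_measurable _)) => //.
  by apply: measurable_fun_limn_esup => n; apply/measurable_EFinP; exact: (f2 n).1.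
have glim : aeon a b (fun y => f ^~ y @ \oo --> g y).
  apply: aeon_imp fcv => y _ c.
  have c' : (fun k => (f k y)%:E) @ \oo --> (limn (f ^~ y))%:E by apply: cvg_EFin => //; exact: nearW.
  have -> : g y = limn (f ^~ y); last exact: c.
  by rewrite /g is_cvg_limn_esupE ?(cvg_lim _ c') //; apply: cvgP c'.
have F k : (\int[mu]_(y in `[a, b]) ((g y - f k y) ^+ 2)%:E <= (4^-1 ^+ k)%:E)%E.
  pose h n y := ((f n y - f k y) ^+ 2)%:E.
  have mh n : measurable_fun `[a, b] (h n).
    by apply/measurable_EFinP; apply: measurable_funX; exact: (fB k n).1.
  have E : (\int[mu]_(y in `[a, b]) ((g y - f k y) ^+ 2)%:E =
      \int[mu]_(y in `[a, b]) limn_einf (h ^~ y))%E.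
    apply: ae_eq_integral.
    - exact: measurable_itv.
    - apply/measurable_EFinP; apply: measurable_funX; apply: measurable_funB => //; exact: (f2 k).1.
    - rewrite (_ : (fun y => limn_einf (h ^~ y)) = (fun y => - limn_esup (fun n => - h n y))%E).
        apply: measurableT_comp => //; apply: measurable_fun_limn_esup => n.
        have mN : measurable_fun `[a, b] (fun y => - 1 * (f n y - f k y) ^+ 2).
          by apply: measurable_funM => //; apply: measurable_funX; exact: (fB k n).1.
        move/measurable_EFinP: mN; apply: eq_measurable_fun => y _ /=.
        by rewrite mulN1r EFinN.
      by apply/funext => y; rewrite /limn_einf.
    - move: glim; rewrite /aeon /ae_eq; apply: filterS => y H yab.
      have yab' : a <= y <= b by move: yab; rewrite /= in_itv.
      have c : h ^~ y @ \oo --> ((g y - f k y) ^+ 2)%:E.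
        apply: cvg_EFin; first exact: nearW.
        by apply: cvgM; apply: cvgB; [exact: H|exact: cvg_cst|exact: H|exact: cvg_cst].
      have cv : cvgn (h ^~ y) by exact: cvgP c.
      by rewrite /= is_cvg_limn_einfE // (cvg_lim _ c).
  rewrite E; apply: le_trans (fatou _ _ _ _) _.
  - exact: measurable_itv.
  - exact: mh.
  - by move=> n y _; rewrite lee_fin sqr_ge0.
  - apply: (@limn_einf_le _ k) => n kn.
    have fBi := (fB k n).2.
    by rewrite (EFin_int fBi) lee_fin; exact: fc.
have gB k : L2r a b (fun y => g y - f k y).
  split; first by apply: measurable_funB => //; exact: (f2 k).1.
  apply/integrableP; split.
    by apply/measurable_EFinP; apply: measurable_funX; apply: measurable_funB => //; exact: (f2 k).1.
  apply: le_lt_trans (ltry (4^-1 ^+ k)); apply: le_trans (F k).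
  rewrite le_eqVlt; apply/orP; left; apply/eqP; apply: eq_integral => y _ /=.
  by rewrite ger0_norm ?sqr_ge0.
exists g.
  have := L2rD (gB 0%N) (f2 0%N).
  by under eq_fun do rewrite subrK.
by move=> k; have := F k; rewrite (EFin_int (gB k).2) lee_fin.
Qed.
End L2Complete.

(** * The Hilbert space of classes of functions *)

Definition fnl (R : realType) := (R -> R[i]) -> (R[i])^o.
HB.instance Definition _ (R : realType) := GRing.Lmodule.on (fnl R).

Section L2Space.
Context {R : realType} (a b : R).
Local Notation C := R[i].
Implicit Types (u v : R -> C).
Local Notation C2 := (C2 a b).
Local Notation ip := (ip a b).

(** A class up to null sets is encoded by the functional of its inner products,
    so that functions equal almost everywhere give equal vectors. *)
Definition class_fun u : fnl R := fun v => if `[< C2 v >] then ip u v else 0.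

Definition is_class : {pred fnl R} := [pred x : fnl R | `[< exists u, C2 u /\ x = class_fun u >]].

Lemma class_funD u v : C2 u -> C2 v -> class_fun (fun y => u y + v y) = class_fun u + class_fun v.
Proof.
move=> u2 v2; apply/funext => w; rewrite /class_fun /=.
transitivity (class_fun u w + class_fun v w); last by [].
by rewrite /class_fun; case: asboolP => w2; rewrite ?addr0 // ipDl.
Qed.

Lemma class_funZ c u : C2 u -> class_fun (fun y => c * u y) = c *: class_fun u.
Proof.
move=> u2; apply/funext => w; transitivity (c * class_fun u w); last by [].
by rewrite /class_fun; case: asboolP => w2; rewrite ?mulr0 // ipZl.
Qed.

Lemma is_class_submod : submod_closed is_class.
Proof.
split=> [|c x y].
  rewrite !inE; exists (fun=> 0); split; first exact: C2_zero.
  have := class_funZ 0 (C2_zero a b); rewrite scale0r => <-; congr class_fun.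
  by apply/funext => y; rewrite mul0r.
rewrite !inE => -[u [u2 ->]] [v [v2 ->]].
exists (fun y => c * u y + v y); split; first by apply: C2D => //; exact: C2Z.
by rewrite class_funD ?class_funZ //; exact: C2Z.
Qed.

HB.instance Definition _ := GRing.isSubmodClosed.Build C (fnl R) is_class is_class_submod.

Record L2sp := L2Sp { l2val : fnl R; l2P : l2val \in is_class }.
HB.instance Definition _ := [isSub for l2val].
HB.instance Definition _ := [Choice of L2sp by <:].
HB.instance Definition _ := [SubChoice_isSubLmodule of L2sp by <:].

Definition cls u : L2sp := insubd (0 : L2sp) (class_fun u).

Lemma val_cls u : C2 u -> \val (cls u) = class_fun u.
Proof. by move=> u2; rewrite /cls insubdK // inE; exists u. Qed.

Lemma repr_ex (x : L2sp) : exists u, C2 u /\ \val x = class_fun u.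
Proof. by have := valP x; rewrite inE. Qed.

Definition repr (x : L2sp) := projT1 (cid (repr_ex x)).

Lemma repr_C2 x : C2 (repr x).
Proof. by rewrite /repr; case: cid => u []. Qed.

Lemma reprK x : cls (repr x) = x.
Proof.
apply: val_inj; rewrite val_cls; last exact: repr_C2.
by rewrite /repr; case: cid => u [].
Qed.

Lemma clsD u v : C2 u -> C2 v -> cls (fun y => u y + v y) = cls u + cls v.
Proof.
move=> u2 v2; apply: val_inj; rewrite val_cls; last exact: C2D.
by rewrite class_funD // raddfD /= !val_cls.
Qed.

Lemma clsZ c u : C2 u -> cls (fun y => c * u y) = c *: cls u.
Proof.
move=> u2; apply: val_inj; rewrite val_cls; last exact: C2Z.
by rewrite class_funZ // linearZ /= val_cls.
Qed.

Context (ltab : a < b).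

Lemma cls_eq u v : C2 u -> C2 v -> cls u = cls v <-> aeon a b (fun y => u y = v y).
Proof.
move=> u2 v2; split=> [E|uv]; last first.
  apply: val_inj; rewrite !val_cls //; apply/funext => w; rewrite /class_fun.
  case: asboolP => // w2; apply: ip_eq_ae => //; exact: aeonT.
have Z : C2 (fun y => -1 * v y) by exact: C2Z.
have w2 : C2 (fun y => u y + -1 * v y) by exact: C2D.
have H w : C2 w -> ip u w = ip v w.
  move=> w2'; have := congr1 (fun x => \val x w) E; rewrite !val_cls //.
  by rewrite /class_fun; case: asboolP.
have : ip (fun y => u y + -1 * v y) (fun y => u y + -1 * v y) = 0.
  by rewrite ipDl // ipZl // H // mulN1r subrr.
move=> /(ip_eq0 ltab w2); apply: aeon_imp => y _ /eqP.
by rewrite mulN1r subr_eq0 => /eqP.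
Qed.

Lemma cls_repr u : C2 u -> aeon a b (fun y => repr (cls u) y = u y).
Proof. by move=> u2; apply/cls_eq => //; [exact: repr_C2|rewrite reprK]. Qed.

Lemma cls_ind (P : L2sp -> Prop) : (forall u, C2 u -> P (cls u)) -> forall x, P x.
Proof. by move=> H x; rewrite -(reprK x); apply: H; exact: repr_C2. Qed.

Definition sp (x y : L2sp) : C := ip (repr x) (repr y).

Lemma sp_cls u v : C2 u -> C2 v -> sp (cls u) (cls v) = ip u v.
Proof.
move=> u2 v2; apply: ip_eq_ae => //; try exact: repr_C2; exact: cls_repr.
Qed.

Lemma spD x y z : sp (x + y) z = sp x z + sp y z.
Proof.
elim/cls_ind: x => u u2; elim/cls_ind: y => v v2; elim/cls_ind: z => w w2.
by rewrite -clsD // !sp_cls ?ipDl //; exact: C2D.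
Qed.

Lemma spZ c x y : sp (c *: x) y = c * sp x y.
Proof.
elim/cls_ind: x => u u2; elim/cls_ind: y => v v2.
by rewrite -clsZ // !sp_cls ?ipZl //; exact: C2Z.
Qed.

Lemma spC x y : sp y x = (sp x y)^*.
Proof. by rewrite /sp ipC //; exact: repr_C2. Qed.

Definition sqint (u : R -> C) : R :=
  \int[@lebesgue_measure R]_(y in `[a, b]) (complex.Re (u y) ^+ 2 + complex.Im (u y) ^+ 2).

Lemma sp_self u : C2 u -> sp (cls u) (cls u) = (sqint u)%:C%C.
Proof. by move=> u2; rewrite sp_cls // ip_self. Qed.

Lemma sqint_ge0 u : 0 <= sqint u.
Proof. by apply: int_ge0 => y _; rewrite addr_ge0 ?sqr_ge0. Qed.

Lemma sp_gt0 x : x != 0 -> 0 < sp x x.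
Proof.
elim/cls_ind: x => u u2; rewrite sp_self // ltcR lt0r sqint_ge0 andbT.
apply: contra_neq => E.
have /(ip_eq0 ltab u2) h : ip u u = 0 by rewrite ip_self // -/(sqint u) E.
have -> : 0 = cls (fun=> 0) :> L2sp.
  have := clsZ 0 (C2_zero a b); rewrite scale0r => <-; congr cls.
  by apply/funext => y; rewrite mul0r.
by apply/cls_eq => //; exact: C2_zero.
Qed.

Lemma sp_complete (x : nat -> L2sp) :
  (forall k l, (k <= l)%N -> sp (x l - x k) (x l - x k) <= 4^-1 ^+ k) ->
  exists y, ulim \oo (fun k => sp (y - x k) (y - x k)) 0.
Proof.
move=> xc; pose u k := repr (x k).
have u2 k : C2 (u k) by exact: repr_C2.
have d2 v w : C2 v -> C2 w -> C2 (fun y => v y - w y).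
  move=> v2 w2; have := C2D v2 (C2Z (-1) w2).
  by under eq_fun do rewrite mulN1r.
have dE v w : C2 v -> C2 w -> cls v - cls w = cls (fun y => v y - w y).
  move=> v2 w2; rewrite -scaleN1r -clsZ // -clsD //; last exact: C2Z.
  by congr cls; apply/funext => y; rewrite mulN1r.
have uc k l : (k <= l)%N -> sqint (fun y => u l y - u k y) <= 4^-1 ^+ k.
  move=> /xc; rewrite -(reprK (x l)) -(reprK (x k)) -/(u l) -/(u k) dE // sp_self; last exact: d2.
  have -> : (4^-1 ^+ k : C) = (((4^-1 : R) ^+ k)%:C)%C by rewrite rmorphXn /= fmorphV rmorph_nat.
  by rewrite lecR.
have sum_int v w : C2 v -> C2 w -> sqint (fun y => v y - w y) =
  \int[@lebesgue_measure R]_(y in `[a, b]) ((complex.Re (v y) - complex.Re (w y)) ^+ 2) +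
  \int[@lebesgue_measure R]_(y in `[a, b]) ((complex.Im (v y) - complex.Im (w y)) ^+ 2).
  move=> v2 w2; have [[_ h1] [_ h2]] := d2 _ _ v2 w2.
  have h3 : itg a b (fun y => (complex.Re (v y) - complex.Re (w y)) ^+ 2).
    by apply: eq_itg h1 => y _; rewrite !cDE.
  have h4 : itg a b (fun y => (complex.Im (v y) - complex.Im (w y)) ^+ 2).
    by apply: eq_itg h2 => y _; rewrite !cDE.
  rewrite -intD //; by apply: eq_int => y _; rewrite !cDE.
have i0 (f : R -> R) : 0 <= \int[@lebesgue_measure R]_(y in `[a, b]) (f y ^+ 2).
  by apply: int_ge0 => y _; exact: sqr_ge0.
have cR k l : (k <= l)%N ->
    \int[@lebesgue_measure R]_(y in `[a, b]) ((complex.Re (u l y) - complex.Re (u k y)) ^+ 2) <= 4^-1 ^+ k.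
  by move=> kl; apply: le_trans (uc k l kl); rewrite sum_int // lerDl.
have cI k l : (k <= l)%N ->
    \int[@lebesgue_measure R]_(y in `[a, b]) ((complex.Im (u l y) - complex.Im (u k y)) ^+ 2) <= 4^-1 ^+ k.
  by move=> kl; apply: le_trans (uc k l kl); rewrite sum_int // lerDr.
have [g1 g12 g1E] := L2r_complete ltab (fun k => (u2 k).1) cR.
have [g2 g22 g2E] := L2r_complete ltab (fun k => (u2 k).2) cI.
pose g y := (g1 y +i* g2 y)%C.
have gC : C2 g by split.
exists (cls g).
apply: (@ulim_squeeze _ _ \oo _ _ (fun k => 2 * 4^-1 ^+ k)).
  suff : ulim \oo (fun k => 2 * 4^-1 ^+ k) (2 * 0 : C) by rewrite mulr0.
  by apply: ulimZ; exact: (quarter_lim (@complex_archi R)).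
apply: filterE => k /=; rewrite -(reprK (x k)) -/(u k) dE // sp_self; last exact: d2.
rewrite ger0_norm; last by rewrite ler0c sqint_ge0.
have -> : (2 * 4^-1 ^+ k : C) = ((2 * (4^-1 : R) ^+ k)%:C)%C.
  by rewrite rmorphM rmorphXn /= fmorphV !rmorph_nat.
rewrite lecR sum_int // mulr_natl mulr2n; apply: lerD; [exact: g1E|exact: g2E].
Qed.

Theorem sp_riesz (phi : L2sp -> C) : (forall x y, phi (x + y) = phi x + phi y) ->
  (forall c x, phi (c *: x) = c * phi x) -> (exists k, forall x, `|phi x| <= k * nrm sp x) ->
  exists z, forall x, phi x = sp x z.
Proof.
exact: (riesz_representation spD spZ spC sp_gt0 sp_complete (@complex_infima R) (@complex_archi R)).
Qed.

(** The action on classes of a formula on functions, through representatives;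
    meaningful for formulas that respect null sets, as in [liftable]. *)
Definition lift (f : (R -> C) -> R -> C) (x : L2sp) : L2sp := cls (f (repr x)).

Definition liftable (f : (R -> C) -> R -> C) :=
  [/\ forall u, C2 u -> C2 (f u),
      forall u v, C2 u -> C2 v -> aeon a b (fun y => u y = v y) -> aeon a b (fun y => f u y = f v y),
      forall u v, C2 u -> C2 v -> aeon a b (fun y => f (fun y => u y + v y) y = f u y + f v y) &
      forall c u, C2 u -> aeon a b (fun y => f (fun y => c * u y) y = c * f u y)].

Lemma lift_cls f u : (forall u, C2 u -> C2 (f u)) ->
  (forall u v, C2 u -> C2 v -> aeon a b (fun y => u y = v y) -> aeon a b (fun y => f u y = f v y)) ->
  C2 u -> lift f (cls u) = cls (f u).
Proof.
move=> f2 fe u2; have r2 := repr_C2 (cls u).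
by apply/cls_eq; [exact: f2|exact: f2|apply: fe => //; exact: cls_repr].
Qed.

Lemma lift_linear f : liftable f -> op_linear (lift f).
Proof.
move=> [f2 fe fD fZ]; split=> [x y|c x].
  elim/cls_ind: x => u u2; elim/cls_ind: y => v v2.
  have uv2 := C2D u2 v2.
  rewrite -clsD // !lift_cls // -clsD; [|exact: f2..].
  by apply/cls_eq; [exact: f2|apply: C2D; exact: f2|exact: fD].
elim/cls_ind: x => u u2; have cu := C2Z c u2.
rewrite -clsZ // !lift_cls // -clsZ; last exact: f2.
by apply/cls_eq; [exact: f2|apply: C2Z; exact: f2|exact: fZ].
Qed.

Lemma lift_sym f : liftable f -> (forall u v, C2 u -> C2 v -> ip (f u) v = ip u (f v)) ->
  op_sym sp (lift f).
Proof.
move=> [f2 fe _ _] fs x y.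
elim/cls_ind: x => u u2; elim/cls_ind: y => v v2.
rewrite (lift_cls f2 fe u2) (lift_cls f2 fe v2) (sp_cls (f2 _ u2) v2) (sp_cls u2 (f2 _ v2)).
exact: fs.
Qed.

Lemma nrm_cls u : C2 u -> nrm sp (cls u) ^+ 2 = (sqint u)%:C%C.
Proof. by move=> u2; rewrite (nrmK sp) sp_self. Qed.

Lemma lift_bounded f (k : R) : liftable f -> 0 <= k ->
  (forall u, C2 u -> sqint (f u) <= k ^+ 2 * sqint u) -> op_bounded sp (lift f) k%:C%C.
Proof.
move=> [f2 fe _ _] k0 fb; split=> [|x]; first by rewrite ler0c.
elim/cls_ind: x => u u2; rewrite lift_cls //.
have kc : (0 : C) <= k%:C%C by rewrite ler0c.
have n0 := nrm_ge0 spZ sp_gt0.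
rewrite -(@ler_pXn2r _ 2) // ?nnegrE ?mulr_ge0 //.
rewrite (nrm_cls (f2 _ u2)).
have -> : (k%:C%C * nrm sp (cls u)) ^+ 2 = (k ^+ 2 * sqint u)%:C%C.
  by rewrite exprMn (nrm_cls u2) rmorphM rmorphXn.
rewrite lecR; exact: fb.
Qed.
End L2Space.

(** * The operators of one Fourier mode *)

Lemma measurable_inv {R : realType} : measurable_fun setT (fun x : R => x^-1).
Proof.
have -> : setT = [set (0 : R)] `|` ~` [set (0 : R)] by rewrite setUv.
have m1 : measurable [set (0 : R)] by exact: measurable_set1.
apply/measurable_funU => //; first exact: measurableC.
split.
  move=> _ Y _; apply: countable_measurable => [t|]; first exact: measurable_set1.
  by apply: (sub_countable (B := [set (0 : R)])) => //; apply: subset_card_le => y [].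
apply: open_continuous_measurable_fun.
  by rewrite openC; exact: (accessible_closed_set1 (hausdorff_accessible (@Rhausdorff R))).
by move=> x xS; apply: inv_continuous; apply/eqP => x0; move: xS; rewrite x0 inE => /(_ erefl).
Qed.

Section ModeOperators.
Context {R : realType} (F : shear_flow R) (hy : y1 F < y2 F)
  (hU : C2_profile F) (hK : class_Kplus F) (m : R) (m0 : 0 < m).
Notation mu := (@lebesgue_measure R).
Local Notation a := (y1 F).
Local Notation b := (y2 F).
Local Notation C := R[i].
Local Notation Re := complex.Re.
Local Notation Im := complex.Im.
Let ab : a <= b := ltW hy.
Local Notation V := (L2sp a b).
Local Notation C2 := (C2 a b).
Local Notation ip := (ip a b).
Local Notation sp := (@sp R a b).
Local Notation cls := (@cls R a b).
Local Notation repr := (@repr R a b).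

Let U_c := U_cont hU. Let ddU_c := ddU_cont hU.

Definition mulop (g : R -> R) (u : R -> C) (y : R) : C := (g y)%:C%C * u y.

Lemma sqint_le (u v : R -> C) (k : R) : C2 u -> C2 v ->
  (forall y, a <= y <= b -> Re (u y) ^+ 2 + Im (u y) ^+ 2 <= k * (Re (v y) ^+ 2 + Im (v y) ^+ 2)) ->
  sqint a b u <= k * sqint a b v.
Proof.
move=> u2 v2 uv; rewrite /sqint -intZ; last exact: C2_sqr.
by apply: int_le => //; [exact: C2_sqr|apply: itgZ; exact: C2_sqr].
Qed.

Section Multiplication.
Context (g : R -> R) (k : R) (mg : measurable_fun `[a, b] g)
  (gk : forall y, a <= y <= b -> `|g y| <= k).

Lemma mulop_liftable : liftable a b (mulop g).
Proof.
split.
- by move=> u u2; exact: C2M gk.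
- by move=> u v _ _; apply: aeon_imp => y _ E; rewrite /mulop E.
- by move=> u v _ _; apply: aeonT => y _; rewrite /mulop mulrDr.
- by move=> c u _; apply: aeonT => y _; rewrite /mulop mulrCA.
Qed.

Lemma mulop_sym : op_sym sp (lift (mulop g)).
Proof. by apply: lift_sym hy _ mulop_liftable _ => u v _ _; exact: ip_mul. Qed.

Lemma mulop_bounded : op_bounded sp (lift (mulop g)) k%:C%C.
Proof.
have k0 : 0 <= k by rewrite (le_trans _ (gk (y := a) _)) // lexx ab.
apply: (lift_bounded hy mulop_liftable k0) => u u2.
have [h1 _ _ _] := mulop_liftable; have g2 := h1 u u2.
apply: sqint_le => // y /gk gy; rewrite /mulop !cDE /= !mul0r subr0 addr0 !exprMn -mulrDr.
rewrite ler_wpM2r ?addr_ge0 ?sqr_ge0 // -(real_normK (num_real (g y))).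
by rewrite lerXn2r ?nnegrE.
Qed.

Lemma mulop_form u : C2 u -> sp (lift (mulop g) (cls u)) (cls u) =
  (\int[mu]_(y in `[a, b]) (g y * (Re (u y) ^+ 2 + Im (u y) ^+ 2)))%:C%C.
Proof.
move=> u2; have [h1 h2 _ _] := mulop_liftable.
rewrite (lift_cls hy h1 h2 u2) (sp_cls hy (h1 _ u2) u2); apply: cE => /=.
  by apply: eq_int => y _; rewrite /mulop !cDE /=; ring.
rewrite (@eq_int _ a b _ (fun=> 0)) ?int_cst ?mul0r // => y _.
by rewrite /mulop !cDE /=; ring.
Qed.
End Multiplication.

Lemma gc_liftable : liftable a b (gc F m).
Proof.
split.
- by move=> u u2; exact: C2_gc.
- by move=> u v u2 v2 uv; apply: aeonT; exact: gc_eq_ae.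
- by move=> u v u2 v2; apply: aeonT; exact: gcD.
- by move=> c u u2; apply: aeonT; exact: gcZ.
Qed.

Lemma gc_lift_sym : op_sym sp (lift (gc F m)).
Proof. by apply: lift_sym hy _ gc_liftable _; exact: gc_sym. Qed.

Lemma int_norm_sqr (f : R -> R) : L2r a b f ->
  (\int[mu]_(y in `[a, b]) `|f y|) ^+ 2 <= (b - a) * \int[mu]_(y in `[a, b]) (f y ^+ 2).
Proof.
move=> f2; have fi := itg_norm (L2r_itg hy f2); have [_ fi2] := f2.
set N := \int[mu]_(y in `[a, b]) `|f y|; set S := \int[mu]_(y in `[a, b]) (f y ^+ 2).
have l0 : 0 < b - a by rewrite subr_gt0.
pose c := N / (b - a).
have i1 : itg a b (fun y => f y ^+ 2 + (- (2 * c)) * `|f y|) by apply: itgD => //; exact: itgZ.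
have : 0 <= \int[mu]_(y in `[a, b]) (f y ^+ 2 + (- (2 * c)) * `|f y| + c ^+ 2).
  apply: int_ge0 => y _; rewrite -(real_normK (num_real (f y))).
  have -> : `|f y| ^+ 2 + - (2 * c) * `|f y| + c ^+ 2 = (`|f y| - c) ^+ 2 by ring.
  exact: sqr_ge0.
rewrite intD //; last exact: itg_cst.
rewrite intD //; last exact: itgZ.
rewrite intZ // int_cst // -/N -/S /c => H.
rewrite -subr_ge0; have -> : (b - a) * S - N ^+ 2 = (b - a) * (S + - (2 * (N / (b - a))) * N + (N / (b - a)) ^+ 2 * (b - a)).
  by field; rewrite gt_eqF.
by rewrite mulr_ge0 // ltW.
Qed.

Lemma gr_sup : exists2 K, 0 <= K & forall f, L2r a b f ->
  (forall y, a <= y <= b -> gr F m f y ^+ 2 <= K * \int[mu]_(z in `[a, b]) (f z ^+ 2)) /\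
  (forall y z, a <= y <= b -> a <= z <= b ->
    `|gr F m f y - gr F m f z| <= K * (\int[mu]_(t in `[a, b]) `|f t|) * `|y - z|).
Proof.
have [K K0 HK] := gr_lipschitz hy m0.
have l0 : 0 <= b - a by rewrite subr_ge0.
exists (K + K ^+ 2 * (b - a)) => [|f f2]; first by rewrite addr_ge0 ?mulr_ge0 ?exprn_ge0.
have [h1 h2] := HK f (L2r_itg hy f2).
have N0 : 0 <= \int[mu]_(t in `[a, b]) `|f t| by exact: int_ge0.
have S0 : 0 <= \int[mu]_(t in `[a, b]) (f t ^+ 2) by apply: int_ge0 => y _; exact: sqr_ge0.
split=> [y yab|y z yab zab].
  rewrite -(real_normK (num_real _)) mulrDl; apply: ler_wpDl; first exact: mulr_ge0.
  apply: le_trans (_ : (K * \int[mu]_(t in `[a, b]) `|f t|) ^+ 2 <= _).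
    by rewrite lerXn2r ?nnegrE ?h1 // mulr_ge0.
  by rewrite exprMn -mulrA ler_wpM2l ?exprn_ge0 // int_norm_sqr.
apply: le_trans (h2 y z yab zab) _; rewrite ler_wpM2r // ler_wpM2r // lerDl.
by rewrite mulr_ge0 // exprn_ge0.
Qed.

Lemma gc_bounded : exists k, op_bounded sp (lift (gc F m)) k.
Proof.
have [K K0 HK] := gr_sup; have l0 : 0 <= b - a by rewrite subr_ge0.
exists (Num.sqrt (K * (b - a)))%:C%C.
apply: (lift_bounded hy gc_liftable (sqrtr_ge0 _)) => u u2.
rewrite sqr_sqrtr ?mulr_ge0 //; have [r2 i2] := u2.
have g2 : C2 (gc F m u) by exact: C2_gc.
have E : sqint a b u = \int[mu]_(y in `[a, b]) (Re (u y) ^+ 2) + \int[mu]_(y in `[a, b]) (Im (u y) ^+ 2).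
  by rewrite -intD //; [exact: r2.2|exact: i2.2].
apply: (@le_trans _ _ (\int[mu]_(y in `[a, b]) (K * sqint a b u))); last first.
  by rewrite int_cst // mulrAC.
apply: int_le; [exact: C2_sqr|exact: itg_cst|].
move=> y yab; rewrite E mulrDr; apply: lerD; [exact: (HK _ r2).1|exact: (HK _ i2).1].
Qed.

(** Potentials are bounded pointwise by the norm of their density, so evaluation
    is represented by a vector. *)
Lemma gc_eval (z : R) : a <= z <= b ->
  exists w : V, forall x : V, gc F m (repr x) z = sp x w.
Proof.
move=> zab; have [K K0 HK] := gr_sup.
apply: (sp_riesz hy).
- move=> x y; have rx := repr_C2 x; have ry := repr_C2 y.
  rewrite -(gcD hy m0 rx ry zab); apply: (gc_eq_ae hy m0) => //; [exact: repr_C2|exact: C2D|].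
  apply/(cls_eq hy); [exact: repr_C2|exact: C2D|].
  by rewrite clsD // !reprK.
- move=> c x; have rx := repr_C2 x.
  rewrite -(gcZ hy m0 c rx zab); apply: (gc_eq_ae hy m0) => //; [exact: repr_C2|exact: C2Z|].
  apply/(cls_eq hy); [exact: repr_C2|exact: C2Z|].
  by rewrite clsZ // !reprK.
- exists (Num.sqrt K)%:C%C => x; have [r2 i2] := repr_C2 x.
  have n0 := nrm_ge0 (@spZ R a b hy) (@sp_gt0 R a b hy).
  have k0 : (0 : C) <= (Num.sqrt K)%:C%C by rewrite ler0c sqrtr_ge0.
  rewrite -(@ler_pXn2r _ 2) // ?nnegrE ?mulr_ge0 ?n0 //.
  have nE : nrm sp x ^+ 2 = (sqint a b (repr x))%:C%C.
    by rewrite -{1}(reprK x); apply: (nrm_cls hy); exact: repr_C2.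
  have -> : ((Num.sqrt K)%:C%C * nrm sp x) ^+ 2 = (K * sqint a b (repr x))%:C%C.
    by rewrite exprMn nE rmorphM -rmorphXn sqr_sqrtr.
  have -> : `|gc F m (repr x) z| ^+ 2 = (gr F m (fun t => Re (repr x t)) z ^+ 2 + gr F m (fun t => Im (repr x t)) z ^+ 2)%:C%C.
    by rewrite normc_def -rmorphXn sqr_sqrtr // addr_ge0 ?sqr_ge0.
  rewrite lecR /sqint intD; [|exact: r2.2|exact: i2.2].
  rewrite mulrDr; apply: lerD; [exact: (HK _ r2).1|exact: (HK _ i2).1].
Qed.

Lemma gc_form_real (x : V) : sp (lift (gc F m) x) x \is Num.real.
Proof. by rewrite CrealE -spC gc_lift_sym. Qed.

Lemma sp_real_Re (z : C) : z \is Num.real -> z = (Re z)%:C%C.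
Proof. by case: z => p q; rewrite complex_real => /= /eqP ->. Qed.

Lemma gc_form_ge0 (x : V) : 0 <= sp (lift (gc F m) x) x.
Proof.
rewrite (sp_real_Re (gc_form_real x)) ler0c.
have [h1 h2 _ _] := gc_liftable.
rewrite -(reprK x) (lift_cls hy h1 h2 (repr_C2 x)) (sp_cls hy (h1 _ (repr_C2 x)) (repr_C2 x)).
exact: gc_pos (repr_C2 x).
Qed.

(** Potentials are equicontinuous: one that vanishes at the nodes of a fine mesh
    is small everywhere. *)
Lemma gc_compact (e : C) : 0 < e -> exists q (f : 'I_q -> V), forall x,
  (forall j, sp x (f j) = 0) -> sp (lift (gc F m) x) x <= e * sp x x.
Proof.
move=> e0.
have e1 : 0 < Re e by move: e0; rewrite ltcE => /andP[].
have eE : e = (Re e)%:C%C by apply: sp_real_Re; exact: gtr0_real.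
have [K K0 HK] := gr_sup; have l0 : 0 < b - a by rewrite subr_gt0.
have [p pE] : exists p : nat, K * (b - a) * (b - a) / Re e < p.+1%:R.
  exists (Num.truncn (K * (b - a) * (b - a) / Re e)); exact: truncnS_gt.
pose w := (b - a) / p.+1%:R.
have p0 : 0 < p.+1%:R :> R by rewrite ltr0n.
have w0 : 0 < w by rewrite divr_gt0.
have wE : K * w * (b - a) <= Re e.
  have -> : K * w * (b - a) = Re e * (K * (b - a) * (b - a) / Re e / p.+1%:R).
    by rewrite /w; field; rewrite !gt_eqF.
  by rewrite ler_piMr ?(ltW e1) // ler_pdivrMr // mul1r ltW.
have nodeab (j : 'I_p.+1) : a <= a + j%:R * w <= b.
  rewrite lerDl mulr_ge0 ?(ltW w0) //= -lerBrDl /w mulrA ler_pdivrMr // mulrC ler_wpM2l ?(ltW l0) //.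
  by rewrite ler_nat ltnW // ltn_ord.
have node y : a <= y <= b -> exists j : 'I_p.+1, `|y - (a + j%:R * w)| <= w.
  move=> /andP[ay yb].
  have : y <= a + p.+1%:R * w by rewrite /w mulrC divfK ?gt_eqF // subrKC.
  have : (p.+1 <= p.+1)%N by [].
  have [k kE] : exists k, k = p.+1 by eexists.
  rewrite -{1 3}kE; elim: k {kE} => [|k IH] kp yk.
    exists ord0; rewrite mul0r addr0; have -> : y = a by apply/eqP; rewrite eq_le ay; move: yk; rewrite mul0r addr0 => ->.
    by rewrite subrr normr0 ltW.
  have [yk'|yk'] := leP y (a + k%:R * w); first exact: IH (ltnW kp) yk'.
  exists (Ordinal kp) => /=; rewrite ger0_norm ?subr_ge0 ?(ltW yk') //.
  by move: yk; rewrite -natr1 mulrDl mul1r addrA -lerBlDl.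
have [f fE] := choice (fun j : 'I_p.+1 => gc_eval (nodeab j)).
exists p.+1, f => x xf.
rewrite (sp_real_Re (gc_form_real x)) eE.
have [h1 h2 _ _] := gc_liftable; have r2 := repr_C2 x.
have z0 (j : 'I_p.+1) : gc F m (repr x) (a + j%:R * w) = 0 by rewrite fE xf.
rewrite -(reprK x) (lift_cls hy h1 h2 r2) (sp_cls hy (h1 _ r2) r2) (sp_self hy r2).
rewrite -rmorphM lecR gc_re //.
have part (g : R -> R) : L2r a b g -> (forall j : 'I_p.+1, gr F m g (a + j%:R * w) = 0) ->
    \int[mu]_(y in `[a, b]) (g y * gr F m g y) <= Re e * \int[mu]_(y in `[a, b]) (g y ^+ 2).
  move=> g2 gz; have gi := L2r_itg hy g2; have ni := itg_norm gi.
  set N := \int[mu]_(y in `[a, b]) `|g y|; have N0 : 0 <= N by exact: int_ge0.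
  have gg : L2r a b (gr F m g) by apply: (L2r_cont hy); exact: gr_cont.
  apply: (@le_trans _ _ (\int[mu]_(y in `[a, b]) (K * N * w * `|g y|))).
    apply: int_le; [exact: L2r_mul|exact: itgZ|].
    move=> y yab; apply: le_trans (ler_norm _) _; rewrite normrM mulrC ler_wpM2r //.
    have [j jE] := node y yab; rewrite -[gr F m g y]subr0 -(gz j).
    apply: le_trans ((HK g g2).2 _ _ yab (nodeab j)) _.
    by rewrite ler_wpM2l // mulr_ge0.
  rewrite intZ // -/N.
  have NS := int_norm_sqr g2; have S0 : 0 <= \int[mu]_(y in `[a, b]) (g y ^+ 2).
    by apply: int_ge0 => y _; exact: sqr_ge0.
  apply: (@le_trans _ _ (K * w * (b - a) * \int[mu]_(y in `[a, b]) (g y ^+ 2))); last by rewrite ler_wpM2r.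
  have -> : K * N * w * N = K * w * N ^+ 2 by ring.
  by rewrite -[leRHS]mulrA ler_wpM2l // mulr_ge0 // ltW.
rewrite /sqint intD; [|exact: r2.1.2|exact: r2.2.2].
rewrite mulrDr; apply: lerD; apply: part; [exact: r2.1| |exact: r2.2|].
  by move=> j; have := congr1 (fun z => Re z) (z0 j).
by move=> j; have := congr1 (fun z => Im z) (z0 j).
Qed.

(** * Splitting of one Fourier mode *)

Local Notation q := (fun y => U F y - Us F).

Let ddUE y : a <= y <= b -> - ddU F y = K2 F y * (U F y - Us F).
Proof. by move=> yab; rewrite (ddU_K2 hy hU hK yab) opprK. Qed.

Lemma K2_neq0 y : a <= y <= b -> K2 F y != 0.
Proof.
move=> yab; have [m1 [M [m10 /(_ y yab) /andP[h _]]]] := K2_bounds hK.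
by rewrite gt_eqF // (lt_le_trans m10).
Qed.

Lemma Kinv_measurable : measurable_fun `[a, b] (fun y => (K2 F y)^-1).
Proof. exact: measurableT_comp measurable_inv (K2_measurable hy hU hK). Qed.

Lemma ddU_measurable : measurable_fun `[a, b] (ddU F).
Proof. exact: (itg_measurable (itg_cont ddU_c)). Qed.

Lemma Kinv_bounds : exists k1 k2 : R, 0 < k1 /\ forall y, a <= y <= b -> k1 <= (K2 F y)^-1 <= k2.
Proof.
have [m1 [M [m10 H]]] := K2_bounds hK; exists M^-1, m1^-1.
have M0 : 0 < M.
  have aa : a <= a <= b by rewrite lexx ab.
  by have /andP[h1 h2] := H a aa; exact: lt_le_trans (le_trans h1 h2).
split=> [|y /H /andP[h1 h2]]; first by rewrite invr_gt0.
have k0 : 0 < K2 F y by exact: lt_le_trans h1.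
by rewrite !lef_pV2 ?posrE // h1 h2.
Qed.

(** [no_neutral_mode] for [Q = U - c], whose zeros form a null set. *)
Lemma neutral_mode_vanishes (c : R) (f : R -> R) : L2r a b f ->
  aeon a b (fun y => (U F y - c) * f y = - (ddU F y * gr F m f y)) ->
  itg a b (fun y => (gr F m f y / (U F y - c)) ^+ 2) ->
  aeon a b (fun y => gr F m f y = 0).
Proof.
move=> f2 fE phi2; have fi := L2r_itg hy f2.
have [d hd] := gr_helm hy m0 fi.
have cQ : {within `[a, b], continuous (fun y => U F y - c)}.
  by move=> y; apply: cvgB; [exact: U_c|exact: cvg_cst].
have dQ y : a < y < b -> is_derive y 1 (fun y => U F y - c) (dU F y).
  move=> yab; have h := is_deriveB (U_derive hU yab) (is_derive_cst c y (1 : R)).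
  by rewrite subr0 in h; exact: h.
pose Q : R -> R := fun y => U F y - c.
have Qper : if geom F is Torus then Q a = Q b /\ dU F a = dU F b else True.
  by have := U_periodic hU; rewrite /Q; case: (geom F) => // -[-> ->].
have H : forall y, a <= y <= b -> Q y != 0 -> gr F m f y = 0.
  apply: (@no_neutral_mode R (geom F) a b m hy m0 Q (dU F) (ddU F) f (gr F m f) d) => //.
  - exact: dU_cont.
  - exact: dU_derive.
  - by move: Qper; case: (geom F).
apply: aeon_imp (level_set_null hy hU hK c) => y yab Uy; apply: H => //.
by rewrite /Q subr_eq0.
Qed.

Lemma gr_L2 (f : R -> R) : L2r a b f -> L2r a b (gr F m f).
Proof. by move=> f2; apply: (L2r_cont hy); apply: gr_cont => //; exact: (L2r_itg hy). Qed.

Definition Lr (f : R -> R) (y : R) := (K2 F y)^-1 * f y - gr F m f y.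

Lemma Lr_L2 f : L2r a b f -> L2r a b (Lr f).
Proof.
move=> f2; have [k1 [k2 [k10 H]]] := Kinv_bounds.
have Kb y : a <= y <= b -> `|(K2 F y)^-1| <= k2.
  by move=> /H /andP[h1 h2]; rewrite ger0_norm // (le_trans (ltW k10)).
have := L2rD (L2rM f2 Kinv_measurable Kb) (L2rZ (-1) (gr_L2 f2)).
by under eq_fun do rewrite mulN1r.
Qed.

(** The defect [z] belongs to the kernel of [L]. If [c] vanishes, [z] is the
    density of a neutral mode at speed [Us] with [G z / (U - Us) = L w].
    Otherwise [w + z / c] is an eigenfunction, hence the density of a neutral
    mode at speed [Us + c]. Both vanish by [neutral_mode_vanishes]. *)
Lemma no_real_eigenfunction (w : R -> R) (c : R) : L2r a b w ->
  aeon a b (fun y => Lr (fun y => - ddU F y * Lr w y - c * w y) y = 0) ->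
  aeon a b (fun y => Lr w y = 0).
Proof.
move=> w2; set z := fun y => - ddU F y * Lr w y - c * w y.
have L2 := Lr_L2 w2; have [kd _ kdE] := cont_bounded ab ddU_c.
have z2 : L2r a b z.
  have := L2rD (L2rM L2 ddU_measurable kdE) (L2rZ c w2) => h.
  have := L2rZ (-1) h; congr (L2r a b _); apply/funext => y; rewrite /z; ring.
move=> zL; have zK : aeon a b (fun y => z y = K2 F y * gr F m z y).
  apply: aeon_imp zL => y yab /eqP; rewrite /Lr subr_eq0 => /eqP <-.
  by rewrite mulVKf // K2_neq0.
have zi := L2r_itg hy z2; have wi := L2r_itg hy w2.
have mQ (e : R) : measurable_fun `[a, b] (fun y => (U F y - e)^-1).
  apply: (measurableT_comp measurable_inv); apply: itg_measurable; apply: itg_cont => x.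
  by apply: cvgB; [exact: U_c|exact: cvg_cst].
have [c0|c0] := eqVneq c 0.
- have phiE : aeon a b (fun y => Lr w y = gr F m z y / (U F y - Us F)).
    have := aeon_and (level_set_null hy hU hK (Us F)) zK.
    apply: aeon_imp => y yab [Uy]; have K0 := K2_neq0 yab.
    rewrite {1}/z c0 mul0r subr0 ddUE // -mulrA => /(mulfI K0) <-.
    by rewrite mulrAC divff ?mul1r // subr_eq0.
  have g0 : aeon a b (fun y => gr F m z y = 0).
    apply: (@neutral_mode_vanishes (Us F)) => //.
      apply: aeon_imp zK => y yab E; rewrite {1}E -mulNr ddUE //; ring.
    apply: eq_itg_ae L2.2 _ _; last by apply: aeon_imp phiE => y _ ->.
    by apply: measurable_funX; apply: measurable_funM => //; exact: (gr_L2 z2).1.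
  by have := aeon_and phiE g0; apply: aeon_imp => y _ [-> ->]; rewrite mul0r.
- pose v y := w y + c^-1 * z y.
  have v2 : L2r a b v by apply: L2rD => //; exact: L2rZ.
  have gv y : a <= y <= b -> gr F m v y = gr F m w y + c^-1 * gr F m z y.
    by move=> yab; rewrite grD ?grZ //; exact: itgZ.
  have vE : aeon a b (fun y => (U F y - (Us F + c)) * v y = - (ddU F y * gr F m v y)).
    apply: aeon_imp zK => y yab E; have K0 := K2_neq0 yab.
    have Ez : z y = K2 F y * (U F y - Us F) * ((K2 F y)^-1 * w y - gr F m w y) - c * w y.
      by rewrite /z /Lr ddUE.
    have g' : gr F m z y = (K2 F y)^-1 * z y by rewrite E mulKf.
    rewrite -mulNr ddUE // gv // g' /v Ez; field; by rewrite c0 K0.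
  have [k1 [k2 [k10 Hk]]] := Kinv_bounds.
  have k20 : 0 <= k2.
    have aa : a <= a <= b by rewrite lexx ab.
    by have /andP[h1 h2] := Hk a aa; exact: le_trans (ltW k10) (le_trans h1 h2).
  have gv0 : aeon a b (fun y => gr F m v y = 0).
    apply: (@neutral_mode_vanishes (Us F + c)) => //.
    have gv2 := gr_L2 v2.
    have [e eE] : exists e : R, e = 2 / `|c| by eexists.
    have mf : measurable_fun `[a, b] (fun y => (gr F m v y / (U F y - (Us F + c))) ^+ 2).
      by apply: measurable_funX; apply: measurable_funM => //; exact: gv2.1.
    have bi : itg a b (fun y => (e * k2) ^+ 2 * v y ^+ 2 + e ^+ 2 * gr F m v y ^+ 2).
      by apply: itgD; apply: itgZ; [exact: v2.2|exact: gv2.2].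
    have e0 : 0 <= e by rewrite eE divr_ge0.
    have step : aeon a b (fun y => (gr F m v y / (U F y - (Us F + c))) ^+ 2 <=
        (e * k2) ^+ 2 * v y ^+ 2 + e ^+ 2 * gr F m v y ^+ 2).
      have := aeon_and (level_set_null hy hU hK (Us F)) vE.
      have := level_set_null hy hU hK (Us F + c) => n1 n2.
      have := aeon_and n1 n2; apply: aeon_imp => y yab [Uc [Uy E]].
      have Qc : U F y - (Us F + c) != 0 by rewrite subr_eq0.
      have Qs : U F y - Us F != 0 by rewrite subr_eq0.
      have cp : 0 < `|c| by rewrite normr_gt0.
      have [big|small] := leP (`|c| / 2) `|U F y - Us F|.
        apply: (@le_trans _ _ ((e * k2) ^+ 2 * v y ^+ 2)); last by rewrite lerDl mulr_ge0 ?sqr_ge0.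
        have -> : gr F m v y / (U F y - (Us F + c)) = (U F y - Us F)^-1 * (K2 F y)^-1 * v y.
          apply: (mulfI Qc); rewrite mulrCA divff // mulr1.
          rewrite mulrCA E -mulNr ddUE //; field; by rewrite (K2_neq0 yab) Qs.
        rewrite !exprMn ler_wpM2r ?sqr_ge0 //; apply: ler_pM; rewrite ?sqr_ge0 //.
          rewrite -(real_normK (num_real (U F y - Us F)^-1)) lerXn2r ?nnegrE // normfV.
          by rewrite eE -invf_div lef_pV2 ?posrE ?divr_gt0 ?normr_gt0.
        have /andP[h1 h2] := Hk y yab.
        by rewrite lerXn2r ?nnegrE // (le_trans (ltW k10)).
      apply: (@le_trans _ _ (e ^+ 2 * gr F m v y ^+ 2)); last by rewrite lerDr mulr_ge0 ?sqr_ge0.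
      rewrite exprMn mulrC ler_wpM2r ?sqr_ge0 //.
      rewrite -(real_normK (num_real (U F y - (Us F + c))^-1)) lerXn2r ?nnegrE // normfV.
      rewrite eE -invf_div lef_pV2 ?posrE ?divr_gt0 ?normr_gt0 //.
      have : `|c| <= `|U F y - Us F| + `|U F y - (Us F + c)|.
        by apply: le_trans (ler_normB _ _); have -> : (U F y - Us F) - (U F y - (Us F + c)) = c by ring.
      by move: small; move: `|U F y - Us F| `|U F y - (Us F + c)| `|c| => A B D; lra.
    have mi : itg a b (fun y => Num.min ((gr F m v y / (U F y - (Us F + c))) ^+ 2)
        ((e * k2) ^+ 2 * v y ^+ 2 + e ^+ 2 * gr F m v y ^+ 2)).
      apply: (le_integrable _ _ _ bi) => //.
        apply/measurable_EFinP; apply: measurable_minr => //; exact: itg_measurable bi.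
      move=> y _ /=; rewrite lee_fin.
      have B0 : 0 <= (e * k2) ^+ 2 * v y ^+ 2 + e ^+ 2 * gr F m v y ^+ 2.
        by rewrite addr_ge0 // mulr_ge0 // sqr_ge0.
      rewrite (ger0_norm B0) ger0_norm; first by rewrite ge_min lexx orbT.
      by rewrite le_min sqr_ge0 B0.
    apply: eq_itg_ae mi mf _.
    by apply: aeon_imp step => y _ h; rewrite (min_idPl h).
  have := aeon_and (aeon_and gv0 vE) (aeon_and (level_set_null hy hU hK (Us F + c)) zK).
  apply: aeon_imp => y yab [[g0 E] [Uc zE]]; have K0 := K2_neq0 yab.
  have v0 : v y = 0.
    by move: E; rewrite g0 mulr0 oppr0 => /eqP; rewrite mulf_eq0 subr_eq0 (negPf Uc) /= => /eqP.
  have wE : w y = - (c^-1 * z y) by apply/eqP; rewrite -addr_eq0 -/(v y) v0.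
  have gE : gr F m w y = - (c^-1 * gr F m z y) by apply/eqP; rewrite -addr_eq0 -gv // g0.
  by rewrite /Lr wE gE {1}zE; field; rewrite c0 K0.
Qed.

Definition Aop : V -> V := lift (mulop (fun y => (K2 F y)^-1)).
Definition Gop : V -> V := lift (gc F m).
Definition Dop : V -> V := lift (mulop (fun y => - ddU F y)).
Definition conj_fun (u : R -> C) (y : R) : C := (u y)^*%C.
Definition Conj : V -> V := lift conj_fun.
Definition Lf (u : R -> C) (y : R) : C := mulop (fun y => (K2 F y)^-1) u y - gc F m u y.

Lemma Kinv_norm : exists k : R, forall y, a <= y <= b -> `|(K2 F y)^-1| <= k.
Proof.
have [k1 [k2 [k10 H]]] := Kinv_bounds; exists k2 => y /H /andP[h1 h2].
by rewrite ger0_norm // (le_trans (ltW k10)).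
Qed.

Lemma Kinv_liftable : liftable a b (mulop (fun y => (K2 F y)^-1)).
Proof. have [k H] := Kinv_norm; exact: mulop_liftable Kinv_measurable H. Qed.

Lemma ddU_norm : exists k : R, forall y, a <= y <= b -> `|- ddU F y| <= k.
Proof. by have [k _ H] := cont_bounded ab ddU_c; exists k => y /H; rewrite normrN. Qed.

Lemma NddU_measurable : measurable_fun `[a, b] (fun y => - ddU F y).
Proof.
by have := itg_measurable (itg_cont ddU_c); have := itgN (itg_cont ddU_c) => /itg_measurable.
Qed.

Lemma ddU_liftable : liftable a b (mulop (fun y => - ddU F y)).
Proof. have [k H] := ddU_norm; exact: mulop_liftable NddU_measurable H. Qed.

Lemma clsN u : C2 u -> cls (fun y => - u y) = - cls u.
Proof.
move=> u2; rewrite -scaleN1r -clsZ //; congr cls; apply/funext => y; by rewrite mulN1r.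
Qed.

Lemma C2N u : C2 u -> C2 (fun y => - u y).
Proof. by move=> u2; have := C2Z (-1) u2; under eq_fun do rewrite mulN1r. Qed.

Lemma Lf_C2 u : C2 u -> C2 (Lf u).
Proof.
by move=> u2; have [h1 _ _ _] := Kinv_liftable; apply: C2D (h1 _ u2) (C2N (C2_gc hy m0 u2)).
Qed.

Lemma Aop_cls u : C2 u -> Aop (cls u) = cls (mulop (fun y => (K2 F y)^-1) u).
Proof. by move=> u2; have [h1 h2 _ _] := Kinv_liftable; exact: (lift_cls hy h1 h2 u2). Qed.

Lemma Gop_cls u : C2 u -> Gop (cls u) = cls (gc F m u).
Proof. by move=> u2; have [h1 h2 _ _] := gc_liftable; exact: (lift_cls hy h1 h2 u2). Qed.

Lemma Dop_cls u : C2 u -> Dop (cls u) = cls (mulop (fun y => - ddU F y) u).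
Proof. by move=> u2; have [h1 h2 _ _] := ddU_liftable; exact: (lift_cls hy h1 h2 u2). Qed.

Lemma Lop_cls u : C2 u -> Lop Aop Gop (cls u) = cls (Lf u).
Proof.
move=> u2; rewrite /Lop (Aop_cls u2) (Gop_cls u2); have [h1 _ _ _] := Kinv_liftable.
have g2 := C2_gc hy m0 u2; by rewrite -(clsN g2) -(clsD (h1 _ u2) (C2N g2)).
Qed.

Lemma Bop_cls u : C2 u -> Bop Aop Gop Dop (cls u) = cls (mulop (fun y => - ddU F y) (Lf u)).
Proof. by move=> u2; rewrite /Bop (Lop_cls u2) (Dop_cls (Lf_C2 u2)). Qed.

Lemma cls0 : cls (fun=> 0) = 0.
Proof.
have := clsZ 0 (@C2_zero R a b); rewrite scale0r => <-; congr cls.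
by apply/funext => y; rewrite mul0r.
Qed.

Lemma cls_eq0 u : C2 u -> cls u = 0 <-> aeon a b (fun y => u y = 0).
Proof. by move=> u2; rewrite -cls0; apply: (cls_eq hy) => //; exact: C2_zero. Qed.

Lemma Re_Lf u y : Re (Lf u y) = Lr (fun y => Re (u y)) y.
Proof. by rewrite /Lf /mulop !cDE /=; rewrite mul0r subr0. Qed.

Lemma Im_Lf u y : Im (Lf u y) = Lr (fun y => Im (u y)) y.
Proof. by rewrite /Lf /mulop !cDE /=; rewrite mul0r addr0. Qed.

Lemma mode_no_real (c : C) (x : V) : c \is Num.real ->
  Lop Aop Gop (Bop Aop Gop Dop x - c *: x) = 0 -> Lop Aop Gop x = 0.
Proof.
move=> cR; have [r ->] : exists r : R, c = r%:C%C by exists (Re c); exact: sp_real_Re.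
elim/(@cls_ind R a b): x => u u2.
have L2 := Lf_C2 u2; have [h1 _ _ _] := ddU_liftable.
have d2 := h1 _ L2; have cu2 := C2N (C2Z r%:C%C u2).
rewrite (Bop_cls u2) -(clsZ r%:C%C u2) -(clsN (C2Z r%:C%C u2)) -(clsD d2 cu2).
have z2 := C2D d2 cu2.
rewrite (Lop_cls z2) (Lop_cls u2) => /(cls_eq0 (Lf_C2 z2)) H.
apply/(cls_eq0 L2).
have HR : aeon a b (fun y => Lr (fun y => Re (u y)) y = 0).
  apply: (no_real_eigenfunction (c := r)); first exact: u2.1.
  apply: aeon_imp H => y _ E; have := congr1 (fun z => Re z) E; rewrite Re_Lf /= => E'; rewrite -[RHS]E'.
  congr (Lr _ y); apply/funext => t.
  by rewrite /mulop ReD ReN !ReM Re_Lf Im_Lf /=; ring.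
have HI : aeon a b (fun y => Lr (fun y => Im (u y)) y = 0).
  apply: (no_real_eigenfunction (c := r)); first exact: u2.2.
  apply: aeon_imp H => y _ E; have := congr1 (fun z => Im z) E; rewrite Im_Lf /= => E'; rewrite -[RHS]E'.
  congr (Lr _ y); apply/funext => t.
  by rewrite /mulop ImD ImN !ImM Re_Lf Im_Lf /=; ring.
have := aeon_and HR HI; apply: aeon_imp => y _ [E1 E2].
by apply: cE; rewrite ?Re_Lf ?Im_Lf.
Qed.

Lemma Conj_cls u : C2 u -> Conj (cls u) = cls (conj_fun u).
Proof.
move=> u2; apply: (lift_cls hy) => // [v v2|v w v2 w2]; first exact: C2_conj.
by apply: aeon_imp => y _; rewrite /conj_fun => ->.
Qed.

(** [1 / K2] is the coercive part and the Green operator the compact part;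
    complex conjugation commutes with the real operators involved. *)
Theorem mode_splitting :
  [/\ forall u, exists x y v,
        [/\ sum_gen (Bop Aop Gop Dop) (fun c => 0 < 'Im c) x,
            sum_gen (Bop Aop Gop Dop) (fun c => 'Im c < 0) y,
            gen_orth (hL sp Aop Gop) (Bop Aop Gop Dop) v & u = x + y + v],
      forall x y v, sum_gen (Bop Aop Gop Dop) (fun c => 0 < 'Im c) x ->
        sum_gen (Bop Aop Gop Dop) (fun c => 'Im c < 0) y ->
        gen_orth (hL sp Aop Gop) (Bop Aop Gop Dop) v -> x + y + v = 0 ->
        [/\ x = 0, y = 0 & v = 0],
      forall v, gen_orth (hL sp Aop Gop) (Bop Aop Gop Dop) v -> 0 <= hL sp Aop Gop v v &
      forall v, gen_orth (hL sp Aop Gop) (Bop Aop Gop Dop) v -> hL sp Aop Gop v v = 0 ->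
        Lop Aop Gop v = 0].
Proof.
have [kA kAE] := Kinv_norm; have [kD kDE] := ddU_norm; have [kG GB] := gc_bounded.
have [k1 [k2 [k10 Hk]]] := Kinv_bounds.
apply: (@hilbert_splitting C V sp _ _ _ _ _ _ _ Aop Gop Dop kA%:C%C kG kD%:C%C k1%:C%C
  _ _ _ _ _ _ _ _ _ _ _ _ _ Conj).
- exact: spD.
- exact: spZ.
- exact: spC.
- exact: sp_gt0.
- exact: sp_riesz.
- exact: complex_archi.
- move=> I U UU f M; exact: (complex_ulim UU).
- exact: (lift_linear hy Kinv_liftable).
- exact: (mulop_sym Kinv_measurable kAE).
- exact: (mulop_bounded Kinv_measurable kAE).
- exact: (lift_linear hy gc_liftable).
- exact: gc_lift_sym.
- exact: GB.
- exact: (lift_linear hy ddU_liftable).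
- exact: (mulop_sym NddU_measurable kDE).
- exact: (mulop_bounded NddU_measurable kDE).
- by rewrite ltcR.
- move=> x; elim/(@cls_ind R a b): x => u u2; rewrite (sp_self hy u2).
  rewrite /Aop (mulop_form Kinv_measurable kAE u2) -rmorphM lecR /sqint -intZ; last exact: C2_sqr.
  have i1 := C2_sqr u2.
  apply: int_le; first exact: itgZ.
    have := itg_mul_bounded i1 Kinv_measurable kAE.
    by apply: eq_itg => y _; rewrite mulrC.
  by move=> y /Hk /andP[h1 _]; rewrite ler_wpM2r // addr_ge0 ?sqr_ge0.
- exact: gc_form_ge0.
- exact: gc_compact.
- move=> x y; elim/(@cls_ind R a b): x => u u2; elim/(@cls_ind R a b): y => v v2.
  rewrite -(clsD u2 v2) (Conj_cls u2) (Conj_cls v2) (Conj_cls (C2D u2 v2)).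
  rewrite -(clsD (C2_conj u2) (C2_conj v2)); congr cls.
  by apply/funext => y; rewrite /conj_fun rmorphD.
- move=> c x; elim/(@cls_ind R a b): x => u u2.
  rewrite -(clsZ c u2) (Conj_cls u2) (Conj_cls (C2Z c u2)) -(clsZ _ (C2_conj u2)); congr cls.
  by apply/funext => y; rewrite /conj_fun rmorphM.
- move=> x; elim/(@cls_ind R a b): x => u u2.
  rewrite (Conj_cls u2) (Conj_cls (C2_conj u2)); congr cls.
  by apply/funext => y; rewrite /conj_fun conjcK.
- move=> x y; elim/(@cls_ind R a b): x => u u2; elim/(@cls_ind R a b): y => v v2.
  rewrite (Conj_cls u2) (Conj_cls v2) (sp_cls hy (C2_conj u2) (C2_conj v2)) (sp_cls hy u2 v2).
  rewrite -[RHS]cint_conj; last by apply: C2_mul => //; exact: C2_conj.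
  by apply: eq_cint => y _; rewrite /conj_fun rmorphM.
- move=> x; elim/(@cls_ind R a b): x => u u2; have [h1 _ _ _] := Kinv_liftable.
  rewrite (Conj_cls u2) (Aop_cls u2) (Aop_cls (C2_conj u2)) (Conj_cls (h1 _ u2)); congr cls.
  by apply/funext => y; rewrite /conj_fun /mulop rmorphM; congr (_ * _); apply: cE; rewrite /= ?oppr0.
- move=> x; elim/(@cls_ind R a b): x => u u2; have g2 := C2_gc hy m0 u2.
  rewrite (Conj_cls u2) (Gop_cls u2) (Gop_cls (C2_conj u2)) (Conj_cls g2).
  apply/(cls_eq hy); [exact: C2_conj|by apply: C2_gc => //; exact: C2_conj|].
  by apply: aeonT => y yab; rewrite /conj_fun gc_conj.
- move=> x; elim/(@cls_ind R a b): x => u u2; have [h1 _ _ _] := ddU_liftable.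
  rewrite (Conj_cls u2) (Dop_cls u2) (Dop_cls (C2_conj u2)) (Conj_cls (h1 _ u2)); congr cls.
  by apply/funext => y; rewrite /conj_fun /mulop rmorphM; congr (_ * _); apply: cE; rewrite /= ?oppr0.
- exact: mode_no_real.
Qed.

(** Complete the square in [<f, G f> >= m |G f|^2]. *)
Lemma gr_upper f : L2r a b f ->
  \int[mu]_(z in `[a, b]) (f z * gr F m f z) <= m^-1 * \int[mu]_(z in `[a, b]) (f z ^+ 2).
Proof.
move=> f2; have g2 := gr_L2 f2; have fg := L2r_mul f2 g2.
have H := gr_coercive hy m0 (L2r_itg hy f2).
have : \int[mu]_(z in `[a, b]) (f z * gr F m f z) <=
    \int[mu]_(z in `[a, b]) ((m^-1 / 2) * f z ^+ 2 + (m / 2) * gr F m f z ^+ 2).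
  apply: int_le => //; first by apply: itgD; apply: itgZ; [exact: f2.2|exact: g2.2].
  move=> z _; move: (f z) (gr F m f z) => p r; rewrite -subr_ge0.
  have -> : m^-1 / 2 * p ^+ 2 + m / 2 * r ^+ 2 - p * r = (m^-1 / 2) * (p - m * r) ^+ 2.
    by field; rewrite gt_eqF.
  by rewrite mulr_ge0 ?sqr_ge0 // divr_ge0 // invr_ge0 ltW.
rewrite intD; [|apply: itgZ; exact: f2.2|apply: itgZ; exact: g2.2].
rewrite (intZ _ f2.2) (intZ _ g2.2).
move: H; set X := \int[mu]_(z in `[a, b]) (f z * _); set S := \int[mu]_(z in `[a, b]) (f z ^+ 2).
set Y := \int[mu]_(z in `[a, b]) (gr F m f z ^+ 2) => H.
have -> : m / 2 * Y = (m * Y) / 2 by ring.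
have -> : m^-1 / 2 * S = (m^-1 * S) / 2 by ring.
by move: H; move: (m * Y) (m^-1 * S) => A B; lra.
Qed.

(** Short waves are stable: [G <= 1 / m < 1 / M <= 1 / K2]. *)
Lemma mode_positive (M : R) : 0 < M -> M < m -> (forall y, a <= y <= b -> K2 F y <= M) -> forall x, x != 0 -> 0 < hL sp Aop Gop x x.
Proof.
move=> M0 Mm KM x; elim/(@cls_ind R a b): x => u u2 x0.
have [kA kAE] := Kinv_norm; have [h1 h2 _ _] := gc_liftable.
have sg := sp_gt0 hy x0; rewrite (sp_self hy u2) ltcR in sg.
rewrite /hL /Lop (gBl (@spD R a b hy) (@spZ R a b hy)) /Aop (mulop_form Kinv_measurable kAE u2).
have GR := gc_form_real (cls u).
rewrite /Gop (sp_real_Re GR) -rmorphB ltcR subr_gt0.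
rewrite (lift_cls hy h1 h2 u2) (sp_cls hy (h1 _ u2) u2) (gc_re hy m0 u2).
apply: (@le_lt_trans _ _ (m^-1 * sqint a b u)).
  rewrite /sqint intD; [|exact: u2.1.2|exact: u2.2.2].
  by rewrite mulrDr; apply: lerD; apply: gr_upper; [exact: u2.1|exact: u2.2].
have i1 := C2_sqr u2.
apply: (@lt_le_trans _ _ (M^-1 * sqint a b u)); first by rewrite ltr_pM2r // ltf_pV2 ?posrE.
rewrite /sqint -intZ //; apply: int_le; first exact: itgZ.
  by have := itg_mul_bounded i1 Kinv_measurable kAE; apply: eq_itg => y _; rewrite mulrC.
move=> y yab; rewrite ler_wpM2r ?addr_ge0 ?sqr_ge0 // lef_pV2 ?posrE ?KM //.
by have [m1 [M1 [m10 H]]] := K2_bounds hK; have /andP[h _] := H y yab; exact: lt_le_trans h.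
Qed.

(** The Green operator only lowers the energy. *)
Lemma hL_upper u : C2 u -> hL sp Aop Gop (cls u) (cls u) <=
  (\int[mu]_(y in `[a, b]) ((K2 F y)^-1 * (Re (u y) ^+ 2 + Im (u y) ^+ 2)))%:C%C.
Proof.
move=> u2; have [kA kAE] := Kinv_norm.
rewrite -(mulop_form Kinv_measurable kAE u2) /hL /Lop (gBl (@spD R a b hy) (@spZ R a b hy)).
by rewrite gerBl; exact: gc_form_ge0.
Qed.
End ModeOperators.

(** * Vorticities as families of modes *)

Section Vorticities.
Context {R : realType} (F : shear_flow R) (hy : y1 F < y2 F) (halpha : 0 < alpha F)
  (hU : C2_profile F) (hK : class_Kplus F).
Notation mu := (@lebesgue_measure R).
Local Existing Instance ae_lebesgue_filter.
Local Notation a := (y1 F).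
Local Notation b := (y2 F).
Local Notation C := R[i].
Local Notation Re := complex.Re.
Local Notation Im := complex.Im.
Local Notation V := (L2sp a b).
Local Notation C2 := (C2 a b).
Local Notation ip := (ip a b).
Local Notation sp := (@sp R a b).
Local Notation cls := (@cls R a b).
Implicit Types (k : int) (v w : vorticity (R := R)) (u : R -> C).

Lemma aeonE u u' : u = u' %[ae mu in yI F] <-> aeon a b (fun y => u y = u' y).
Proof.
split; rewrite /aeon; apply: filterS => y H yab.
  by apply: H; rewrite /yI /= in_itv.
by apply: H; move: yab; rewrite /yI /= in_itv.
Qed.

Lemma feqP v w : feq F v w <-> forall k, aeon a b (fun y => v k y = w k y).
Proof. by split => H k; apply/aeonE; exact: H. Qed.

Definition wsq u (y : R) : R := (K2 F y)^-1 * (Re (u y) ^+ 2 + Im (u y) ^+ 2).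
Definition wnorm u : R := \int[mu]_(y in `[a, b]) wsq u y.
Definition wsum w (N : nat) : R :=
  \sum_(n < N) (wnorm (w n.+1%:Z) + wnorm (w (- n.+1%:Z))).

Lemma wsq_ge0 u y : a <= y <= b -> 0 <= wsq u y.
Proof.
move=> yab; have [k1 [k2 [k10 /(_ y yab) /andP[h _]]]] := Kinv_bounds hy hK.
by rewrite mulr_ge0 ?addr_ge0 ?sqr_ge0 // (le_trans (ltW k10)).
Qed.

Lemma wnorm_ge0 u : 0 <= wnorm u.
Proof. by apply: int_ge0 => y; exact: wsq_ge0. Qed.

Lemma wsq_itg u : C2 u -> itg a b (wsq u).
Proof.
move=> u2; have i1 := C2_sqr u2; have [k kE] := Kinv_norm hy hK.
have := itg_mul_bounded i1 (Kinv_measurable hy hU hK) kE.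
by apply: eq_itg => y _; rewrite /wsq mulrC.
Qed.

Lemma sqr_itg_wsq u (f : R -> R) : measurable_fun `[a, b] f -> itg a b (wsq u) ->
  (forall y, f y ^+ 2 <= Re (u y) ^+ 2 + Im (u y) ^+ 2) -> L2r a b f.
Proof.
move=> mf iw fu; split => //; have [m [M [m0 KM]]] := K2_bounds hK.
apply: (le_integrable _ _ _ (itgZ M iw)) => //.
  by apply/measurable_EFinP; exact: measurable_funX.
move=> y /=; rewrite in_itv /= => yab; have /andP[h1 h2] := KM y yab.
have K0 : 0 < K2 F y by exact: lt_le_trans h1.
have W := wsq_ge0 u yab; have M0 : 0 <= M by exact: le_trans (ltW K0) h2.
rewrite lee_fin (ger0_norm (sqr_ge0 _)) (ger0_norm (mulr_ge0 M0 W)).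
apply: le_trans (fu y) _; rewrite /wsq mulrA ler_peMl ?addr_ge0 ?sqr_ge0 //.
by rewrite ler_pdivlMr // mul1r.
Qed.

Lemma normX2_mode w k : (\int[mu]_(y in yI F) ((Re (w k y) ^+ 2 + Im (w k y) ^+ 2) / K2 F y)%:E =
  \int[mu]_(y in `[a, b]) (wsq (w k) y)%:E)%E.
Proof. by apply: eq_integral => y _; rewrite /wsq mulrC. Qed.

Lemma normX2_mode_ge0 w k : (0 <= \int[mu]_(y in `[a, b]) (wsq (w k) y)%:E)%E.
Proof. by apply: integral_ge0 => y /=; rewrite in_itv /= => yab; rewrite lee_fin wsq_ge0. Qed.

Definition int_range (N : nat) : seq int :=
  [seq n.+1%:Z | n <- iota 0 N] ++ [seq - n.+1%:Z | n <- iota 0 N].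

Lemma mem_int_range N k : (k \in int_range N) = (k != 0) && (`|k|%N <= N)%N.
Proof.
rewrite mem_cat; apply/idP/idP.
  case/orP => /mapP[n]; rewrite mem_iota add0n => /andP[_ nN] ->; first by rewrite absz_nat.
  by rewrite oppr_eq0 abszN absz_nat.
case: k => [[|n]|n] //=.
  by move=> nN; apply/orP; left; apply/mapP; exists n => //; rewrite mem_iota.
move=> nN; rewrite NegzE; apply/orP; right; apply/mapP; exists n => //.
by rewrite mem_iota.
Qed.

Lemma int_range_uniq N : uniq (int_range N).
Proof.
have i1 : injective (fun n : nat => n.+1%:Z) by move=> x y [].
have i2 : injective (fun n : nat => - n.+1%:Z) by move=> x y /oppr_inj; exact: i1.
rewrite cat_uniq (map_inj_uniq i1) (map_inj_uniq i2) !iota_uniq andbT /=.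
apply/hasPn => k /mapP[n _ ->]; apply/negP => /mapP[p _] /eqP.
by rewrite eq_sym -subr_eq0 opprK -PoszD.
Qed.

Lemma sum_int_range (f : int -> R) N :
  \sum_(n < N) (f n.+1%:Z + f (- n.+1%:Z)) = \sum_(k <- int_range N) f k.
Proof.
by rewrite big_cat /= !big_map -big_split /= -(big_mkord xpredT (fun n => f n.+1%:Z + f (- n.+1%:Z))) /index_iota subn0.
Qed.

Lemma wsum_int_range w N : \sum_(k <- int_range N) wnorm (w k) = wsum w N.
Proof. exact: esym (sum_int_range (fun k => wnorm (w k)) N). Qed.

(** All terms are nonnegative, so the symmetric partial sums decide the
    convergence of the unconditional sum. *)
Lemma X_iff w : X F w <-> [/\ forall k, C2 (w k), aeon a b (fun y => w 0 y = 0) &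
  exists B : R, forall N, wsum w N <= B].
Proof.
have c0 : 0 < 2 * pi / alpha F by rewrite divr_gt0 // mulr_gt0 // pi_gt0.
have Nenv w' (S : seq int) : uniq S -> (forall k, C2 (w' k)) ->
  (\sum_(k \in [set` S]) \int[mu]_(y in `[a, b]) (wsq (w' k) y)%:E =
   (\sum_(k <- S) wnorm (w' k))%:E)%E.
  move=> uS C2w; rewrite -(@fsbig_seq _ _ _ _ S) // -sumEFin; apply: eq_bigr => k _.
  by rewrite (EFin_int (wsq_itg (C2w k))).
split.
- case=> mw w0; rewrite /normX2 => fin.
  have fin' : (\esum_(k in [set k : int | (k != 0)%R])
    \int[mu]_(y in `[a, b]) (wsq (w k) y)%:E < +oo)%E.
    rewrite (eq_esum (b := fun k => (\int[mu]_(y in yI F)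
      ((Re (w k y) ^+ 2 + Im (w k y) ^+ 2) / K2 F y)%:E)%E)); last first.
      by move=> k _; rewrite normX2_mode.
    rewrite ltNge; apply/negP; rewrite leye_eq => /eqP E; move: fin; rewrite E.
    by rewrite gt0_muley ?lte_fin.
  have ge w' := normX2_mode_ge0 w'.
  have C2w k : C2 (w k).
    have [->|k0] := eqVneq k 0.
      move/aeonE: w0 => w0; have [m1 m2] := mw 0.
      have z := @C2_zero R a b; split; [apply: L2r_eq_ae z.1 m1 _|apply: L2r_eq_ae z.2 m2 _];
        by apply: aeon_imp w0 => y _ ->.
    have i1 : itg a b (wsq (w k)).
      apply/integrableP; have [m1 m2] := mw k; split.
        apply/measurable_EFinP; apply: measurable_funM; first exact: Kinv_measurable.
        by apply: measurable_funD; apply: measurable_funX.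
      apply: le_lt_trans fin'; apply: esum_ge; exists [set k].
        by split => //= _ ->.
      rewrite fsbig_set1 le_eqVlt; apply/orP; left; apply/eqP; apply: eq_integral => y.
      rewrite inE /= in_itv /= => yab; rewrite ger0_norm //; exact: wsq_ge0.
    have [m1 m2] := mw k; split; apply: (sqr_itg_wsq _ i1) => // y.
      by rewrite lerDl sqr_ge0.
    by rewrite lerDr sqr_ge0.
  split => //.
  have fn : (\esum_(k in [set k : int | (k != 0)%R])
    \int[mu]_(y in `[a, b]) (wsq (w k) y)%:E)%E \is a fin_num.
    rewrite ge0_fin_numE //; exact: esum_ge0.
  exists (fine (\esum_(k in [set k : int | (k != 0)%R])
    \int[mu]_(y in `[a, b]) (wsq (w k) y)%:E)%E) => N.
  rewrite -lee_fin fineK // -wsum_int_range -(Nenv _ _ (int_range_uniq N) C2w).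
  apply: esum_ge; exists [set` int_range N] => //; split; first exact: finite_seq.
  by move=> k /=; rewrite mem_int_range => /andP[].
- case=> C2w w0 [B HB]; split.
  + by move=> k; have [[m1 _] [m2 _]] := C2w k.
  + exact: ((aeonE (w 0) (cst 0)).2 w0).
  + rewrite /normX2 (eq_esum (b := fun k => (\int[mu]_(y in `[a, b]) (wsq (w k) y)%:E)%E)); last first.
      by move=> k _; rewrite normX2_mode.
    apply: (@le_lt_trans _ _ ((2 * pi / alpha F)%:E * B%:E)%E); last by rewrite -EFinM ltry.
    rewrite lee_pmul2l ?lte_fin //; apply: ge_ereal_sup => _ [S [fS S0] <-].
    have /finite_seqP[s sE] := fS.
    have := HB (\sum_(k <- s) `|k|%N)%N; rewrite -lee_fin -wsum_int_range.
    rewrite -(Nenv _ _ (int_range_uniq _) C2w); apply: le_trans.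
    apply: lee_fsum_nneg_subset => //; first exact: finite_seq.
      move=> k; rewrite !inE /= => Sk; rewrite mem_int_range; apply/andP; split; first exact: S0.
      have ks : k \in s by move: Sk; rewrite sE.
      by rewrite (big_rem k) //= leq_addr.
    by move=> k _; exact: normX2_mode_ge0.
Qed.

Definition wavenumber k : R := (k%:~R * alpha F) ^+ 2.
Definition hm k : V -> V -> C := hL sp (Aop (F := F)) (Gop (wavenumber k)).
Definition Lm k : V -> V := Lop (Aop (F := F)) (Gop (wavenumber k)).
Definition Bm k : V -> V := Bop (Aop (F := F)) (Gop (wavenumber k)) (Dop (F := F)).
Definition md w k : V := cls (w k).

Lemma wavenumber_gt0 k : k != 0 -> 0 < wavenumber k.
Proof. by move=> k0; rewrite /wavenumber exprn_even_gt0 // mulf_neq0 ?intr_eq0 // gt_eqF. Qed.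

Lemma Lm_linear k : k != 0 -> op_linear (Lm k).
Proof.
move=> /wavenumber_gt0 m0; apply: Lop_linear; apply: (lift_linear hy).
  exact: (Kinv_liftable hy hU hK).
exact: (gc_liftable hy m0).
Qed.

Lemma Bm_linear k : k != 0 -> op_linear (Bm k).
Proof.
move=> k0; have [LD LZ] := Lm_linear k0; have [DD DZ] : op_linear (Dop (F := F)) := lift_linear hy (ddU_liftable hy hU).
split=> [u v|c u]; rewrite /Bm /Bop -!/(Lm k _); first by rewrite LD DD.
by rewrite LZ DZ.
Qed.

Lemma Lm_sym k : k != 0 -> op_sym sp (Lm k).
Proof.
move=> /wavenumber_gt0 m0; have [kA kAE] := Kinv_norm hy hK.
apply: (Lop_sym (@spD R a b hy) (@spZ R a b hy) (@spC R a b)).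
  exact: (mulop_sym hy (Kinv_measurable hy hU hK) kAE).
exact: (gc_lift_sym hy m0).
Qed.

Lemma hmD k : k != 0 -> forall x y z : V, hm k (x + y) z = hm k x z + hm k y z.
Proof.
move=> k0 x y z; rewrite -(spD hy); congr sp; exact: (Lm_linear k0).1.
Qed.

Lemma hmZ k : k != 0 -> forall c (x y : V), hm k (c *: x) y = c * hm k x y.
Proof.
move=> k0 c x y; rewrite -(spZ hy); congr sp; exact: (Lm_linear k0).2.
Qed.

Lemma hmC k : k != 0 -> forall x y : V, hm k y x = (hm k x y)^*.
Proof.
move=> k0 x y; transitivity (sp y (Lm k x)); first exact: (Lm_sym k0 y x).
exact: (spC (Lm k x) y).
Qed.

Lemma hmDr k : k != 0 -> forall x y z : V, hm k x (y + z) = hm k x y + hm k x z.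
Proof. by move=> k0 x y z; rewrite (hmC k0 (y + z) x) (hmD k0 y z x) rmorphD (hmC k0 y x) (hmC k0 z x). Qed.

Lemma hm_real k (x : V) : k != 0 -> Im (hm k x x) = 0.
Proof.
move=> k0; have := hmC k0 x x; case: (hm k x x) => p q /(congr1 (fun z => Im z)) /= E.
by move: E; lra.
Qed.

Lemma hm_Bm k (x y : V) : k != 0 -> hm k (Bm k x) y = hm k x (Bm k y).
Proof.
move=> k0; have [kD kDE] := ddU_norm hy hU.
transitivity (sp (Bm k x) (Lm k y)); first exact: (Lm_sym k0 (Bm k x) y).
transitivity (sp (Lm k x) (Bm k y)); last by [].
exact: (mulop_sym hy (NddU_measurable hU) kDE (Lm k x) (Lm k y)).
Qed.

Lemma md_add v w k : C2 (v k) -> C2 (w k) -> md (fadd v w) k = md v k + md w k.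
Proof. exact: clsD. Qed.

Lemma md_scale c w k : C2 (w k) -> md (fscale c w) k = c *: md w k.
Proof. exact: clsZ. Qed.

Lemma X_C2 w k : X F w -> C2 (w k).
Proof. by move=> /X_iff[]. Qed.

Lemma md_eq v w : (forall k, C2 (v k)) -> (forall k, C2 (w k)) ->
  feq F v w <-> forall k, md v k = md w k.
Proof.
move=> v2 w2; split => [/feqP H k|H]; first by apply/(cls_eq hy).
by apply/feqP => k; apply/(cls_eq hy) => //; exact: H.
Qed.

Lemma md0_X w : X F w -> md w 0 = 0.
Proof. by move=> /X_iff[w2 w0 _]; apply/(cls_eq0 hy). Qed.

Lemma wsum_homo w : {homo wsum w : n m / (n <= m)%N >-> n <= m}.
Proof.
apply: homo_leq => //; first by move=> x y z; exact: le_trans.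
by move=> n; rewrite /wsum big_ord_recr /= lerDl addr_ge0 ?wnorm_ge0.
Qed.

Lemma X_finite w N : (forall k, C2 (w k)) -> md w 0 = 0 ->
  (forall k, (N < `|k|)%N -> md w k = 0) -> X F w.
Proof.
move=> w2 w0 wN; apply/X_iff; split => //; first exact/(cls_eq0 hy).
have z k : (N < `|k|)%N -> wnorm (w k) = 0.
  move=> /wN /(cls_eq0 hy (w2 k)) H; rewrite /wnorm.
  have -> : \int[mu]_(y in `[a, b]) wsq (w k) y = \int[mu]_(y in `[a, b]) (0 * (0 : R)).
    apply: (@eq_int_ae R a b); first exact: itg_measurable (wsq_itg (w2 k)).
      by apply: itg_measurable (itgZ _ (itg_cst _ _ _)).
    by apply: aeon_imp H => y _; rewrite /wsq => -> /=; rewrite expr0n addr0 !mulr0.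
  by rewrite intZ ?mul0r //; exact: itg_cst.
exists (wsum w N) => n; apply: (@le_trans _ _ (wsum w (N + n))).
  by apply: wsum_homo; exact: leq_addl.
rewrite {1}/wsum big_split_ord /= gerDl big1 // => i _.
by rewrite !z ?addr0 // ?abszN absz_nat ltnS leq_addr.
Qed.

Lemma XD v w : X F v -> X F w -> X F (fadd v w).
Proof.
move=> Xv Xw; have v2 k := X_C2 k Xv; have w2 k := X_C2 k Xw.
have /X_iff[_ v0 [Bv HBv]] := Xv; have /X_iff[_ w0 [Bw HBw]] := Xw; apply/X_iff; split.
- by move=> k; exact: C2D.
- by have := aeon_and v0 w0; apply: aeon_imp => y _ [E1 E2]; rewrite /fadd E1 E2 addr0.
- have le k : wnorm (fadd v w k) <= 2 * wnorm (v k) + 2 * wnorm (w k).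
    have i1 := itgZ 2 (wsq_itg (v2 k)); have i2 := itgZ 2 (wsq_itg (w2 k)).
    rewrite /wnorm -(intZ 2 (wsq_itg (v2 k))) -(intZ 2 (wsq_itg (w2 k))) -(intD i1 i2).
    apply: int_le; [by apply: wsq_itg; exact: C2D|exact: itgD|move=> y yab].
    have [k1 [k2 [k10 /(_ y yab) /andP[h _]]]] := Kinv_bounds hy hK.
    have K0 : 0 <= (K2 F y)^-1 := le_trans (ltW k10) h.
    rewrite /wsq /fadd ReD ImD; move: (Re (v k y)) (Im (v k y)) (Re (w k y)) (Im (w k y)) => p q r s.
    rewrite -subr_ge0.
    have -> : 2 * ((K2 F y)^-1 * (p ^+ 2 + q ^+ 2)) + 2 * ((K2 F y)^-1 * (r ^+ 2 + s ^+ 2)) -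
      (K2 F y)^-1 * ((p + r) ^+ 2 + (q + s) ^+ 2) =
      (K2 F y)^-1 * ((p - r) ^+ 2 + (q - s) ^+ 2) by ring.
    by rewrite mulr_ge0 // addr_ge0 ?sqr_ge0.
  exists (2 * Bv + 2 * Bw) => N.
  apply: (@le_trans _ _ (2 * wsum v N + 2 * wsum w N)); last first.
    by apply: lerD; rewrite ler_pM2l.
  rewrite /wsum !mulr_sumr -big_split /=; apply: ler_sum => n _.
  by have := le n.+1%:Z; have := le (- n.+1%:Z); lra.
Qed.

Lemma XZ c w : X F w -> X F (fscale c w).
Proof.
move=> Xw; have w2 k := X_C2 k Xw.
have /X_iff[_ w0 [B HB]] := Xw; apply/X_iff; split.
- by move=> k; exact: C2Z.
- by move: w0; apply: aeon_imp => y _ E; rewrite /fscale E mulr0.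
- have c0 : 0 <= Re c ^+ 2 + Im c ^+ 2 by rewrite addr_ge0 ?sqr_ge0.
  exists ((Re c ^+ 2 + Im c ^+ 2) * B) => N.
  apply: le_trans (ler_wpM2l c0 (HB N)).
  have E k : wnorm (fscale c w k) = (Re c ^+ 2 + Im c ^+ 2) * wnorm (w k).
    rewrite /wnorm -(intZ _ (wsq_itg (w2 k))); apply: eq_int => y _.
    by rewrite /wsq /fscale ReM ImM; ring.
  rewrite /wsum mulr_sumr le_eqVlt; apply/orP; left; apply/eqP; apply: eq_bigr => n _.
  by rewrite !E mulrDr.
Qed.

Lemma X_zero : X F fzero.
Proof.
apply: (@X_finite _ 0%N) => [k||k _]; first exact: C2_zero.
  exact: cls0.
exact: cls0.
Qed.

(** [JL] acts on the mode [k] as this factor times [Bm k]. *)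
Definition mode_factor k : C := - ('i%C * (k%:~R * alpha F)%:C%C).

Lemma mode_factor_neq0 k : k != 0 -> mode_factor k != 0.
Proof.
move=> k0; rewrite oppr_eq0 mulf_neq0 //; first by rewrite eq_complex /= oner_eq0 andbF.
by rewrite eq_complex /= eqxx andbT mulf_neq0 ?intr_eq0 // gt_eqF.
Qed.

Lemma Re_mode_factor k (c : C) : Re (mode_factor k * c) = k%:~R * alpha F * Im c.
Proof. by rewrite /mode_factor !cDE /=; ring. Qed.

Lemma L_mode w k : k != 0 -> L F w k = Lf F (wavenumber k) (w k).
Proof. by move=> /negPf k0; apply/funext => y; rewrite /L /inv_laplacian k0. Qed.

Lemma JL_mode w k : k != 0 ->
  JL F w k = (fun y => mode_factor k * mulop (fun y => - ddU F y) (Lf F (wavenumber k) (w k)) y).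
Proof.
move=> k0; apply/funext => y; rewrite /JL /J /dx (L_mode w k0) /mode_factor /mulop.
by rewrite (_ : (- ddU F y)%:C%C = - (ddU F y)%:C%C); [ring|apply: cE => /=; rewrite ?oppr0].
Qed.

Lemma JL_mode0 w y : JL F w 0 y = 0.
Proof. by rewrite /JL /J /dx mul0r [(0%:C)%C]/(0 : C) mulr0 mul0r mulr0. Qed.

Lemma JL_C2 w k : C2 (w k) -> C2 (JL F w k).
Proof.
move=> w2; have [->|k0] := eqVneq k 0.
  rewrite (_ : JL F w 0 = fun=> 0); first exact: C2_zero.
  by apply/funext => y; exact: JL_mode0.
have m0 := wavenumber_gt0 k0; have [h1 _ _ _] := ddU_liftable hy hU.
by rewrite (JL_mode w k0); apply: C2Z => //; apply: h1; exact: Lf_C2.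
Qed.

Lemma md_JL w k : k != 0 -> C2 (w k) -> md (JL F w) k = mode_factor k *: Bm k (md w k).
Proof.
move=> k0 w2; have m0 := wavenumber_gt0 k0; have [h1 _ _ _] := ddU_liftable hy hU.
rewrite /md (JL_mode w k0) (clsZ (mode_factor k) (h1 _ (Lf_C2 hy hU hK m0 w2))).
by congr (_ *: _); exact: esym (Bop_cls hy hU hK m0 w2).
Qed.

Lemma md_JL0 w : md (JL F w) 0 = 0.
Proof.
rewrite /md (_ : JL F w 0 = fun=> 0); first exact: cls0.
by apply/funext => y; exact: JL_mode0.
Qed.

(** * Generalized eigenvectors and their spans *)

Lemma cls_sum n (c : 'I_n -> C) (v : 'I_n -> R -> C) : (forall j, C2 (v j)) ->
  cls (fun y => \sum_(j < n) c j * v j y) = \sum_(j < n) c j *: cls (v j).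
Proof.
elim: n c v => [|n IH] c v v2.
  rewrite big_ord0 -(cls0 F); congr cls; apply/funext => y; exact: big_ord0.
rewrite big_ord_recr /= -(IH (fun j => c (widen_ord (leqnSn n) j)) (fun j => v (widen_ord (leqnSn n) j))) //.
have h1 := C2_sum (fun j => c (widen_ord (leqnSn n) j)) (fun j => v2 (widen_ord (leqnSn n) j)).
rewrite -(clsZ _ (v2 ord_max)) -(clsD h1 (C2Z _ (v2 ord_max))); congr cls.
by apply/funext => y; rewrite big_ord_recr.
Qed.

Lemma op_linear0 (f : V -> V) : op_linear f -> f 0 = 0.
Proof. by move=> [_ fZ]; have := fZ 0 0; rewrite !scale0r. Qed.

Lemma ker_pow_X lam n w : ker_pow F lam n w -> X F w.
Proof. by case: n => [|n] [] // []. Qed.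

(** The eigenvalue [lam] of [JL] corresponds to the eigenvalue
    [lam / mode_factor k] of [Bm k]. *)
Lemma md_shift lam w k : k != 0 -> C2 (w k) ->
  md (fadd (JL F w) (fscale (- lam) w)) k =
  mode_factor k *: bshift (Bm k) (lam / mode_factor k) (md w k).
Proof.
move=> k0 w2; rewrite (md_add (JL_C2 w2) (C2Z (- lam) w2)) (md_JL k0 w2) (md_scale (- lam) w2).
rewrite /bshift scalerBr scalerA mulrCA divff ?mode_factor_neq0 // mulr1.
by rewrite (scaleNr lam).
Qed.

Lemma ker_pow_mode lam n w k : k != 0 -> ker_pow F lam n w ->
  iter n (bshift (Bm k) (lam / mode_factor k)) (md w k) = 0.
Proof.
move=> k0; elim: n w => [|n IH] w.
  move=> [Xw /feqP /(_ k) H]; apply/(cls_eq0 hy) => //; exact: X_C2.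
move=> [[Xw _] /IH]; rewrite (md_shift lam k0 (X_C2 k Xw)).
rewrite (iter_bshiftZ (Bm_linear k0).2) -iterSr => /eqP.
by rewrite scaler_eq0 (negPf (mode_factor_neq0 k0)) => /eqP.
Qed.

Lemma mode_ker_pow lam n w k : k != 0 -> X F w -> (forall j, j != k -> md w j = 0) ->
  iter n (bshift (Bm k) (lam / mode_factor k)) (md w k) = 0 -> ker_pow F lam n w.
Proof.
move=> k0; elim: n w => [|n IH] w Xw wk.
  move=> E; split => //; apply/md_eq => [j|j|j]; [exact: X_C2|exact: C2_zero|].
  have [->|/wk jk] := eqVneq j k; [rewrite [RHS]cls0; exact: E|rewrite jk; exact: esym (cls0 F)].
rewrite iterSr => E; have w2 j := X_C2 j Xw.
have XJ : X F (JL F w).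
  apply: (@X_finite _ `|k|%N) => [j||j jk]; [exact: JL_C2|exact: md_JL0|].
  have [->|j0] := eqVneq j 0; first exact: md_JL0.
  rewrite (md_JL j0 (w2 j)) wk ?(op_linear0 (Bm_linear j0)) ?scaler0 //.
  by apply: contraTneq jk => ->; rewrite ltnn.
split; first by [].
apply: IH.
- by apply: XD => //; exact: XZ.
- move=> j jk; have [j0|j0] := eqVneq j 0.
    rewrite j0 (md_add (JL_C2 (w2 0)) (C2Z (- lam) (w2 0))) md_JL0 (md_scale _ (w2 0)).
    by rewrite (md0_X Xw) scaler0 addr0.
  by rewrite (md_shift lam j0 (w2 j)) (wk j jk) (bshift0 (Bm_linear j0).2) scaler0.
- by rewrite (md_shift lam k0 (w2 k)) (iter_bshiftZ (Bm_linear k0).2) E scaler0.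
Qed.

Lemma feq_trans v w w' : feq F v w -> feq F w w' -> feq F v w'.
Proof.
move=> /feqP vw /feqP ww; apply/feqP => k; have := aeon_and (vw k) (ww k).
by apply: aeon_imp => y _ [-> ->].
Qed.

Lemma feq_pointwise v w : (forall k y, v k y = w k y) -> feq F v w.
Proof. by move=> E; apply/feqP => k; apply: aeonT => y _. Qed.

Lemma feqD v v' w w' : feq F v v' -> feq F w w' -> feq F (fadd v w) (fadd v' w').
Proof.
move=> /feqP vv /feqP ww; apply/feqP => k; have := aeon_and (vv k) (ww k).
by apply: aeon_imp => y _ [E1 E2]; rewrite /fadd E1 E2.
Qed.

Section Span.
Variable S : set (vorticity (R := R)).

Lemma span_feq v w : X F w -> feq F w v -> span F S v -> span F S w.
Proof.
move=> Xw wv [_ [n [c [f [Sf vf]]]]]; split => //; exists n, c, f; split => //.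
exact: feq_trans wv vf.
Qed.

Lemma span_zero : span F S fzero.
Proof.
split; first exact: X_zero.
exists 0%N, (fun=> 0), (fun=> fzero); split => [[]//|].
by apply: feq_pointwise => k y; rewrite /lincomb big_ord0.
Qed.

Lemma span_mem w : X F w -> S w -> span F S w.
Proof.
move=> Xw Sw; split => //; exists 1%N, (fun=> 1), (fun=> w); split => //.
by apply: feq_pointwise => k y; rewrite /lincomb big_ord1 mul1r.
Qed.

Lemma span_add v w : span F S v -> span F S w -> span F S (fadd v w).
Proof.
move=> [Xv [n [c [f [Sf vf]]]]] [Xw [p [d [g [Sg wg]]]]]; split; first exact: XD.
exists (n + p)%N, (fun j : 'I_((n + p)%N) => match fintype.split j with inl i => c i | inr i => d i end),
  (fun j : 'I_((n + p)%N) => match fintype.split j with inl i => f i | inr i => g i end); split.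
  by move=> j; case: (fintype.split j).
apply: feq_trans (feqD vf wg) _; apply: feq_pointwise => k y.
rewrite /fadd /lincomb big_split_ord /=; congr (_ + _); apply: eq_bigr => i _.
  by rewrite -[lshift p i]/(unsplit (inl _ i)) unsplitK.
by rewrite -[rshift n i]/(unsplit (inr _ i)) unsplitK.
Qed.
End Span.

(** Both signs of the real part are treated at once: [s] is [1] or [-1]. *)
Definition unstable_gen (s : R) : set (vorticity (R := R)) :=
  [set w | exists2 lam, 0 < s * Re lam & gen_eigenspace F lam w].
Definition unstable (s : R) : set (vorticity (R := R)) := span F (unstable_gen s).
(** The condition on the eigenvalue [c] of [Bm k] that
    [0 < s * Re (mode_factor k * c)]. *)
Definition halfplane (s : R) k (c : C) : Prop := 0 < s * (k%:~R * alpha F * Im c).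

Lemma Es_unstable : Es F = unstable (-1).
Proof.
rewrite /Es /unstable; congr span; apply/seteqP; split => w [lam h g]; exists lam => //.
  by rewrite mulN1r oppr_gt0.
by move: h; rewrite mulN1r oppr_gt0.
Qed.

Lemma Eu_unstable : Eu F = unstable 1.
Proof.
by rewrite /Eu /unstable; congr span; apply/seteqP; split => w [lam h g]; exists lam => //;
  move: h; rewrite mul1r.
Qed.

Definition single k u : vorticity (R := R) := fun j => if j == k then u else fun=> 0.

Lemma single_C2 k u j : C2 u -> C2 (single k u j).
Proof. by rewrite /single; case: (j == k) => // _; exact: C2_zero. Qed.

Lemma md_single_neq k u j : j != k -> md (single k u) j = 0.
Proof. by rewrite /md /single => /negPf ->; exact: cls0. Qed.

Lemma md_single k u : md (single k u) k = cls u.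
Proof. by rewrite /md /single eqxx. Qed.

Lemma X_single k u : k != 0 -> C2 u -> X F (single k u).
Proof.
move=> k0 u2; apply: (@X_finite _ `|k|%N) => [j||j jk]; first exact: single_C2.
  by rewrite md_single_neq // eq_sym.
by rewrite md_single_neq //; apply: contraTneq jk => ->; rewrite ltnn.
Qed.

Lemma unstable_single s k x : k != 0 -> sum_gen (Bm k) (halfplane s k) x ->
  forall u, C2 u -> cls u = x -> unstable s (single k u).
Proof.
move=> k0; elim=> {x} [|c x v Pc [n gx] _ IH] u u2 E.
  apply: span_feq (span_zero _); first exact: X_single.
  apply/md_eq => j; [exact: single_C2|exact: C2_zero|].
  rewrite [RHS]cls0; have [->|jk] := eqVneq j k; first by rewrite md_single.
  exact: md_single_neq.
have x2 := repr_C2 x; have v2 := repr_C2 v.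
have X1 := X_single k0 x2; have X2 := X_single k0 v2.
apply: (@span_feq _ (fadd (single k (repr x)) (single k (repr v)))).
- exact: X_single.
- apply/md_eq => j; [exact: single_C2|by apply: C2D; exact: single_C2|].
  rewrite (md_add (single_C2 k j x2) (single_C2 k j v2)).
  have [->|jk] := eqVneq j k; first by rewrite !md_single !reprK.
  by rewrite !md_single_neq // addr0.
- apply: span_add; last by apply: IH => //; exact: reprK.
  apply: span_mem => //; exists (mode_factor k * c); first by rewrite Re_mode_factor.
  exists n; apply: (mode_ker_pow k0 X1) => [j jk|]; first exact: md_single_neq.
  by rewrite md_single reprK mulrAC divff ?mode_factor_neq0 // mul1r.
Qed.

Lemma unstable_mode s w k : k != 0 -> unstable s w -> sum_gen (Bm k) (halfplane s k) (md w k).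
Proof.
move=> k0 [Xw [n [c [v [Sv wv]]]]].
have v2 j : C2 (v j k) by have [lam _ [p /ker_pow_X H]] := Sv j; exact: X_C2.
have -> : md w k = \sum_(j < n) c j *: md (v j) k.
  transitivity (cls (fun y => \sum_(j < n) c j * v j k y)).
    apply/(cls_eq hy); [exact: X_C2|exact: C2_sum|by move/feqP: wv].
  exact: cls_sum.
elim/big_ind: _ => [|x y sx sy|j _]; first exact: sum_gen0.
  exact: sum_gen_add sx sy.
apply: (sum_genZ (Bm_linear k0).2); rewrite -[md _ _]addr0.
have [lam l0 [p gp]] := Sv j; apply: (@sum_genD _ _ _ _ (lam / mode_factor k)) (sum_gen0 _ _).
  rewrite /halfplane -Re_mode_factor mulrCA divff ?mode_factor_neq0 // mulr1.
  exact: l0.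
by exists p; exact: ker_pow_mode.
Qed.

(** * Assembling the Fourier modes *)

(** [mode_positive] applies as soon as the wave number exceeds the bound of
    [K2]. *)
Lemma hm_positive : exists N, forall k, (N < `|k|)%N -> forall x : V, x != 0 -> 0 < hm k x x.
Proof.
have [m [M [m0 KM]]] := K2_bounds hK; have a2 : 0 < alpha F ^+ 2 by rewrite exprn_gt0.
have M0 : 0 < Num.max M 1 by rewrite lt_max ltr01 orbT.
exists (Num.bound (Num.max M 1 / alpha F ^+ 2)) => k Nk x x0.
have k0 : k != 0 by apply: contraTneq Nk => ->.
have Mm : Num.max M 1 < wavenumber k.
  have h1 : Num.max M 1 / alpha F ^+ 2 < (`|k|%N)%:R.
    apply: lt_trans (archi_boundP _) _; first by rewrite divr_ge0 // ltW.
    by rewrite ltr_nat.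
  have h2 : (`|k|%N)%:R <= (k%:~R : R) ^+ 2.
    rewrite (_ : (k%:~R : R) ^+ 2 = (`|k|%N)%:R ^+ 2); last first.
      by rewrite natr_absz intr_norm real_normK ?num_real.
    by rewrite expr2 ler_peMl ?ler0n // ler1n absz_gt0.
  rewrite /wavenumber exprMn -ltr_pdivrMr //; exact: lt_le_trans h1 h2.
apply: (mode_positive hy hU hK (wavenumber_gt0 k0) M0 Mm) => // y /KM /andP[_ h].
by rewrite le_max h.
Qed.

Lemma halfplane_Im s k c : halfplane s k c -> c != c^*.
Proof.
move=> h; apply/negP => /eqP E; move: h; rewrite /halfplane.
suff -> : Im c = 0 by rewrite mulr0 mulr0 ltxx.
by have := congr1 (fun z => Im z) E; case: c {E} => p q /= E; move: E; lra.
Qed.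

(** Where the energy is positive definite, the eigenvalues are real. *)
Lemma sum_gen_positive s k : k != 0 -> (forall x : V, x != 0 -> 0 < hm k x x) ->
  forall x, sum_gen (Bm k) (halfplane s k) x -> x = 0.
Proof.
move=> k0 pos x; elim=> {x} // c x v /halfplane_Im Pc [n gx] _ ->; rewrite addr0.
have inj z : bshift (Bm k) c z = 0 -> z = 0.
  move=> /eqP; rewrite subr_eq0 => /eqP E; apply/eqP; apply: contraT => /pos z0.
  have h1 : hm k (Bm k z) z = c * hm k z z by rewrite E (hmZ k0).
  have h2 : hm k z (Bm k z) = c^* * hm k z z.
    rewrite (hmC k0 (Bm k z) z) h1 rmorphM; congr (_ * _); exact: esym (hmC k0 z z).
  have := hm_Bm z z k0; rewrite h1 h2 => /(mulIf (lt0r_neq0 z0)) cc.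
  by case/eqP: Pc.
by elim: n gx => //= n IH /inj.
Qed.

Lemma unstable_finite s : exists N, forall k, (N < `|k|)%N -> forall x,
  sum_gen (Bm k) (halfplane s k) x -> x = 0.
Proof.
have [N HN] := hm_positive; exists N => k Nk; apply: sum_gen_positive; last exact: HN.
by apply: contraTneq Nk => ->.
Qed.

Definition restrict_modes (r : seq int) w : vorticity (R := R) :=
  fun k => if k \in r then w k else fun=> 0.

Lemma unstable_restrict s w r : X F w -> uniq r -> (0 \notin r) ->
  (forall k, k != 0 -> sum_gen (Bm k) (halfplane s k) (md w k)) -> unstable s (restrict_modes r w).
Proof.
move=> Xw + + H; elim: r => [|k r IH] /=; first by move=> _ _; exact: span_zero.
rewrite inE negb_or eq_sym => /andP[kr ur] /andP[k0 r0].
have w2 j := X_C2 j Xw; have us := IH ur r0; have [Xr _] := us.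
have E : restrict_modes (k :: r) w = fadd (single k (w k)) (restrict_modes r w).
  apply/funext => j; apply/funext => y; rewrite /restrict_modes /fadd /single inE.
  have [->|jk] /= := eqVneq j k; first by rewrite (negPf kr) addr0.
  by rewrite add0r.
rewrite E; apply: span_add => //; apply: (unstable_single k0 (H k k0)) => //; exact: w2.
Qed.

(** Only finitely many modes carry unstable vectors, so a condition on each mode
    describes a finite span. *)
Lemma unstableP s w : unstable s w <-> X F w /\ forall k, k != 0 -> sum_gen (Bm k) (halfplane s k) (md w k).
Proof.
split => [u|[Xw H]]; first by split => [|k k0]; [case: u|exact: unstable_mode].
have [N HN] := unstable_finite s; have w2 j := X_C2 j Xw.
apply: (@span_feq _ (restrict_modes (int_range N) w)) => //; last first.
  by apply: unstable_restrict => //; [exact: int_range_uniq|rewrite mem_int_range].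
apply/md_eq => [//|j|j]; first by rewrite /restrict_modes; case: ifP => // _; exact: C2_zero.
rewrite /md /restrict_modes mem_int_range.
have [->|j0] /= := eqVneq j 0; first by rewrite [RHS]cls0; exact: md0_X.
case: leqP => // /HN h; rewrite [RHS]cls0; apply: h; exact: H.
Qed.

Lemma halfplane_pos s k c : 0 < s * k%:~R -> halfplane s k c <-> 0 < 'Im c.
Proof.
move=> sk; rewrite -complexIm (ltcR 0) /halfplane !mulrA.
by rewrite pmulr_rgt0 // mulr_gt0.
Qed.

Lemma halfplane_neg s k c : s * k%:~R < 0 -> halfplane s k c <-> 'Im c < 0.
Proof.
move=> sk; rewrite -complexIm (ltcR _ 0) /halfplane !mulrA.
by rewrite nmulr_rgt0 // pmulr_llt0.
Qed.

(** Division by the purely imaginary factor of the mode turns the left and right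
    half planes into the lower and upper ones, in an order that depends on the
    sign of [k]. *)
Lemma mode_dichotomy k : k != 0 ->
  [/\ forall x : V, exists p q r : V,
        [/\ sum_gen (Bm k) (halfplane (-1) k) p, sum_gen (Bm k) (halfplane 1 k) q,
            gen_orth (hm k) (Bm k) r & x = p + q + r],
      forall p q r : V, sum_gen (Bm k) (halfplane (-1) k) p -> sum_gen (Bm k) (halfplane 1 k) q ->
        gen_orth (hm k) (Bm k) r -> p + q + r = 0 -> [/\ p = 0, q = 0 & r = 0],
      forall r : V, gen_orth (hm k) (Bm k) r <-> forall q : V,
        sum_gen (Bm k) (halfplane (-1) k) q \/ sum_gen (Bm k) (halfplane 1 k) q -> hm k r q = 0,
      forall r : V, gen_orth (hm k) (Bm k) r -> 0 <= hm k r r &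
      forall r : V, gen_orth (hm k) (Bm k) r -> hm k r r = 0 -> Lm k r = 0].
Proof.
move=> k0; have [h1 h2 h3 h4] := mode_splitting hy hU hK (wavenumber_gt0 k0).
have sub := @sum_gen_sub _ _ (Bm k).
have [kp|kn|k00] := ltgtP 0 k; last by rewrite -k00 eqxx in k0.
- have p c := @halfplane_pos 1 k c; have n c := @halfplane_neg (-1) k c.
  have k1 : 0 < 1 * (k%:~R : R) by rewrite mul1r ltr0z.
  have k2 : -1 * (k%:~R : R) < 0 by rewrite mulN1r oppr_lt0 ltr0z.
  have P (u : V) : sum_gen (Bm k) (halfplane 1 k) u <-> sum_gen (Bm k) (fun c => 0 < 'Im c) u.
    by split; apply: sub => c h; apply/(p c k1).
  have N (u : V) : sum_gen (Bm k) (halfplane (-1) k) u <-> sum_gen (Bm k) (fun c => 'Im c < 0) u.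
    by split; apply: sub => c h; apply/(n c k2).
  split => //.
  + move=> x; have [u [s [v [Hu Hs Hv ->]]]] := h1 x; exists s, u, v; split => //; first exact/N.
      exact/P.
    by rewrite (addrC u).
  + move=> s u v /N Hs /P Hu Hv; rewrite (addrC s) => E.
    by have [-> -> ->] := h2 _ _ _ Hu Hs Hv E.
  + move=> v; split => H u [Hu|Hu]; apply: H.
    * by right; exact/N.
    * by left; exact/P.
    * by right; exact/P.
    * by left; exact/N.
- have p c := @halfplane_pos (-1) k c; have n c := @halfplane_neg 1 k c.
  have k1 : 0 < -1 * (k%:~R : R) by rewrite mulN1r oppr_gt0 ltrz0.
  have k2 : 1 * (k%:~R : R) < 0 by rewrite mul1r ltrz0.
  have P (u : V) : sum_gen (Bm k) (halfplane (-1) k) u <-> sum_gen (Bm k) (fun c => 0 < 'Im c) u.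
    by split; apply: sub => c h; apply/(p c k1).
  have N (u : V) : sum_gen (Bm k) (halfplane 1 k) u <-> sum_gen (Bm k) (fun c => 'Im c < 0) u.
    by split; apply: sub => c h; apply/(n c k2).
  split => //.
  + move=> x; have [u [s [v [Hu Hs Hv ->]]]] := h1 x; exists u, s, v; split => //; first exact/P.
    exact/N.
  + by move=> s u v /P Hs /N Hu Hv; exact: h2.
  + move=> v; split => H u [Hu|Hu]; apply: H.
    * by left; exact/P.
    * by right; exact/N.
    * by left; exact/P.
    * by right; exact/N.
Qed.

Lemma eq_sum_modes (f g : int -> R) : (forall k, k != 0 -> f k = g k) -> sum_modes f = sum_modes g.
Proof.
move=> fg; rewrite /sum_modes; congr (limn _); apply/funext => N; apply: eq_bigr => n _.
by rewrite !fg // oppr_eq0.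
Qed.

Lemma sum_modes0 (f : int -> R) : (forall k, k != 0 -> f k = 0) -> sum_modes f = 0.
Proof.
move=> f0; rewrite (eq_sum_modes (g := fun=> 0)) // /sum_modes.
rewrite (_ : (fun N => _) = cst 0); first exact: lim_cst.
by apply/funext => N; rewrite big1 // => n _; rewrite addr0.
Qed.

Lemma sum_modes_single k0 (f : int -> R) : k0 != 0 ->
  (forall k, k != 0 -> k != k0 -> f k = 0) -> sum_modes f = f k0.
Proof.
move=> nz f0; apply: (@lim_near_cst _ (@Rhausdorff R)); exists `|k0|%N => // N /= kN.
rewrite sum_int_range (bigD1_seq k0) ?int_range_uniq //=; last by rewrite mem_int_range nz.
rewrite big_seq_cond big1 ?addr0 // => k; rewrite mem_int_range => /andP[/andP[k0' _] kk].
exact: f0.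
Qed.

Lemma sum_modes_ge (f : int -> R) (M : R) k0 : (forall k, k != 0 -> 0 <= f k) ->
  (forall N, \sum_(n < N) (f n.+1%:Z + f (- n.+1%:Z)) <= M) -> k0 != 0 -> f k0 <= sum_modes f.
Proof.
move=> f0 fM nz; set s := fun N => \sum_(n < N) (f n.+1%:Z + f (- n.+1%:Z)).
have sh : {homo s : n m / (n <= m)%N >-> n <= m}.
  apply: homo_leq => //; first by move=> x y z; exact: le_trans.
  by move=> n; rewrite /s big_ord_recr /= lerDl addr_ge0 // f0 // oppr_eq0.
have sc : cvgn s by apply: nondecreasing_is_cvgn => //; exists M => _ [N _ <-]; exact: fM.
apply: le_trans (nondecreasing_cvgn_le sh sc `|k0|%N).
rewrite /s sum_int_range (bigD1_seq k0) ?int_range_uniq ?mem_int_range ?nz ?leqnn //= lerDl.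
rewrite big_seq_cond sumr_ge0 // => k; rewrite mem_int_range => /andP[/andP[k0' _] _].
exact: f0.
Qed.

Lemma Lform_modes v w : X F v -> X F w -> Lform F v w = (2 * pi / alpha F)%:C%C *
  (sum_modes (fun k => Re (hm k (md v k) (md w k))) +i*
   sum_modes (fun k => Im (hm k (md v k) (md w k))))%C.
Proof.
move=> Xv Xw.
have E k : k != 0 -> cintegral F (fun y => L F v k y * (w k y)^*%C) = hm k (md v k) (md w k).
  move=> k0; have m0 := wavenumber_gt0 k0; have v2 := X_C2 k Xv; have w2 := X_C2 k Xw.
  rewrite (L_mode v k0); apply: esym; rewrite /hm /hL /md (Lop_cls hy hU hK m0 v2).
  exact: (sp_cls hy (Lf_C2 hy hU hK m0 v2) w2).
rewrite /Lform /pairing; congr (_ * _).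
by apply: cE; apply: eq_sum_modes => k k0;
  [exact: (congr1 (fun z => Re z) (E k k0))|exact: (congr1 (fun z => Im z) (E k k0))].
Qed.

Lemma hm0l k : k != 0 -> forall x : V, hm k 0 x = 0.
Proof.
by move=> k0 x; have := hmZ k0 0 0 x; rewrite mul0r => <-; congr (hm k _ x); rewrite scale0r.
Qed.

Lemma hm0r k : k != 0 -> forall x : V, hm k x 0 = 0.
Proof. by move=> k0 x; rewrite (hmC k0 0 x) (hm0l k0 x); exact: conjC0. Qed.

Lemma Lform_single v w k : k != 0 -> X F v -> X F w -> (forall j, j != k -> md w j = 0) ->
  Lform F v w = (2 * pi / alpha F)%:C%C * hm k (md v k) (md w k).
Proof.
move=> k0 Xv Xw wk; rewrite (Lform_modes Xv Xw); congr (_ * _).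
have z j : j != 0 -> j != k -> hm j (md v j) (md w j) = 0.
  by move=> j0 /wk ->; exact: hm0r.
apply: cE.
  exact: (@sum_modes_single k (fun k => Re (hm k (md v k) (md w k))) k0
    (fun j j0 jk => congr1 (fun t : C => Re t) (z j j0 jk))).
exact: (@sum_modes_single k (fun k => Im (hm k (md v k) (md w k))) k0
  (fun j j0 jk => congr1 (fun t : C => Im t) (z j j0 jk))).
Qed.

(** Members of [Es] and [Eu] supported on a single mode are sufficient tests. *)
Lemma EcP w : Ec F w <-> X F w /\ forall k, k != 0 -> gen_orth (hm k) (Bm k) (md w k).
Proof.
have c0 : (2 * pi / alpha F)%:C%C != 0 :> C.
  by rewrite eq_complex /= eqxx andbT gt_eqF // divr_gt0 // mulr_gt0 // pi_gt0.
rewrite /Ec Es_unstable Eu_unstable; split.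
  case=> Xw H; split => // k k0; have [_ _ h3 _ _] := mode_dichotomy k0; apply/h3 => q Hq.
  have q2 := repr_C2 q; have X0 := X_zero; have Xq := X_single k0 q2.
  have md0 j : md fzero j = 0 by exact: cls0.
  have key z : X F z -> (forall j, md z j = md (single k (repr q)) j) -> Lform F w z = 0 ->
      hm k (md w k) q = 0.
    move=> Xz zE; rewrite (@Lform_single w z k) //; last first.
      by move=> j jk; rewrite zE md_single_neq.
    by rewrite zE md_single reprK => /eqP; rewrite mulf_eq0 (negPf c0) => /eqP.
  case: Hq => Hq; have us := unstable_single k0 Hq q2 (reprK q).
    apply: (key (fadd (single k (repr q)) fzero)); first exact: XD.
      by move=> j; rewrite (md_add (X_C2 j Xq) (X_C2 j X0)) md0 addr0.
    by apply: H => //; exact: span_zero.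
  apply: (key (fadd fzero (single k (repr q)))); first exact: XD.
    by move=> j; rewrite (md_add (X_C2 j X0) (X_C2 j Xq)) md0 add0r.
  by apply: H => //; exact: span_zero.
case=> Xw H; split => // p q /unstableP[Xp Hp] /unstableP[Xq Hq].
rewrite (Lform_modes Xw (XD Xp Xq)).
have z k : k != 0 -> hm k (md w k) (md (fadd p q) k) = 0.
  move=> k0; have [_ _ h3 _ _] := mode_dichotomy k0; have /h3 h := H k k0.
  rewrite (md_add (X_C2 k Xp) (X_C2 k Xq)) (hmDr k0) h ?h ?addr0 //.
    by right; exact: Hq.
  by left; exact: Hp.
have -> : sum_modes (fun k => Re (hm k (md w k) (md (fadd p q) k))) = 0.
  by apply: sum_modes0 => k /z ->.
have -> : sum_modes (fun k => Im (hm k (md w k) (md (fadd p q) k))) = 0.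
  by apply: sum_modes0 => k /z ->.
exact: mulr0.
Qed.

Lemma hm_Re_bound w N : X F w ->
  \sum_(n < N) (Re (hm n.+1%:Z (md w n.+1%:Z) (md w n.+1%:Z)) +
    Re (hm (- n.+1%:Z) (md w (- n.+1%:Z)) (md w (- n.+1%:Z)))) <= wsum w N.
Proof.
move=> Xw; have le k : k != 0 -> Re (hm k (md w k) (md w k)) <= wnorm (w k).
  move=> k0; have := hL_upper hy hU hK (wavenumber_gt0 k0) (X_C2 k Xw).
  have -> : hL sp (Aop (F := F)) (Gop (wavenumber k)) (cls (w k)) (cls (w k)) =
      (Re (hm k (md w k) (md w k)))%:C%C.
    by apply: cE => //=; exact: hm_real.
  by rewrite lecR.
by apply: ler_sum => n _; apply: lerD; apply: le; rewrite ?oppr_eq0.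
Qed.

(** The mode energies are nonnegative by [mode_dichotomy] and summable by
    [hL_upper]. *)
Lemma Lform_center w : Ec F w -> exists2 r : R, Lform F w w = r%:C%C &
  0 <= r /\ (r = 0 -> forall k, k != 0 -> Lm k (md w k) = 0).
Proof.
move=> /EcP[Xw H]; have c0 : 0 < 2 * pi / alpha F by rewrite divr_gt0 // mulr_gt0 // pi_gt0.
set f := fun k => Re (hm k (md w k) (md w k)).
have fE k : k != 0 -> hm k (md w k) (md w k) = (f k)%:C%C.
  by move=> k0; apply: cE => //=; exact: hm_real.
have f0 k : k != 0 -> 0 <= f k.
  move=> k0; have [_ _ _ h4 _] := mode_dichotomy k0.
  by have := h4 _ (H k k0); rewrite (fE k k0) (lecR 0).
have [_ _ [M HM]] := (X_iff w).1 Xw.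
have fS k : k != 0 -> f k <= sum_modes f.
  by apply: (@sum_modes_ge f M) => // N; apply: le_trans (HM N); exact: hm_Re_bound.
exists (2 * pi / alpha F * sum_modes f).
  have real_scale (c S : R) : c%:C%C * (S +i* 0)%C = (c * S)%:C%C by apply: cE => /=; ring.
  rewrite (Lform_modes Xw Xw) (@sum_modes0 (fun k => Im (hm k (md w k) (md w k)))).
    exact: real_scale.
  by move=> k k0; exact: hm_real.
split; first by rewrite mulr_ge0 ?(ltW c0) // (le_trans (f0 1 _)) // fS.
move=> /eqP; rewrite mulf_eq0 gt_eqF //= => /eqP s0 k k0; have [_ _ _ _ h5] := mode_dichotomy k0.
apply: h5; first exact: H.
by rewrite (fE k k0) (_ : f k = 0) //; apply/eqP; rewrite eq_le f0 // -s0 fS.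
Qed.

Lemma kerLP w : X F w -> kerL F w <-> forall k, k != 0 -> Lm k (md w k) = 0.
Proof.
move=> Xw; have w2 k := X_C2 k Xw.
have E k : k != 0 -> Lm k (md w k) = 0 <-> aeon a b (fun y => L F w k y = 0).
  move=> k0; have m0 := wavenumber_gt0 k0; rewrite (L_mode w k0) /Lm /md.
  by rewrite (Lop_cls hy hU hK m0 (w2 k)); apply: (cls_eq0 hy); exact: Lf_C2.
split => [[_ /feqP H] k k0|H]; first by apply/E.
split => //; apply/feqP => k; have [->|k0] := eqVneq k 0; last exact/(E k k0)/H.
have /X_iff[_ w0 _] := Xw; apply: aeon_imp w0 => y _ E0.
by rewrite /L /inv_laplacian eqxx E0 mulr0 subr0.
Qed.

Lemma md_JL_X w k : k != 0 -> X F w -> md (JL F w) k = mode_factor k *: Bm k (md w k).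
Proof. by move=> k0 Xw; exact: md_JL k0 (X_C2 k Xw). Qed.

Lemma unstable_invariant s : invariant_JL F (unstable s).
Proof.
move=> w /unstableP[Xw H] [_ XJ]; apply/unstableP; split => // k k0.
rewrite (md_JL_X k0 Xw); apply: (sum_genZ (Bm_linear k0).2).
exact: (sum_genB (Bm_linear k0).1 (Bm_linear k0).2 (H k k0)).
Qed.

Lemma Ec_invariant : invariant_JL F (Ec F).
Proof.
move=> w /EcP[Xw H] [_ XJ]; apply/EcP; split; first exact: XJ.
move=> k k0; rewrite (md_JL_X k0 Xw) => x Hx.
transitivity (mode_factor k * hm k (Bm k (md w k)) x); first exact: (hmZ k0).
rewrite (hm_Bm (md w k) x k0) (H k k0 (Bm k x)); first exact: mulr0.
by case: Hx => Hx; [left|right]; exact: (sum_genB (Bm_linear k0).1 (Bm_linear k0).2 Hx).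
Qed.

Lemma feq0P w : X F w -> feq F w fzero <-> forall k, k != 0 -> md w k = 0.
Proof.
move=> Xw; have md0 j : md fzero j = 0 by exact: cls0.
split=> [/md_eq H k _|H].
  by rewrite -(md0 k); apply: H => j; [exact: X_C2|exact: C2_zero].
apply/md_eq => [j|j|j]; [exact: X_C2|exact: C2_zero|rewrite md0].
have [->|j0] := eqVneq j 0; [exact: md0_X|exact: H].
Qed.

(** The prescribed modes vanish for large [k], so they sum to an element of
    [X]. *)
Lemma unstable_of_modes s (x : int -> V) :
  (forall k, k != 0 -> sum_gen (Bm k) (halfplane s k) (x k)) ->
  exists2 w, unstable s w & forall k, k != 0 -> md w k = x k.
Proof.
move=> H; have [N HN] := unstable_finite s.
pose w : vorticity (R := R) := fun k => if k == 0 then fun=> 0 else repr (x k).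
have w2 k : C2 (w k) by rewrite /w; case: eqP => _; [exact: C2_zero|exact: repr_C2].
have E k : k != 0 -> md w k = x k by move=> /negPf k0; rewrite /md /w k0 reprK.
exists w => //; apply/unstableP; split; last by move=> k k0; rewrite (E k k0); exact: H.
apply: (@X_finite w N) => // [|k Nk]; first by rewrite /md /w eqxx; exact: cls0.
have k0 : k != 0 by apply: contraTneq Nk => ->.
by rewrite (E k k0); apply: (HN k Nk); exact: H.
Qed.

(** Split every mode by [mode_dichotomy]; the stable and unstable pieces are
    finite in number, and the center part is the remainder. *)
Theorem spectral_decomposition : direct_sum3 F (Es F) (Eu F) (Ec F).
Proof.
rewrite Es_unstable Eu_unstable; split.
- by split=> w [].
- move=> w Xw.
  have C0 k : exists p : V * V * V, k != 0 -> [/\ sum_gen (Bm k) (halfplane (-1) k) p.1.1,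
      sum_gen (Bm k) (halfplane 1 k) p.1.2, gen_orth (hm k) (Bm k) p.2 &
      md w k = p.1.1 + p.1.2 + p.2].
    have [k0|k0] := eqVneq k 0; first by exists (0, 0, 0).
    have [h1 _ _ _ _] := mode_dichotomy k0; have [p [q [r [h h' h'' E]]]] := h1 (md w k).
    by exists (p, q, r).
  have [p Hp] := choice C0.
  have [v1 u1 E1] := @unstable_of_modes (-1) (fun k => (p k).1.1) (fun k (nz : k != 0) => let: And4 h _ _ _ := Hp k nz in h).
  have [v2 u2 E2] := @unstable_of_modes 1 (fun k => (p k).1.2) (fun k (nz : k != 0) => let: And4 _ h _ _ := Hp k nz in h).
  have X1 : X F v1 by case: u1.
  have X2 : X F v2 by case: u2.
  have X12 := XD X1 X2; have Xm := XZ (-1) X12.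
  exists v1, v2, (fadd w (fscale (-1) (fadd v1 v2))); split => //; last first.
    by apply: feq_pointwise => k y; rewrite /fadd /fscale; ring.
  apply/EcP; split; first exact: XD.
  move=> k k0; have [_ _ h E] := Hp k k0.
  rewrite (md_add (X_C2 k Xw) (X_C2 k Xm)) (md_scale _ (X_C2 k X12)).
  rewrite (md_add (X_C2 k X1) (X_C2 k X2)) (E1 k k0) (E2 k k0) E scaleN1r.
  by rewrite (addrC (_ + _) (p k).2) addrK.
- move=> v1 v2 v3 /unstableP[X1 H1] /unstableP[X2 H2] /EcP[X3 H3].
  move=> /(feq0P (XD (XD X1 X2) X3)) H.
  have E k : k != 0 -> [/\ md v1 k = 0, md v2 k = 0 & md v3 k = 0].
    move=> k0; have [_ h2 _ _ _] := mode_dichotomy k0; apply: h2; [exact: H1|exact: H2|exact: H3|].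
    have := H k k0; rewrite (md_add (X_C2 k (XD X1 X2)) (X_C2 k X3)).
    by rewrite (md_add (X_C2 k X1) (X_C2 k X2)).
  by split; apply/feq0P => // k /E[].
Qed.

Lemma Ec_fzero : Ec F fzero.
Proof.
apply/EcP; split => [|k k0 q _]; first exact: X_zero.
have -> : md fzero k = 0 by exact: cls0.
exact: hm0l.
Qed.

Theorem Ec_nminus : nminus F (Ec F) = 0%E.
Proof.
apply/eqP; rewrite eq_le; apply/andP; split.
  apply: ge_ereal_sup => _ [[|n] [v [H1 H2 H3]] <-] //.
  pose c (j : 'I_n.+1) : C := 1.
  have nz : ~ feq F (lincomb c v) fzero by move=> /H2 /(_ ord0) /eqP; rewrite oner_eq0.
  have [r rE [r0 _]] := Lform_center (H1 c).
  by have := H3 c nz; rewrite rE (ltcR _ 0) ltNge r0.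
apply: ereal_sup_ubound; exists 0%N => //.
pose v0 (j : 'I_0) : vorticity (R := R) := fzero.
have E c : lincomb c v0 = fzero.
  by apply/funext => k; apply/funext => y; rewrite /lincomb big_ord0.
exists v0; split => [c|c _ []//|c []]; first by rewrite E; exact: Ec_fzero.
by rewrite E; apply: feq_pointwise.
Qed.

Theorem Ec_L_positive : L_pos_mod_ker F (Ec F).
Proof.
split=> [w kw|w Ew nk].
  have Xw : X F w by case: kw.
  apply/EcP; split => // k k0 q _; have /(kerLP Xw) H := kw.
  rewrite /hm /hL -/(Lm k _) (H k k0) -(scale0r (0 : V)); exact: etrans (spZ hy 0 0 q) (mul0r _).
have [r -> [r0 rk]] := Lform_center Ew; rewrite (ltcR 0) lt_neqAle r0 andbT.
apply/eqP => r00; apply: nk; have [Xw _] := Ew; apply/(kerLP Xw); exact: rk (esym r00).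
Qed.
End Vorticities.

Theorem lemma4p2 (R : realType) (F : shear_flow R)
    (hy : y1 F < y2 F) (halpha : 0 < alpha F)
    (hU : C2_profile F) (hK : class_Kplus F) :
  [/\ direct_sum3 F (Es F) (Eu F) (Ec F),
      [/\ invariant_JL F (Es F), invariant_JL F (Eu F) &
          invariant_JL F (Ec F)],
      nminus F (Ec F) = 0%E &
      L_pos_mod_ker F (Ec F)].
Proof.
split.
- exact: spectral_decomposition.
- rewrite Es_unstable Eu_unstable; split; [exact: unstable_invariant|exact: unstable_invariant|].
  exact: Ec_invariant.
- exact: Ec_nminus.
- exact: Ec_L_positive.
Qed.
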